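(* Let $(\widetilde{\mathfrak g},H_0)$ be a simple regular graded Lie algebra over $F$ of rank $k+1$, and let $(I^-,H_0,I^+)$, the involution $\gamma$ and $H=Z_G(I^+)$ be as in the context. For $j=0,\dots,k$ let $\nabla_j$ be the polynomial on $V^-$ defined by $\nabla_j(Y)=\Delta_j(\gamma(Y))$. The polynomials $\nabla_j$ are irreducible of degree $\kappa(k+1-j)$. (1) $\nabla_0$ is the (fundamental) relative invariant of $V^-$ under the action of $G$. (2) For $j=0,\dots,k$, $\nabla_j$ is relatively invariant under the parabolic subgroup $P$: $\nabla_j(p.Y)=\chi_j^-(p)\nabla_j(Y)$ for $p\in P$, $Y\in V^-$, where $\chi_j^-$ is a character of $P$ such that $\chi_j^-(n)=1$ for $n\in N$; $\chi_j^-(a)=a^{-\kappa(\lambda_0+\dots+\lambda_{k-j})}$ for $a\in A$; and $\chi_j^-(l)=1$ for $l\in L\cap H$.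
   Context: Setting. $F$ is a finite extension of $\mathbb Q_p$ whose residue field has characteristic $\neq 2$; $\overline F$ is an algebraic closure and $\overline U=U\otimes_F\overline F$. A regular graded Lie algebra is a reductive Lie algebra $\widetilde{\mathfrak g}$ over $F$ with an element $H_0$ such that (H1) $\widetilde{\mathfrak g}=V^-\oplus\mathfrak g\oplus V^+$ with $V^+\ne 0$, where $V^-,\mathfrak g,V^+$ are the eigenspaces of $\operatorname{ad}H_0$ for $-2,0,2$; (H2) the bracket representation of $\mathfrak g$ on $\overline{V^+}$ is irreducible; (H3) there are elements of $V^-$ and $V^+$ forming with $H_0$ an $\mathfrak{sl}_2$-triple. Convention: $(Y,H,X)$ is an $\mathfrak{sl}_2$-triple if $[H,X]=2X$, $[H,Y]=-2Y$, $[Y,X]=H$. Roots and descent. $\mathfrak a$ is a maximal split abelian subalgebra of $\mathfrak g$ containing $H_0$; $\widetilde\Sigma$ is the root system of $(\widetilde{\mathfrak g},\mathfrak a)$, $\widetilde{\mathfrak g}^\lambda$ the root spaces, $H_\lambda\in\mathfrak a$ the coroot of $\lambda$. Fix a basis $\widetilde\Pi$ of $\widetilde\Sigma$ with $\nu(H_0)\in\{0,2\}$ for all $\nu\in\widetilde\Pi$; exactly one simple root, $\lambda_0$, satisfies $\lambda_0(H_0)=2$. Inductively, $\widetilde{\mathfrak l}_i$ is the subalgebra generated by $\widetilde{\mathfrak g}^{\pm\lambda_i}$, $\widetilde{\mathfrak g}_j$ is the centralizer of $\widetilde{\mathfrak l}_0\oplus\dots\oplus\widetilde{\mathfrak l}_{j-1}$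 in $\widetilde{\mathfrak g}$ ($\widetilde{\mathfrak g}_0=\widetilde{\mathfrak g}$), $\widetilde\Sigma_j$ is the set of roots strongly orthogonal to $\lambda_0,\dots,\lambda_{j-1}$, ordered by $\widetilde\Sigma^+\cap\widetilde\Sigma_j$, and $\lambda_j$ is its unique simple root with $\lambda_j(H_0)=2$; the process stops at $\lambda_k$, when the centralizer of $\widetilde{\mathfrak l}_0\oplus\dots\oplus\widetilde{\mathfrak l}_k$ meets $V^+$ in $0$. The rank is $k+1$. $\mathfrak a^0=\bigoplus_{j=0}^kFH_{\lambda_j}$; $E_{i,j}(p,q)=\{X\in\widetilde{\mathfrak g}:[H_{\lambda_i},X]=pX,[H_{\lambda_j},X]=qX,[H_{\lambda_s},X]=0\ (s\ne i,j)\}$. $\widetilde{\mathfrak g}_j$ is again a regular graded Lie algebra, graded by $H_{\lambda_j}+\dots+H_{\lambda_k}$, with $V_j^+=V^+\cap\widetilde{\mathfrak g}_j$. Groups. $\widetilde G=\mathrm{Aut}_0(\widetilde{\mathfrak g})$ is the group of automorphisms of $\widetilde{\mathfrak g}$ which become elementary (finite products of $e^{\operatorname{ad}x}$, $\operatorname{ad}x$ nilpotent) over $\overline F$; $G=\{g\in\widetilde G:g.H_0=H_0\}$; $G_j$ is the analogous group for $(\widetilde{\mathfrak g}_j,H_{\lambda_j}+\dots+H_{\lambda_k})$; $L=Z_G(\mathfrak a^0)$; $N=\exp(\operatorname{ad}\mathfrak n)$ with $\mathfrak n=\bigoplus_{i<j}E_{i,j}(1,-1)$; $P=LN$. $A$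 is the maximal split torus of $G$ with Lie algebra $\mathfrak a$; $a^\lambda$ is the eigenvalue of $a\in A$ on $\widetilde{\mathfrak g}^\lambda$, extended to $\mathbb Z$-combinations of roots. Polynomials. $\Delta_j$ is the polynomial on $V^+=V_j^+\oplus V_j^\perp$, $V_j^\perp=(\bigoplus_{r<s,\,r<j}E_{r,s}(1,1))\oplus(\bigoplus_{r<j}\widetilde{\mathfrak g}^{\lambda_r})$, given by $\Delta_j(X+Y)=P_j(X)$ ($X\in V_j^+$, $Y\in V_j^\perp$), where $P_j$ is the (unique up to scalar) absolutely irreducible polynomial on $V_j^+$ relatively invariant under $G_j$; normalized by $\Delta_j(I^+)=1$. $\kappa$ is the common degree of the fundamental relative invariants of the rank one graded algebras $\widetilde{\mathfrak l}_j$: $\kappa=\delta$ if $\widetilde{\mathfrak l}_j\simeq\mathfrak{sl}_2(D)$ with $D$ a central division algebra of degree $\delta$, and $\kappa=2$ in the only other case, $\dim\widetilde{\mathfrak g}^{\lambda_j}=3$. The triple and $\gamma$. $I^+=X_0+\dots+X_k$, $I^-=Y_0+\dots+Y_k$ with $X_j\in\widetilde{\mathfrak g}^{\lambda_j}\setminus\{0\}$, $Y_j\in\widetilde{\mathfrak g}^{-\lambda_j}\setminus\{0\}$, each $(Y_j,H_{\lambda_j},X_j)$ an $\mathfrak{sl}_2$-triple, chosen moreover so that $\gamma_{i,k-i}(X_i)=X_{k-i}$ for $0\le i<k/2$, where $\gamma_{i,j}=e^{\operatorname{ad}X}e^{\operatorname{ad}Y}e^{\operatorname{ad}X}$ for a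 fixed $\mathfrak{sl}_2$-triple $(Y,H_{\lambda_i}-H_{\lambda_j},X)$ with $X\in E_{i,j}(1,-1)$, $Y\in E_{i,j}(-1,1)$. $\gamma\in\widetilde G$ is a fixed element normalizing $\mathfrak a^0$ with $\gamma.H_{\lambda_j}=-H_{\lambda_{k-j}}$, $\gamma.X_j=Y_{k-j}$ for all $j$ and $\gamma^2=\mathrm{Id}$ (it exists; it exchanges $V^+$ and $V^-$ and normalizes $G,P,L,N$), constructed as $\gamma=\widetilde\gamma w$ where $w=e^{\operatorname{ad}I^+}e^{\operatorname{ad}I^-}e^{\operatorname{ad}I^+}$, $\widetilde\gamma=\prod_{0\le i<k/2}\gamma_{i,k-i}w_i^2$ and $w_i=e^{\operatorname{ad}X_i}e^{\operatorname{ad}Y_i}e^{\operatorname{ad}X_i}$. *)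

(* Defs.v *)
From HB Require Import structures.
From mathcomp Require Import all_boot all_order all_algebra all_field.
From mathcomp Require Import mpoly.
Set Implicit Arguments.
Unset Strict Implicit.
Unset Printing Implicit Defensive.
Import Order.TTheory GRing.Theory Num.Theory.
Local Open Scope ring_scope.

(* A valuation is an integer-valued function whose value at 0 is irrelevant;  *)
(* [val_ge v N x] is "v(x) >= N" with the convention v(0) = +oo.              *)
Definition val_ge (K : fieldType) (v : K -> int) (N : int) (x : K) : Prop :=
  x = 0 \/ N <= v x.

(* (K, v) is the completion of Q for the p-adic valuation, i.e. K = Q_p.      *)
Record is_padic_field (p : nat) (K : fieldType) (v : K -> int) : Prop := {
  padic_prime : prime p;
  padic_char0 : [pchar K] =i pred0;
  padic_valM : forall x y, x != 0 -> y != 0 -> v (x * y) = v x + v y;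
  padic_valD : forall N x y, val_ge v N x -> val_ge v N y -> val_ge v N (x + y);
  padic_val_nat : forall n : nat, (0 < n)%N -> v n%:R = (logn p n)%:Z;
  padic_dense : forall (x : K) (N : int), exists q : rat, val_ge v N (x - ratr q);
  padic_complete : forall u : nat -> K,
    (forall N, exists m, forall i j, (m <= i)%N -> (m <= j)%N ->
       val_ge v N (u i - u j)) ->
    exists l, forall N, exists m, forall i, (m <= i)%N -> val_ge v N (u i - l)
}.

Section ResidueField.
Variables (Qp : fieldType) (v : Qp -> int) (F : fieldExtType Qp).

(* Ring of integers of F: the integral closure of Z_p = {x | v x >= 0}.       *)
Definition integer_ring (x : F) : Prop :=
  exists2 q : {poly Qp}, q \is monic /\ (forall i, val_ge v 0 q`_i)
    & root (map_poly (in_alg F) q) x.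

(* Its maximal ideal: the non-invertible integers.                            *)
Definition max_ideal (x : F) : Prop :=
  integer_ring x /\ ~ (x != 0 /\ integer_ring x^-1).

(* n : nat vanishes in the residue field iff it lies in the maximal ideal.    *)
Definition residue_char_neq (n : nat) : Prop := ~ max_ideal n%:R.

End ResidueField.

Definition is_algebraic_closure (F : fieldType) (Fbar : closedFieldType)
    (iota : {rmorphism F -> Fbar}) : Prop :=
  forall x : Fbar, algebraicOver iota x.

Section LieAlgebra.
Variables (F : fieldType) (V : vectType F) (br : V -> V -> V).
Implicit Types (x y H X Y : V) (U W : {vspace V}).

Record lie_bracket : Prop := {
  lie_linearl : forall y, linear (fun x => br x y);
  lie_linearr : forall x, linear (br x);
  lie_alternating : forall x, br x x = 0;
  lie_jacobi : forall x y z,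
    br x (br y z) + br y (br z x) + br z (br x y) = 0
}.

Definition lie_ideal W : Prop := forall x y, y \in W -> br x y \in W.

Definition lie_simple : Prop :=
  (exists x y, br x y != 0) /\
  (forall W, lie_ideal W -> W = 0%VS \/ W = fullv).

(* Complete reducibility of the adjoint representation.                       *)
Definition lie_reductive : Prop :=
  forall W, lie_ideal W ->
    exists W', [/\ lie_ideal W', (W + W')%VS = fullv & (W :&: W')%VS = 0%VS].

Definition adl x : 'End(V) := linfun (br x).

Definition ad_eigen H (c : F) : {vspace V} := passmx.leigenspace (adl H) c.

Definition Vplus (H0 : V) : {vspace V} := ad_eigen H0 2%:R.
Definition Vzero (H0 : V) : {vspace V} := ad_eigen H0 0.
Definition Vminus (H0 : V) : {vspace V} := ad_eigen H0 (- 2%:R).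

(* The sign convention is [Y, X] = H.                                         *)
Definition sl2_triple Y H X : Prop :=
  [/\ br H X = 2%:R *: X, br H Y = - 2%:R *: Y & br Y X = H].

Definition ad_nilpotent x : Prop := exists m, forall y, iter m (br x) y = 0.

(* The terms of index > dim V vanish when ad x is nilpotent, the only case in *)
(* which [exp_ad] is used.                                                    *)
Definition exp_ad x y : V :=
  \sum_(i < (\dim {:V}).+1) (i`!%:R)^-1 *: iter i (br x) y.

(* e^{ad X} e^{ad Y} e^{ad X} *)
Definition weyl_elt X Y (v : V) : V := exp_ad X (exp_ad Y (exp_ad X v)).

Definition elementary (phi : V -> V) : Prop :=
  exists s : seq V, (forall x, x \in s -> ad_nilpotent x) /\
    phi =1 foldr (fun x f => exp_ad x \o f) id s.

Definition lie_aut (g : 'End(V)) : Prop :=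
  lker g = 0%VS /\ forall x y, g (br x y) = br (g x) (g y).

Definition bracket_space U W : {vspace V} :=
  <<[seq br x y | x <- vbasis U, y <- vbasis W]>>%VS.

(* Subalgebra generated by U: the increasing iteration W |-> W + [W, W] is    *)
(* stationary after at most dim V steps.                                      *)
Definition lie_gen U : {vspace V} :=
  iter (\dim {:V}) (fun W => (W + bracket_space W W)%VS) U.

Definition centralizer W : {vspace V} :=
  (\bigcap_(i < \dim W) lker (adl (vbasis W)`_i))%VS.

(* Bracket of a subalgebra W, transported to the vectType of its elements.    *)
Definition sub_br W (x y : subvs_of W) : subvs_of W :=
  vsproj W (br (vsval x) (vsval y)).

Definition ad_diagonalizable x : Prop :=
  exists s : seq F, (\sum_(c <- s) ad_eigen x c)%VS = fullv.

Definition split_abelian (a : {vspace V}) : Prop :=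
  (forall x y, x \in a -> y \in a -> br x y = 0) /\
  (forall x, x \in a -> ad_diagonalizable x).

Definition max_split_abelian (H0 : V) (a : {vspace V}) : Prop :=
  [/\ (a <= Vzero H0)%VS, H0 \in a, split_abelian a
    & forall a', (a' <= Vzero H0)%VS -> split_abelian a' -> (a <= a')%VS ->
        a' = a].

End LieAlgebra.

Section BaseChange.
Variables (F : fieldType) (Fbar : closedFieldType) (iota : {rmorphism F -> Fbar}).
Variables (V : vectType F) (br : V -> V -> V).

(* V (x)_F Fbar is realised as Fbar^n in the basis [vbasis {:V}] of V.        *)
Notation n := (\dim {:V}).
Notation e i := ((vbasis {:V})`_i).

Definition bar (v : V) : 'rV[Fbar]_n := \row_i iota (coord (vbasis {:V}) i v).

Definition bar_br (x y : 'rV[Fbar]_n) : 'rV[Fbar]_n :=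
  \sum_(i < n) \sum_(j < n) (x 0 i * y 0 j) *: bar (br (e i) (e j)).

Definition bar_fun (g : 'End(V)) (x : 'rV[Fbar]_n) : 'rV[Fbar]_n :=
  \sum_(i < n) x 0 i *: bar (g (e i)).

Definition bar_space (U : {vspace V}) : {vspace 'rV[Fbar]_n} :=
  <<[seq bar u | u <- vbasis U]>>%VS.

(* Aut_0 of the Lie algebra (V, br).                                          *)
Definition Aut0 (g : 'End(V)) : Prop :=
  lie_aut br g /\ elementary bar_br (bar_fun g).

Definition Aut0_fix (H : V) (g : 'End(V)) : Prop := Aut0 g /\ g H = H.

Record regular_graded (H0 : V) : Prop := {
  rg_lie : lie_bracket br;
  rg_reductive : lie_reductive br;
  rg_sum : (Vminus br H0 + Vzero br H0 + Vplus br H0)%VS = fullv;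
  rg_Vplus_neq0 : Vplus br H0 <> 0%VS;
  rg_irreducible : forall W : {vspace 'rV[Fbar]_n},
    (W <= bar_space (Vplus br H0))%VS ->
    (forall x w, x \in bar_space (Vzero br H0) -> w \in W -> bar_br x w \in W) ->
    W = 0%VS \/ W = bar_space (Vplus br H0);
  rg_sl2 : exists Y X, [/\ Y \in Vminus br H0, X \in Vplus br H0
                         & sl2_triple br Y H0 X]
}.

End BaseChange.

Section Roots.
Variables (F : fieldType) (V : vectType F) (br : V -> V -> V).
Variable a : {vspace V}.

Definition dual := 'Hom(subvs_of a, F^o).
Implicit Types (lam mu : dual) (B : seq dual).

Definition pairing lam (H : V) : F := lam (vsproj a H).

Definition root_space lam : {vspace V} :=
  (\bigcap_(i < \dim a)
     ad_eigen br (vbasis a)`_i (pairing lam (vbasis a)`_i))%VS.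

Definition is_root lam : Prop := lam <> 0 /\ root_space lam <> 0%VS.

Definition nonneg_comb B lam : Prop :=
  exists c : nat -> nat, lam = \sum_(i < size B) B`_i *+ c i.

Definition root_basis (S : dual -> Prop) B : Prop :=
  [/\ forall lam, lam \in B -> S lam, free B
    & forall lam, S lam -> nonneg_comb B lam \/ nonneg_comb B (- lam)].

Definition pos_root B lam : Prop := is_root lam /\ nonneg_comb B lam.

(* The conditions "<> 0" exclude lam = mu and lam = - mu.                     *)
Definition strongly_orthogonal lam mu : Prop :=
  [/\ lam + mu <> 0, lam - mu <> 0, ~ is_root (lam + mu) & ~ is_root (lam - mu)].

(* The element H of a such that mu |-> mu - mu(H) lam is the reflection of    *)
(* the root system attached to lam; it is unique as soon as the roots span    *)
(* the dual of a, in particular if the Lie algebra is simple.                 *)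
Definition is_coroot lam (H : V) : Prop :=
  [/\ H \in a, pairing lam H = 2%:R
    & forall mu, is_root mu -> is_root (mu - pairing mu H *: lam)].

End Roots.

Section Descent.
Variables (F : fieldType) (V : vectType F) (br : V -> V -> V) (H0 : V).
Variables (a : {vspace V}) (k : nat).
Variables (lam : 'I_k.+1 -> dual a) (h : 'I_k.+1 -> V).
Implicit Types (i j s : 'I_k.+1) (g : 'End(V)).

Definition lsub j : {vspace V} :=
  lie_gen br (root_space br (lam j) + root_space br (- lam j))%VS.

(* [gsub j] makes sense up to j = k + 1.                                      *)
Definition gsub (j : nat) : {vspace V} :=
  centralizer br (\sum_(s < k.+1 | (s < j)%N) lsub s)%VS.

Definition Sigma (j : nat) (mu : dual a) : Prop :=
  is_root br mu /\
  forall s, (s < j)%N -> strongly_orthogonal br mu (lam s).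

Definition Vplus_sub (W : {vspace V}) : {vspace V} := (Vplus br H0 :&: W)%VS.

Record is_descent (B : seq (dual a)) : Prop := {
  descent_step : forall j, exists Bj : seq (dual a),
    [/\ root_basis (Sigma j) Bj,
        forall mu, mu \in Bj -> pos_root br B mu,
        lam j \in Bj,
        pairing (lam j) H0 = 2%:R
      & forall mu, mu \in Bj -> pairing mu H0 = 2%:R -> mu = lam j];
  descent_continue : forall j, Vplus_sub (gsub j) <> 0%VS;
  descent_stop : Vplus_sub (gsub k.+1) = 0%VS
}.

(* Below, h j is the coroot of lam j.                                         *)
Definition a0 : {vspace V} := <<[seq h j | j <- enum 'I_k.+1]>>%VS.

Definition Eij i j (p q : int) : {vspace V} :=
  (ad_eigen br (h i) p%:~R :&: ad_eigen br (h j) q%:~R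
   :&: \bigcap_(s < k.+1 | (s != i) && (s != j)) ad_eigen br (h s) 0)%VS.

Definition hgrade j : V := \sum_(s < k.+1 | (j <= s)%N) h s.

Definition Vplus_j j : {vspace V} := Vplus_sub (gsub j).

Definition Vperp j : {vspace V} :=
  ((\sum_(r < k.+1) \sum_(s < k.+1 | ((r < s) && (r < j))%N) Eij r s 1 1)
   + \sum_(r < k.+1 | (r < j)%N) root_space br (lam r))%VS.

Definition nsub : {vspace V} :=
  (\sum_(i < k.+1) \sum_(j < k.+1 | (i < j)%N) Eij i j 1 (-1))%VS.

Definition Ngroup g : Prop :=
  exists2 x, x \in nsub & forall v, g v = exp_ad br x v.

Variables (Fbar : closedFieldType) (iota : {rmorphism F -> Fbar}).

Definition Lgroup g : Prop :=
  Aut0_fix iota br H0 g /\ forall x, x \in a0 -> g x = x.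

Definition Pgroup g : Prop :=
  exists l n, [/\ Lgroup l, Ngroup n & g = (l \o n)%VF].

End Descent.

Section PolynomialFunctions.
Variables (F : fieldType) (V : vectType F).
Implicit Types (U W : {vspace V}).

(* A polynomial on a subspace U is an mpoly in the coordinates of [vbasis U]. *)
Definition peval U (P : {mpoly F[\dim U]}) (X : V) : F :=
  P.@[fun i => coord (vbasis U) i X].

(* The polynomial X |-> P (f X) on U, for a linear map f sending U to W.      *)
Definition pullback U W (f : 'End(V)) (P : {mpoly F[\dim W]}) :
    {mpoly F[\dim U]} :=
  comp_mpoly
    [tuple \sum_(i < \dim U) coord (vbasis W) j (f (vbasis U)`_i) *: 'X_i
       | j < \dim W] P.

End PolynomialFunctions.

Definition irreducible_elt (R : idomainType) (x : R) : Prop :=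
  [/\ x != 0, x \isn't a GRing.unit
    & forall y z, x = y * z -> y \is a GRing.unit \/ z \is a GRing.unit].

Section Invariants.
Variables (F : fieldType) (Fbar : closedFieldType) (iota : {rmorphism F -> Fbar}).
Variables (V E : vectType F).

Definition abs_irreducible n (P : {mpoly F[n]}) : Prop :=
  irreducible_elt (map_mpoly iota P).

Definition is_character (S : 'End(E) -> Prop) (chi : 'End(E) -> F) : Prop :=
  (forall g, S g -> chi g != 0) /\
  (forall g g', S g -> S g' -> chi (g \o g')%VF = chi g * chi g').

Variables (U : {vspace V}) (S : 'End(E) -> Prop) (act : 'End(E) -> V -> V).

(* Relative invariance on U under the group S acting through [act].           *)
Definition relatively_invariant_by (chi : 'End(E) -> F)
    (P : {mpoly F[\dim U]}) : Prop :=
  forall g X, S g -> X \in U -> peval P (act g X) = chi g * peval P X.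

Definition relatively_invariant (P : {mpoly F[\dim U]}) : Prop :=
  exists2 chi, is_character S chi & relatively_invariant_by chi P.

Definition fundamental_invariant (P : {mpoly F[\dim U]}) : Prop :=
  [/\ abs_irreducible P, relatively_invariant P
    & forall Q, abs_irreducible Q -> relatively_invariant Q ->
        exists c : F, Q = c *: P].

End Invariants.

Section SubalgebraInvariants.
Variables (F : fieldType) (Fbar : closedFieldType) (iota : {rmorphism F -> Fbar}).
Variables (V : vectType F) (br : V -> V -> V) (H0 : V).

Definition sub_act (W : {vspace V}) (g : 'End(subvs_of W)) (X : V) : V :=
  vsval (g (vsproj W X)).

(* Fundamental relative invariant on V^+ :&: W of the graded subalgebra W     *)
(* with grading element H, under Aut_0(W) fixing H.                           *)
Definition sub_fundamental_invariant (W : {vspace V}) (H : V)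
    (P : {mpoly F[\dim (Vplus_sub br H0 W)]}) : Prop :=
  fundamental_invariant iota (Aut0_fix iota (sub_br br (W := W)) (vsproj W H))
    (@sub_act W) P.

End SubalgebraInvariants.

Section Delta.
Variables (F : fieldType) (V : vectType F) (br : V -> V -> V) (H0 : V).
Variables (a : {vspace V}) (k : nat).
Variables (lam : 'I_k.+1 -> dual a) (h : 'I_k.+1 -> V).
Variable j : 'I_k.+1.
Variable Pj : {mpoly F[\dim (Vplus_j br H0 lam j)]}.

Definition Delta : {mpoly F[\dim (Vplus br H0)]} :=
  pullback (Vplus br H0)
    (daddv_pi (Vplus_j br H0 lam j) (Vperp br lam h j)) Pj.

Definition nabla (gamma : 'End(V)) : {mpoly F[\dim (Vminus br H0)]} :=
  pullback (Vminus br H0) gamma Delta.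

End Delta.

Section Tori.
Variables (F : fieldType) (V : vectType F).
Implicit Types (A : 'End(V) -> Prop).

(* A is (the group of F-points of) a closed subgroup of GL(V) isomorphic to   *)
(* (G_m)^r, with Lie algebra LieA in End(V): V is the sum of the spaces W i   *)
(* on which t acts by the character t^(c i) of (G_m)^r, and the c i generate  *)
(* Z^r, which says that (G_m)^r -> GL(V) is a closed immersion.               *)
Definition split_torus A (LieA : 'End(V) -> Prop) : Prop :=
  exists r n (W : 'I_n -> {vspace V}) (c : 'I_n -> 'I_r -> int),
  [/\ (\sum_i W i)%VS = fullv /\ directv (\sum_i W i)%VS,
      forall i, W i <> 0%VS,
      forall m : 'I_r, exists z : 'I_n -> int,
        forall m', \sum_i z i * c i m' = (m == m')%:R,
      forall f, A f <-> exists t : 'I_r -> F, (forall m, t m != 0) /\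
        (forall i v, v \in W i -> f v = (\prod_m t m ^ c i m) *: v)
    & forall f, LieA f <-> exists t : 'I_r -> F,
        forall i v, v \in W i -> f v = (\sum_m t m *~ c i m) *: v].

Definition max_split_torus (G : 'End(V) -> Prop) A LieA : Prop :=
  [/\ split_torus A LieA, forall f, A f -> G f
    & forall A' LieA', split_torus A' LieA' -> (forall f, A' f -> G f) ->
        (forall f, A f -> A' f) -> forall f, A' f -> A f].

(* The scalar by which g acts on a nonzero subspace U, when it does.          *)
Definition scalar_on (g : 'End(V)) (U : {vspace V}) : F :=
  coord [tuple vpick U] ord0 (g (vpick U)).

End Tori.

Section Involution.
Variables (F : fieldType) (V : vectType F) (br : V -> V -> V) (k : nat).
Variables (X Y Xg Yg : 'I_k.+1 -> V).

(* w = e^{ad I+} e^{ad I-} e^{ad I+} *)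
Definition w_elt : V -> V := weyl_elt br (\sum_j X j) (\sum_j Y j).

(* Here (Yg i, _, Xg i) is the triple defining gamma_{i,k-i}; note that       *)
(* [rev_ord i] is k - i.                                                      *)
Definition gamma_tilde : V -> V :=
  foldr (fun i f => weyl_elt br (Xg i) (Yg i) \o weyl_elt br (X i) (Y i)
                      \o weyl_elt br (X i) (Y i) \o f) id
    [seq i : 'I_k.+1 <- enum 'I_k.+1 | (i.*2 < k)%N].

End Involution.

(* Main.v *)
Require Import Defs.
From HB Require Import structures.
From mathcomp Require Import all_boot all_order all_algebra all_field.
From mathcomp Require Import mpoly.
From mathcomp Require Import ring.
From Stdlib Require Import Classical.
Set Implicit Arguments.
Unset Strict Implicit.
Unset Printing Implicit Defensive.
Import Order.TTheory GRing.Theory Num.Theory.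
Local Open Scope ring_scope.

(** Everything rests on one differential equation. Call $X\in V^+$ invertible with inverse $Y$ when
    $(Y,H_0,X)$ is an $\mathfrak{sl}_2$-triple; such $X$ are generic, because they contain the locus
    where a polynomial equal to 1 at $I^+$ does not vanish ([invertible_qdet]). For $K$ the Killing
    form, a relative invariant $P$ of $V^+$ satisfies $dP_X(z)=c\,K(Y,z)P(X)$ ([log_derivative]).
    Indeed, products of two Weyl elements make $P$ infinitesimally semi-invariant under $\mathfrak
    g$; the resulting linear form on $\mathfrak g$ kills commutators, so $K$ represents it by a
    central element of $\mathfrak g$, which Schur's lemma identifies as a multiple of $H_0$. Two
    polynomials with equal logarithmic derivatives along lines are proportional, and automorphisms
    preserve both $K$ and inverses; most invariance statements follow from this remark.

    Next split $H_0=h_1+h_2$ by two commuting triples $(f_i,h_i,e_i)$ and look at $R(Z)=P(e_1+Z)$ on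
    the weight 0 space of $h_1$ in $V^+$. The same equation holds there, so $R$ is relatively
    invariant under the $\mathrm{Aut}_0$ of the subalgebra ([block_relatively_invariant]) and
    homogeneous ([block_homog]), and $P$ is multiplicative on block diagonal elements
    ([block_factor]). A unipotent element brings a generic $x$ to block diagonal form; clearing
    denominators in this Schur complement gives $D^dP=S\cdot(R\circ q)$, and since $P$ is prime in a
    factorial polynomial ring, $R$ is absolutely irreducible ([block_irreducible]). Uniqueness of
    fundamental invariants then yields $P_j(Z)=P_0(X_0+\dots+X_{j-1}+Z)$ ([P_block]); the same
    argument for the rank one algebras gives $P_0(\sum x_sX_s)=\prod x_s^\kappa$ ([P0_diag]), whence
    the degrees.

    Consequently $\nabla_j(y)=P_0(X_0+\dots+X_{j-1}+\pi_j(\gamma y))$, with $\pi_j$ the projection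
    of $V^+$ onto $V_j^+$ along $V_j^\perp$, and $\gamma$ exchanges the data on $V^-$ and $V^+$.
    Elements of $L$ act semi-invariantly by the differential equation. An element of $N$ acts, after
    $\pi_j$, through a unipotent fixing $X_s$ for $s<j$, and unipotents leave $P_0$ invariant, since
    $p(t)p(-t)=1$ forces a polynomial $p$ to be constant ([unipotent_invariance]). As
    $\nabla_j(I^-)=1$, the character is $q\mapsto\nabla_j(q.I^-)$: the diagonal formula computes it
    on $A$, and it is 1 on $L\cap H$ because fixing $H_0$ and $I^+$ forces fixing $I^-$ ([fix_f]).
    For (1), a second invariant of $V^-$, moved to $V^+$ by $\gamma$, satisfies the same kind of
    equation, so powers of the two polynomials are proportional ([log_derivative_unique]). *)

Section FactorialRings.

(** * Gauss's theorem: polynomials over a factorial ring *)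

Definition rdvd (R : idomainType) (a b : R) : Prop := exists c, b = c * a.

Definition prime_elt (R : idomainType) (p : R) : Prop :=
  [/\ p != 0, p \isn't a GRing.unit
    & forall x y, rdvd p (x * y) -> rdvd p x \/ rdvd p y].

(** Existence of factorizations into primes is enough: their uniqueness is automatic, since the
    factors are prime and not merely irreducible. *)
Definition factorial (R : idomainType) : Prop := forall c : R, c != 0 ->
  exists u s, [/\ u \is a GRing.unit, forall p, p \in s -> prime_elt p
                & c = u * \prod_(p <- s) p].

Lemma rdvd_add (R : idomainType) (a b c : R) :
  rdvd a b -> rdvd a c -> rdvd a (b + c).
Proof. by move=> [x ->] [y ->]; exists (x + y); rewrite mulrDl. Qed.

Lemma rdvd_mull (R : idomainType) (a b c : R) : rdvd a b -> rdvd a (c * b).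
Proof. by move=> [x ->]; exists (c * x); rewrite mulrA. Qed.

Lemma rdvd_mulr (R : idomainType) (a b c : R) : rdvd a b -> rdvd a (b * c).
Proof. by rewrite mulrC; apply: rdvd_mull. Qed.

Lemma prime_elt_prod (R : idomainType) (p u : R) s :
  prime_elt p -> u \is a GRing.unit -> rdvd p (u * \prod_(q <- s) q) ->
  exists2 q, q \in s & rdvd p q.
Proof.
move=> [p0 pu pP] uu; elim: s => [|q s IH] in u uu *.
  rewrite big_nil mulr1 => -[c uc]; case/negP: pu.
  by move: uu; rewrite uc unitrM => /andP[].
rewrite big_cons mulrCA => /pP [pq|/(IH _ uu) [r rs pr]].
  by exists q; rewrite ?mem_head.
by exists r; rewrite // inE rs orbT.
Qed.

Lemma factorial_irreducible_prime (R : idomainType) (p : R) :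
  factorial R -> irreducible_elt p -> prime_elt p.
Proof.
move=> fR [p0 pu pI]; have [u [s [uu sP pE]]] := fR p p0.
case: s => [|q s] in sP pE *.
  by move: pu; rewrite pE big_nil mulr1 uu.
have [q0 qu qP] : prime_elt q by apply: sP; rewrite mem_head.
move: pE; rewrite big_cons mulrCA => pE.
have [qu'|wu] := pI _ _ pE; first by rewrite qu' in qu.
set w := u * _ in pE wu.
split=> // x y [c xyE]; have [|[d ->]|[d ->]] := qP x y.
- by by exists (c * w); rewrite xyE pE -mulrA (mulrC w).
- by left; exists (d * w^-1); rewrite pE mulrCA divrK // mulrC.
- by right; exists (d * w^-1); rewrite pE mulrCA divrK // mulrC.
Qed.

Lemma rdvd_polyC (R : idomainType) (a : R) (f : {poly R}) :
  rdvd a%:P f <-> forall i, rdvd a f`_i.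
Proof.
split=> [[g ->] i|H]; first by exists g`_i; rewrite coefMC.
have : forall n, exists g : {poly R}, \poly_(i < n) f`_i = g * a%:P.
  elim=> [|n [g gE]]; first by exists 0; rewrite poly_def big_ord0 mul0r.
  have [c cE] := H n; exists (g + c *: 'X^n).
  rewrite poly_def big_ord_recr /= -poly_def gE mulrDl cE.
  by rewrite -!mul_polyC polyCM -!mulrA (mulrC a%:P).
by move=> /(_ (size f)) [g]; rewrite coefK => ->; exists g.
Qed.

(** The quotient of $R[X]$ by $p$ is $(R/p)[X]$, a domain. Concretely, $p$ divides one of the two
    leading coefficients; that leading term is stripped off and induction on the sum of the sizes
    applies. *)
Lemma prime_elt_polyC (R : idomainType) (p : R) :
  prime_elt p -> prime_elt p%:P.
Proof.
move=> [p0 pu pP]; split; first by rewrite polyC_eq0.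
  by rewrite poly_unitE coefC eqxx (negPf pu) andbF.
move=> f g; have [n] := ubnP (size f + size g); elim: n f g => // n IH f g le.
have [->|f0] := eqVneq f 0; first by left; exists 0; rewrite mul0r.
have [->|g0] := eqVneq g 0; first by right; exists 0; rewrite mul0r.
have low (h : {poly R}) : h != 0 ->
    (size (h - lead_coef h *: 'X^((size h).-1))%R < size h)%N.
  move=> h0; have [->|hl0] := eqVneq (h - lead_coef h *: 'X^((size h).-1)) 0.
    by rewrite size_poly0 lt0n size_poly_eq0.
  rewrite ltnNge; apply/negP => hle; move: hl0; rewrite -lead_coef_eq0.
  set k := (h - _) in hle *.
  have lek : (size k <= size h)%N.
    apply: leq_trans (size_polyD _ _) _; rewrite size_polyN geq_max leqnn /=.
    apply: leq_trans (size_scale_leq _ _) _.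
    by rewrite size_polyXn prednK // lt0n size_poly_eq0.
  have ek : size k = size h by apply/eqP; rewrite eqn_leq lek.
  by rewrite lead_coefE ek coefB coefZ coefXn eqxx mulr1 -lead_coefE subrr eqxx.
have div_lead (h : {poly R}) : rdvd p (lead_coef h) ->
    rdvd p%:P (lead_coef h *: 'X^((size h).-1)).
  by move=> [c ->]; exists (c *: 'X^((size h).-1)); rewrite [RHS]mulrC mul_polyC scalerA mulrC.
move=> fg; have [|pf|pg] := pP (lead_coef f) (lead_coef g).
- by rewrite -lead_coefM; move/rdvd_polyC: fg; rewrite lead_coefE; apply.
- set f' := f - lead_coef f *: 'X^((size f).-1).
  have fE : f = f' + lead_coef f *: 'X^((size f).-1) by rewrite subrK.
  have [||pf'|] := IH f' g.
  + by rewrite ltnS in le; apply: leq_trans le; rewrite ltn_add2r low.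
  + rewrite /f' mulrBl; apply: rdvd_add => //; rewrite -mulNr -scaleNr.
    apply: rdvd_mulr; rewrite scaleNr -mulN1r; apply: rdvd_mull; exact: div_lead.
  + by left; rewrite fE; apply: rdvd_add => //; apply: div_lead.
  + by right.
- set g' := g - lead_coef g *: 'X^((size g).-1).
  have gE : g = g' + lead_coef g *: 'X^((size g).-1) by rewrite subrK.
  have [|||pg'] := IH f g'.
  + by rewrite ltnS in le; apply: leq_trans le; rewrite ltn_add2l low.
  + rewrite /g' mulrBr; apply: rdvd_add => //; rewrite -mulrN -scaleNr.
    apply: rdvd_mull; rewrite scaleNr -mulN1r; apply: rdvd_mull; exact: div_lead.
  + by left.
  + by right; rewrite gE; apply: rdvd_add => //; apply: div_lead.
Qed.

(* Gauss: a nonzero constant dividing a product of polynomials can be         *)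
(* distributed over the factors, one prime at a time.                         *)
Lemma gauss_split (R : idomainType) (c : R) (f g h : {poly R}) :
  factorial R -> c != 0 -> c%:P * f = g * h -> exists a b : R,
  [/\ a != 0, b != 0 & exists g' h', [/\ g = a%:P * g', h = b%:P * h' & f = g' * h']].
Proof.
move=> fR c0; have [u [s [uu sP ->]]] := fR c c0.
elim: s => [|p s IH] in sP f g h *.
  rewrite big_nil mulr1 => E; exists 1, u; split; rewrite ?oner_neq0 //.
    by apply: contraTneq uu => ->; rewrite unitr0.
  exists g, (u^-1%:P * h); split; first by rewrite mul1r.
    by rewrite mulrA -polyCM divrr // mul1r.
  by rewrite mulrCA -E mulrA -polyCM mulVr // mul1r.
have [q0 qu qP] : prime_elt p%:P by apply: prime_elt_polyC; apply: sP; rewrite mem_head.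
have sP' r : r \in s -> prime_elt r by move=> rs; apply: sP; rewrite inE rs orbT.
have p0 : p != 0 by rewrite -polyC_eq0.
rewrite big_cons mulrCA polyCM -mulrA => E.
have [|[g1 g1E]|[h1 h1E]] := qP g h; first by exists ((u * \prod_(j <- s) j)%:P * f); rewrite -E mulrC.
  have [|a [b [a0 b0 [g' [h' [gE hE fE]]]]]] := IH sP' f g1 h.
    by apply: (mulfI q0); rewrite E g1E mulrA (mulrC g1).
  exists (p * a), b; split; rewrite ?mulf_neq0 //; exists g', h'; split=> //.
  by rewrite g1E gE mulrC polyCM mulrA.
have [|a [b [a0 b0 [g' [h' [gE hE fE]]]]]] := IH sP' f g h1.
  by apply: (mulfI q0); rewrite E h1E !mulrA (mulrC _ p%:P) mulrA.
exists a, (p * b); split; rewrite ?mulf_neq0 //; exists g', h'; split=> //.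
by rewrite h1E hE mulrC polyCM mulrA.
Qed.

(** The argument runs over the fraction field, where irreducible polynomials are prime by the
    Euclidean algorithm. The divisibility [%|] allows a nonzero constant multiplier and so plays the
    role of divisibility over that field; [gauss_split] removes the multiplier. *)
Lemma primitive_irreducible_prime (R : idomainType) (f : {poly R}) :
  factorial R -> (1 < size f)%N ->
  (forall p, prime_elt p -> ~ rdvd p%:P f) ->
  (forall g h, f = g * h -> (size g <= 1)%N \/ (size h <= 1)%N) ->
  prime_elt f.
Proof.
move=> fR f1 fprim firr.
have f0 : f != 0 by rewrite -size_poly_gt0 ltnW.
have irrf : Pdiv.Field.irreducible_poly f \/ True by right.
(* This is irreducibility over the fraction field. *)
have dvd_or d : d %| f -> size d = 1%N \/ d %= f.
  move=> /Pdiv.WeakIdomain.dvdpP [[c q] /= c0 E].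
  rewrite -mul_polyC in E.
  have [a [b [a0 b0 [g' [h' [qE dE fE]]]]]] := gauss_split fR c0 E.
  have d0 : h' != 0 by apply: contraNneq f0 => h0; rewrite fE h0 mulr0.
  have [s1|s1] := firr _ _ fE; last first.
    left; apply/eqP; rewrite eqn_leq dE mul_polyC size_scale // s1.
    by rewrite size_poly_gt0.
  right; have g0 : g' != 0 by apply: contraNneq f0 => g0; rewrite fE g0 mul0r.
  have g1 : size g' = 1%N by apply/eqP; rewrite eqn_leq s1 size_poly_gt0.
  have /size_poly1P [e e0 gE] : size g' == 1%N by rewrite g1.
  apply/eqpP; exists (e, b) => /=; first by rewrite e0 b0.
  by rewrite dE fE gE -!mul_polyC mulrCA.
split=> //.
  by rewrite poly_unitE; case: eqP => //= f1'; rewrite f1' in f1.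
move=> x y [c xyE].
have fxy : f %| x * y by rewrite xyE dvdp_mull.
(* Since $f$ is primitive, the constant $b$ that [gauss_split] extracts from it has no prime factor,
   hence is a unit. *)
have fin z : f %| z -> rdvd f z.
  move=> /Pdiv.WeakIdomain.dvdpP [[d q] /= d0 E]; rewrite -mul_polyC in E.
  have [a [b [a0 b0 [g' [h' [qE fE zE]]]]]] := gauss_split fR d0 E.
  have [u [s [uu sP bE]]] := fR b b0.
  case: s => [|p s] in sP bE *.
    rewrite big_nil mulr1 in bE; exists (u^-1%:P * g').
    by rewrite zE fE bE mulrAC mulrA -polyCM mulVr // mul1r mulrC.
  case: (fprim p); first by apply: sP; rewrite mem_head.
  rewrite fE bE big_cons; exists ((u * \prod_(j <- s) j)%:P * h').
  by rewrite mulrCA polyCM -mulrA mulrC.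
have [cop|ncop] := boolP (coprimep f x).
  by right; apply: fin; rewrite -(Gauss_dvdpr _ cop).
left; apply: fin; have [g1|geq] := dvd_or (gcdp f x) (dvdp_gcdl _ _).
  by rewrite /coprimep g1 in ncop.
by rewrite -(eqp_dvdl _ geq) dvdp_gcdr.
Qed.

(** The induction is on the size of $f$ and then on the number of primes in its leading coefficient.
    Dividing by a prime constant lowers the second number, a proper factorization lowers the first,
    and otherwise $f$ is itself prime. *)
Lemma factorial_poly (R : idomainType) : factorial R -> factorial {poly R}.
Proof.
move=> fR f f0.
have [n] := ubnP (size f); elim: n => // n IHn in f f0 *; rewrite ltnS => lef.
have l0 : lead_coef f != 0 by rewrite lead_coef_eq0.
have [u [s [uu sP lE]]] := fR _ l0.
have [m] := ubnP (size s); elim: m => // m IHm in f f0 lef l0 u s uu sP lE *.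
rewrite ltnS => les.
have [f1|f1] := leqP (size f) 1.
  exists u%:P, [seq p%:P | p <- s]; split.
  - rewrite poly_unitE size_polyC coefC eqxx uu andbT.
    by rewrite (_ : u != 0) //; apply: contraTneq uu => ->; rewrite unitr0.
  - by move=> p /mapP [q qs ->]; apply: prime_elt_polyC; apply: sP.
  - rewrite [LHS]size1_polyC // big_map -rmorph_prod -polyCM -lE lead_coefE.
    by congr (_`_ _)%:P; case: (size f) f1 => [|[]].
(* The prime constant $p$ divides the leading coefficient, hence is associated to some $q$ in the
   list [s]; the quotient has the list [s] without $q$. *)
have [[p [pP [g gE]]]|nop] := classic (exists p, prime_elt p /\ rdvd p%:P f).
  have [|q qs pq] := @prime_elt_prod _ p u s pP uu.
    by exists (lead_coef g); rewrite -lE gE lead_coefM lead_coefC.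
  have [q0 qu qP] := sP q qs; have [w qE] := pq.
  have [p0 pu pPr] := pP.
  have wu : w \is a GRing.unit.
    have [|[z zE]|[z zE]] := qP w p; first by exists 1; rewrite mul1r -qE.
      move: (pu); case/negP; apply/unitrP; exists z.
      have /mulIf : q != 0 by []. 
      by move=> /(_ (z * p) 1) E; split; rewrite ?(mulrC p); apply: E; rewrite mul1r -mulrA (mulrC p) mulrA -zE qE.
    apply/unitrP; exists z; have E : z * w = 1.
      by apply: (mulIf p0); rewrite mul1r -mulrA -qE -zE.
    by split=> //; rewrite mulrC.
  have g0 : g != 0 by apply: contraNneq f0 => g0; rewrite gE g0 mul0r.
  have sizeg : size g = size f by rewrite gE mulrC mul_polyC size_scale.
  have [||||||u' [s' [uu' sP' gE']]] := IHm g g0 _ _ (u * w) (rem q s).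
  - by rewrite sizeg.
  - by rewrite lead_coef_eq0.
  - by rewrite unitrM uu wu.
  - by move=> r rs; apply: sP; apply: mem_rem rs.
  - apply: (mulIf p0).
    transitivity (lead_coef f); first by rewrite gE lead_coefM lead_coefC.
    rewrite lE (perm_big _ (perm_to_rem qs)) /= big_cons {1}qE.
    by rewrite !mulrA (mulrAC _ p).
  - by rewrite size_rem //; case: (s) qs les => //= *; apply: leq_trans _ les; rewrite ltnS leqnn.
  - exists u', (p%:P :: s'); split=> //.
      by move=> r; rewrite inE => /orP [/eqP ->|/sP'//]; apply: prime_elt_polyC.
    by rewrite gE gE' big_cons mulrAC -!mulrA (mulrC p%:P).
have [[g [h [fE g1 h1]]]|nofact] :=
    classic (exists g h, [/\ f = g * h, (1 < size g)%N & (1 < size h)%N]).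
  have g0 : g != 0 by rewrite -size_poly_gt0 ltnW.
  have h0 : h != 0 by rewrite -size_poly_gt0 ltnW.
  have sE : size f = (size g + size h).-1 by rewrite fE size_mul.
  have lt x y : (1 < x -> 1 < y -> (x + y).-1 <= n -> x < n)%N.
    by case: y => [|[|y]] // _ _; rewrite !addnS /=; apply: leq_ltn_trans; rewrite leq_addr.
  have [|ug [sg [ugu sgP gE]]] := IHn g g0.
    by apply: lt g1 h1 _; rewrite -sE.
  have [|uh [sh [uhu shP hE]]] := IHn h h0.
    by apply: lt h1 g1 _; rewrite addnC -sE.
  exists (ug * uh), (sg ++ sh); split; first by rewrite unitrM ugu uhu.
    by move=> p; rewrite mem_cat => /orP [/sgP|/shP].
  by rewrite big_cat /= fE gE hE mulrACA.
exists 1, [:: f]; split; rewrite ?unitr1 ?big_seq1 ?mul1r // => p.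
rewrite inE => /eqP ->; apply: primitive_irreducible_prime => //.
- by move=> q qP qf; apply: nop; exists q.
- move=> g h fE; have [g1|g1] := leqP (size g) 1; first by left.
  by right; rewrite leqNgt; apply/negP => h1; apply: nofact; exists g, h.
Qed.

Lemma factorial_transfer (R S : idomainType) (f : {rmorphism R -> S})
    (g : {rmorphism S -> R}) :
  cancel f g -> cancel g f -> factorial R -> factorial S.
Proof.
move=> fK gK fR c c0.
have gc0 : g c != 0 by apply: contraNneq c0 => gc; rewrite -[c]gK gc rmorph0.
have [u [s [uu sP cE]]] := fR _ gc0.
have unitf x : (f x \is a GRing.unit) = (x \is a GRing.unit).
  apply/idP/idP=> [/(rmorph_unit g)|/(rmorph_unit f)//]; by rewrite fK.
exists (f u), (map f s); split; first by rewrite unitf.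
  move=> p /mapP [q /sP [q0 qu qP] ->]; split.
  - by apply: contraNneq q0 => fq; rewrite -[q]fK fq rmorph0.
  - by rewrite unitf.
  - move=> x y [d xyE]; have [|[e eE]|[e eE]] := qP (g x) (g y).
    + by exists (g d); rewrite -rmorphM xyE rmorphM /= fK.
    + by left; exists (f e); rewrite -[x]gK eE rmorphM.
    + by right; exists (f e); rewrite -[y]gK eE rmorphM.
by rewrite big_map -rmorph_prod -rmorphM -cE gK.
Qed.

End FactorialRings.

(** * Factoriality of polynomial rings in several variables *)

Section FactorialMPoly.
Variable K : fieldType.

(** The inverse of [muni]: together they identify $K[X_0,\dots,X_n]$ with one-variable polynomials
    over $K[X_0,\dots,X_{n-1}]$, which is the induction step for factoriality. *)
Definition mmultiX n : {poly {mpoly K[n]}} -> {mpoly K[n.+1]} :=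
  horner_eval ('X_ord_max) \o map_poly (@mwiden n K).

HB.instance Definition _ n := GRing.RMorphism.on (@mmultiX n).

Lemma mpoly_morph_eq n (S : comNzRingType) (f g : {rmorphism {mpoly K[n]} -> S}) :
  (forall c, f c%:MP = g c%:MP) -> (forall i, f 'X_i = g 'X_i) -> f =1 g.
Proof.
move=> eC eX p; rewrite (mpolyE p) !rmorph_sum; apply: eq_bigr => m _.
rewrite -mul_mpolyC !rmorphM eC; congr (_ * _).
rewrite mpolyXE_id !rmorph_prod; apply: eq_bigr => i _.
by rewrite !rmorphXn eX.
Qed.

Lemma muniX n (i : 'I_n.+1) :
  muni ('X_i : {mpoly K[n.+1]}) = if unlift ord_max i is Some j then ('X_j)%:P else 'X.
Proof.
rewrite muniE msuppX big_seq1 mcoeffX eqxx scale1r.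
case: unliftP => [j|] ->.
  rewrite mnm1E eq_sym (negPf (neq_lift _ _)) expr0.
  rewrite alg_polyC; congr (_%:P); congr 'X_[_]; apply/mnmP=> l.
  rewrite !mnmE -!val_eqE /= /bump leqNgt ltn_ord add0n.
  by [].
rewrite mnm1E eqxx expr1 -[RHS]scale1r; congr (_ *: _).
rewrite -mpolyX0; congr 'X_[_]; apply/mnmP=> l; rewrite !mnmE -val_eqE /=.
by rewrite gtn_eqF.
Qed.

Lemma muniK n : cancel (@muni n K) (@mmultiX n).
Proof.
move=> p; pose f : {rmorphism _ -> _} := @mmultiX n \o @muni n K.
pose g : {rmorphism {mpoly K[n.+1]} -> {mpoly K[n.+1]}} := idfun.
apply: (@mpoly_morph_eq _ _ f g) => [c|i] /=.
  by rewrite muniC /mmultiX /= map_polyC /horner_eval /= hornerC mwidenC.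
rewrite muniX /mmultiX; case: unliftP => [j|] -> /=.
  rewrite map_polyC /horner_eval /= hornerC mwidenX mnmwiden1; congr 'X_(_).
  by apply: val_inj; rewrite /= /bump leqNgt ltn_ord.
by rewrite map_polyX /horner_eval hornerX.
Qed.

Lemma mmultiXK n : cancel (@mmultiX n) (@muni n K).
Proof.
have mw (p : {mpoly K[n]}) : muni (mwiden p) = p%:P.
  pose f : {rmorphism _ -> _} := @muni n K \o @mwiden n K.
  pose g : {rmorphism {mpoly K[n]} -> {poly {mpoly K[n]}}} := polyC.
  apply: (@mpoly_morph_eq _ _ f g) => [c|i] /=; first by rewrite mwidenC muniC.
  rewrite mwidenX mnmwiden1 muniX.
  have -> : widen_ord (leqnSn n) i = lift ord_max i.
    by apply: val_inj; rewrite /= /bump leqNgt ltn_ord.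
  by rewrite liftK.
move=> p; rewrite /mmultiX /= /horner_eval horner_coef rmorph_sum /=.
rewrite size_map_inj_poly ?mwiden0 //; last exact: inj_mwiden.
rewrite -[RHS]coefK poly_def; apply: eq_bigr => i _.
rewrite coef_map /= rmorphM rmorphXn /= mw muniX.
by rewrite unlift_none mul_polyC.
Qed.

Lemma factorial_mpoly n : factorial {mpoly K[n]}.
Proof.
elim: n => [|n IH].
  move=> c c0; exists c, [::]; split=> //; last by rewrite big_nil mulr1.
  rewrite unfold_in /= /mpoly_unit; rewrite -nvar0_mpolyC eqxx /= unitfE.
  by apply: contraNneq c0 => c0; rewrite (nvar0_mpolyC c) c0 mpolyC0.
exact: (factorial_transfer (@mmultiXK n) (@muniK n) (factorial_poly IH)).
Qed.

Lemma mpoly_irreducible_prime n (p : {mpoly K[n]}) :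
  irreducible_elt p -> prime_elt p.
Proof. exact/factorial_irreducible_prime/factorial_mpoly. Qed.

End FactorialMPoly.

(** * Substitution, derivatives and irreducibility of multivariate polynomials *)

Section MPolyTools.

Lemma mpoly_alg_ind n (R : comNzRingType) (Q : {mpoly R[n]} -> Prop) :
  (forall c, Q c%:MP) -> (forall i, Q 'X_i) ->
  (forall p q, Q p -> Q q -> Q (p + q)) ->
  (forall p q, Q p -> Q q -> Q (p * q)) -> forall p, Q p.
Proof.
move=> QC QX QD QM p; rewrite (mpolyE p).
apply: (big_ind Q) => [|//|m _]; first by rewrite -mpolyC0.
rewrite -mul_mpolyC; apply: (QM _ _ (QC _)); rewrite mpolyXE_id.
apply: (big_ind Q); [by rewrite -mpolyC1 | exact: QM | move=> i _].
by elim: (m i) => [|k IH]; [rewrite expr0 -mpolyC1 | rewrite exprS; apply: QM].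
Qed.

(** The chain rule along a polynomial curve [x]. *)
Lemma deriv_mmap n (R : comNzRingType) (x : 'I_n -> {poly R}) (p : {mpoly R[n]}) :
  (mmap polyC x p)^`() = \sum_i mmap polyC x p^`M(i) * (x i)^`().
Proof.
elim/mpoly_alg_ind: p => [c|i|p q IHp IHq|p q IHp IHq].
- rewrite mmapC derivC big1 // => i _.
  by rewrite mderivC raddf0 mul0r.
- rewrite mmapX mmap1U (bigD1 i) //= big1 => [|j ji].
    by rewrite mderivX mnmE eqxx scale1r (_ : (_ - _)%MM = 0%MM) ?mpolyX0 ?rmorph1 ?mul1r ?addr0 //;
      apply/mnmP => j; rewrite mnmBE subnn mnm0E.
  by rewrite mderivX mnmE eq_sym (negPf ji) scale0r rmorph0 mul0r.
- rewrite rmorphD derivD IHp IHq -big_split; apply: eq_bigr => i _ /=.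
  by rewrite mderivD rmorphD mulrDl.
- rewrite rmorphM derivM IHp IHq mulr_suml mulr_sumr -big_split.
  apply: eq_bigr => i _ /=.
  by rewrite mderivM rmorphD !rmorphM mulrDl; congr (_ + _); rewrite ?mulrA // mulrAC.
Qed.

Lemma horner_mmap n (R : comNzRingType) (x : 'I_n -> {poly R}) (p : {mpoly R[n]}) t :
  (mmap polyC x p).[t] = p.@[fun i => (x i).[t]].
Proof.
elim/mpoly_alg_ind: p => [c|i|p q IHp IHq|p q IHp IHq].
- by rewrite mmapC mevalC hornerC.
- by rewrite mmapX mmap1U mevalXU.
- by rewrite rmorphD mevalD hornerD IHp IHq.
- by rewrite rmorphM mevalM hornerM IHp IHq.
Qed.

Lemma comp_mpolyA n m l (R : comNzRingType) (p : {mpoly R[n]})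
    (lq : n.-tuple {mpoly R[m]}) (lr : m.-tuple {mpoly R[l]}) :
  (p \mPo lq) \mPo lr = p \mPo [tuple (tnth lq i) \mPo lr | i < n].
Proof.
elim/mpoly_alg_ind: p => [c|i|p q IHp IHq|p q IHp IHq].
- by rewrite !comp_mpolyC.
- by rewrite !comp_mpolyXU -!tnth_nth tnth_mktuple.
- by rewrite !rmorphD /= IHp IHq.
- by rewrite !rmorphM /= IHp IHq.
Qed.

Lemma msize_comp_linear n m (R : idomainType) (p : {mpoly R[n]})
    (lq : n.-tuple {mpoly R[m]}) :
  (forall i, msize (tnth lq i) <= 2)%N -> (msize (p \mPo lq) <= msize p)%N.
Proof.
move=> lq2; rewrite comp_mpolyEX.
apply: leq_trans (msize_sum _ _ _) _; rewrite big_tnth; apply/bigmax_leqP => i _.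
set mm := tnth _ _; have mms : mm \in msupp p by exact: mem_tnth.
apply: leq_trans (msizeZ_le _ _) _.
apply: leq_trans (msize_mdeg_lt mms); rewrite comp_mpolyX.
have prodle (r : seq 'I_n) :
    (msize (\prod_(j <- r) tnth lq j ^+ mm j) <= (\sum_(j <- r) mm j).+1)%N.
  elim: r => [|j r IH]; first by rewrite !big_nil msize1.
  rewrite !big_cons.
  have [->|a0] := eqVneq (tnth lq j ^+ mm j) 0; first by rewrite mul0r msize0.
  have [->|b0] := eqVneq (\prod_(j <- r) tnth lq j ^+ mm j) 0; first by rewrite mulr0 msize0.
  rewrite msizeM //.
  have powle : (msize (tnth lq j ^+ mm j) <= (mm j).+1)%N.
    elim: (mm j) => [|k IHk]; first by rewrite expr0 msize1.
    have [->|c0] := eqVneq (tnth lq j) 0; first by rewrite exprS mul0r msize0.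
    rewrite exprS msizeM ?expf_neq0 //.
    have := leq_add (lq2 j) IHk; case: (msize (tnth lq j) + _)%N => //= l.
  have := leq_add powle IH; rewrite addSn addnS.
  by case: (msize _ + msize _)%N.
by apply: leq_trans (prodle _) _; rewrite mdegE.
Qed.

Lemma mpoly_unitE n (K : fieldType) (p : {mpoly K[n]}) :
  (p \is a GRing.unit) = (msize p == 1%N).
Proof.
apply/idP/msize_poly1P => [|[c c0 ->]].
  rewrite unfold_in /= /mpoly_unit unitfE => /andP [/eqP pE p0].
  by exists p@_0%MM.
by rewrite rmorph_unit // unitfE.
Qed.

(* An irreducible polynomial pulled back along a linear projection [tau] with *)
(* section [sigma] stays irreducible: a factor restricting to a constant on   *)
(* the section is constant, since the degrees add up.                         *)
Lemma irreducible_comp n m (K : fieldType) (p : {mpoly K[n]})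
    (tau : n.-tuple {mpoly K[m]}) (sigma : m.-tuple {mpoly K[n]}) :
  (forall i, msize (tnth tau i) <= 2)%N -> (forall i, msize (tnth sigma i) <= 2)%N ->
  (forall i, tnth tau i \mPo sigma = 'X_i) ->
  irreducible_elt p -> irreducible_elt (p \mPo tau).
Proof.
move=> tau2 sigma2 ts [p0 pu pI].
have ptsE : (p \mPo tau) \mPo sigma = p.
  rewrite comp_mpolyA -[RHS]comp_mpoly_id; congr (_ \mPo _).
  by apply: eq_from_tnth => i; rewrite !tnth_mktuple.
have sz : msize (p \mPo tau) = msize p.
  apply/eqP; rewrite eqn_leq msize_comp_linear //=.
  have : (msize ((p \mPo tau) \mPo sigma) <= msize (p \mPo tau))%N.
    exact: msize_comp_linear.
  by rewrite ptsE.
split.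
- by apply: contraNneq p0 => pt0; rewrite -ptsE pt0 comp_mpoly0.
- by rewrite mpoly_unitE sz -mpoly_unitE.
move=> y z pE.
have pE' : p = (y \mPo sigma) * (z \mPo sigma) by rewrite -rmorphM /= -pE ptsE.
have y0 : y != 0 by apply: contraNneq p0 => y0; rewrite pE' y0 comp_mpoly0 mul0r.
have z0 : z != 0 by apply: contraNneq p0 => z0; rewrite pE' z0 comp_mpoly0 mulr0.
have ys0 : y \mPo sigma != 0 by apply: contraNneq p0 => h; rewrite pE' h mul0r.
have zs0 : z \mPo sigma != 0 by apply: contraNneq p0 => h; rewrite pE' h mulr0.
have szE : (msize y + msize z = msize (y \mPo sigma) + msize (z \mPo sigma))%N.
  apply: succn_inj; have := sz; rewrite pE [in RHS]pE' !msizeM // => /(congr1 succn).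
  rewrite !prednK ?addn_gt0 ?lt0n ?msize_poly_eq0 ?y0 ?ys0 // => ->; congr (_.+1).
have leys := msize_comp_linear y sigma2.
have lezs := msize_comp_linear z sigma2.
have eqy : msize y = msize (y \mPo sigma).
  apply/eqP; rewrite eqn_leq leys andbT -(leq_add2r (msize z)) szE.
  by rewrite leq_add2l.
have eqz : msize z = msize (z \mPo sigma).
  by apply/eqP; rewrite -(eqn_add2l (msize y)) szE eqy.
by case: (pI _ _ pE'); rewrite !mpoly_unitE -?eqy -?eqz; [left|right].
Qed.

(** A factorization over [K] is also one over [L], and units are detected by their size, which [f]
    preserves. *)
Lemma irreducible_map n (K L : fieldType) (f : {rmorphism K -> L}) (p : {mpoly K[n]}) :
  irreducible_elt (map_mpoly f p) -> irreducible_elt p.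
Proof.
have sz (q : {mpoly K[n]}) : msize (map_mpoly f q) = msize q.
  by rewrite !msizeE; apply: perm_big; apply: msupp_map_mpoly; apply: fmorph_inj.
case=> p0 pu pI; split.
- by apply: contraNneq p0 => ->; rewrite rmorph0.
- by move: pu; rewrite !mpoly_unitE sz.
- by move=> y z pE; move: (pI (map_mpoly f y) (map_mpoly f z)); rewrite -rmorphM -pE
    !mpoly_unitE !sz => /(_ erefl).
Qed.

End MPolyTools.

(** * Polynomial identities in characteristic 0 *)

Section Char0.
Variable F : fieldType.
Hypothesis charF : [pchar F] =i pred0.

Lemma natf_eq0 n : (n%:R == 0 :> F) = (n == 0%N).
Proof. exact: (pcharf0P F).1. Qed.

Lemma natSf_neq0 n : (n.+1%:R : F) != 0.
Proof. by rewrite natf_eq0. Qed.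

Lemma natf_inj : injective (fun n : nat => n%:R : F).
Proof.
move=> m n; wlog lemn : m n / (m <= n)%N => [wl|] E.
  by case: (leqP m n) => [/wl->//|/ltnW /wl->].
apply/eqP; rewrite eqn_leq lemn -subn_eq0 /= -natf_eq0.
by rewrite natrB // E subrr.
Qed.

Lemma natf_eqr m n : (m%:R == n%:R :> F) = (m == n).
Proof. exact: (inj_eq natf_inj). Qed.

Lemma poly_eq0_eval (p : {poly F}) : (forall t, p.[t] = 0) -> p = 0.
Proof.
move=> p0; apply/eqP; apply: contraT => pn0.
pose rs : seq F := [seq i%:R | i <- iota 0 (size p)].
have : (size rs < size p)%N; last by rewrite size_map size_iota ltnn.
apply: max_poly_roots => //; first by apply/allP => x _; rewrite /root p0.
by rewrite map_inj_uniq ?iota_uniq //; apply: natf_inj.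
Qed.

(** The Zariski density argument of the whole proof: [q] will vanish at the non-invertible points of
    a line, so that identities need checking at invertible points only. *)
Lemma poly_eq0_dense (q p : {poly F}) :
  q != 0 -> (forall t, q.[t] != 0 -> p.[t] = 0) -> p = 0.
Proof.
move=> q0 H; have /eqP : p * q = 0.
  apply: poly_eq0_eval => t; rewrite hornerM.
  by have [->|/H ->] := eqVneq q.[t] 0; rewrite ?mulr0 ?mul0r.
by rewrite mulf_eq0 (negPf q0) orbF => /eqP.
Qed.

Lemma mpoly_eq0_eval n (p : {mpoly F[n]}) : (forall v, p.@[v] = 0) -> p = 0.
Proof.
elim: n p => [|n IH] p p0.
  by rewrite (nvar0_mpolyC p); have := p0 (fun _ => 0); rewrite {1}(nvar0_mpolyC p) mevalC => ->.
rewrite -[p]muniK; suff -> : muni p = 0 by rewrite rmorph0.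
apply/polyP => i; rewrite coef0; apply: IH => v.
pose vc c (j : 'I_n.+1) := if unlift ord_max j is Some j' then v j' else c.
have ev c : (map_poly (meval v) (muni p)).[c] = p.@[vc c].
  pose f : {rmorphism _ -> _} := horner_eval c \o map_poly (meval v) \o @muni n F.
  pose g : {rmorphism {mpoly F[n.+1]} -> F} := meval (vc c).
  apply: (@mpoly_morph_eq _ _ _ f g) => [d|j] /=.
    by rewrite muniC map_polyC /horner_eval /= hornerC !mevalC.
  rewrite muniX mevalXU /vc; case: unliftP => [l|] _.
    by rewrite map_polyC /horner_eval /= hornerC mevalXU.
  by rewrite map_polyX /horner_eval hornerX.
have /polyP /(_ i) : map_poly (meval v) (muni p) = 0.
  by apply: poly_eq0_eval => c; rewrite ev.
by rewrite coef_map coef0.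
Qed.

(** Formally $(p/q)'=0$. The difference $r=p-cq$ vanishes at $t_0$ and satisfies $r'q=rq'$; if it
    had a zero of finite multiplicity $m+1$ there, the lowest order terms would give
    $(m+1)s(t_0)q(t_0)=0$. *)
Lemma deriv_ratio_const (p q : {poly F}) (t0 : F) :
  p^`() * q = p * q^`() -> q.[t0] != 0 -> p = (p.[t0] / q.[t0]) *: q.
Proof.
move=> E q0; set c := _ / _; apply/eqP; rewrite -subr_eq0; set r := p - _.
have rE : r^`() * q = r * q^`().
  by rewrite derivB derivZ !mulrBl E -!mul_polyC mulrAC -mulrA.
have r0 : root r t0 by rewrite /root hornerD hornerN hornerZ divfK // subrr.
apply: contraT => rn0.
have [m [s sn0 rsE]] := multiplicity_XsubC r t0.
rewrite rn0 /= in sn0; case: m => [|m] in rsE *.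
  by move: r0; rewrite rsE expr0 mulr1 (negPf sn0).
have X0 : ('X - t0%:P) ^+ m != 0 by rewrite expf_neq0 // polyXsubC_eq0.
have : ('X - t0%:P) ^+ m * ((s * q) *+ m.+1 + ('X - t0%:P) * (s^`() * q))
     = ('X - t0%:P) ^+ m * (('X - t0%:P) * (s * q^`())).
  have := rE; rewrite rsE derivM deriv_exp derivXsubC mul1r /= exprS => E'.
  transitivity ((s^`() * (('X - t0%:P) * ('X - t0%:P) ^+ m) +
     s * (('X - t0%:P) ^+ m *+ m.+1)) * q); last by rewrite E'; ring.
  by rewrite -!mulrnAr; ring.
move/(mulfI X0)/(congr1 (horner^~ t0)).
rewrite hornerD hornerMn -mulr_natl !hornerM hornerXsubC subrr !mul0r addr0.
by move/eqP; rewrite !mulf_eq0 (negPf q0) -/(root s t0) (negPf sn0) (negPf (natSf_neq0 _)).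
Qed.

(** Comparing leading coefficients. This is what makes a constant defined by Killing forms a natural
    number. *)
Lemma euler_monomial (m : F) (p : {poly F}) :
  'X * p^`() = m *: p -> p != 0 -> exists d : nat, m = d%:R.
Proof.
move=> E p0; exists (size p).-1.
have := congr1 (fun q : {poly F} => q`_(size p).-1) E.
rewrite /= coefXM coefZ -lead_coefE coef_deriv.
have l0 : lead_coef p != 0 by rewrite lead_coef_eq0.
case: (size p) (lead_coefE p) => [|[|n]] /= lE.
- by move=> /esym/eqP; rewrite mulf_eq0 (negPf l0) orbF => /eqP.
- by move=> /esym/eqP; rewrite mulf_eq0 (negPf l0) orbF => /eqP.
- by move=> H; apply: (mulIf l0); rewrite -H lE mulr_natl.
Qed.

Lemma euler_eval (d : nat) (p : {poly F}) :
  'X * p^`() = d%:R *: p -> forall t, p.[t] = t ^+ d * p.[1].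
Proof.
move=> E; suff -> : p = p`_d *: 'X^d.
  by move=> t; rewrite !hornerZ !hornerXn expr1n mulr1 mulrC.
apply/polyP => i; rewrite coefZ coefXn.
have [->|ni] := eqVneq i d; first by rewrite mulr1.
have := congr1 (fun q : {poly F} => q`_i) E.
rewrite /= coefXM coefZ coef_deriv mulr0.
case: i ni => [|i] ni /=.
  move=> /esym/eqP; rewrite mulf_eq0 => /orP [|/eqP //].
  by rewrite natf_eq0 eq_sym (negPf ni).
rewrite -[_ *+ i.+1]mulr_natl => /eqP; rewrite -subr_eq0 -mulrBl mulf_eq0 subr_eq0.
by rewrite natf_eqr (negPf ni) => /eqP.
Qed.

(** Substituting $tX_i$ for $X_i$ multiplies the coefficient of a monomial by $t$ to its degree;
    $t=2$ already separates the degrees. *)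
Lemma msize_homog n (P : {mpoly F[n]}) d : P != 0 ->
  (forall t v, P.@[fun i => t * v i] = t ^+ d * P.@[v]) -> msize P = d.+1.
Proof.
move=> P0 H.
have E t : P \mPo [tuple t *: 'X_i | i < n] = t ^+ d *: P.
  apply/eqP; rewrite -subr_eq0; apply/eqP; apply: mpoly_eq0_eval => v.
  rewrite mevalB mevalZ comp_mpoly_meval -H.
  by rewrite [X in X - _](_ : _ = P.@[fun i => t * v i]) ?subrr //;
    apply: meval_eq => i; rewrite tnth_mktuple mevalZ mevalXU.
have coefE t m : (P \mPo [tuple t *: 'X_i | i < n])@_m = t ^+ mdeg m * P@_m.
  rewrite comp_mpolyEX raddf_sum /= [in RHS](mpolyE P) raddf_sum mulr_sumr /=.
  apply: eq_bigr => m' _; rewrite !mcoeffZ comp_mpolyX.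
  have -> : \prod_(i < n) tnth [tuple t *: ('X_i : {mpoly F[n]}) | i < n] i ^+ m' i
     = t ^+ mdeg m' *: 'X_[m'].
    rewrite (eq_bigr (fun i => t ^+ m' i *: 'X_i ^+ m' i)); last first.
      by move=> i _; rewrite tnth_mktuple exprZn.
    by rewrite scaler_prod -mpolyXE_id prodrXr -mdegE.
  rewrite mcoeffZ mcoeffX; have [->|_] := eqVneq m' m; first by rewrite mulrCA.
  by rewrite !mulr0.
have degE m : m \in msupp P -> mdeg m = d.
  rewrite mcoeff_msupp => Pm.
  have := coefE 2%:R m; rewrite E mcoeffZ => /(mulIf Pm).
  by rewrite -!natrX => /natf_inj /eqP; rewrite eqn_exp2l // => /eqP ->.
by rewrite -(mlead_deg P0) degE // mlead_supp.
Qed.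

End Char0.

(** * Algebras of polynomial functions *)

Section FunctionAlgebras.
Variable F : fieldType.

(* A ring of functions [T -> F] containing the constants: the polynomial      *)
(* functions on [F], and those on a subspace of a vector space.               *)
Record fun_alg (T : Type) (A : (T -> F) -> Prop) : Prop := FunAlg {
  fa_ext : forall f g, f =1 g -> A f -> A g;
  fa_cst : forall c, A (fun _ => c);
  fa_add : forall f g, A f -> A g -> A (fun t => f t + g t);
  fa_mul : forall f g, A f -> A g -> A (fun t => f t * g t)
}.

Definition upoly (f : F -> F) : Prop := exists p : {poly F}, forall t, f t = p.[t].

Lemma upoly_alg : fun_alg upoly.
Proof.
split=> [f g fg [p pE]|c|f g [p pE] [q qE]|f g [p pE] [q qE]].
- by exists p => t; rewrite -fg.
- by exists c%:P => t; rewrite hornerC.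
- by exists (p + q) => t; rewrite hornerD pE qE.
- by exists (p * q) => t; rewrite hornerM pE qE.
Qed.

Lemma upoly_id : upoly id.
Proof. by exists 'X => t; rewrite hornerX. Qed.

Variable V : vectType F.
Implicit Type U : {vspace V}.

Definition poly_on U (f : V -> F) : Prop :=
  exists P : {mpoly F[\dim U]}, forall X, X \in U -> f X = peval P X.

Lemma peval_is_rmorph U X :
  [/\ forall c, peval (U := U) c%:MP X = c,
      forall P Q : {mpoly F[\dim U]}, peval (P + Q) X = peval P X + peval Q X
    & forall P Q : {mpoly F[\dim U]}, peval (P * Q) X = peval P X * peval Q X].
Proof. by split=> *; rewrite /peval ?mevalC ?mevalD ?mevalM. Qed.

Lemma poly_on_alg U : fun_alg (poly_on U).
Proof.
split=> [f g fg [p pE]|c|f g [p pE] [q qE]|f g [p pE] [q qE]].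
- by exists p => t tU; rewrite -fg pE.
- by exists c%:MP => t tU; rewrite /peval mevalC.
- by exists (p + q) => t tU; rewrite /peval mevalD pE ?qE.
- by exists (p * q) => t tU; rewrite /peval mevalM pE ?qE.
Qed.

Lemma poly_on_peval U (P : {mpoly F[\dim U]}) : poly_on U (peval P).
Proof. by exists P. Qed.

Section Closure.
Variables (T : Type) (A : (T -> F) -> Prop).
Hypothesis hA : fun_alg A.

Lemma fa_sum I (r : seq I) (P : pred I) (f : I -> T -> F) :
  (forall i, P i -> A (f i)) -> A (fun t => \sum_(i <- r | P i) f i t).
Proof.
move=> H; elim: r => [|i r IH].
  by apply: fa_ext (fa_cst hA 0) => // t; rewrite big_nil.
case Pi : (P i).
  by apply: fa_ext (fa_add hA (H i Pi) IH) => // t; rewrite big_cons Pi.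
by apply: fa_ext IH => // t; rewrite big_cons Pi.
Qed.

Lemma fa_prod I (r : seq I) (P : pred I) (f : I -> T -> F) :
  (forall i, P i -> A (f i)) -> A (fun t => \prod_(i <- r | P i) f i t).
Proof.
move=> H; elim: r => [|i r IH].
  by apply: fa_ext (fa_cst hA 1) => // t; rewrite big_nil.
case Pi : (P i).
  by apply: fa_ext (fa_mul hA (H i Pi) IH) => // t; rewrite big_cons Pi.
by apply: fa_ext IH => // t; rewrite big_cons Pi.
Qed.

Lemma fa_exp (f : T -> F) n : A f -> A (fun t => f t ^+ n).
Proof.
move=> Af; elim: n => [|n IH].
  by apply: fa_ext (fa_cst hA 1).
by apply: fa_ext (fa_mul hA Af IH) => // t; rewrite exprS.
Qed.

Lemma fa_det n (M : T -> 'M[F]_n) :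
  (forall i j, A (fun t => M t i j)) -> A (fun t => \det (M t)).
Proof.
move=> H; apply: fa_sum => s _.
apply: (fa_mul hA); first exact: (fa_cst hA).
exact: fa_prod.
Qed.

Lemma fa_adj n (M : T -> 'M[F]_n) i j :
  (forall i j, A (fun t => M t i j)) -> A (fun t => (\adj (M t)) i j).
Proof.
move=> H; apply: (fa_ext hA (f := fun t => cofactor (M t) j i)).
  by move=> t; rewrite mxE.
apply: (fa_mul hA); first exact: (fa_cst hA).
apply: fa_det => i' j'; apply: fa_ext (H (lift j i') (lift i j')) => // t.
by rewrite !mxE.
Qed.

Lemma fa_meval n (P : {mpoly F[n]}) (x : T -> 'I_n -> F) :
  (forall i, A (x^~ i)) -> A (fun t => P.@[x t]).
Proof.
move=> H; apply: (fa_ext hA (f := fun t =>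
    \sum_(m <- msupp P) P@_m * \prod_i x t i ^+ m i)) => [t|].
  by rewrite mevalE.
apply: fa_sum => m _; apply: (fa_mul hA); first exact: (fa_cst hA).
by apply: fa_prod => i _; apply: fa_exp.
Qed.

(** Vector-valued polynomial maps. Closure of these under brackets, adjugates and sums proves
    polynomiality in a parameter without exhibiting a polynomial. *)
Definition avec (x : T -> V) : Prop := forall i, A (fun t => coord (vbasis {:V}) i (x t)).

Lemma vbasis_sum (x : V) :
  x = \sum_i coord (vbasis {:V}) i x *: (vbasis {:V})`_i.
Proof. by rewrite -coord_vbasis ?memvf. Qed.

Lemma avec_scalar (phi : {scalar V}) x : avec x -> A (fun t => phi (x t)).
Proof.
move=> Ax; apply: (fa_ext hA (f := fun t =>
    \sum_i coord (vbasis {:V}) i (x t) * phi (vbasis {:V})`_i)) => [t|].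
  rewrite [in RHS](vbasis_sum (x t)) linear_sum; apply: eq_bigr => i _.
  by rewrite linearZ.
by apply: fa_sum => i _; apply: (fa_mul hA) => //; apply: (fa_cst hA).
Qed.

Lemma avec_linear (g : {linear V -> V}) x : avec x -> avec (fun t => g (x t)).
Proof. by move=> Ax i; apply: (avec_scalar (coord (vbasis {:V}) i \o g)). Qed.

Lemma avec_cst v : avec (fun _ => v).
Proof. by move=> i; apply: (fa_cst hA). Qed.

Lemma avec_ext x y : x =1 y -> avec x -> avec y.
Proof. by move=> xy Ax i; apply: fa_ext (Ax i) => // t; rewrite xy. Qed.

Lemma avec_add x y : avec x -> avec y -> avec (fun t => x t + y t).
Proof.
by move=> Ax Ay i; apply: fa_ext (fa_add hA (Ax i) (Ay i)) => // t; rewrite linearD.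
Qed.

Lemma avec_scale f x : A f -> avec x -> avec (fun t => f t *: x t).
Proof.
by move=> Af Ax i; apply: fa_ext (fa_mul hA Af (Ax i)) => // t; rewrite linearZ.
Qed.

Lemma avec_opp x : avec x -> avec (fun t => - x t).
Proof.
move=> Ax; apply: avec_ext (avec_scale (fa_cst hA (-1)) Ax) => t.
by rewrite scaleN1r.
Qed.

Lemma avec_sum I (r : seq I) (P : pred I) (f : I -> T -> V) :
  (forall i, P i -> avec (f i)) -> avec (fun t => \sum_(i <- r | P i) f i t).
Proof.
move=> H j; apply: (fa_ext hA (f := fun t =>
    \sum_(i <- r | P i) coord (vbasis {:V}) j (f i t))) => [t|].
  by rewrite linear_sum.
by apply: fa_sum => i Pi; apply: H.
Qed.

Lemma avec_bilinear (b : V -> V -> V) x y :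
  (forall v, linear (b^~ v)) -> (forall v, linear (b v)) ->
  avec x -> avec y -> avec (fun t => b (x t) (y t)).
Proof.
move=> bl br Ax Ay.
have lin (g : V -> V) : linear g -> forall (I : Type) (r : seq I) (c : I -> F) (v : I -> V),
    g (\sum_(i <- r) c i *: v i) = \sum_(i <- r) c i *: g (v i).
  move=> gl I r c v; elim: r => [|i r IH].
    rewrite !big_nil; have := gl (-1) 0 0; rewrite scaler0 addr0 scaleN1r => E.
    by rewrite E addNr.
  by rewrite !big_cons gl IH.
apply: (avec_ext (x := fun t => \sum_i \sum_j
   (coord (vbasis {:V}) i (x t) * coord (vbasis {:V}) j (y t)) *:
       b (vbasis {:V})`_i (vbasis {:V})`_j)) => [t|].
  rewrite [in RHS](vbasis_sum (x t)) (lin _ (bl _)); apply: eq_bigr => i _.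
  rewrite [in RHS](vbasis_sum (y t)) (lin _ (br _)) scaler_sumr.
  by apply: eq_bigr => j _; rewrite scalerA.
apply: avec_sum => i _; apply: avec_sum => j _; apply: avec_scale (avec_cst _).
exact: (fa_mul hA).
Qed.

Lemma avec_peval U (P : {mpoly F[\dim U]}) x : avec x -> A (fun t => peval P (x t)).
Proof.
move=> Ax; apply: fa_meval => i.
exact: (avec_scalar (coord (vbasis U) i)).
Qed.

End Closure.


End FunctionAlgebras.

(** * Determinant and adjugate on a stable subspace *)

Section Determinants.
Variables (F : fieldType) (V : vectType F) (U : {vspace V}).

Definition mxU (g : 'End(V)) : 'M[F]_(\dim U) :=
  \matrix_(i, j) coord (vbasis U) j (g (vbasis U)`_i).

Definition detU g : F := \det (mxU g).

(** The adjugate stands in for the inverse of [g] on [U]: it depends polynomially on [g], at the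
    price of the factor [detU g]. Coordinates are rows, so matrices act on the right. *)
Definition adjU g (w : V) : V :=
  \sum_j ((\row_i coord (vbasis U) i w) *m \adj (mxU g)) 0 j *: (vbasis U)`_j.

Lemma mem_adjU g w : adjU g w \in U.
Proof.
by apply: memv_suml => j _; apply: memvZ; apply: vbasis_mem; apply: mem_nth; rewrite size_tuple.
Qed.

Lemma adjUK (g : 'End(V)) w : (forall v, v \in U -> g v \in U) -> w \in U ->
  g (adjU g w) = detU g *: w.
Proof.
move=> gU wU; pose r := \row_i coord (vbasis U) i w.
have gb (i : 'I_(\dim U)) : g (vbasis U)`_i = \sum_j mxU g i j *: (vbasis U)`_j.
  have gbU : g (vbasis U)`_i \in U by apply/gU/vbasis_mem/mem_nth; rewrite size_tuple.
  by rewrite [LHS](coord_vbasis gbU); apply: eq_bigr => j _; rewrite mxE.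
have : r *m \adj (mxU g) *m mxU g = detU g *: r.
  by rewrite -mulmxA mul_adj_mx mul_mx_scalar.
rewrite /adjU -/r; set s := r *m _ => sE.
rewrite linear_sum (eq_bigr (fun i => \sum_j (s 0 i * mxU g i j) *: (vbasis U)`_j)).
  rewrite exchange_big /= [in RHS](coord_vbasis wU) scaler_sumr.
  apply: eq_bigr => j _; rewrite -scaler_suml scalerA; congr (_ *: _).
  by have /rowP /(_ j) := sE; rewrite !mxE.
by move=> i _; rewrite linearZ /= gb scaler_sumr; apply: eq_bigr => j _; rewrite scalerA.
Qed.

Lemma detU_id (g : 'End(V)) : (forall v, v \in U -> g v = v) -> detU g = 1.
Proof.
move=> gU; rewrite /detU (_ : mxU g = 1%:M) ?det1 //.
apply/matrixP => i j; rewrite !mxE gU; last by apply/vbasis_mem/mem_nth; rewrite size_tuple.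
by rewrite coord_free // ?(basis_free (vbasisP U)) // eq_sym.
Qed.

Lemma detU_surj (g : 'End(V)) : (forall v, v \in U -> g v \in U) -> detU g != 0 ->
  forall w, w \in U -> exists2 v, v \in U & g v = w.
Proof.
move=> gU g0 w wU; exists ((detU g)^-1 *: adjU g w); first by rewrite memvZ ?mem_adjU.
by rewrite linearZ /= adjUK // scalerA mulVf // scale1r.
Qed.

Section Closure.
Variables (T : Type) (A : (T -> F) -> Prop) (hA : fun_alg A) (g : T -> 'End(V)).
Hypothesis Ag : forall v, v \in U -> avec A (fun t => g t v).

Let Ag_mx i j : A (fun t => mxU (g t) i j).
Proof.
apply: (fa_ext hA (f := fun t => coord (vbasis U) j (g t (vbasis U)`_i))) => [t|].
  by rewrite mxE.
apply: (avec_scalar hA (coord (vbasis U) j)); apply: Ag.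
by apply/vbasis_mem/mem_nth; rewrite size_tuple.
Qed.

Lemma fa_detU : A (fun t => detU (g t)).
Proof. exact: fa_det. Qed.

Lemma avec_adjU w : avec A w -> avec A (fun t => adjU (g t) (w t)).
Proof.
move=> Aw; apply: avec_sum => // j _; apply: avec_scale => //; last exact: avec_cst.
apply: (fa_ext hA (f := fun t => \sum_i coord (vbasis U) i (w t) * (\adj (mxU (g t))) i j)).
  by move=> t; rewrite [in RHS]mxE; apply: eq_bigr => i _; rewrite mxE.
apply: fa_sum => // i _; apply: (fa_mul hA).
  exact: (avec_scalar hA (coord (vbasis U) i)).
exact: fa_adj.
Qed.

End Closure.
End Determinants.

Section Pullback.
Variables (F : fieldType) (V : vectType F) (U W : {vspace V}).

Lemma peval_pullback (f : 'End(V)) (P : {mpoly F[\dim W]}) X :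
  X \in U -> peval (pullback U f P) X = peval P (f X).
Proof.
move=> XU; rewrite /peval /pullback comp_mpoly_meval; apply: meval_eq => i.
rewrite tnth_mktuple rmorph_sum /=.
rewrite [in RHS](coord_vbasis XU) !linear_sum; apply: eq_bigr => j _.
by rewrite mevalZ mevalXU !linearZ mulrC.
Qed.
End Pullback.

(** * Directional derivatives of polynomials on a subspace *)

Section Derivative.
Variables (F : fieldType) (V : vectType F) (U : {vspace V}).
Implicit Types (P Q : {mpoly F[\dim U]}) (X v w z : V).

Definition dpe P X z : F := \sum_i peval P^`M(i) X * coord (vbasis U) i z.

Definition d2pe P X v w : F :=
  \sum_i \sum_j peval P^`M(i)^`M(j) X * coord (vbasis U) j v * coord (vbasis U) i w.

Lemma dpeD P X z z' : dpe P X (z + z') = dpe P X z + dpe P X z'.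
Proof. by rewrite -big_split; apply: eq_bigr => i _; rewrite linearD mulrDr. Qed.

Lemma dpeZ P X c z : dpe P X (c *: z) = c * dpe P X z.
Proof. by rewrite mulr_sumr; apply: eq_bigr => i _; rewrite linearZ /= mulrCA. Qed.

Lemma dpeN P X z : dpe P X (- z) = - dpe P X z.
Proof. by rewrite -scaleN1r dpeZ mulN1r. Qed.

Lemma dpe0 P X : dpe P X 0 = 0.
Proof. by rewrite -(scale0r X) dpeZ mul0r. Qed.

Lemma dpeM P Q X z : dpe (P * Q) X z = dpe P X z * peval Q X + peval P X * dpe Q X z.
Proof.
rewrite mulr_suml mulr_sumr -big_split; apply: eq_bigr => i _ /=.
have [_ pD pM] := peval_is_rmorph U X.
by rewrite mderivM pD !pM; ring.
Qed.

Lemma dpeX P n X z : dpe (P ^+ n.+1) X z = (peval P X ^+ n * dpe P X z) *+ n.+1.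
Proof.
have pX m : peval (P ^+ m) X = peval P X ^+ m by rewrite /peval rmorphXn.
elim: n => [|n IH]; first by rewrite expr0 mul1r.
by rewrite exprS dpeM IH pX [RHS]mulrS mulrnAr mulrA -exprS [dpe _ _ _ * _]mulrC.
Qed.

Lemma d2peC P X v w : d2pe P X v w = d2pe P X w v.
Proof.
rewrite /d2pe exchange_big /=; apply: eq_bigr => j _; apply: eq_bigr => i _.
by rewrite mderiv_comm mulrAC.
Qed.

(** Curves of degree 2 occur because the operators [Uquad] are quadratic in their parameter; lines
    are the case [c = 0]. *)
Lemma peval_curve P a b c : exists p : {poly F},
  (forall t, p.[t] = peval P (a + t *: b + t ^+ 2 *: c)) /\
  (forall t, p^`().[t] = dpe P (a + t *: b + t ^+ 2 *: c) (b + (t *+ 2) *: c)).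
Proof.
pose cU i := coord (vbasis U) i.
pose x i := (cU i a)%:P + cU i b *: 'X + cU i c *: 'X^2.
have ev Q t : (mmap polyC x Q).[t] = peval Q (a + t *: b + t ^+ 2 *: c).
  rewrite horner_mmap; apply: meval_eq => i; rewrite /x !hornerD !hornerZ hornerC hornerX hornerXn.
  by rewrite !linearD !linearZ /= /cU; ring.
exists (mmap polyC x P); split=> t; first exact: ev.
rewrite deriv_mmap horner_sum; apply: eq_bigr => i _.
rewrite hornerM ev; congr (_ * _); rewrite /x !derivD derivC !derivZ derivX derivXn.
rewrite !hornerD !hornerZ hornerMn hornerXn horner0 hornerC linearD linearZ /= /cU; ring.
Qed.

Lemma dpe_curve P X v w w' : exists p : {poly F},
  (forall t, p.[t] = dpe P (X + t *: v) (w + t *: w')) /\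
  p^`().[0] = d2pe P X v w + dpe P X w'.
Proof.
have /fin_all_exists [q qE] (i : 'I_(\dim U)) := peval_curve P^`M(i) X v 0.
pose cU i := coord (vbasis U) i.
exists (\sum_i q i * ((cU i w)%:P + cU i w' *: 'X)); split.
  move=> t; rewrite horner_sum; apply: eq_bigr => i _.
  rewrite hornerM (qE i).1 scaler0 addr0 hornerD hornerC hornerZ hornerX /cU.
  by rewrite [in RHS]linearD linearZ /= [t * _]mulrC.
rewrite raddf_sum /= horner_sum -big_split; apply: eq_bigr => i _ /=.
rewrite derivM hornerD !hornerM (qE i).1 (qE i).2 !scaler0 !addr0 scale0r addr0.
rewrite derivD derivC derivZ derivX hornerD hornerC hornerZ hornerX mulr0 addr0 add0r.
by rewrite hornerZ hornerC mulr1 /dpe mulr_suml /cU.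
Qed.

Hypothesis charF : [pchar F] =i pred0.

(** [P] is an eigenvector of the two linear vector fields [A] and [B], so their commutator kills it;
    at the level of second derivatives this is the symmetry of [d2pe]. *)
Lemma dpe_commutator P (A B : V -> V) alpha beta :
  linear A -> linear B ->
  (forall x, x \in U -> A x \in U) -> (forall x, x \in U -> B x \in U) ->
  (forall x, x \in U -> dpe P x (A x) = alpha * peval P x) ->
  (forall x, x \in U -> dpe P x (B x) = beta * peval P x) ->
  forall x, x \in U -> dpe P x (A (B x) - B (A x)) = 0.
Proof.
move=> Al Bl AU BU hA hB x xU.
(* Differentiate the eigenvector identity for [B'] at [x] in the direction [A' x]. *)
have half (A' B' : V -> V) alpha' beta' : linear B' ->
   (forall x, x \in U -> A' x \in U) ->
   (forall x, x \in U -> dpe P x (A' x) = alpha' * peval P x) ->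
   (forall x, x \in U -> dpe P x (B' x) = beta' * peval P x) ->
   d2pe P x (A' x) (B' x) + dpe P x (B' (A' x)) = beta' * (alpha' * peval P x).
  move=> Bl' AU' hA' hB'.
  have [p [pE p0]] := dpe_curve P x (A' x) (B' x) (B' (A' x)).
  have [q [qE q0]] := peval_curve P x (A' x) 0.
  have pq : p = beta' *: q.
    apply/eqP; rewrite -subr_eq0; apply/eqP/(poly_eq0_eval charF) => t.
    rewrite hornerD hornerN hornerZ pE qE scaler0 addr0 -hB'.
      by rewrite [x + _]addrC Bl' [B' x + _]addrC subrr.
    by rewrite memvD // memvZ // AU'.
  rewrite -p0 pq derivZ hornerZ q0 !scaler0 !addr0 scale0r addr0 hA' //.
rewrite dpeD dpeN.
have := half A B alpha beta Bl AU hA hB; have := half B A beta alpha Al BU hB hA.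
rewrite d2peC [alpha * _]mulrCA => <- /addrI ->.
by rewrite subrr.
Qed.

End Derivative.

Lemma vcoord_inj (F : fieldType) (V : vectType F) (x y : V) :
  (forall i : 'I_(\dim {:V}), coord (vbasis {:V}) i x = coord (vbasis {:V}) i y) -> x = y.
Proof.
by move=> E; rewrite (vbasis_sum x) (vbasis_sum y); apply: eq_bigr => i _; rewrite E.
Qed.

(* Linear identities between vectors, checked on coordinates. *)
Ltac vcoord :=
  match goal with V : vectType _ |- _ => apply: (@vcoord_inj _ V) => ? end;
  rewrite ?(linearD, linearN, linearZ, linear0, linearMn) /=.
Ltac vring := vcoord; ring.
Ltac vfield := vcoord; field.

(** * Elementary identities in Lie algebras *)

Section LieBasics.
Variables (F : fieldType) (V : vectType F) (br : V -> V -> V).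
Hypothesis hL : lie_bracket br.
Implicit Types (x y z H v w : V) (U W Z : {vspace V}).

Lemma brDr x y z : br x (y + z) = br x y + br x z.
Proof. by have := lie_linearr hL x 1 y z; rewrite !scale1r. Qed.

Lemma br0r x : br x 0 = 0.
Proof. by apply: (addrI (br x 0)); rewrite -brDr !addr0. Qed.

Lemma brZr c x y : br x (c *: y) = c *: br x y.
Proof. by have := lie_linearr hL x c y 0; rewrite br0r !addr0. Qed.

Lemma brNr x y : br x (- y) = - br x y.
Proof. by rewrite -scaleN1r brZr scaleN1r. Qed.

Lemma brBr x y z : br x (y - z) = br x y - br x z.
Proof. by rewrite brDr brNr. Qed.

Lemma brC x y : br x y = - br y x.
Proof.
have := lie_alternating hL (x + y).
have Dl z : br (x + y) z = br x z + br y z.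
  by have := lie_linearl hL z 1 x y; rewrite !scale1r.
rewrite Dl !brDr !lie_alternating // add0r addr0 => /eqP.
by rewrite addr_eq0 => /eqP.
Qed.

Lemma brDl x y z : br (x + y) z = br x z + br y z.
Proof. by rewrite brC brDr opprD -!(brC _ z). Qed.

Lemma br0l x : br 0 x = 0.
Proof. by rewrite brC br0r oppr0. Qed.

Lemma brZl c x y : br (c *: x) y = c *: br x y.
Proof. by rewrite brC brZr -scalerN -brC. Qed.

Lemma brNl x y : br (- x) y = - br x y.
Proof. by rewrite -scaleN1r brZl scaleN1r. Qed.

Lemma brBl x y z : br (x - y) z = br x z - br y z.
Proof. by rewrite brDl brNl. Qed.

Lemma brxx x : br x x = 0.
Proof. exact: lie_alternating. Qed.

(* [ad x] is a derivation. *)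
Lemma brA x y z : br x (br y z) = br (br x y) z + br y (br x z).
Proof.
have /eqP := lie_jacobi hL x y z; rewrite -addrA addr_eq0 => /eqP ->.
by rewrite opprD addrC (brC z (br x y)) opprK (brC z x) brNr opprK.
Qed.

Lemma br_sumr I (r : seq I) (P : pred I) x (f : I -> V) :
  br x (\sum_(i <- r | P i) f i) = \sum_(i <- r | P i) br x (f i).
Proof. by apply: (big_morph (br x)) => [y z|]; [apply: brDr|apply: br0r]. Qed.

Lemma br_suml I (r : seq I) (P : pred I) x (f : I -> V) :
  br (\sum_(i <- r | P i) f i) x = \sum_(i <- r | P i) br (f i) x.
Proof. by apply: (big_morph (br^~ x)) => [y z|]; [apply: brDl|apply: br0l]. Qed.

Lemma adlE x y : adl br x y = br x y.
Proof.
pose f := GRing.isLinear.Build F V V _ (br x) (lie_linearr hL x).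
pose g : {linear V -> V} := HB.pack (br x) f.
exact: (lfunE g).
Qed.

Lemma mem_ad_eigen H (c : F) v : (v \in ad_eigen br H c) = (br H v == c *: v).
Proof.
by rewrite memv_ker add_lfunE opp_lfunE scale_lfunE id_lfunE adlE subr_eq0.
Qed.

Lemma ad_eigenP H (c : F) v : reflect (br H v = c *: v) (v \in ad_eigen br H c).
Proof. by rewrite mem_ad_eigen; apply: eqP. Qed.

Lemma br_eigen H c d x y :
  br H x = c *: x -> br H y = d *: y -> br H (br x y) = (c + d) *: br x y.
Proof. by move=> Hx Hy; rewrite brA Hx Hy brZl brZr -scalerDl. Qed.

Lemma centralizerP W v : reflect (forall w, w \in W -> br w v = 0) (v \in centralizer br W).
Proof.
apply: (iffP idP) => [vW w wW|H].
  rewrite (coord_vbasis wW) br_suml big1 // => i _; rewrite brZl.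
  have /subv_bigcapP /(_ i isT) : (<[v]> <= centralizer br W)%VS by rewrite -memvE.
  by rewrite -memvE memv_ker adlE => /eqP ->; rewrite scaler0.
rewrite memvE; apply/subv_bigcapP => i _; rewrite -memvE memv_ker adlE H //.
by apply/vbasis_mem/mem_nth; rewrite size_tuple.
Qed.

Lemma centralizer_br W x y :
  x \in centralizer br W -> y \in centralizer br W -> br x y \in centralizer br W.
Proof.
move=> /centralizerP hx /centralizerP hy; apply/centralizerP => w wW.
by rewrite brA (hx _ wW) (hy _ wW) br0l br0r addr0.
Qed.

Lemma mem_bracket_space U W x y : x \in U -> y \in W -> br x y \in bracket_space br U W.
Proof.
move=> xU yW; rewrite (coord_vbasis xU) br_suml; apply: memv_suml => i _.
rewrite (coord_vbasis yW) br_sumr; apply: memv_suml => j _.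
rewrite brZl brZr; do 2!apply: memvZ; apply: memv_span.
by apply: allpairs_f; apply: mem_nth; rewrite size_tuple.
Qed.

Lemma bracket_space_sub U W Z :
  (forall x y, x \in U -> y \in W -> br x y \in Z) -> (bracket_space br U W <= Z)%VS.
Proof.
move=> H; apply/span_subvP => z /allpairsP [[x y] /= [xU yW ->]].
by apply: H; apply: vbasis_mem.
Qed.

Let genstep W := (W + bracket_space br W W)%VS.

Lemma lie_gen_sub U : (U <= lie_gen br U)%VS.
Proof.
rewrite /lie_gen; elim: (\dim _) => [|n IH]; first exact: subvv.
by rewrite iterS; apply: subv_trans IH _; apply: addvSl.
Qed.

Lemma lie_gen_min U W : (U <= W)%VS ->
  (forall x y, x \in W -> y \in W -> br x y \in W) -> (lie_gen br U <= W)%VS.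
Proof.
move=> UW WW; rewrite /lie_gen; elim: (\dim _) => [|n IH] //.
rewrite iterS subv_add IH /=; apply: bracket_space_sub => x y xW yW.
by apply: WW; apply: (subvP IH).
Qed.

(** An increasing chain of subspaces is stationary within $\dim V$ steps, and a stationary term is
    closed under the bracket. *)
Lemma lie_gen_br U x y :
  x \in lie_gen br U -> y \in lie_gen br U -> br x y \in lie_gen br U.
Proof.
rewrite /lie_gen -/genstep; set n := \dim _.
have [i [lei fixi]] : exists i, (i <= n)%N /\ iter i.+1 genstep U = iter i genstep U.
  apply: NNPP => nex.
  have step i : (i <= n.+1)%N -> (i <= \dim (iter i genstep U))%N.
    elim: i => // i IH lt; have := IH (ltnW lt); set W := iter i genstep U => leW.
    apply: leq_ltn_trans leW _; rewrite iterS -/W.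
    have sub : (W <= genstep W)%VS by apply: addvSl.
    rewrite ltn_neqAle dimvS // andbT; apply/negP => /eqP E; apply: nex.
    by exists i; split=> //; rewrite iterS -/W; apply/eqP; rewrite eq_sym eqEdim sub E leqnn.
  by have := leq_trans (step n.+1 (leqnn _)) (dimvS (subvf _)); rewrite ltnn.
have fixj j : iter (i + j) genstep U = iter i genstep U.
  by elim: j => [|j IH]; rewrite ?addn0 // addnS iterS IH -iterS fixi.
have -> : iter n genstep U = iter i genstep U by rewrite -(subnKC lei) fixj.
move=> xW yW; rewrite -fixi iterS; apply: (subvP (addvSr _ _)).
exact: mem_bracket_space.
Qed.

End LieBasics.

(** * Exponentials of nilpotent derivations *)

Section TriangularSum.

Lemma sum_triangle (Z : nmodType) (f : nat -> nat -> Z) N :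
  \sum_(n < N) \sum_(i < n.+1) f i (n - i)%N = \sum_(i < N) \sum_(j < N - i) f i j.
Proof.
elim: N => [|N IH]; first by rewrite !big_ord0.
rewrite big_ord_recr /= IH big_ord_recr /= addrA.
rewrite [in RHS]big_ord_recr /= subSn // subnn big_ord_recl big_ord0 addr0.
congr (_ + _); rewrite -?big_split /=.
by apply: eq_bigr => i _; rewrite subSn ?(ltnW (ltn_ord i)) // big_ord_recr.
Qed.

Lemma sum_triangle_square (Z : nmodType) (f : nat -> nat -> Z) m :
  (forall i j, (m <= i)%N || (m <= j)%N -> f i j = 0) ->
  \sum_(n < m + m) \sum_(i < n.+1) f i (n - i)%N = \sum_(i < m) \sum_(j < m) f i j.
Proof.
move=> f0; rewrite sum_triangle big_split_ord /= [X in _ + X]big1 ?addr0 => [|i _].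
  apply: eq_bigr => i _; have lei : (m <= m + m - i)%N.
    by rewrite -addnBA ?leq_addr // ltnW.
  rewrite -(subnKC lei) big_split_ord /= [X in _ + X]big1 ?addr0 // => j _.
  by rewrite f0 // leq_addr orbT.
by rewrite big1 // => j _; rewrite f0 // leq_addr.
Qed.

End TriangularSum.

Section Exponential.
Variables (F : fieldType).
Hypothesis charF : [pchar F] =i pred0.

Definition expD (V : lmodType F) (D : V -> V) N y : V :=
  \sum_(i < N) (i`!%:R)^-1 *: iter i D y.

(** The binomial formula turns the derivation rule into multiplicativity of the exponential; the
    higher powers vanish, so the triangular sum is a full square. Three different spaces are allowed
    in order to cover brackets, invariant forms and the evaluation of endomorphisms. *)
Lemma expD_leibniz (V W Z : lmodType F) (b : V -> W -> Z) (D1 : V -> V) (D2 : W -> W)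
    (DZ : Z -> Z) m :
  (forall x, linear (b x)) -> (forall y, linear (b^~ y)) -> linear DZ ->
  (forall x y, DZ (b x y) = b (D1 x) y + b x (D2 y)) ->
  (forall x, iter m D1 x = 0) -> (forall y, iter m D2 y = 0) ->
  forall x y, b (expD D1 m x) (expD D2 m y) = expD DZ (m + m) (b x y).
Proof.
move=> br_ bl_ DZl Db D1m D2m x y.
have bDr x1 y1 y2 : b x1 (y1 + y2) = b x1 y1 + b x1 y2.
  by have := br_ x1 1 y1 y2; rewrite !scale1r.
have b0r x1 : b x1 0 = 0 by apply: (addrI (b x1 0)); rewrite -bDr !addr0.
have bZr c x1 y1 : b x1 (c *: y1) = c *: b x1 y1.
  by have := br_ x1 c y1 0; rewrite b0r !addr0.
have bDl x1 x2 y1 : b (x1 + x2) y1 = b x1 y1 + b x2 y1.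
  by have := bl_ y1 1 x1 x2; rewrite !scale1r.
have b0l y1 : b 0 y1 = 0 by apply: (addrI (b 0 y1)); rewrite -bDl !addr0.
have bZl c x1 y1 : b (c *: x1) y1 = c *: b x1 y1.
  by have := bl_ y1 c x1 0; rewrite b0l !addr0.
have ZD z1 z2 : DZ (z1 + z2) = DZ z1 + DZ z2 by have := DZl 1 z1 z2; rewrite !scale1r.
have Z0 : DZ 0 = 0 by apply: (addrI (DZ 0)); rewrite -ZD !addr0.
have ZZ c z : DZ (c *: z) = c *: DZ z by have := DZl c z 0; rewrite Z0 !addr0.
have itD n : iter n DZ (b x y) =
    \sum_(i < n.+1) 'C(n, i)%:R *: b (iter i D1 x) (iter (n - i) D2 y).
  elim: n => [|n IH]; first by rewrite big_ord_recl big_ord0 addr0 scale1r.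
  rewrite iterS IH (big_morph DZ ZD Z0).
  have step i : DZ ('C(n, i)%:R *: b (iter i D1 x) (iter (n - i) D2 y)) =
      'C(n, i)%:R *: b (iter i.+1 D1 x) (iter (n - i) D2 y) +
      'C(n, i)%:R *: b (iter i D1 x) (iter (n - i).+1 D2 y).
    by rewrite ZZ Db scalerDr.
  rewrite (eq_bigr _ (fun (i : 'I_n.+1) _ => step i)) big_split /=.
  rewrite [in RHS]big_ord_recl /= ?subn0 bin0 big_ord_recr /= binn subnn.
  rewrite [X in _ + X]big_ord_recl /= ?subn0 bin0 addrCA; congr (_ + _).
  rewrite [in RHS]big_ord_recr /= /bump /= !add1n binn subnn addrAC; congr (_ + _).
  rewrite -big_split /=; apply: eq_bigr => i _.
  rewrite /bump /= !add1n add0n subSS -[D2 (iter _ D2 y)]iterS -subSn ?ltn_ord // subSS -scalerDl -natrD.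
  by rewrite addnC -binS.
have -> : expD DZ (m + m) (b x y) = \sum_(n < m + m) \sum_(i < n.+1)
    (fun i j => ((i`!%:R)^-1 * (j`!%:R)^-1) *: b (iter i D1 x) (iter j D2 y)) i (n - i)%N.
  apply: eq_bigr => n _; rewrite itD scaler_sumr; apply: eq_bigr => i _.
  rewrite scalerA; congr (_ *: _).
  have lein : (i <= n)%N by rewrite -ltnS.
  have fn0 k : (k`!%:R : F) != 0 by rewrite (natf_eq0 charF) -lt0n fact_gt0.
  apply: (mulfI (fn0 n)); rewrite mulVKf // -(bin_fact lein) !natrM.
  by field; rewrite !fn0.
rewrite (@sum_triangle_square _ (fun i j => ((i`!%:R)^-1 * (j`!%:R)^-1) *: b (iter i D1 x) (iter j D2 y))); last first.
  have it0 (U : lmodType F) (D : U -> U) u k : (forall u, iter m D u = 0) -> (m <= k)%N -> iter k D u = 0.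
    by move=> H /subnK <-; rewrite addnC iterD H.
  by move=> i j /orP [h|h]; rewrite (it0 _ _ _ _ _ h) ?b0l ?b0r ?scaler0.
rewrite /expD (big_morph (b^~ _) (fun u v => bDl u v _) (b0l _)); apply: eq_bigr => i _.
rewrite (big_morph (b _) (fun u v => bDr _ u v) (b0r _)); apply: eq_bigr => j _.
by rewrite bZl bZr scalerA.
Qed.

Lemma expD_widen (V : lmodType F) (D : V -> V) m N y :
  (forall y, iter m D y = 0) -> (m <= N)%N -> expD D N y = expD D m y.
Proof.
move=> D0 /subnKC <-; rewrite /expD big_split_ord /= [X in _ + X]big1 ?addr0 // => i _.
by rewrite iterD D0 scaler0.
Qed.

End Exponential.

Section NilpotentExp.
Variables (F : fieldType).
Hypothesis charF : [pchar F] =i pred0.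
Variables (V : vectType F) (br : V -> V -> V).

(** The images of the powers of [f] decrease strictly until they become stationary, and the
    stationary value is 0 by nilpotency. *)
Lemma nilpotent_dim (f : 'End(V)) m :
  (forall y, iter m f y = 0) -> forall y, iter (\dim {:V}) f y = 0.
Proof.
move=> fm; pose U i := iter i (fun W => f @: W)%VS fullv.
have itU i y : iter i f y \in U i.
  by elim: i => [|i IH]; [rewrite memvf|rewrite iterS; apply: memv_img].
have Ule i : (U i.+1 <= U i)%VS.
  by elim: i => [|i IH]; [apply: subvf|rewrite /U !iterS; apply: limgS].
have Uit i u : u \in U i -> exists y, u = iter i f y.
  elim: i u => [|i IH] u; first by exists u.
  by rewrite /U iterS => /memv_imgP [v /IH [y ->] ->]; exists y; rewrite iterS.
have dimU i : (\dim (U i) <= \dim {:V} - i)%N.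
  elim: i => [|i IH]; first by rewrite subn0.
  have [E|ne] := eqVneq (U i.+1) (U i); last first.
    have lt : (\dim (U i.+1) < \dim (U i))%N.
      rewrite ltn_neqAle dimvS // andbT; apply: contraNneq ne => E.
      by rewrite eqEdim Ule E leqnn.
    by rewrite subnS -ltnS; apply: leq_trans lt (leq_trans IH (leqSpred _)).
  have stab j : U (i + j)%N = U i.
    by elim: j => [|j IHj]; rewrite ?addn0 // addnS /U iterS -/(U (i + j)%N) IHj.
  suff -> : U i.+1 = 0%VS by rewrite dimv0.
  rewrite E; apply/eqP; rewrite -subv0; apply/subvP => u.
  rewrite -(stab m) => /Uit [y ->]; rewrite iterD fm memv0.
  by apply/eqP; elim: (i) => // l IHl; rewrite iterS IHl linear0.
move=> y; apply/eqP; rewrite -memv0.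
have /eqP <- : U (\dim {:V}) == 0%VS by rewrite -dimv_eq0 -leqn0 -(subnn (\dim {:V})).
exact: itU.
Qed.

Section OneElement.
Variable x : V.
Hypotheses (brl : linear (br x)) (nilx : ad_nilpotent br x).

Let f : {linear V -> V} := HB.pack (br x) (GRing.isLinear.Build F V V _ (br x) brl).

Let D0 : br x 0 = 0 := linear0 f.

Lemma ad_nilpotent_dim N y : (\dim {:V} <= N)%N -> iter N (br x) y = 0.
Proof.
have [m fm] := nilx => /subnK <-.
have E n z : iter n (linfun f) z = iter n (br x) z.
  by apply: eq_iter => w; rewrite lfunE.
rewrite addnC iterD -E; apply: (@nilpotent_dim _ m) => z.
by rewrite E.
Qed.

Lemma exp_adE N y : (\dim {:V} <= N)%N -> exp_ad br x y = expD (br x) N y.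
Proof.
move=> leN; rewrite (@expD_widen _ _ _ (\dim {:V})) //.
  by rewrite -(@expD_widen _ _ _ _ (\dim {:V}).+1) // => z; apply: ad_nilpotent_dim.
by move=> z; apply: ad_nilpotent_dim.
Qed.

Lemma exp_ad_leibniz (Z : lmodType F) (b : V -> V -> Z) (DZ : Z -> Z) y z :
  (forall x, linear (b x)) -> (forall y, linear (b^~ y)) -> linear DZ ->
  (forall y z, DZ (b y z) = b (br x y) z + b y (br x z)) ->
  b (exp_ad br x y) (exp_ad br x z) = expD DZ (\dim {:V} + \dim {:V}) (b y z).
Proof.
move=> blr bll DZl Db; rewrite !(exp_adE _ (leqnn _)).
by apply: expD_leibniz => // w; apply: ad_nilpotent_dim.
Qed.

(** An invariant form is a bilinear map whose target carries the zero derivation, so only the term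
    of index 0 survives in [exp_ad_leibniz]. *)
Lemma exp_ad_form (b : V -> V -> F) :
  (forall x, scalar (b x)) -> (forall y, scalar (b^~ y)) ->
  (forall y z, b (br x y) z + b y (br x z) = 0) ->
  forall y z, b (exp_ad br x y) (exp_ad br x z) = b y z.
Proof.
move=> blr bll bsk y z.
rewrite (@exp_ad_leibniz F^o b (fun _ => 0)) //; last first.
  by move=> c u v; rewrite scaler0 addr0.
rewrite /expD; case E : (\dim {:V} + \dim {:V})%N => [|n].
  have V0 (v : V) : v = 0.
    move/eqP: E; rewrite addn_eq0 => /andP [/eqP d0 _].
    by apply/eqP; rewrite -memv0; move: (memvf v); have /eqP -> : {:V}%VS == 0%VS by rewrite -dimv_eq0 d0.
  rewrite big_ord0 (V0 y); have := blr 0 1 0 0.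
  by rewrite (V0 z) scale1r addr0 mul1r -{1}[b 0 0]addr0 => /addrI ->.
rewrite big_ord_recl /= fact0 invr1 scale1r big1 ?addr0 // => i _.
by rewrite scaler0.
Qed.

Lemma exp_ad_linear : linear (exp_ad br x).
Proof.
have itl n : linear (iter n (br x)).
  by elim: n => [|n IH] // c u v; rewrite !iterS IH brl.
move=> c u v; rewrite /exp_ad scaler_sumr -big_split; apply: eq_bigr => i _ /=.
by rewrite itl scalerDr !scalerA mulrC.
Qed.

(** Applying to the exponential the last power of $\mathrm{ad}\,x$ that does not kill $y$ leaves a
    single nonzero term. *)
Lemma exp_ad_inj y : exp_ad br x y = 0 -> y = 0.
Proof.
move=> E; apply: NNPP => /eqP y0.
have it0 n : iter n (br x) 0 = 0 by elim: n => // n IH; rewrite iterS IH D0.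
have [m fm] := nilx.
have ex : exists n, iter n (br x) y == 0 by exists m; rewrite fm.
have [n /eqP yn min] := ex_minnP ex.
case: n => [|n] in yn min; first by rewrite -[y]/(iter 0 (br x) y) yn eqxx in y0.
have := congr1 (iter n (br x)) E; rewrite it0.
have itsum k (I : seq nat) (g : nat -> V) (c : nat -> F) :
    iter k (br x) (\sum_(i <- I) c i *: g i) = \sum_(i <- I) c i *: iter k (br x) (g i).
  elim: k => // k IH; rewrite iterS IH; elim: I {IH} => [|a I IH].
    by rewrite !big_nil D0.
  by rewrite !big_cons brl IH.
rewrite /exp_ad -(big_mkord xpredT (fun i => (i`!%:R)^-1 *: iter i (br x) y)) itsum.
rewrite big_ltn // fact0 invr1 scale1r big1_seq ?addr0 => [H|i].
  by have := min n; rewrite H eqxx ltnn => /(_ isT).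
rewrite mem_index_iota /= => /andP [i1 _]; rewrite -iterD.
have -> : (n + i = i.-1 + n.+1)%N by rewrite addnS -addSn prednK // addnC.
by rewrite iterD yn it0 scaler0.
Qed.

End OneElement.

Lemma exp_ad_br x y z : lie_bracket br -> ad_nilpotent br x ->
  exp_ad br x (br y z) = br (exp_ad br x y) (exp_ad br x z).
Proof.
move=> hL nilx; have brl := lie_linearr hL x.
rewrite (@exp_ad_leibniz x brl nilx V br (br x)) //.
- by rewrite (exp_adE brl nilx (N := (\dim {:V} + \dim {:V})%N) _ (leq_addr _ _)).
- exact: lie_linearr.
- exact: lie_linearl.
- by move=> u v; rewrite brA.
Qed.

End NilpotentExp.

(** * Traces and the Killing form *)

Section Trace.
Variable F : fieldType.

Definition ltrace (V : vectType F) (f : 'End(V)) : F :=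
  \sum_(i < \dim {:V}) coord (vbasis {:V}) i (f (vbasis {:V})`_i).

Lemma ltraceC (V W : vectType F) (f : 'Hom(W, V)) (g : 'Hom(V, W)) :
  ltrace (f \o g)%VF = ltrace (g \o f)%VF.
Proof.
have ex (V' W' : vectType F) (f' : 'Hom(W', V')) (g' : 'Hom(V', W')) : ltrace (f' \o g')%VF =
    \sum_(i < \dim {:V'}) \sum_(j < \dim {:W'}) coord (vbasis {:W'}) j (g' (vbasis {:V'})`_i) *
      coord (vbasis {:V'}) i (f' (vbasis {:W'})`_j).
  apply: eq_bigr => i _; rewrite comp_lfunE {1}(vbasis_sum (g' (vbasis {:V'})`_i)) !linear_sum.
  by apply: eq_bigr => j _; rewrite !linearZ.
rewrite !ex exchange_big; apply: eq_bigr => i _; apply: eq_bigr => j _.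
by rewrite mulrC.
Qed.

Variable V : vectType F.

Lemma ltraceD (f g : 'End(V)) : ltrace (f + g) = ltrace f + ltrace g.
Proof. by rewrite -big_split; apply: eq_bigr => i _; rewrite add_lfunE linearD. Qed.

Lemma ltraceZ c (f : 'End(V)) : ltrace (c *: f) = c * ltrace f.
Proof. by rewrite mulr_sumr; apply: eq_bigr => i _; rewrite scale_lfunE linearZ. Qed.

Lemma ltraceN (f : 'End(V)) : ltrace (- f) = - ltrace f.
Proof. by rewrite -scaleN1r ltraceZ mulN1r. Qed.

Lemma ltrace1 : ltrace (\1%VF : 'End(V)) = (\dim {:V})%:R.
Proof.
rewrite /ltrace (eq_bigr (fun _ => 1)) ?big_const_ord ?iter_addr_0 // => i _.
by rewrite id_lfunE coord_free ?eqxx // (basis_free (vbasisP _)).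
Qed.

End Trace.

Section Killing.
Variables (F : fieldType) (V : vectType F) (br : V -> V -> V).
Hypothesis hL : lie_bracket br.

Definition killing x y : F := ltrace (adl br x \o adl br y)%VF.

Lemma adl_br x y : adl br (br x y) = (adl br x \o adl br y)%VF - (adl br y \o adl br x)%VF.
Proof.
apply/lfunP => z; rewrite add_lfunE opp_lfunE !comp_lfunE !adlE //.
by rewrite (brA hL x y z) addrK.
Qed.

Lemma adlD x y : adl br (x + y) = adl br x + adl br y.
Proof. by apply/lfunP => z; rewrite add_lfunE !adlE // brDl. Qed.

Lemma adlZ c x : adl br (c *: x) = c *: adl br x.
Proof. by apply/lfunP => z; rewrite scale_lfunE !adlE // brZl. Qed.

Lemma killingC x y : killing x y = killing y x.
Proof. exact: ltraceC. Qed.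

Lemma killingDl x y z : killing (x + y) z = killing x z + killing y z.
Proof. by rewrite /killing adlD comp_lfunDl ltraceD. Qed.

Lemma killingZl c x y : killing (c *: x) y = c * killing x y.
Proof. by rewrite /killing adlZ -comp_lfunZl ltraceZ. Qed.

Lemma killingDr x y z : killing x (y + z) = killing x y + killing x z.
Proof. by rewrite killingC killingDl !(killingC x). Qed.

Lemma killingZr c x y : killing x (c *: y) = c * killing x y.
Proof. by rewrite killingC killingZl killingC. Qed.

Lemma killingNl x y : killing (- x) y = - killing x y.
Proof. by rewrite -scaleN1r killingZl mulN1r. Qed.

Lemma killingNr x y : killing x (- y) = - killing x y.
Proof. by rewrite -scaleN1r killingZr mulN1r. Qed.

Lemma killing0l y : killing 0 y = 0.
Proof. by rewrite -(scale0r 0) killingZl mul0r. Qed.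

Lemma killing0r y : killing y 0 = 0.
Proof. by rewrite killingC killing0l. Qed.

Lemma killing_br x y z : killing (br x y) z = killing x (br y z).
Proof.
rewrite /killing !adl_br comp_lfunDl comp_lfunDr !ltraceD comp_lfunNl comp_lfunNr !ltraceN.
congr (_ - _); first by rewrite comp_lfunA.
by rewrite -comp_lfunA ltraceC -!comp_lfunA.
Qed.

Lemma killing_aut (g : 'End(V)) x y : lie_aut br g -> killing (g x) (g y) = killing x y.
Proof.
move=> [/eqP g0 gbr].
have adg z : (adl br (g z) = g \o adl br z \o g^-1)%VF.
  apply/lfunP => w; rewrite !comp_lfunE !adlE // gbr.
  by rewrite lker0_lfunVK.
rewrite /killing !adg -!comp_lfunA (comp_lfunA g^-1 g).
rewrite (lker0_compVf g0) comp_lfun1l ltraceC -!comp_lfunA.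
by rewrite (lker0_compVf g0) comp_lfun1r.
Qed.

Lemma killing_eigen H c d x y :
  br H x = c *: x -> br H y = d *: y -> c + d != 0 -> killing x y = 0.
Proof.
move=> Hx Hy cd; apply: (mulfI cd); rewrite mulr0 mulrDl -killingZl -killingZr -Hx -Hy.
by rewrite (brC hL H x) killingNl killing_br addNr.
Qed.

End Killing.

(** * Base change to the algebraic closure *)

Section BaseChangeTheory.
Variables (F : fieldType) (Fbar : closedFieldType) (iota : {rmorphism F -> Fbar}).
Hypothesis charF : [pchar F] =i pred0.
Variables (V : vectType F) (br : V -> V -> V).
Hypothesis hL : lie_bracket br.

Notation n := (\dim {:V}).
Notation e i := ((vbasis {:V})`_i).
Notation bar := (@bar F Fbar iota V).
Notation bar_br := (@bar_br F Fbar iota V br).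

Lemma barD x y : bar (x + y) = bar x + bar y.
Proof. by apply/rowP => i; rewrite !mxE linearD rmorphD. Qed.

Lemma barZ c x : bar (c *: x) = iota c *: bar x.
Proof. by apply/rowP => i; rewrite !mxE linearZ rmorphM. Qed.

Lemma bar0 : bar 0 = 0.
Proof. by apply/rowP => i; rewrite !mxE linear0 rmorph0. Qed.

Lemma bar_inj : injective bar.
Proof.
move=> x y E; rewrite (vbasis_sum x) (vbasis_sum y); apply: eq_bigr => i _; congr (_ *: _).
by apply: (fmorph_inj iota); have /rowP /(_ i) := E; rewrite !mxE.
Qed.

Lemma bar_basis (i : 'I_n) : bar (e i) = delta_mx 0 i.
Proof.
apply/rowP => j; rewrite !mxE eqxx /= coord_free ?(basis_free (vbasisP _)) // eq_sym.
by rewrite rmorph_nat.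
Qed.

Lemma bar_span (w : 'rV[Fbar]_n) : w = \sum_(i < n) w 0 i *: bar (e i).
Proof. by rewrite {1}[w]row_sum_delta; apply: eq_bigr => i _; rewrite bar_basis. Qed.

Lemma bar_ext (W : lmodType Fbar) (f g : 'rV[Fbar]_n -> W) :
  linear f -> linear g -> (forall v, f (bar v) = g (bar v)) -> f =1 g.
Proof.
have lin (h : 'rV[Fbar]_n -> W) : linear h -> forall w, h w = \sum_(i < n) w 0 i *: h (bar (e i)) :> W.
  move=> hl w; have h0 : h 0 = 0.
    by have := hl (-1) 0 0; rewrite scaler0 addr0 scaleN1r => {1}->; rewrite addNr.
  have hD u v : h (u + v) = h u + h v by have := hl 1 u v; rewrite !scale1r.
  rewrite {1}(bar_span w) (big_morph h hD h0); apply: eq_bigr => i _.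
  by have := hl (w 0 i) (bar (e i)) 0; rewrite h0 !addr0.
move=> fl gl fg w; rewrite (lin f) // (lin g) //.
by apply: eq_bigr => i _; rewrite fg.
Qed.

Lemma bar_br_linearr x : linear (bar_br x).
Proof.
move=> c u v; rewrite /bar_br scaler_sumr -big_split; apply: eq_bigr => i _ /=.
rewrite scaler_sumr -big_split; apply: eq_bigr => j _ /=.
by rewrite !mxE mulrDr scalerDl scalerA mulrCA.
Qed.

Lemma bar_br_linearl y : linear (bar_br^~ y).
Proof.
move=> c u v; rewrite /bar_br scaler_sumr -big_split; apply: eq_bigr => i _ /=.
rewrite scaler_sumr -big_split; apply: eq_bigr => j _ /=.
by rewrite !mxE mulrDl scalerDl scalerA mulrA.
Qed.

Lemma bar_sum I (r : seq I) (f : I -> V) :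
  bar (\sum_(i <- r) f i) = \sum_(i <- r) bar (f i).
Proof. exact: (big_morph bar barD bar0). Qed.

Lemma bar_br_bar x y : bar_br (bar x) (bar y) = bar (br x y).
Proof.
rewrite [in RHS](vbasis_sum x) (br_suml hL) bar_sum; apply: eq_bigr => i _.
rewrite (brZl hL) [in RHS](vbasis_sum y) (br_sumr hL) scaler_sumr bar_sum.
by apply: eq_bigr => j _; rewrite (brZr hL) scalerA barZ rmorphM !mxE.
Qed.

Lemma bar_fun_linear (g : 'End(V)) : linear (bar_fun iota g).
Proof.
move=> c u v; rewrite /bar_fun scaler_sumr -big_split; apply: eq_bigr => i _ /=.
by rewrite !mxE scalerDl scalerA.
Qed.

Lemma bar_fun_bar (g : 'End(V)) v : bar_fun iota g (bar v) = bar (g v).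
Proof.
rewrite [in RHS](vbasis_sum v) linear_sum bar_sum; apply: eq_bigr => i _.
by rewrite linearZ barZ mxE.
Qed.

Lemma bar_iter x v k : iter k (bar_br (bar x)) (bar v) = bar (iter k (br x) v).
Proof. by elim: k => // k IH; rewrite !iterS IH bar_br_bar. Qed.

Lemma iter_linear (W : lmodType Fbar) (f : W -> W) k : linear f -> linear (iter k f).
Proof. by move=> fl; elim: k => [|k IH] // c u v; rewrite !iterS IH fl. Qed.

Lemma bar_ad_nilpotent x : ad_nilpotent br x -> ad_nilpotent bar_br (bar x).
Proof.
move=> [m xm]; exists m; apply: (@bar_ext _ _ (fun _ => 0)) => [||v].
- exact/iter_linear/bar_br_linearr.
- by move=> c u v; rewrite scaler0 addr0.
- by rewrite bar_iter xm bar0.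
Qed.

Lemma bar_exp_ad x v : exp_ad bar_br (bar x) (bar v) = bar (exp_ad br x v).
Proof.
rewrite /exp_ad (_ : \dim {: 'rV[Fbar]_n} = n); last by rewrite dimvf dim_matrix mul1r.
rewrite bar_sum; apply: eq_bigr => i _.
by rewrite barZ bar_iter fmorphV rmorph_nat.
Qed.

Lemma pchar_bar : [pchar Fbar] =i pred0.
Proof. by move=> q; rewrite (fmorph_pchar iota) charF. Qed.

(* An automorphism which is a product of exponentials over F itself.          *)
Lemma Aut0_exp (s : seq V) (g : 'End(V)) :
  (forall x, x \in s -> ad_nilpotent br x) ->
  g =1 foldr (fun x f => exp_ad br x \o f) id s -> Aut0 iota br g.
Proof.
move=> nils gE; split.
  suff [inj morph] : (forall x, foldr (fun x f => exp_ad br x \o f) id s x = 0 -> x = 0) /\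
     (forall x y, foldr (fun x f => exp_ad br x \o f) id s (br x y) =
        br (foldr (fun x f => exp_ad br x \o f) id s x) (foldr (fun x f => exp_ad br x \o f) id s y)).
    split; last by move=> x y; rewrite !gE.
    apply/eqP; rewrite -subv0; apply/subvP => x; rewrite memv_ker gE memv0 => /eqP /inj ->.
    by rewrite eqxx.
  elim: s nils {gE} => [|a s IH] nils //=.
  have [|inj morph] := IH; first by move=> x xs; apply: nils; rewrite inE xs orbT.
  have nila : ad_nilpotent br a by apply: nils; rewrite mem_head.
  split=> [x /(exp_ad_inj (lie_linearr hL a) nila) /inj //|x y].
  by rewrite morph (exp_ad_br charF).
exists (map bar s); split=> [x /mapP [y ys ->]|]; first exact/bar_ad_nilpotent/nils.
apply: bar_ext => [|  |v]; first exact: bar_fun_linear.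
  elim: s {gE nils} => [|a s IH] // c u v /=; rewrite IH.
  exact: exp_ad_linear (bar_br_linearr _) _ _ _.
rewrite bar_fun_bar gE; elim: s {gE nils} => //= a s <-.
by rewrite bar_exp_ad.
Qed.

(** Elements of $\mathrm{Aut}_0$ are products of exponentials only over $\overline F$, so the form
    is extended there and each factor preserves it. It will be applied to a subalgebra, with the
    Killing form of the ambient algebra. *)
Lemma Aut0_form (b : V -> V -> F) (g : 'End(V)) :
  (forall x, scalar (b x)) -> (forall y, scalar (b^~ y)) ->
  (forall x y z, b (br x y) z + b y (br x z) = 0) ->
  Aut0 iota br g -> forall y z, b (g y) (g z) = b y z.
Proof.
move=> bl br_ bsk [_ [s [nils gE]]] y z.
pose B (u v : 'rV[Fbar]_n) : Fbar^o := \sum_(i < n) \sum_(j < n) u 0 i * v 0 j * iota (b (e i) (e j)).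
have Br u : linear (B u).
  move=> c w w'; rewrite /B scaler_sumr -big_split; apply: eq_bigr => i _ /=.
  rewrite scaler_sumr -big_split; apply: eq_bigr => j _ /=.
  rewrite !mxE mulrDr mulrDl; congr (_ + _).
  by rewrite -[RHS]/(c * (u 0 i * w 0 j * _)) mulrCA !mulrA.
have Bl v : linear (B^~ v).
  move=> c w w'; rewrite /B scaler_sumr -big_split; apply: eq_bigr => i _ /=.
  rewrite scaler_sumr -big_split; apply: eq_bigr => j _ /=.
  rewrite !mxE !mulrDl; congr (_ + _).
  by rewrite -[RHS]/(c * (w 0 i * v 0 j * _)) !mulrA.
have slin (f : V -> F) (fl : scalar f) : forall w, f w = \sum_(i < n) coord (vbasis {:V}) i w * f (e i).
  have f0 : f 0 = 0.
    by have := fl (-1) 0 0; rewrite scaler0 addr0 mulN1r => {1}->; rewrite addNr.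
  have fD u v : f (u + v) = f u + f v by have := fl 1 u v; rewrite scale1r mul1r.
  move=> w; rewrite {1}(vbasis_sum w) (big_morph f fD f0); apply: eq_bigr => i _.
  by have := fl (coord (vbasis {:V}) i w) (e i) 0; rewrite f0 !addr0.
have Bbar u v : B (bar u) (bar v) = iota (b u v).
  rewrite (slin _ (br_ v)) rmorph_sum; apply: eq_bigr => i _.
  rewrite (slin _ (bl (e i))) mulr_sumr rmorph_sum; apply: eq_bigr => j _.
  by rewrite !mxE !rmorphM mulrA.
have Bsk x u v : B (bar_br x u) v + B u (bar_br x v) = 0.
  have := @bar_ext Fbar^o (fun x => B (bar_br x u) v + B u (bar_br x v)) (fun _ => 0).
  apply=> [c w w'|c w w'|x']; rewrite ?scaler0 ?addr0 //.
    by rewrite !bar_br_linearl Bl Br scalerDr addrACA.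
  have := @bar_ext Fbar^o (fun u => B (bar_br (bar x') u) v + B u (bar_br (bar x') v)) (fun _ => 0).
  apply=> [c w w'|c w w'|u']; rewrite ?scaler0 ?addr0 //.
    by rewrite !bar_br_linearr !Bl scalerDr addrACA.
  have := @bar_ext Fbar^o (fun v => B (bar_br (bar x') (bar u')) v + B (bar u') (bar_br (bar x') v)) (fun _ => 0).
  apply=> [c w w'|c w w'|v']; rewrite ?scaler0 ?addr0 //.
    by rewrite !bar_br_linearr !Br scalerDr addrACA.
  by rewrite !bar_br_bar !Bbar -rmorphD bsk rmorph0.
apply: (fmorph_inj iota); rewrite -!Bbar -!bar_fun_bar !gE.
elim: s nils {gE} => [|a s IH] nils //=.
rewrite (exp_ad_form pchar_bar (bar_br_linearr _)) ?IH //.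
- by move=> x xs; apply: nils; rewrite inE xs orbT.
- by apply: nils; rewrite mem_head.
Qed.

Lemma mem_bar_space (U : {vspace V}) v : v \in U -> bar v \in bar_space iota U.
Proof.
move=> vU; rewrite (coord_vbasis vU) bar_sum; apply: memv_suml => i _.
rewrite barZ memvZ //; apply/memv_span/map_f/mem_nth; by rewrite size_tuple.
Qed.

Lemma bar_space_ind (U : {vspace V}) (Q : 'rV[Fbar]_n -> Prop) :
  (forall c u v, Q u -> Q v -> Q (c *: u + v)) -> (forall v, v \in U -> Q (bar v)) ->
  forall w, w \in bar_space iota U -> Q w.
Proof.
move=> QD QU w; rewrite /bar_space => /(@coord_span _ _ _ (in_tuple _)) ->.
have Q0 : Q 0 by rewrite -bar0; apply: QU; apply: mem0v.
apply: (big_ind Q) => // [u v Qu Qv|i _]; first by rewrite -[u]scale1r; apply: QD.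
rewrite -[_ *: _]addr0; apply: QD => //=.
have := mem_nth 0 (ltn_ord i) => /mapP [v vU ->]; apply: QU.
exact: vbasis_mem vU.
Qed.

(* Schur's lemma for the irreducible module [V^+] over [Fbar]; the scalar     *)
(* lies in F because the endomorphism is defined over F.                      *)
Lemma schur_Vplus H0 z : regular_graded iota br H0 ->
  z \in Vzero br H0 -> (forall u, u \in Vzero br H0 -> br z u = 0) ->
  exists c, forall x, x \in Vplus br H0 -> br z x = c *: x.
Proof.
move=> hg z0 zc; set Vp := Vplus br H0.
have br0p u x : u \in Vzero br H0 -> x \in Vp -> br u x \in Vp.
  move=> /(ad_eigenP hL) hu /(ad_eigenP hL) hx; apply/(ad_eigenP hL).
  by rewrite (br_eigen hL hu hx) add0r.
set W := bar_space iota Vp.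
have stab u w : u \in bar_space iota (Vzero br H0) -> w \in W -> bar_br u w \in W.
  move=> uU wW; move: u uU; apply: bar_space_ind => [c u v hu hv|u uU].
    by rewrite bar_br_linearl memvD ?memvZ.
  move: w wW; apply: bar_space_ind => [c w v hu hv|w wU].
    by rewrite bar_br_linearr memvD ?memvZ.
  by rewrite bar_br_bar mem_bar_space ?br0p.
pose T : {linear 'rV[Fbar]_n -> 'rV[Fbar]_n} :=
  HB.pack (bar_br (bar z)) (GRing.isLinear.Build Fbar _ _ _ (bar_br (bar z)) (bar_br_linearr _)).
have TL c w w' : T (c *: w + w') = c *: T w + T w' by rewrite linearP.
have TZ c w : T (c *: w) = c *: T w by rewrite linearZ.
have [x xVp x0] : exists2 x, x \in Vp & x != 0.
  exists (vpick Vp); first exact: memv_pick.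
  by rewrite vpick0; apply/eqP; apply: (rg_Vplus_neq0 hg).
have TW w : w \in W -> T w \in W by apply: stab; apply: mem_bar_space.
(* An eigenvector of $\mathrm{ad}\,z$ on $\overline{V^+}$, from a root of the characteristic
   polynomial. *)
have [a [w [wW w0 wE]]] : exists a w, [/\ w \in W, w != 0 & T w = a *: w].
  pose M := mxU W (linfun T).
  have d0 : (0 < \dim W)%N.
    rewrite lt0n dimv_eq0; apply/eqP => W0.
    have : bar x \in W by apply: mem_bar_space.
    rewrite W0 memv0 -bar0 (inj_eq bar_inj) => /eqP xx; by rewrite xx eqxx in x0.
  have [a /rootP] : exists a, root (char_poly M) a.
    by apply/closed_rootP; rewrite size_char_poly eqSS -lt0n.
  rewrite -[_ = 0]/(_ = 0) => /rootP; rewrite -eigenvalue_root_char => /eigenvalueP [v vE v0].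
  exists a, (\sum_i v 0 i *: (vbasis W)`_i); split.
  - apply: memv_suml => i _; apply: memvZ; apply/vbasis_mem/mem_nth; by rewrite size_tuple.
  - apply: contraNneq v0 => s0; apply/eqP/rowP => i; rewrite mxE.
    by have /freeP := basis_free (vbasisP W); apply.
  - rewrite linear_sum scaler_sumr.
    have Tb (i : 'I_(\dim W)) : T (vbasis W)`_i = \sum_j M i j *: (vbasis W)`_j.
      have bW : (vbasis W)`_i \in W by apply/vbasis_mem/mem_nth; rewrite size_tuple.
      by rewrite [LHS](coord_vbasis (TW _ bW)); apply: eq_bigr => j _; rewrite mxE lfunE.
    rewrite (eq_bigr (fun i => \sum_j (v 0 i * M i j) *: (vbasis W)`_j)); last first.
      by move=> i _; rewrite TZ Tb scaler_sumr; apply: eq_bigr => j _; rewrite scalerA.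
    rewrite exchange_big; apply: eq_bigr => j _ /=; rewrite -scaler_suml scalerA.
    by congr (_ *: _); have /rowP /(_ j) := vE; rewrite !mxE.
pose E := (W :&: lker (linfun T - a *: \1%VF))%VS.
have inE_ v : v \in E = (v \in W) && (T v == a *: v).
  by rewrite memv_cap memv_ker add_lfunE opp_lfunE scale_lfunE id_lfunE lfunE subr_eq0.
have comm u v : u \in bar_space iota (Vzero br H0) -> v \in W ->
    T (bar_br u v) = bar_br u (T v).
  move=> uU vW; move: u uU; apply: bar_space_ind => [c u u' hu hu'|u uU].
    by rewrite !bar_br_linearl TL hu hu'.
  move: v vW; apply: bar_space_ind => [c v v' hv hv'|v vU].
    by rewrite TL !bar_br_linearr TL hv hv'.
  by rewrite /= !bar_br_bar (brA hL z u v) zc // (br0l hL) add0r.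
have EW : E = W.
  have [||E0|//] := rg_irreducible hg (W := E).
  - exact: capvSl.
  - move=> u v uU; rewrite !inE_ => /andP [vW /eqP vE]; rewrite (stab _ _ uU vW) andTb.
    rewrite comm // vE; have := bar_br_linearr u a v 0.
    have -> : bar_br u 0 = 0.
      by have := bar_br_linearr u (-1) 0 0; rewrite scaler0 addr0 scaleN1r => {1}->; rewrite addNr.
    by rewrite !addr0 => ->.
  - by move: w0; rewrite -memv0 -E0 inE_ wW wE eqxx.
have Ta v : v \in Vp -> bar (br z v) = a *: bar v.
  move=> vU; have : bar v \in E by rewrite EW mem_bar_space.
  by rewrite inE_ /= bar_br_bar => /andP [_ /eqP].
have [i xi] : exists i, coord (vbasis {:V}) i x != 0.
  apply: NNPP => nex; move/eqP: x0; apply; rewrite (vbasis_sum x) big1 // => i _.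
  by case: (eqVneq (coord (vbasis {:V}) i x) 0) => [->|h]; [rewrite scale0r|case: nex; exists i].
(* The eigenvalue is a ratio of coordinates of two vectors defined over $F$. *)
exists (coord (vbasis {:V}) i (br z x) / coord (vbasis {:V}) i x) => y yVp.
apply: bar_inj; rewrite Ta // barZ; congr (_ *: _).
have /rowP /(_ i) := Ta x xVp; rewrite !mxE => E1.
by rewrite fmorph_div E1 mulfK // fmorph_eq0.
Qed.

End BaseChangeTheory.

(** * Gradings of length three and the sl2-triples inside them *)

Section Graded.
Variables (F : fieldType).
Hypothesis charF : [pchar F] =i pred0.
Variables (V : vectType F) (br : V -> V -> V).
Hypothesis hL : lie_bracket br.

(** The eigenvalues $-2,0,2$ expressed as one cubic identity: it is symmetric under $H_0\mapsto
    -H_0$ and makes the projections onto the three pieces polynomials in $\mathrm{ad}\,H_0$. *)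
Definition grading (H0 : V) : Prop :=
  forall v, br H0 (br H0 (br H0 v)) = 4%:R *: br H0 v.

(** The neutral element [h] may differ from [H0]; when it is [H0], the element [e] counts as
    invertible with inverse [f]. *)
Definition gtriple (H0 f h e : V) : Prop :=
  [/\ f \in Vminus br H0, e \in Vplus br H0 & sl2_triple br f h e].

Let nz n : n.+1%:R != 0 :> F. Proof. exact (natSf_neq0 charF n). Qed.

Lemma two_neq0 : 2%:R != 0 :> F. Proof. exact: (nz 1). Qed.
Lemma four_neq0 : 4%:R != 0 :> F. Proof. exact: (nz 3). Qed.

Lemma VplusN H0 : Vplus br (- H0) = Vminus br H0.
Proof.
apply/vspaceP => v; rewrite !mem_ad_eigen // (brNl hL) // scaleNr.
by rewrite -(inj_eq oppr_inj) opprK.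
Qed.

Lemma VminusN H0 : Vminus br (- H0) = Vplus br H0.
Proof. by rewrite -[in RHS](opprK H0) VplusN. Qed.

Lemma VzeroN H0 : Vzero br (- H0) = Vzero br H0.
Proof. by apply/vspaceP => v; rewrite !mem_ad_eigen // (brNl hL) // !scale0r oppr_eq0. Qed.

Lemma gradingN H0 : grading H0 -> grading (- H0).
Proof. by move=> hg v; rewrite !(brNl hL, brNr hL) !opprK hg scalerN. Qed.

Lemma sl2_tripleN f h e : sl2_triple br f h e -> sl2_triple br e (- h) f.
Proof.
move=> [he hf fe]; split; rewrite ?(brNl hL) // ?he ?hf ?scaleNr ?opprK //.
by rewrite brC // fe.
Qed.

Lemma gtripleN H0 f h e : gtriple H0 f h e -> gtriple (- H0) e (- h) f.
Proof. by move=> [fm ep t]; split; rewrite ?VplusN ?VminusN //; apply: sl2_tripleN. Qed.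

Section Weights.
Variable H0 : V.
Hypothesis hg : grading H0.
Notation Vp := (Vplus br H0).
Notation Vz := (Vzero br H0).
Notation Vm := (Vminus br H0).

Lemma VpP x : reflect (br H0 x = 2%:R *: x) (x \in Vp).
Proof. exact: ad_eigenP. Qed.

Lemma VmP x : reflect (br H0 x = - 2%:R *: x) (x \in Vm).
Proof. exact: ad_eigenP. Qed.

Lemma VzP x : reflect (br H0 x = 0) (x \in Vz).
Proof. by apply: (iffP (ad_eigenP hL _ _ _)); rewrite scale0r. Qed.

Lemma eigen_bad c v : br H0 v = c *: v -> c * (c * c - 4%:R) != 0 -> v = 0.
Proof.
move=> Hv c0; have := hg v; rewrite !(Hv, brZr hL) !scalerA => /eqP.
rewrite -subr_eq0 -scalerBl scaler_eq0 => /orP [|/eqP //].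
by rewrite (_ : _ - _ = c * (c * c - 4%:R)) ?(negPf c0) //; ring.
Qed.

Lemma br_pp x y : x \in Vp -> y \in Vp -> br x y = 0.
Proof.
move=> /VpP hx /VpP hy; apply: eigen_bad (br_eigen hL hx hy) _.
by rewrite (_ : _ * _ = 48%:R) ?nz //; ring.
Qed.

Lemma br_mm x y : x \in Vm -> y \in Vm -> br x y = 0.
Proof.
move=> /VmP hx /VmP hy; apply: eigen_bad (br_eigen hL hx hy) _.
by rewrite (_ : _ * _ = - 48%:R) ?oppr_eq0 ?nz //; ring.
Qed.

Lemma br_pm x y : x \in Vp -> y \in Vm -> br x y \in Vz.
Proof. by move=> /VpP hx /VmP hy; apply/VzP; rewrite (br_eigen hL hx hy) subrr scale0r. Qed.

Lemma br_mp x y : x \in Vm -> y \in Vp -> br x y \in Vz.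
Proof. by move=> hx hy; rewrite brC // memvN br_pm. Qed.

Lemma br_zp x y : x \in Vz -> y \in Vp -> br x y \in Vp.
Proof. by move=> /ad_eigenP hx /VpP hy; apply/VpP; rewrite (br_eigen hL (hx _) hy) // add0r. Qed.

Lemma br_pz x y : x \in Vp -> y \in Vz -> br x y \in Vp.
Proof. by move=> hx hy; rewrite brC // memvN br_zp. Qed.

Lemma br_zm x y : x \in Vz -> y \in Vm -> br x y \in Vm.
Proof. by move=> /ad_eigenP hx /VmP hy; apply/VmP; rewrite (br_eigen hL (hx _) hy) // add0r. Qed.

Lemma br_mz x y : x \in Vm -> y \in Vz -> br x y \in Vm.
Proof. by move=> hx hy; rewrite brC // memvN br_zm. Qed.

Lemma br_zz x y : x \in Vz -> y \in Vz -> br x y \in Vz.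
Proof.
by move=> /ad_eigenP hx /ad_eigenP hy; apply/ad_eigenP; rewrite // (br_eigen hL (hx _) (hy _)) // add0r.
Qed.

Lemma br_zpp z x y : x \in Vp -> y \in Vp -> z \in Vm -> br (br z x) y = br (br z y) x.
Proof.
move=> xp yp zm; have := brA hL z x y; rewrite (br_pp xp yp) (br0r hL).
by move=> /esym/eqP; rewrite addr_eq0 => /eqP ->; rewrite brC // opprK.
Qed.

Lemma mem_H0 : H0 \in Vz.
Proof. by apply/VzP; apply: brxx. Qed.

Definition proj_p v := 8%:R^-1 *: (br H0 (br H0 v) + 2%:R *: br H0 v).
Definition proj_m v := 8%:R^-1 *: (br H0 (br H0 v) - 2%:R *: br H0 v).
Definition proj_z v := v - 4%:R^-1 *: br H0 (br H0 v).

Lemma proj_pP v : proj_p v \in Vp.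
Proof.
apply/VpP; rewrite /proj_p (brZr hL) (brDr hL) (brZr hL) hg scalerA mulrC -scalerA.
by congr (_ *: _); rewrite scalerDr scalerA addrC -natrM.
Qed.

Lemma proj_mP v : proj_m v \in Vm.
Proof.
apply/VmP; rewrite /proj_m (brZr hL) (brBr hL) (brZr hL) hg scalerA mulrC -scalerA.
by congr (_ *: _); rewrite scalerBr !scalerA !mulNr -natrM !scaleNr opprK addrC.
Qed.

Lemma proj_zP v : proj_z v \in Vz.
Proof. by apply/VzP; rewrite /proj_z (brBr hL) (brZr hL) hg scalerA mulVf ?four_neq0 // scale1r subrr. Qed.

Lemma proj_sum v : v = proj_m v + proj_z v + proj_p v.
Proof.
rewrite /proj_m /proj_z /proj_p; set a := br H0 v; set b := br H0 a.
have -> : 4%:R^-1 = 8%:R^-1 + 8%:R^-1 :> F by field; rewrite !nz.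
rewrite scalerBr scalerDr [(_^-1 + _^-1) *: _]scalerDl; set c := _ *: b; set d := _ *: (2%:R *: a).
by rewrite [RHS]addrAC [c - d + _]addrACA addNr addr0 [RHS]addrC subrK.
Qed.

Lemma proj_pK x : x \in Vp -> proj_p x = x.
Proof.
move=> /VpP hx; rewrite /proj_p !(hx, brZr hL) !scalerA -scalerDl.
by rewrite scalerA (_ : _ * _ = 1) ?scale1r //; field; rewrite ?nz.
Qed.

Lemma proj_p_linear : linear proj_p.
Proof.
move=> c u v; rewrite /proj_p !(brDr hL, brZr hL).
rewrite [c *: (_ *: _)]scalerA mulrC -scalerA -scalerDr; congr (_ *: _).
by rewrite !scalerDr addrACA !scalerA [c * _]mulrC.
Qed.

End Weights.
Section Triple.
Variables (H0 f h e : V).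
Hypotheses (hg : grading H0) (ht : gtriple H0 f h e).
Notation Vp := (Vplus br H0).
Notation Vz := (Vzero br H0).
Notation Vm := (Vminus br H0).

Let fm : f \in Vm. Proof. by case: ht. Qed.
Let ep : e \in Vp. Proof. by case: ht. Qed.
Let fe : br f e = h. Proof. by case: ht => _ _ []. Qed.
Let he : br h e = 2%:R *: e. Proof. by case: ht => _ _ []. Qed.
Let hf : br h f = - 2%:R *: f. Proof. by case: ht => _ _ []. Qed.

Lemma triple_hz : h \in Vz.
Proof. by rewrite -fe br_mp. Qed.

Lemma ad_ef v : br e (br f v) = br f (br e v) - br h v.
Proof. by rewrite (brA hL e f) addrC (brC hL e f) fe (brNl hL). Qed.

Lemma ad_hf v : br h (br f v) = br f (br h v) - 2%:R *: br f v.
Proof. by rewrite (brA hL h f) hf (brZl hL) // scaleNr addrC. Qed.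

Lemma ad_he v : br h (br e v) = br e (br h v) + 2%:R *: br e v.
Proof. by rewrite (brA hL h e) he (brZl hL) // addrC. Qed.

Lemma ef_p x : x \in Vp -> br e (br f x) = - br h x.
Proof. by move=> xp; rewrite ad_ef (br_pp hg ep xp) (br0r hL) // add0r. Qed.

Lemma eff_p x : x \in Vp ->
  br e (br f (br f x)) = - (2%:R *: br f (br h x)) + 2%:R *: br f x.
Proof.
by move=> xp; rewrite ad_ef ef_p // ad_hf (brNr hL); vring.
Qed.

Lemma ffh_p x : x \in Vp -> br f (br f (br h x)) = 2%:R *: br f (br f x).
Proof.
move=> xp; have fxz : br f x \in Vz by apply: br_mp.
have : br e (br f (br f (br f x))) = 0.
  by rewrite (br_mm hg fm (br_mz fm fxz)) (br0r hL).
rewrite ad_ef eff_p // !ad_hf !(brDr hL, brNr hL, brZr hL).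
set u := br f (br f (br h x)); set w := br f (br f x) => E.
apply: (scalerI (nz 2)); apply/eqP; rewrite -subr_eq0 -oppr_eq0 -E.
by apply/eqP; vring.
Qed.

(** The weights of $h$ on $V^+$ are 0, 1 and 2. Since $\mathrm{ad}(f)^3$ kills $V^+$, the operator
    $h-2$ maps into the kernel of $\mathrm{ad}(f)^2$, then $h-1$ into the kernel of
    $\mathrm{ad}\,f$, where $h=-\mathrm{ad}(e)\mathrm{ad}(f)$ vanishes. *)
Lemma cubic_p x : x \in Vp ->
  br h (br h (br h x)) = 3%:R *: br h (br h x) - 2%:R *: br h x.
Proof.
move=> xp; have hzp v : v \in Vp -> br h v \in Vp by apply: br_zp triple_hz.
set x1 := br h x - 2%:R *: x; have x1p : x1 \in Vp by rewrite memvB ?memvZ ?hzp.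
have ff1 : br f (br f x1) = 0 by rewrite !(brBr hL, brZr hL) ffh_p // subrr.
set x2 := br h x1 - x1; have x2p : x2 \in Vp by rewrite memvB ?hzp.
have f2 : br f x2 = 0.
  have := eff_p x1p; rewrite ff1 (br0r hL) // => /esym/eqP; rewrite addrC subr_eq0.
  by move=> /eqP /(scalerI two_neq0) E; rewrite (brBr hL) // -E subrr.
have : br h x2 = 0 by apply: oppr_inj; rewrite -ef_p // f2 (br0r hL) // oppr0.
rewrite /x2 /x1 !(brBr hL, brZr hL) => /eqP; rewrite subr_eq0 => /eqP E.
apply/eqP; rewrite -subr_eq0; move/eqP: E; rewrite -subr_eq0 => E.
by apply/eqP; rewrite -[RHS](eqP E); vring.
Qed.

Lemma wt_p c x : x \in Vp -> br h x = c *: x -> c * (c - 1) * (c - 2%:R) != 0 -> x = 0.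
Proof.
move=> xp hx c0; have := cubic_p xp; rewrite !(hx, brZr hL) !scalerA => E.
apply/eqP; move/eqP: E; rewrite -subr_eq0 -!scalerBl scaler_eq0 => /orP [|//].
by rewrite (_ : _ - _ = c * (c - 1) * (c - 2%:R)) ?(negPf c0) //; ring.
Qed.

Lemma eeff_p x : x \in Vp -> br h x = 2%:R *: x ->
  br e (br e (br f (br f x))) = 4%:R *: x.
Proof.
move=> xp hx; rewrite eff_p // hx !(brDr hL, brNr hL, brZr hL) ef_p // hx.
by vring.
Qed.

Lemma eff_p2 x : x \in Vp -> br h x = 2%:R *: x -> br e (br f (br f x)) = - (2%:R *: br f x).
Proof. by move=> xp hx; rewrite eff_p // hx (brZr hL) //; vring. Qed.

(** Lagrange interpolation in $\mathrm{ad}\,h$ at 0, 1, 2: on $V^+$ these three operators are the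
    projections onto the weight spaces, the Peirce decomposition of Jordan theory. *)
Definition peirce0 v := v - (3%:R / 2%:R) *: br h v + 2%:R^-1 *: br h (br h v).
Definition peirce1 v := 2%:R *: br h v - br h (br h v).
Definition peirce2 v := 2%:R^-1 *: (br h (br h v) - br h v).

Lemma peirce_sum v : v = peirce2 v + peirce1 v + peirce0 v.
Proof. by rewrite /peirce0 /peirce1 /peirce2; vfield; rewrite two_neq0. Qed.

Lemma peirce_mem x : x \in Vp -> [/\ peirce0 x \in Vp, peirce1 x \in Vp & peirce2 x \in Vp].
Proof.
move=> xp; have hzp v : v \in Vp -> br h v \in Vp by apply: br_zp triple_hz.
have h1 := hzp _ xp; have h2 := hzp _ h1.
split; first by apply: memvD; [apply: memvB; rewrite ?memvZ|rewrite memvZ].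
  by apply: memvB; rewrite ?memvZ.
by apply: memvZ; apply: memvB.
Qed.

Lemma peirce_wt x : x \in Vp ->
  [/\ br h (peirce0 x) = 0, br h (peirce1 x) = peirce1 x
    & br h (peirce2 x) = 2%:R *: peirce2 x].
Proof.
move=> xp; rewrite /peirce0 /peirce1 /peirce2 !(brDr hL, brBr hL, brZr hL, brNr hL) cubic_p //.
by split; vfield; rewrite ?two_neq0.
Qed.

End Triple.

Section TripleMinus.
Variables (H0 f h e : V).
Hypotheses (hg : grading H0) (ht : gtriple H0 f h e).
Notation Vp := (Vplus br H0).
Notation Vz := (Vzero br H0).
Notation Vm := (Vminus br H0).

Let hgN := gradingN hg.
Let htN := gtripleN ht.

Lemma wt_m c y : y \in Vm -> br h y = c *: y -> c * (c + 1) * (c + 2%:R) != 0 -> y = 0.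
Proof.
rewrite -VplusN => ym hy c0; apply: (wt_p hgN htN (c := - c) ym).
  by rewrite (brNl hL) // hy scaleNr.
have -> : - c * (- c - 1) * (- c - 2%:R) = - (c * (c + 1) * (c + 2%:R)) by ring.
by rewrite oppr_eq0.
Qed.

Lemma ffee_m y : y \in Vm -> br h y = - 2%:R *: y ->
  br f (br f (br e (br e y))) = 4%:R *: y.
Proof.
by rewrite -VplusN => ym hy; rewrite (eeff_p hgN htN) // (brNl hL) // hy scaleNr opprK.
Qed.

Lemma fee_m2 y : y \in Vm -> br h y = - 2%:R *: y -> br f (br e (br e y)) = - (2%:R *: br e y).
Proof.
by rewrite -VplusN => ym hy; rewrite (eff_p2 hgN htN) // (brNl hL) // hy scaleNr opprK.
Qed.

Lemma fe_m y : y \in Vm -> br f (br e y) = br h y.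
Proof. by rewrite -VplusN => ym; rewrite (ef_p hgN htN) // (brNl hL) // opprK. Qed.

Lemma peirceN_wt y : y \in Vm -> let h' := - h in
  [/\ br h (peirce0 h' y) = 0, br h (peirce1 h' y) = - peirce1 h' y
    & br h (peirce2 h' y) = - 2%:R *: peirce2 h' y].
Proof.
rewrite -VplusN => ym h'; have [p0 p1 p2] := peirce_wt hgN htN ym.
by split; apply: oppr_inj; rewrite -(brNl hL) // ?p0 ?p1 ?p2 ?oppr0 ?opprK ?scaleNr ?opprK.
Qed.

Lemma peirceN_mem y : y \in Vm -> let h' := - h in
  [/\ peirce0 h' y \in Vm, peirce1 h' y \in Vm & peirce2 h' y \in Vm].
Proof. by rewrite -VplusN => ym h'; apply: peirce_mem htN _ ym. Qed.

End TripleMinus.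

(** Suppose $y\in V_0$ has weight $-2$. Then $[f,y]$ has weight $-4$ in $V^-$ and is 0; $[e,y]$ has
    weight 0 in $V^+$, which forces it to be 0 as well; and a vector killed by $e$ and $f$ has
    weight 0. *)
Lemma wtm2_z H0 f h e y : grading H0 -> gtriple H0 f h e ->
  y \in Vzero br H0 -> br h y = - 2%:R *: y -> y = 0.
Proof.
move=> hg ht yz hy; have [fm ep _] := ht.
have ey : br e y \in Vplus br H0 by apply: br_pz.
have fy0 : br f y = 0.
  apply: (wt_m hg ht (c := - 4%:R)); first exact: br_mz.
    by rewrite (ad_hf ht) hy (brZr hL) // -scalerBl; congr (_ *: _); ring.
  by rewrite (_ : _ * _ = - 24%:R) ?oppr_eq0 ?nz //; ring.
have hey : br h (br e y) = 0 by rewrite (ad_he ht) hy (brZr hL) // -scalerDl addNr scale0r.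
have := ef_p hg ht ey; rewrite hey oppr0.
have efe : br f (br e y) = - 2%:R *: y.
  by have := ad_ef ht y; rewrite fy0 (br0r hL) // hy => /esym/eqP; rewrite subr_eq0 => /eqP.
rewrite efe (brZr hL) // => /eqP; rewrite scaler_eq0 oppr_eq0 (negPf two_neq0) /= => /eqP ey0.
by move: efe; rewrite ey0 (br0r hL) // => /esym/eqP; rewrite scaler_eq0 oppr_eq0 (negPf two_neq0) /= => /eqP.
Qed.

Lemma wt2_z H0 f h e y : grading H0 -> gtriple H0 f h e ->
  y \in Vzero br H0 -> br h y = 2%:R *: y -> y = 0.
Proof.
move=> hg ht yz hy; apply: (wtm2_z (gradingN hg) (gtripleN ht)); first by rewrite VzeroN.
by rewrite (brNl hL) // hy scaleNr.
Qed.

End Graded.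

(** * Exponentials and Weyl elements of the graded pieces *)

Section SimpleGraded.
Variables (F : fieldType).
Hypothesis charF : [pchar F] =i pred0.
Variables (V : vectType F) (br : V -> V -> V).
Hypothesis hL : lie_bracket br.

Let nz n : n.+1%:R != 0 :> F. Proof. exact (natSf_neq0 charF n). Qed.
Let nz2 : 2%:R != 0 :> F := two_neq0 charF.

Section Exp.
Variable H0 : V.
Hypothesis hg : grading br H0.
Notation Vp := (Vplus br H0).
Notation Vz := (Vzero br H0).
Notation Vm := (Vminus br H0).

Lemma grade_dec v : exists m z p, [/\ m \in Vm, z \in Vz, p \in Vp & v = m + z + p].
Proof.
exists (proj_m br H0 v), (proj_z br H0 v), (proj_p br H0 v).
split; [exact: proj_mP|exact: proj_zP|exact: proj_pP|exact: proj_sum].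
Qed.

Lemma ad_cube_p x v : x \in Vp -> br x (br x (br x v)) = 0.
Proof.
move=> xp; have [m [z [p [mm zz pp ->]]]] := grade_dec v; rewrite !(brDr hL).
rewrite (br_pp charF hL hg xp pp) !(br0r hL) addr0.
rewrite (br_pp charF hL hg xp (br_pz hL xp zz)) !(br0r hL) addr0.
by rewrite (br_pp charF hL hg xp (br_pz hL xp (br_pm hL xp mm))).
Qed.

Lemma ad_nilpotent_p x : x \in Vp -> ad_nilpotent br x.
Proof. by move=> xp; exists 3 => y; apply: ad_cube_p. Qed.

Lemma exp_ad_p x v : x \in Vp ->
  exp_ad br x v = v + br x v + 2%:R^-1 *: br x (br x v).
Proof.
move=> xp; have brl := lie_linearr hL x.
rewrite (exp_adE brl (ad_nilpotent_p xp) (N := (3 + \dim {:V})%N)) ?leq_addl //.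
rewrite (@expD_widen _ _ _ 3) ?leq_addr //; last by move=> y; apply: ad_cube_p.
by rewrite /expD !big_ord_recr big_ord0 /= add0r !invr1 !scale1r.
Qed.

End Exp.

Section ExpMinus.
Variable H0 : V.
Hypothesis hg : grading br H0.
Notation Vm := (Vminus br H0).

Lemma ad_nilpotent_m x : x \in Vm -> ad_nilpotent br x.
Proof. rewrite -VplusN //; exact/ad_nilpotent_p/gradingN. Qed.

Lemma exp_ad_m x v : x \in Vm ->
  exp_ad br x v = v + br x v + 2%:R^-1 *: br x (br x v).
Proof. rewrite -VplusN //; exact/exp_ad_p/gradingN. Qed.

End ExpMinus.

Section FullTriple.
Variables (H0 f e : V).
Hypotheses (hg : grading br H0) (ht : gtriple br H0 f H0 e).
Notation Vp := (Vplus br H0).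
Notation Vz := (Vzero br H0).
Notation Vm := (Vminus br H0).

Lemma gtriple_f : f \in Vm. Proof. by case: ht. Qed.
Lemma gtriple_e : e \in Vp. Proof. by case: ht. Qed.
Lemma gtriple_fe : br f e = H0. Proof. by case: ht => _ _ []. Qed.
Let fm := gtriple_f.
Let ep := gtriple_e.
Let fe := gtriple_fe.

Lemma full_ef x : x \in Vp -> br e (br f x) = - (2%:R *: x).
Proof. by move=> xp; rewrite (ef_p charF hL hg ht xp) ((VpP hL _ _) xp). Qed.

Lemma full_eff x : x \in Vp -> br e (br f (br f x)) = - (2%:R *: br f x).
Proof. by move=> xp; apply: (eff_p2 charF hL hg ht xp); apply/VpP. Qed.

Lemma full_eeff x : x \in Vp -> br e (br e (br f (br f x))) = 4%:R *: x.
Proof. by move=> xp; apply: (eeff_p charF hL hg ht xp); apply/VpP. Qed.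

Lemma full_fe y : y \in Vm -> br f (br e y) = - 2%:R *: y.
Proof. by move=> ym; rewrite (fe_m charF hL hg ht ym); apply: (VmP hL _ _ ym). Qed.

Lemma full_ffee y : y \in Vm -> br f (br f (br e (br e y))) = 4%:R *: y.
Proof. by move=> ym; apply: (ffee_m charF hL hg ht ym); apply/VmP. Qed.

(** For a triple with neutral element $H_0$, each nonzero vector of $V^+$ generates a
    three-dimensional representation of $\mathfrak{sl}_2$, in which the Weyl element exchanges the
    extreme weights. *)
Lemma weyl_p x : x \in Vp -> weyl_elt br e f x = 2%:R^-1 *: br f (br f x).
Proof.
move=> xp; have fxz : br f x \in Vz by apply: br_mp.
have ffm : br f (br f x) \in Vm by apply: br_mz.
rewrite /weyl_elt (exp_ad_p hg x ep) (br_pp charF hL hg ep xp) (br0r hL) scaler0 !addr0.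
rewrite (exp_ad_m hg _ fm) (exp_ad_p hg _ ep) !(brDr hL, brZr hL).
rewrite (br_pp charF hL hg ep xp) (br0r hL) full_ef // full_eff // !(brNr hL, brZr hL) full_ef //.
by rewrite (br_pp charF hL hg ep xp); vfield; rewrite ?nz2.
Qed.

End FullTriple.

Lemma weyl_m H0 f e y : grading br H0 -> gtriple br H0 f H0 e -> y \in Vminus br H0 ->
  weyl_elt br e f y = 2%:R^-1 *: br e (br e y).
Proof.
move=> hg ht ym; have [fm ep _] := ht.
rewrite /weyl_elt (exp_ad_p hg y ep) (exp_ad_m hg _ fm) !(brDr hL, brZr hL).
rewrite (br_mm charF hL hg fm ym) (br0r hL) (full_fe hg ht ym).
have E : br f (br e (br e y)) = - (2%:R *: br e y).
  by apply: (fee_m2 charF hL hg ht ym); apply/(VmP hL).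
rewrite E !(brNr hL, brZr hL) (full_fe hg ht ym) (br_mm charF hL hg fm ym).
set z := _ + _; have -> : z = 2%:R^-1 *: br e (br e y) by rewrite /z; vfield; rewrite ?nz2.
have zp : 2%:R^-1 *: br e (br e y) \in Vplus br H0 by apply: memvZ; apply: (br_pz hL ep); apply: (br_pm hL ep ym).
by rewrite (exp_ad_p hg _ ep) (br_pp charF hL hg ep zp) (br0r hL) scaler0 !addr0.
Qed.

End SimpleGraded.

(** * Nondegeneracy of the Killing form *)

Section KillingNondegenerate.
Variables (F : fieldType).
Hypothesis charF : [pchar F] =i pred0.
Variables (V : vectType F) (br : V -> V -> V).
Hypotheses (hL : lie_bracket br) (hS : lie_simple br).

Let nz n : n.+1%:R != 0 :> F. Proof. exact (natSf_neq0 charF n). Qed.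

Variables (H0 f e : V).
Hypotheses (hg : grading br H0) (ht : gtriple br H0 f H0 e) (hVp : Vplus br H0 <> 0%VS).
Notation Vp := (Vplus br H0).
Notation Vz := (Vzero br H0).
Notation Vm := (Vminus br H0).
Notation K := (killing br).

Let fm : f \in Vm := gtriple_f ht.
Let ep : e \in Vp := gtriple_e ht.
Let fe : br f e = H0 := gtriple_fe ht.

Lemma center0 z : (forall v, br z v = 0) -> z = 0.
Proof.
move=> zc; have [[x [y xy]] ideal] := hS.
have [|z0|zf] := ideal <[z]>%VS.
- move=> a b /vlineP [c ->]; rewrite (brZr hL) (brC hL) zc oppr0 scaler0; exact: mem0v.
- by apply/eqP; rewrite -memv0 -z0 memv_line.
- have /vlineP [c xE] : x \in <[z]>%VS by rewrite zf memvf.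
  by move: xy; rewrite xE (brZl hL) zc scaler0 eqxx.
Qed.

(** $\mathrm{ad}(H_0)^2/4$ is the projection onto $V^-\oplus V^+$, so $K(H_0,H_0)$ is four times the
    dimension of this space. The trace of the idempotent is its rank, by factoring it through its
    image and using cyclicity. *)
Lemma killing_H0 : K H0 H0 != 0.
Proof.
pose E : 'End(V) := 4%:R^-1 *: (adl br H0 \o adl br H0)%VF.
have EE v : E v = 4%:R^-1 *: br H0 (br H0 v) by rewrite scale_lfunE comp_lfunE !adlE.
have idem v : E (E v) = E v.
  by rewrite !EE !(brZr hL) hg ?(brZr hL) [4%:R^-1 *: (4%:R *: _)]scalerA mulVf ?nz // scale1r.
pose U := limg E; pose f1 : 'Hom(V, subvs_of U) := (linfun (vsproj U) \o E)%VF.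
pose g1 : 'Hom(subvs_of U, V) := linfun vsval.
have EU v : E v \in U by apply: memv_img; apply: memvf.
have f1E v : vsval (f1 v) = E v by rewrite comp_lfunE lfunE /= vsprojK.
have g1E u : g1 u = vsval u by rewrite lfunE.
have gf : (g1 \o f1)%VF = E by apply/lfunP => v; rewrite comp_lfunE g1E f1E.
have fg : (f1 \o g1)%VF = \1%VF.
  apply/lfunP => u; apply: val_inj; have /memv_imgP [v _ uE] := subvsP u.
  by rewrite comp_lfunE id_lfunE [LHS]f1E g1E uE idem.
have -> : K H0 H0 = 4%:R * ltrace E by rewrite /E ltraceZ mulVKf ?nz.
rewrite mulf_neq0 ?nz // -gf ltraceC fg ltrace1 natf_eq0 // dimvf /=.
have [x xVp x0] : exists2 x, x \in Vp & x != 0.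
  exists (vpick Vp); first exact: memv_pick.
  by rewrite vpick0; apply/eqP.
rewrite -dimvf dimv_eq0; apply/eqP => U0.
have xE : E x = x.
  rewrite EE; move/(VpP hL _ _): xVp => hx; rewrite !(hx, brZr hL) !scalerA -!natrM.
  by rewrite mulVf ?nz // scale1r.
have : vsproj U x \in {: subvs_of U}%VS by apply: memvf.
rewrite U0 memv0 => /eqP /(congr1 vsval); rewrite vsprojK; last by rewrite -xE EU.
by rewrite linear0 => x00; rewrite x00 eqxx in x0.
Qed.

Let krow (x : V) : 'rV[F]_(\dim {:V}) := \row_i K x (vbasis {:V})`_i.

Let krow_linear : linear krow.
Proof. by move=> c x y; apply/rowP => i; rewrite !mxE killingDl // killingZl. Qed.

Let krowL : {linear V -> 'rV[F]_(\dim {:V})} :=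
  HB.pack krow (GRing.isLinear.Build F V _ _ krow krow_linear).

Let krow0 x : (krow x == 0) = (linfun krowL x == 0).
Proof. by rewrite lfunE. Qed.

(** The radical of $K$ is an ideal which does not contain $H_0$, hence is 0 by simplicity. *)
Lemma killing_nondeg x : (forall y, K x y = 0) -> x = 0.
Proof.
move=> Kx; pose W := lker (linfun krowL).
have inW v : v \in W <-> forall y, K v y = 0.
  rewrite memv_ker -krow0; split=> [/eqP/rowP H y|H]; last first.
    by apply/eqP/rowP => i; rewrite !mxE H.
  rewrite (vbasis_sum y) (big_morph (K v) (killingDr hL v) (killing0r hL v)) big1 // => i _.
  by rewrite killingZr //; have := H i; rewrite !mxE => ->; rewrite mulr0.
have [|W0|Wf] := hS.2 W.
- move=> a b bW; apply/inW => y; have {}bW := (inW _).1 bW.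
  by rewrite (brC hL) killingNl // killing_br // bW oppr0.
- by apply/eqP; rewrite -memv0 -W0; apply/inW.
- have /inW /(_ H0) /eqP : H0 \in W by rewrite Wf memvf.
  by rewrite (negPf killing_H0).
Qed.

Lemma killing_repr (psi : V -> F) : scalar psi -> exists z, forall v, psi v = K z v.
Proof.
move=> psil; have ker0 : lker (linfun krowL) == 0%VS.
  apply/lker0P => x y E; apply/eqP; rewrite -subr_eq0; apply/eqP; apply: killing_nondeg => v.
  have {}E : krow (x - y) = 0.
    by apply/eqP; rewrite krow0 linearB /= E subrr.
  rewrite (vbasis_sum v) (big_morph (K (x - y)) (killingDr hL _) (killing0r hL _)) big1 // => i _.
  by rewrite killingZr //; have /rowP /(_ i) := E; rewrite !mxE => ->; rewrite mulr0.
have limgf : limg (linfun krowL) = fullv.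
  apply/eqP; rewrite eqEdim subvf limg_dim_eq; last by rewrite (eqP ker0) capv0.
  by rewrite [X in (X <= _)%N]dimvf dim_matrix mul1r /= leqnn.
pose r : 'rV[F]_(\dim {:V}) := \row_i psi (vbasis {:V})`_i.
have /memv_imgP [z _ zE] : r \in limg (linfun krowL) by rewrite limgf memvf.
exists z => v.
have psi0 : psi 0 = 0.
  by have := psil (-1) 0 0; rewrite scaler0 addr0 mulN1r => {1}->; rewrite addNr.
have psiD u w : psi (u + w) = psi u + psi w by have := psil 1 u w; rewrite scale1r mul1r.
rewrite (vbasis_sum v) (big_morph psi psiD psi0) (big_morph (K z) (killingDr hL _) (killing0r hL _)).
apply: eq_bigr => i _; have := psil (coord (vbasis {:V}) i v) (vbasis {:V})`_i 0.
rewrite psi0 !addr0 => ->; rewrite killingZr //; congr (_ * _).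
by have /rowP /(_ i) := zE; rewrite lfunE !mxE.
Qed.

Lemma killing_nondeg_m y : y \in Vm -> (forall x, x \in Vp -> K y x = 0) -> y = 0.
Proof.
move=> ym Ky; apply: killing_nondeg => v.
have [m [z [p [/(VmP hL _ _) mm /(VzP hL _ _) zz pp ->]]]] := grade_dec charF hL hg v.
move/(VmP hL _ _): ym => hy; rewrite !killingDr // (Ky p pp) addr0.
rewrite (killing_eigen hL hy mm) ?add0r; last by rewrite -opprD oppr_eq0 -natrD nz.
by apply: (killing_eigen hL hy (d := 0)); rewrite ?scale0r // addr0 oppr_eq0 nz.
Qed.

Lemma killing_nondeg_z u : u \in Vz -> (forall w, w \in Vz -> K u w = 0) -> u = 0.
Proof.
move=> /(VzP hL _ _) uz Ku; apply: killing_nondeg => v.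
have [m [z [p [/(VmP hL _ _) mm zz /(VpP hL _ _) pp ->]]]] := grade_dec charF hL hg v.
have uz' : br H0 u = 0 *: u by rewrite scale0r.
rewrite !killingDr // (Ku z zz) (killing_eigen hL uz' mm) ?(killing_eigen hL uz' pp) ?addr0 ?add0r //.
by rewrite oppr_eq0 nz.
Qed.

(** $V^-+[V^-,V^+]+V^+$ is a nonzero ideal, hence everything, and its part of degree 0 is
    $[V^-,V^+]$. *)
Lemma Vz_generated u : u \in Vz -> u \in bracket_space br Vm Vp.
Proof.
move=> uz; pose I := (Vm + bracket_space br Vm Vp + Vp)%VS.
have bz : (bracket_space br Vm Vp <= Vz)%VS.
  by apply: bracket_space_sub => x y; apply: br_mp.
have bI x : x \in bracket_space br Vm Vp -> x \in I.
  by move=> xb; apply: (subvP (addvSl _ _)); apply: (subvP (addvSr _ _)).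
have mI x : x \in Vm -> x \in I.
  by move=> xb; do 2!apply: (subvP (addvSl _ _)).
have pI x : x \in Vp -> x \in I by move=> xb; apply: (subvP (addvSr _ _)).
have [|I0|If] := hS.2 I.
- move=> x y; have [m [z [p [mm zz pp ->]]]] := grade_dec charF hL hg x.
  move=> /memv_addP [_ /memv_addP [m' mm' [b' bb' ->]] [p' pp' ->]].
  have bz' := subvP bz _ bb'.
  have zb : br z b' \in bracket_space br Vm Vp.
    have : (bracket_space br Vm Vp <= adl br z @^-1: bracket_space br Vm Vp)%VS.
      apply: bracket_space_sub => a c am cp; rewrite -memv_preim adlE // (brA hL).
      by apply: memvD; apply: mem_bracket_space => //; [apply: br_zm|apply: br_zp].
    by move=> /subvP /(_ _ bb'); rewrite -memv_preim adlE.
  rewrite !(brDr hL, brDl hL); do !apply: memvD.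
  + by rewrite (br_mm charF hL hg mm mm') mem0v.
  + by apply/mI/br_zm.
  + by rewrite (brC hL) memvN; apply/bI/mem_bracket_space.
  + by apply/mI/br_mz.
  + exact: bI.
  + by apply/pI/br_pz.
  + by apply/bI/mem_bracket_space.
  + by apply/pI/br_zp.
  + by rewrite (br_pp charF hL hg pp pp') mem0v.
- case: hVp; apply/eqP; rewrite -subv0; apply/subvP => x xp.
  by rewrite -I0; apply: pI.
have : u \in I by rewrite If memvf.
move=> /memv_addP [_ /memv_addP [m mm [b bb ->]] [p pp E]].
have bz' := subvP bz _ bb.
(* Applying $\mathrm{ad}\,H_0$ once and twice isolates the components of degree $-2$ and $2$, which
   must vanish. *)
have E0 : br H0 u = br H0 (m + b + p) by rewrite E.
have E1 : br H0 (br H0 u) = br H0 (br H0 (m + b + p)) by rewrite E.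
move: E0 E1; rewrite !(brDr hL) ((VzP hL _ _) uz) ((VzP hL _ _) bz') (br0r hL).
rewrite ((VmP hL _ _) mm) ((VpP hL _ _) pp) !(brZr hL) ((VmP hL _ _) mm) ((VpP hL _ _) pp).
rewrite !addr0 !scalerA => E0 E1.
have m0 : m = 0.
  apply: (scalerI (nz 7)); rewrite scaler0 -[RHS]subr0 {1}E1 -[X in _ - X](scaler0 _ 2%:R) E0.
  by vring.
have p0 : p = 0.
  apply: (scalerI (nz 7)); rewrite scaler0 -[RHS]addr0 {1}E1 -[X in _ + X](scaler0 _ 2%:R) E0.
  by vring.
by rewrite E m0 p0 add0r addr0.
Qed.

End KillingNondegenerate.

(** * Invertible elements of V^+ are generic *)

Section Invertibility.
Variables (F : fieldType).
Hypothesis charF : [pchar F] =i pred0.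
Variables (V : vectType F) (br : V -> V -> V).
Hypotheses (hL : lie_bracket br) (hS : lie_simple br).

Let nz n : n.+1%:R != 0 :> F. Proof. exact (natSf_neq0 charF n). Qed.

Variables (H0 f e : V).
Hypotheses (hg : grading br H0) (ht : gtriple br H0 f H0 e) (hVp : Vplus br H0 <> 0%VS).
Notation Vp := (Vplus br H0).
Notation Vz := (Vzero br H0).
Notation Vm := (Vminus br H0).
Notation K := (killing br).

Section OneElement.
Variable X : V.
Hypotheses (Xp : X \in Vp)
  (surj : forall x, x \in Vp -> exists2 y, y \in Vm & br X (br X y) = x).

Lemma ad2_inj y : y \in Vm -> br X (br X y) = 0 -> y = 0.
Proof.
move=> ym Sy; apply: (killing_nondeg_m charF hL hS hg hVp) => // x /surj [y' _ <-].
rewrite -!killing_br // (brC hL (br y X)) (brC hL y X) (brNr hL) opprK Sy.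
by rewrite killing0l.
Qed.

(* The trace of ad(H0)ad(c) vanishes: ad(X)^2 intertwines the actions of c on *)
(* V^- and V^+.                                                               *)
Lemma killing_H0_cent c : c \in Vz -> br X c = 0 -> K H0 c = 0.
Proof.
move=> cz Xc; pose C := adl br c; pose H := adl br H0.
have [S SE] : exists S : 'End(V), forall v, S v = br X (br X v).
  by exists (adl br X \o adl br X)%VF => v; rewrite comp_lfunE !adlE.
have [Pp PpE] : exists Pp : 'End(V), forall v, Pp v = proj_p br H0 v.
  exists (8%:R^-1 *: ((H \o H)%VF + 2%:R *: H)) => v.
  by rewrite scale_lfunE add_lfunE comp_lfunE scale_lfunE !adlE.
have [Pm PmE] : exists Pm : 'End(V), forall v, Pm v = proj_m br H0 v.
  exists (8%:R^-1 *: ((H \o H)%VF - 2%:R *: H)) => v.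
  by rewrite scale_lfunE add_lfunE comp_lfunE opp_lfunE scale_lfunE !adlE.
have Pmm v : Pm v \in Vm by rewrite PmE; apply: proj_mP.
have Ppp v : Pp v \in Vp by rewrite PpE; apply: proj_pP.
have SPm v : S (Pm v) = S v.
  rewrite [in RHS](proj_sum charF br H0 v) -PmE !SE.
  move: (proj_z br H0 v) (proj_p br H0 v) (proj_zP charF hL hg v) (proj_pP hL hg v) => z p zz pp.
  rewrite !(brDr hL) (br_pp charF hL hg Xp pp) (br0r hL) addr0.
  by rewrite (br_pp charF hL hg Xp (br_pz hL Xp zz)) addr0.
have Sp v : S v \in Vp by rewrite -SPm SE; apply: (br_pz hL Xp); apply: br_pm.
have Pinj y : y \in Vm -> S y = 0 -> y = 0 by move=> ym; rewrite SE; apply: ad2_inj.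
(* [R] inverts $\mathrm{ad}(X)^2:V^-\to V^+$; conjugation by it will match the two traces of
   $\mathrm{ad}\,c$. *)
have [R RE] : exists R : 'End(V), forall v, R v = Pm (S^-1%VF (Pp v)).
  by exists (Pm \o S^-1 \o Pp)%VF => v; rewrite !comp_lfunE.
have SR : (S \o R)%VF = Pp.
  apply/lfunP => v; rewrite comp_lfunE RE SPm limg_lfunVK //.
  by have [y _ <-] := surj (Ppp v); rewrite -SE memv_img ?memvf.
have RS : (R \o S)%VF = Pm.
  apply/lfunP => v; rewrite comp_lfunE RE [Pp (S v)]PpE (proj_pK charF hL (Sp v)).
  apply/eqP; rewrite -subr_eq0; apply/eqP; apply: Pinj; first by rewrite memvB.
  by rewrite linearB /= !SPm limg_lfunVK ?subrr // memv_img ?memvf.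
have CS : (C \o S = S \o C)%VF.
  apply/lfunP => v; rewrite !comp_lfunE !SE !adlE // (brA hL c X) (brC hL c X) Xc oppr0 (br0l hL) add0r.
  by rewrite (brA hL c X) (brC hL c X) Xc oppr0 (br0l hL) add0r.
have HE : H = 2%:R *: Pp - 2%:R *: Pm.
  apply/lfunP => v; rewrite add_lfunE opp_lfunE !scale_lfunE PpE PmE adlE // /proj_p /proj_m.
  by vfield; rewrite ?nz.
rewrite /killing -/H -/C HE comp_lfunDl comp_lfunNl -!comp_lfunZl ltraceD ltraceN !ltraceZ.
suff -> : ltrace (Pp \o C)%VF = ltrace (Pm \o C)%VF by rewrite subrr.
by rewrite -SR -RS -comp_lfunA ltraceC -comp_lfunA CS comp_lfunA.
Qed.

(** Solve $[X,[X,Y]]=2X$. Then $k=[Y,X]-H_0$ commutes with $X$, and it is $K$-orthogonal to $V_0$: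
    any $w\in V_0$ is some $[X,y]$, to which $k$ is orthogonal, plus some $c$ commuting with $X$;
    for this $c$, $K([Y,X],c)=K(Y,[X,c])=0$ and $K(H_0,c)=0$. *)
Lemma invertible_of_surj : exists Y, gtriple br H0 Y H0 X.
Proof.
have [Y ym YE] := surj (memvZ 2%:R Xp).
have HX := (VpP hL H0 X) Xp; have HY := (VmP hL H0 Y) ym.
exists Y; split=> //; split=> //.
apply/eqP; rewrite -subr_eq0; set k := _ - _.
have kz : k \in Vz by apply: memvB; [apply: (br_mp hL)|apply: (mem_H0 hL)].
have Xk : br X k = 0.
  by rewrite (brBr hL) (brC hL X H0) HX opprK (brC hL Y) (brNr hL) YE addNr.
apply/eqP; apply: (killing_nondeg_z charF hL hS hg hVp kz) => w wz.
have [y ym' yE] := surj (br_pz hL Xp wz).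
have Kk : K k (br X y) = 0.
  by rewrite -killing_br // (brC hL k X) Xk oppr0 killing0l.
have cz : w - br X y \in Vz by apply: memvB => //; apply: (br_pm hL).
have Xc : br X (w - br X y) = 0 by rewrite (brBr hL) yE subrr.
rewrite -[w](subrK (br X y)) killingDr // Kk addr0 killingDl // killingNl // killing_br // Xc.
by rewrite killing0r // sub0r (killing_H0_cent cz Xc) oppr0.
Qed.

End OneElement.

(** The quadratic operator $U_X$ of the Jordan algebra structure on $V^+$ with unit $e$; the factor
    $1/4$ makes $U_e$ the identity of $V^+$. *)
Definition Uquad X : 'End(V) :=
  4%:R^-1 *: (adl br X \o adl br X \o adl br f \o adl br f)%VF.

Let fm : f \in Vm := gtriple_f ht.
Let ep : e \in Vp := gtriple_e ht.
Let fe : br f e = H0 := gtriple_fe ht.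

Lemma UquadE X x : Uquad X x = 4%:R^-1 *: br X (br X (br f (br f x))).
Proof. by rewrite scale_lfunE !comp_lfunE !adlE. Qed.

Lemma Uquad_mem X x : X \in Vp -> x \in Vp -> Uquad X x \in Vp.
Proof.
move=> Xp xp; rewrite UquadE memvZ // (br_pz hL Xp) // (br_pm hL Xp) //.
by rewrite (br_mz hL fm) // (br_mp hL fm).
Qed.

Lemma Uquad_e x : x \in Vp -> Uquad e x = x.
Proof.
by move=> xp; rewrite UquadE (full_eeff charF hL hg ht xp) scalerA mulVf ?nz // scale1r.
Qed.

(** A polynomial in $X$, equal to 1 at $e$, whose nonvanishing makes $\mathrm{ad}(X)^2$ surjective
    onto $V^+$ and hence $X$ invertible. *)
Definition qdet X : F := detU Vp (Uquad X).

Lemma qdet_e : qdet e = 1.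
Proof. by apply: detU_id => x; apply: Uquad_e. Qed.

Lemma invertible_qdet X : X \in Vp -> qdet X != 0 -> exists Y, gtriple br H0 Y H0 X.
Proof.
move=> Xp d0; apply: invertible_of_surj => // x xp.
have [v vp <-] := detU_surj (fun v => Uquad_mem (x := v) Xp) d0 xp.
exists (4%:R^-1 *: br f (br f v)); last by rewrite UquadE !(brZr hL).
by rewrite memvZ // (br_mz hL fm) // (br_mp hL fm).
Qed.

Lemma fa_qdet T (A : (T -> F) -> Prop) (X : T -> V) :
  fun_alg A -> avec A X -> A (fun t => qdet (X t)).
Proof.
move=> hA AX; apply: fa_detU => // v _.
apply: (avec_ext hA (x := fun t => 4%:R^-1 *: br (X t) (br (X t) (br f (br f v))))).
  by move=> t; rewrite UquadE.
have brl := lie_linearl hL; have brr := lie_linearr hL.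
apply: avec_scale => //; first exact: fa_cst.
apply: avec_bilinear => //; apply: avec_bilinear => //; exact: avec_cst.
Qed.

(* Along a line through e, all but finitely many points are invertible.       *)
Lemma invertible_line X z : X \in Vp -> z \in Vp -> qdet X != 0 ->
  exists2 d : {poly F}, d != 0 &
    forall t, d.[t] != 0 -> exists Y, gtriple br H0 Y H0 (X + t *: z).
Proof.
move=> Xp zp X0.
have [d dE] : upoly (fun t => qdet (X + t *: z)).
  apply: fa_qdet; first exact: upoly_alg.
  apply: avec_add; [exact: upoly_alg|exact: (avec_cst (upoly_alg F))|].
  by apply: avec_scale; [exact: upoly_alg|exact: upoly_id|exact: (avec_cst (upoly_alg F))].
exists d => [|t]; last first.
  by rewrite -dE; apply: invertible_qdet; apply: memvD => //; apply: memvZ.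
by apply: contraNneq X0 => d0; rewrite -[X]addr0 -(scale0r z) dE d0 horner0.
Qed.

End Invertibility.

Lemma peval_neq0 (F : fieldType) (V : vectType F) (U : {vspace V}) (P : {mpoly F[\dim U]}) :
  [pchar F] =i pred0 -> P != 0 -> exists2 x, x \in U & peval P x != 0.
Proof.
move=> charF P0; apply: NNPP => nex; move/eqP: P0; apply; apply: (mpoly_eq0_eval charF) => v.
apply: NNPP => /eqP Pv; apply: nex; exists (\sum_i v i *: (vbasis U)`_i).
  by apply: memv_suml => i _; rewrite memvZ //; apply/vbasis_mem/mem_nth; rewrite size_tuple.
rewrite /peval (meval_eq (v2 := v)) // => i.
by rewrite coord_sum_free // (basis_free (vbasisP U)).
Qed.

Lemma peval_ext (F : fieldType) (V : vectType F) (U : {vspace V}) (P Q : {mpoly F[\dim U]}) :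
  [pchar F] =i pred0 -> (forall x, x \in U -> peval P x = peval Q x) -> P = Q.
Proof.
move=> charF E; apply/eqP; rewrite -subr_eq0; apply: contraT => /(peval_neq0 charF) [x xU].
by rewrite /peval mevalB -!/(peval _ _) (E x xU) subrr eqxx.
Qed.

(** * The logarithmic derivative of a relative invariant *)

Section LogDerivative.
Variables (F : fieldType) (Fbar : closedFieldType) (iota : {rmorphism F -> Fbar}).
Hypothesis charF : [pchar F] =i pred0.
Variables (V : vectType F) (br : V -> V -> V).
Hypotheses (hL : lie_bracket br) (hS : lie_simple br).

Let nz n : n.+1%:R != 0 :> F. Proof. exact (natSf_neq0 charF n). Qed.

Variables (H0 f e : V).
Hypotheses (hR : regular_graded iota br H0).
Hypotheses (hg : grading br H0) (ht : gtriple br H0 f H0 e) (hVp : Vplus br H0 <> 0%VS).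
Notation Vp := (Vplus br H0).
Notation Vz := (Vzero br H0).
Notation Vm := (Vminus br H0).
Notation K := (killing br).

Let fm : f \in Vm := gtriple_f ht.
Let ep : e \in Vp := gtriple_e ht.
Let fe : br f e = H0 := gtriple_fe ht.

(** Two Weyl elements compose to an element fixing $H_0$ which acts on $V^+$ as $U_X$, so it depends
    polynomially on $X$ and can be differentiated. *)
Lemma weyl_weyl X Y x : gtriple br H0 Y H0 X -> x \in Vp ->
  weyl_elt br X Y (weyl_elt br e f x) = Uquad br f X x.
Proof.
move=> htX xp; rewrite (weyl_p charF hL hg ht xp).
have m : 2%:R^-1 *: br f (br f x) \in Vm.
  by apply: memvZ; apply: (br_mz hL fm); apply: (br_mp hL fm).
by rewrite (weyl_m charF hL hg htX m) (UquadE hL) !(brZr hL) scalerA -invfM -natrM.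
Qed.

Lemma Uquad_line z x t : z \in Vp -> x \in Vp ->
  Uquad br f (e + t *: z) x =
    x + t *: br (br f z) x + t ^+ 2 *: (4%:R^-1 *: br z (br z (br f (br f x)))).
Proof.
move=> zp xp; rewrite (UquadE hL); set w := br f (br f x).
rewrite !(brDl hL, brZl hL, brDr hL, brZr hL).
have ew : br e w = - (2%:R *: br f x) := full_eff charF hL hg ht xp.
have eew : br e (br e w) = 4%:R *: x := full_eeff charF hL hg ht xp.
have ez : br e (br z w) = br z (br e w).
  by rewrite (brA hL e z w) (br_pp charF hL hg ep zp) (br0l hL) add0r.
rewrite ez eew ew !(brNr hL, brZr hL) (brC hL z (br f x)) (br_zpp charF hL hg xp zp fm).
by vfield; rewrite ?nz.
Qed.

(** [U] is kept apart from $V^+$, to which it is equal, because the type of [P] depends on it and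
    $P_0$ lives on [Vplus_j] at index 0. *)
Variables (U : {vspace V}) (hU : U = Vp) (P : {mpoly F[\dim U]}).
Hypotheses (P0 : P != 0)
  (hInv : forall X Y, gtriple br H0 Y H0 X -> exists c, forall x, x \in Vp ->
     peval P (weyl_elt br X Y (weyl_elt br e f x)) = c * peval P x).

Let memU y : (y \in U) = (y \in Vp).
Proof. by rewrite hU. Qed.

(** $U_{e+tz}=1+t\,\mathrm{ad}[f,z]+O(t^2)$ multiplies $P$ by a factor depending on $t$ only; the
    derivative at $t=0$ is the claim. *)
Lemma inf_inv_basic z : z \in Vp -> exists c, forall x, x \in Vp ->
  dpe P x (br (br f z) x) = c * peval P x.
Proof.
move=> zp; have [x0 x0U Px0] := peval_neq0 charF P0; rewrite memU in x0U.
have qe0 : qdet br H0 f e != 0 by rewrite (qdet_e charF hL hg ht) oner_neq0.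
have [d d0 dinv] := invertible_line charF hL hS hg ht hVp ep zp qe0.
exists (dpe P x0 (br (br f z) x0) / peval P x0) => x xp.
have [p [pE pD]] := peval_curve P x (br (br f z) x) (4%:R^-1 *: br z (br z (br f (br f x)))).
have [q [qE qD]] := peval_curve P x0 (br (br f z) x0) (4%:R^-1 *: br z (br z (br f (br f x0)))).
(* Evaluating also at [x0] eliminates the factor [c], which is not known to be polynomial in [t]. *)
have pq : peval P x0 *: p - peval P x *: q = 0.
  apply: (poly_eq0_dense charF d0) => t /dinv [Y htY].
  have [c cE] := hInv htY.
  rewrite hornerD hornerN !hornerZ pE qE -!Uquad_line // -!(weyl_weyl htY) // !cE //.
  by ring.
have := congr1 (fun r : {poly F} => r^`().[0]) pq.
rewrite derivB !derivZ hornerD hornerN !hornerZ pD qD deriv0 horner0 mul0rn !scale0r !addr0.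
rewrite expr0n /= !scale0r !addr0 => /eqP; rewrite subr_eq0 => /eqP E.
by apply: (mulfI Px0); rewrite E mulrA mulrCA divff // mulr1 mulrC.
Qed.

(** The elements $[f,z]$ and their commutators span $V_0=[V^-,V^+]$: write $y\in V^-$ as
    $[f,[f,s]]/4$ and expand $[[f,[f,s]],z]$ by the Jacobi identity. *)
Lemma inf_inv u : u \in Vz -> exists c, forall x, x \in Vp -> dpe P x (br u x) = c * peval P x.
Proof.
have add u1 u2 : (exists c, forall x, x \in Vp -> dpe P x (br u1 x) = c * peval P x) ->
    (exists c, forall x, x \in Vp -> dpe P x (br u2 x) = c * peval P x) ->
    (exists c, forall x, x \in Vp -> dpe P x (br (u1 + u2) x) = c * peval P x).
  by move=> [c1 E1] [c2 E2]; exists (c1 + c2) => x xp; rewrite (brDl hL) dpeD E1 // E2 // mulrDl.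
have scale k u1 : (exists c, forall x, x \in Vp -> dpe P x (br u1 x) = c * peval P x) ->
    (exists c, forall x, x \in Vp -> dpe P x (br (k *: u1) x) = c * peval P x).
  by move=> [c1 E1]; exists (k * c1) => x xp; rewrite (brZl hL) dpeZ E1 // mulrA.
have comm u1 u2 : u1 \in Vz -> u2 \in Vz ->
    (exists c, forall x, x \in Vp -> dpe P x (br u1 x) = c * peval P x) ->
    (exists c, forall x, x \in Vp -> dpe P x (br u2 x) = c * peval P x) ->
    (exists c, forall x, x \in Vp -> dpe P x (br (br u1 u2) x) = c * peval P x).
  move=> z1 z2 [c1 E1] [c2 E2]; exists 0 => x xp.
  have -> : br (br u1 u2) x = br u1 (br u2 x) - br u2 (br u1 x) by rewrite (brA hL u1) addrK.
  rewrite mul0r; apply: (dpe_commutator charF (lie_linearr hL u1) (lie_linearr hL u2)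
    (alpha := c1) (beta := c2)); last (by rewrite memU); move=> y; rewrite !memU => yp;
     by [apply: (br_zp hL z1)|apply: (br_zp hL z2)|apply: E1|apply: E2].
have gen y z : y \in Vm -> z \in Vp ->
    exists c, forall x, x \in Vp -> dpe P x (br (br y z) x) = c * peval P x.
  move=> ym zp; pose s := br e (br e y).
  have sp : s \in Vp by apply: (br_pz hL ep); apply: (br_pm hL ep).
  have yE : y = 4%:R^-1 *: br f (br f s).
    by rewrite (full_ffee charF hL hg ht ym) scalerA mulVf ?nz // scale1r.
  have -> : br y z = 4%:R^-1 *: (br f (br (br f s) z) + (- 1) *: br (br f s) (br f z)).
    by rewrite {1}yE (brZl hL) (brA hL f (br f s)) scaleN1r addrK.
  apply: (scale); apply: (add).
    by apply: inf_inv_basic; apply: br_zp => //; apply: br_mp.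
  by apply: (scale); apply: (comm); do ?[exact: (br_mp hL fm)|exact: inf_inv_basic].
move=> /(Vz_generated charF hL hS hg hVp) /(@coord_span _ _ _ (in_tuple _)) ->.
apply: (big_ind (fun u => exists c, forall x, x \in Vp -> dpe P x (br u x) = c * peval P x)) => //.
  by exists 0 => x _; rewrite (br0l hL) dpe0 mul0r.
move=> i _; apply: (scale) => /=.
have := mem_nth 0 (ltn_ord i) => /allpairsP [[y z] /= [yU zU ->]].
by apply: (gen); apply: vbasis_mem.
Qed.

(** The infinitesimal character of $V_0$ is represented through $K$ by some $z_0\in V_0$. It
    vanishes on commutators, so $z_0$ is central in $V_0$, acts on $V^+$ by a scalar by Schur's
    lemma, and is therefore a multiple of $H_0$. *)
Theorem log_derivative : exists c, forall X Y z, gtriple br H0 Y H0 X -> z \in Vp ->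
  dpe P X z = c * K Y z * peval P X.
Proof.
have [x0 x0U Px0] := peval_neq0 charF P0; rewrite memU in x0U.
(* The projection extends the character by zero to $V^\pm$, so that the Killing form of the whole
   algebra can represent it. *)
pose psi u := dpe P x0 (proj_p br H0 (br u x0)) / peval P x0.
have psil : scalar psi.
  move=> c u v; rewrite /psi (brDl hL) (brZl hL) (proj_p_linear hL) dpeD dpeZ.
  by rewrite mulrDl mulrA.
have psiE u : u \in Vz -> forall x, x \in Vp -> dpe P x (br u x) = psi u * peval P x.
  move=> uz; have [c cE] := inf_inv uz; move=> x xp; rewrite cE //; congr (_ * _).
  by rewrite /psi (proj_pK charF hL (br_zp hL uz x0U)) cE // mulfK.
have psi_pm v : v \in Vp \/ v \in Vm -> psi v = 0.
  move=> hv; rewrite /psi (_ : proj_p _ _ _ = 0) ?dpe0 ?mul0r //.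
  case: hv => hv; rewrite /proj_p.
    by rewrite (br_pp charF hL hg hv x0U) !(br0r hL) scaler0 addr0 scaler0.
  by rewrite ((VzP hL H0 _) (br_mp hL hv x0U)) (br0r hL) scaler0 addr0 scaler0.
have [z0 z0E] := killing_repr charF hL hS hg hVp psil.
have z0z : z0 \in Vz.
  have Km v : v \in Vm -> K z0 v = 0 by move=> hv; rewrite -z0E psi_pm //; right.
  have Kp v : v \in Vp -> K z0 v = 0 by move=> hv; rewrite -z0E psi_pm //; left.
  apply/(VzP hL); apply: (killing_nondeg charF hL hS hg hVp) => v.
  rewrite (brC hL) killingNl // killing_br //.
  have [m [z [p [mm zz pp ->]]]] := grade_dec charF hL hg v.
  rewrite !(brDr hL) ((VmP hL _ _) mm) ((VzP hL _ _) zz) ((VpP hL _ _) pp) addr0.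
  by rewrite killingDr // !killingZr // Km // Kp // !mulr0 addr0 oppr0.
have z0c u : u \in Vz -> br z0 u = 0.
  move=> uz; apply: (killing_nondeg_z charF hL hS hg hVp (br_zz hL z0z uz)) => w wz.
  rewrite killing_br // -z0E; apply: (mulIf Px0); rewrite mul0r -psiE ?(br_zz hL) //.
  have -> : br (br u w) x0 = br u (br w x0) - br w (br u x0) by rewrite (brA hL u) addrK.
  apply: (dpe_commutator charF (lie_linearr hL u) (lie_linearr hL w)
    (alpha := psi u) (beta := psi w)); last (by rewrite memU); move=> y; rewrite !memU => yp;
     by [apply: (br_zp hL uz)|apply: (br_zp hL wz)|apply: psiE|apply: psiE].
have [c cE] := schur_Vplus hL hR z0z z0c.
have z0H : z0 = (c / 2%:R) *: H0.
  apply/eqP; rewrite -subr_eq0; apply/eqP; set w := _ - _.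
  have wz : w \in Vz by apply: memvB => //; apply: memvZ; apply: (mem_H0 hL).
  have wp x : x \in Vp -> br w x = 0.
    move=> xp; rewrite (brBl hL) cE // (brZl hL) ((VpP hL _ _) xp) scalerA divfK ?nz //.
    by rewrite subrr.
  apply: (center0 hL hS) => v.
  have [m [z [p [mm zz pp ->]]]] := grade_dec charF hL hg v.
  rewrite !(brDr hL) (wp p pp) addr0 (_ : br w z = 0) ?addr0.
    apply: (killing_nondeg_m charF hL hS hg hVp (br_zm hL wz mm)) => x xp.
    by rewrite (brC hL) killingNl // killing_br // wp // killing0r // oppr0.
  by rewrite (brBl hL) z0c // (brZl hL) ((VzP hL _ _) zz) scaler0 subr0.
exists (- (c / 2%:R)) => X Y z htX zp; have [Ym Xp [_ HY YX]] := htX.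
apply: (mulfI (nz 1)); rewrite -dpeZ.
(* Every direction is tangent to the orbit: $[[Y,z],X]=[[Y,X],z]=[H_0,z]$. *)
have -> : 2%:R *: z = br (br Y z) X.
  by rewrite (br_zpp charF hL hg zp Xp Ym) YX ((VpP hL _ _) zp).
rewrite psiE ?(br_mp hL) // z0E z0H killingZl // -killing_br // HY killingZl //.
by ring.
Qed.

End LogDerivative.

(** * Splitting H_0 by two commuting triples *)

Section Blocks.
Variables (F : fieldType).
Hypothesis charF : [pchar F] =i pred0.
Variables (V : vectType F) (br : V -> V -> V).
Hypotheses (hL : lie_bracket br) (hS : lie_simple br).

Let nz n : n.+1%:R != 0 :> F. Proof. exact (natSf_neq0 charF n). Qed.

(* Two commuting sl2-triples whose neutral elements add up to H0.             *)
Definition block (H0 f1 h1 e1 f2 h2 e2 : V) : Prop :=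
  [/\ gtriple br H0 f1 h1 e1, gtriple br H0 f2 h2 e2,
      br f1 e2 = 0, br f2 e1 = 0 & h1 + h2 = H0].

Lemma blockC H0 f1 h1 e1 f2 h2 e2 :
  block H0 f1 h1 e1 f2 h2 e2 -> block H0 f2 h2 e2 f1 h1 e1.
Proof. by move=> [t1 t2 c1 c2 hh]; split; rewrite // addrC. Qed.

Section OneBlock.
Variables (H0 f1 h1 e1 f2 h2 e2 : V).
Hypotheses (hg : grading br H0) (hb : block H0 f1 h1 e1 f2 h2 e2).
Notation Vp := (Vplus br H0).
Notation Vz := (Vzero br H0).
Notation Vm := (Vminus br H0).
Notation K := (killing br).

Let t1 : gtriple br H0 f1 h1 e1. Proof. by case: hb. Qed.
Let t2 : gtriple br H0 f2 h2 e2. Proof. by case: hb. Qed.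
Let hh : h1 + h2 = H0. Proof. by case: hb. Qed.
Let f1m : f1 \in Vm. Proof. by case: t1. Qed.
Let f2m : f2 \in Vm. Proof. by case: t2. Qed.
Let e1p : e1 \in Vp. Proof. by case: t1. Qed.
Let e2p : e2 \in Vp. Proof. by case: t2. Qed.
Let h1e : br h1 e1 = 2%:R *: e1. Proof. by case: t1 => _ _ []. Qed.
Let h1f : br h1 f1 = - 2%:R *: f1. Proof. by case: t1 => _ _ []. Qed.
Let fe1 : br f1 e1 = h1. Proof. by case: t1 => _ _ []. Qed.
Let fe2 : br f2 e2 = h2. Proof. by case: t2 => _ _ []. Qed.

Lemma block_h1e2 : br h1 e2 = 0.
Proof.
have /eqP := brA hL f1 e1 e2; case: hb => _ _ -> _ _.
by rewrite (br_pp charF hL hg e1p e2p) !(br0r hL) addr0 fe1 eq_sym => /eqP.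
Qed.

Lemma block_h1f2 : br h1 f2 = 0.
Proof.
have /eqP := brA hL e1 f1 f2; case: hb => _ _ _ f2e1 _.
rewrite (br_mm charF hL hg f1m f2m) (brC hL e1 f2) f2e1 oppr0 !(br0r hL) addr0.
by rewrite (brC hL e1) fe1 (brNl hL) eq_sym oppr_eq0 => /eqP.
Qed.

Lemma block_gtriple : gtriple br H0 (f1 + f2) H0 (e1 + e2).
Proof.
case: hb => _ _ c1 c2 _; split; [exact: memvD|exact: memvD|split].
- by apply/(VpP hL); apply: memvD.
- by apply/(VmP hL); apply: memvD.
- by rewrite !(brDr hL, brDl hL) fe1 fe2 c1 c2 add0r addr0.
Qed.

Lemma h2_wt c d x : br H0 x = c *: x -> br h1 x = d *: x -> br h2 x = (c - d) *: x.
Proof.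
by move=> Hx h1x; rewrite scalerBl -Hx -h1x -hh (brDl hL) addrAC subrr add0r.
Qed.

Lemma h1_H0 : br h1 H0 = 0.
Proof. by rewrite (brC hL) ((VzP hL _ _) (triple_hz hL t1)) oppr0. Qed.

Lemma br_m2p0 A Z : A \in Vm -> br h1 A = - 2%:R *: A ->
  Z \in Vp -> br h1 Z = 0 -> br A Z = 0.
Proof.
move=> Am hA Zp hZ; apply: (wtm2_z charF hL hg t1); first exact: br_mp.
by rewrite (brA hL h1) hA hZ (br0r hL) addr0 (brZl hL).
Qed.

Lemma br_m0p2 A Y : A \in Vm -> br h1 A = 0 ->
  Y \in Vp -> br h1 Y = 2%:R *: Y -> br A Y = 0.
Proof.
move=> Am hA Yp hY; apply: (wt2_z charF hL hg t1); first exact: br_mp.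
by rewrite (brA hL h1) hA hY (br0l hL) add0r (brZr hL).
Qed.

(* The component in [V^-] of weight 0 of the inverse of [e1 + Z] is an        *)
(* inverse of [Z] for the second triple.                                      *)
Lemma block_inverse Xm Z : gtriple br H0 Xm H0 (e1 + Z) -> Z \in Vp -> br h1 Z = 0 ->
  exists Zm, [/\ Zm \in Vm, br h1 Zm = 0 & br Zm Z = h2].
Proof.
move=> [am _ [_ _ aX]] Zp hZ.
have /= := peirceN_wt charF hL hg t1 am; have /= := peirceN_mem hL t1 am.
have := peirce_sum charF br (- h1) Xm.
set a0 := peirce0 _ _ _; set a1 := peirce1 _ _ _; set a2 := peirce2 _ _ _.
move: a0 a1 a2 => a0 a1 a2 aE [a0m a1m a2m] [ha0 ha1 ha2].
exists a0; split=> //.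
have E : br a2 e1 + br a0 Z + (br a1 e1 + br a1 Z) = H0.
  rewrite -aX aE !(brDr hL, brDl hL) (br_m2p0 a2m ha2 Zp hZ) (br_m0p2 a0m ha0 e1p h1e).
  by vring.
have wt0 : br h1 (br a2 e1 + br a0 Z) = 0.
  rewrite (brDr hL) !(brA hL h1) ha2 ha0 h1e hZ (br0l hL) (br0r hL) (brZl hL) (brZr hL).
  by vring.
have w1 : br h1 (br a1 e1) = br a1 e1.
  by rewrite (brA hL h1) ha1 h1e (brNl hL) (brZr hL); vring.
have w2 : br h1 (br a1 Z) = - br a1 Z.
  by rewrite (brA hL h1) ha1 hZ (brNl hL) (br0r hL) addr0.
have E1 : br a1 e1 - br a1 Z = 0.
  by have := congr1 (br h1) E; rewrite h1_H0 (brDr hL) wt0 add0r (brDr hL) w1 w2.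
have E2 : br a1 e1 + br a1 Z = 0.
  by have := congr1 (br h1) E1; rewrite (brBr hL) w1 w2 opprK (br0r hL).
move: E; rewrite E2 addr0 => E.
(* The weight $-2$ part of the inverse is $f_1$ itself: the difference is killed by
   $\mathrm{ad}(e_1)^2$, which is injective in that weight. *)
pose d := a2 - f1; have dm : d \in Vm by rewrite memvB.
have hd : br h1 d = - 2%:R *: d by rewrite (brBr hL) ha2 h1f -scalerBr.
have dE : br d e1 + br a0 Z = h2.
  by rewrite (brBl hL) fe1 addrAC E -hh addrC addKr.
have e1a0 : br e1 (br a0 Z) = 0.
  rewrite (brA hL e1) (brC hL e1 a0) (br_m0p2 a0m ha0 e1p h1e) oppr0 (br0l hL).
  by rewrite (br_pp charF hL hg e1p Zp) (br0r hL) addr0.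
have e1h2 : br e1 h2 = 0.
  rewrite (brC hL) (h2_wt ((VpP hL _ _) e1p) h1e) subrr scale0r oppr0 //.
have d0 : d = 0.
  have := ffee_m charF hL hg t1 dm hd.
  have -> : br e1 (br e1 d) = 0.
    have := congr1 (br e1) dE; rewrite (brDr hL) e1a0 addr0 e1h2 (brC hL d) (brNr hL).
    by move/eqP; rewrite oppr_eq0 => /eqP.
  rewrite !(br0r hL) => /esym/eqP; rewrite scaler_eq0 (negPf (nz 3)) /=.
  by move/eqP.
by rewrite -dE d0 (br0l hL) add0r.
Qed.

Lemma block_inverse_add Y Ym Z Zm :
  Y \in Vp -> br h1 Y = 2%:R *: Y -> Z \in Vp -> br h1 Z = 0 ->
  Ym \in Vm -> br h2 Ym = 0 -> br Ym Y = h1 ->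
  Zm \in Vm -> br h1 Zm = 0 -> br Zm Z = h2 ->
  gtriple br H0 (Ym + Zm) H0 (Y + Z).
Proof.
move=> Yp hY Zp hZ Ymm hYm YY Zmm hZm ZZ.
have hYm1 : br h1 Ym = - 2%:R *: Ym.
  by have := (VmP hL _ _) Ymm; rewrite -hh (brDl hL) hYm addr0.
split; [exact: memvD|exact: memvD|split].
- by apply/(VpP hL); apply: memvD.
- by apply/(VmP hL); apply: memvD.
rewrite !(brDr hL, brDl hL) YY ZZ (br_m0p2 Zmm hZm Yp hY) (br_m2p0 Ymm hYm1 Zp hZ).
by rewrite add0r addr0.
Qed.

Lemma killing_m2p0 A Z : br h1 A = - 2%:R *: A -> br h1 Z = 0 -> K A Z = 0.
Proof.
move=> hA hZ; have hZ' : br h1 Z = 0 *: Z by rewrite scale0r.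
by apply: (killing_eigen hL hA hZ'); rewrite addr0 oppr_eq0 nz.
Qed.

End OneBlock.

(** The degenerate splitting, through which statements about the whole of $V^+$ become instances of
    those about blocks. *)
Lemma block0 H0 f e : gtriple br H0 f H0 e -> block H0 0 0 0 f H0 e.
Proof.
move=> t; split=> //; rewrite ?(br0l hL) ?(br0r hL) ?add0r //.
split; rewrite ?mem0v //; split; by rewrite ?(br0l hL) ?(br0r hL) ?scaler0.
Qed.

End Blocks.

(** * Restriction of a relative invariant to a block *)

Section BlockPolynomials.
Variables (F : fieldType).
Hypothesis charF : [pchar F] =i pred0.
Variables (V : vectType F) (br : V -> V -> V).
Hypotheses (hL : lie_bracket br) (hS : lie_simple br).

Let nz n : n.+1%:R != 0 :> F. Proof. exact (natSf_neq0 charF n). Qed.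

Variables (H0 : V).
Hypotheses (hg : grading br H0) (hVp : Vplus br H0 <> 0%VS).
Notation Vp := (Vplus br H0).
Notation Vz := (Vzero br H0).
Notation Vm := (Vminus br H0).
Notation K := (killing br).

Variables (U : {vspace V}) (hU : U = Vp) (P : {mpoly F[\dim U]}) (c : F).
Hypothesis hlog : forall X Y z, gtriple br H0 Y H0 X -> z \in Vp ->
  dpe P X z = c * K Y z * peval P X.

Variables (f1 h1 e1 f2 h2 e2 : V).
Hypothesis hb : block br H0 f1 h1 e1 f2 h2 e2.
Hypothesis Pe : peval P (e1 + e2) = 1.

Let t1 : gtriple br H0 f1 h1 e1. Proof. by case: hb. Qed.
Let t2 : gtriple br H0 f2 h2 e2. Proof. by case: hb. Qed.
Let hh : h1 + h2 = H0. Proof. by case: hb. Qed.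
Let f1m : f1 \in Vm. Proof. by case: t1. Qed.
Let e1p : e1 \in Vp. Proof. by case: t1. Qed.
Let e2p : e2 \in Vp. Proof. by case: t2. Qed.
Let h1e : br h1 e1 = 2%:R *: e1. Proof. by case: t1 => _ _ []. Qed.
Let h1f : br h1 f1 = - 2%:R *: f1. Proof. by case: t1 => _ _ []. Qed.
Let fe1 : br f1 e1 = h1. Proof. by case: t1 => _ _ []. Qed.
Let h1e2 := block_h1e2 charF hL hg hb.
Let ht := block_gtriple hL hb.

Let h2f1 : br h2 f1 = 0.
Proof. by rewrite (h2_wt hL hb ((VmP hL _ _) f1m) h1f) subrr scale0r. Qed.

Let brBZ Z t : br h1 Z = 0 -> br h1 (e2 + t *: (Z - e2)) = 0.
Proof. by move=> hZ; rewrite (brDr hL) (brZr hL) (brBr hL) h1e2 hZ subrr scaler0 addr0. Qed.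

Let memBZ Z t : Z \in Vp -> e2 + t *: (Z - e2) \in Vp.
Proof. by move=> Zp; rewrite memvD // memvZ // memvB. Qed.

(** $e_1+Z_t$ is invertible for generic $t$, and then [block_inverse] provides an inverse of $Z_t$
    within the block; so identities along the line from $e_2$ to $Z$ may be checked at such
    points. *)
Lemma block_dense (q : F -> F) Z : Z \in Vp -> br h1 Z = 0 -> upoly q ->
  (forall t Zm, let Zt := e2 + t *: (Z - e2) in
    Zm \in Vm -> br h1 Zm = 0 -> br Zm Zt = h2 -> q t = 0) -> forall t, q t = 0.
Proof.
move=> Zp hZ [p pE] H.
have qe0 : qdet br H0 (f1 + f2) (e1 + e2) != 0 by rewrite (qdet_e charF hL hg ht) oner_neq0.
have ep : e1 + e2 \in Vp by apply: memvD.
have Zep : Z - e2 \in Vp by apply: memvB.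
have [d d0 dinv] := invertible_line charF hL hS hg ht hVp ep Zep qe0.
have p0 : p = 0.
  apply: (poly_eq0_dense charF d0) => t /dinv [Y]; rewrite -addrA => tY.
  have [Zm [Zmm hZm ZZ]] := block_inverse charF hL hg hb tY (memBZ t Zp) (brBZ t hZ).
  by rewrite -pE; apply: H Zmm hZm ZZ.
by move=> t; rewrite pE p0 horner0.
Qed.

(** $f_1+Z_m$ is inverse to $e_1+Z$, and $f_1$ is $K$-orthogonal to the weight 0 space. *)
Lemma block_log Z Zm z : Z \in Vp -> br h1 Z = 0 -> Zm \in Vm -> br h1 Zm = 0 ->
  br Zm Z = h2 -> z \in Vp -> br h1 z = 0 ->
  dpe P (e1 + Z) z = c * K Zm z * peval P (e1 + Z).
Proof.
move=> Zp hZ Zmm hZm ZZ zp hz.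
rewrite (hlog (block_inverse_add charF hL hg hb e1p h1e Zp hZ f1m h2f1 fe1 Zmm hZm ZZ) zp).
by rewrite killingDl // (killing_m2p0 charF hL h1f hz) add0r.
Qed.

(* Two polynomials with the same logarithmic derivative along the line        *)
(* through [e2] and [Z].                                                      *)
Let log_line (p q : {poly F}) Z : Z \in Vp -> br h1 Z = 0 -> q.[0] = 1 ->
  (forall t Zm, let Zt := e2 + t *: (Z - e2) in
     Zm \in Vm -> br h1 Zm = 0 -> br Zm Zt = h2 ->
     exists l, p^`().[t] = l * p.[t] /\ q^`().[t] = l * q.[t]) ->
  p.[1] = p.[0] * q.[1].
Proof.
move=> Zp hZ q0 H.
have E : p^`() * q = p * q^`().
  apply/eqP; rewrite -subr_eq0; apply/eqP/(poly_eq0_eval charF).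
  apply: (block_dense Zp hZ); first by exists (p^`() * q - p * q^`()).
  move=> t Zm Zt Zmm hZm ZZ; have [l [pl ql]] := H t Zm Zmm hZm ZZ.
  by rewrite hornerD hornerN !hornerM pl ql; ring.
have := deriv_ratio_const charF E (t0 := 0); rewrite q0 oner_neq0 => /(_ isT) pE.
by rewrite {1}pE hornerZ divr1.
Qed.

(** Both sides have the same logarithmic derivative along the lines from $e_2$. All that is asked of
    [phi] is to carry inverses to inverses compatibly with $K$, which covers automorphisms of the
    whole algebra as well as those of a subalgebra. *)
Lemma block_semi_invariance (phi : V -> V) : linear phi ->
  (forall Z, Z \in Vp -> br h1 Z = 0 -> phi Z \in Vp /\ br h1 (phi Z) = 0) ->
  (forall Z Zm, Z \in Vp -> br h1 Z = 0 -> Zm \in Vm -> br h1 Zm = 0 -> br Zm Z = h2 ->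
     exists y, [/\ y \in Vm, br h1 y = 0, br y (phi Z) = h2
       & forall z, z \in Vp -> br h1 z = 0 -> K y (phi z) = K Zm z]) ->
  forall Z, Z \in Vp -> br h1 Z = 0 ->
    peval P (e1 + phi Z) = peval P (e1 + phi e2) * peval P (e1 + Z).
Proof.
move=> phil phiW phiI Z Zp hZ; set D := Z - e2.
have phiD x y : phi (x + y) = phi x + phi y by have := phil 1 x y; rewrite !scale1r.
have phi0 : phi 0 = 0 by apply: (addrI (phi 0)); rewrite -phiD !addr0.
have phiZ a x : phi (a *: x) = a *: phi x by have := phil a x 0; rewrite phi0 !addr0.
have Dp : D \in Vp by apply: memvB.
have hD : br h1 D = 0 by rewrite (brBr hL) hZ h1e2 subrr.
have [p [pE pD]] := peval_curve P (e1 + phi e2) (phi D) 0.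
have [q [qE qD]] := peval_curve P (e1 + e2) D 0.
have := @log_line p q Z Zp hZ.
rewrite !pE !qE !scaler0 !addr0 !scale0r !addr0 !scale1r Pe -!addrA -phiD !(addrC _ D) subrK.
apply=> // t Zm Zt Zmm hZm ZZ.
have Ztp : Zt \in Vp by apply: memBZ.
have hZt : br h1 Zt = 0 by apply: brBZ.
have [y [ym hy yE yK]] := phiI Zt Zm Ztp hZt Zmm hZm ZZ.
have [pp hp] := phiW Zt Ztp hZt; have [Dp' hD'] := phiW D Dp hD.
exists (c * K Zm D); rewrite pD qD pE qE !scaler0 !addr0 -!addrA -phiZ -phiD -/Zt.
by rewrite (block_log pp hp ym hy yE Dp' hD') yK // (block_log Ztp hZt Zmm hZm ZZ Dp hD).
Qed.

(** For fixed $Y$ invertible in its block, both sides have the same logarithmic derivative in $Z$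
    and agree at $Z=e_2$; the general case follows by density in $Y$. *)
Lemma block_factor Y Z : Y \in Vp -> br h1 Y = 2%:R *: Y -> Z \in Vp -> br h1 Z = 0 ->
  peval P (Y + Z) = peval P (Y + e2) * peval P (e1 + Z).
Proof.
move=> Yp hY Zp hZ.
have inv Y' Xm : Y' \in Vp -> br h1 Y' = 2%:R *: Y' -> gtriple br H0 Xm H0 (e2 + Y') ->
    peval P (Y' + Z) = peval P (Y' + e2) * peval P (e1 + Z).
  move=> Yp' hY' tX.
  have hY2 : br h2 Y' = 0 by rewrite (h2_wt hL hb ((VpP hL _ _) Yp') hY') subrr scale0r.
  have [Ym [Ymm hYm YY]] := block_inverse charF hL hg (blockC hb) tX Yp' hY2.
  have hYm1 : br h1 Ym = - 2%:R *: Ym.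
    by have := (VmP hL _ _) Ymm; rewrite -hh (brDl hL) hYm addr0.
  set D := Z - e2; have Dp : D \in Vp by apply: memvB.
  have hD : br h1 D = 0 by rewrite (brBr hL) hZ h1e2 subrr.
  have [p [pE pD]] := peval_curve P (Y' + e2) D 0.
  have [q [qE qD]] := peval_curve P (e1 + e2) D 0.
  have := @log_line p q Z Zp hZ.
  rewrite !pE !qE !scaler0 !addr0 !scale0r !addr0 !scale1r Pe -!addrA !(addrC _ D) subrK.
  apply=> // t Zm Zt Zmm hZm ZZ.
  have Ztp : Zt \in Vp by apply: memBZ.
  have hZt : br h1 Zt = 0 by apply: brBZ.
  exists (c * K Zm D); rewrite pD qD pE qE !scaler0 !addr0 -!addrA -/Zt.
  rewrite (block_log Ztp hZt Zmm hZm ZZ Dp hD).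
  rewrite (hlog (block_inverse_add charF hL hg hb Yp' hY' Ztp hZt Ymm hYm YY Zmm hZm ZZ) Dp).
  by rewrite killingDl // (killing_m2p0 charF hL hYm1 hD) add0r.
have qe0 : qdet br H0 (f1 + f2) (e1 + e2) != 0 by rewrite (qdet_e charF hL hg ht) oner_neq0.
have ep : e1 + e2 \in Vp by apply: memvD.
set D := Y - e1; have Dp : D \in Vp by apply: memvB.
have hD : br h1 D = 2%:R *: D by rewrite (brBr hL) hY h1e scalerBr.
have [d d0 dinv] := invertible_line charF hL hS hg ht hVp ep Dp qe0.
have [p [pE _]] := peval_curve P (e1 + Z) D 0.
have [q [qE _]] := peval_curve P (e1 + e2) D 0.
have E : p - peval P (e1 + Z) *: q = 0.
  apply: (poly_eq0_dense charF d0) => t /dinv [Xm].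
  rewrite addrAC addrC => tX.
  rewrite hornerD hornerN hornerZ pE qE !scaler0 !addr0 [e1 + Z + _]addrAC [e1 + e2 + _]addrAC.
  rewrite (inv (e1 + t *: D) Xm) ?[_ * peval P (e1 + Z)]mulrC ?subrr //.
    by apply: memvD => //; apply: memvZ.
  by rewrite (brDr hL) (brZr hL) hD h1e; vring.
have := congr1 (fun r : {poly F} => r.[1]) E.
rewrite hornerD hornerN hornerZ pE qE !scaler0 !addr0 !scale1r horner0 [e1 + Z + _]addrAC [e1 + e2 + _]addrAC /D.
by rewrite (addrC e1) subrK => /eqP; rewrite subr_eq0 mulrC => /eqP.
Qed.

End BlockPolynomials.

(* Gauss elimination for the Peirce decomposition: if [P] is irreducible and  *)
(* [D^d P = S . (R o q)], where [sigma] is a section of [q] on which [D] and  *)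
(* [S] are 1, then a factorization of [R] would give one of [P] up to factors *)
(* which are invisible on the section.                                        *)
Lemma irreducible_schur n m (K : fieldType) (P D S : {mpoly K[n]}) (R : {mpoly K[m]})
    (q : m.-tuple {mpoly K[n]}) (sigma : n.-tuple {mpoly K[m]}) d :
  irreducible_elt P -> R != 0 -> R \isn't a GRing.unit ->
  D ^+ d * P = S * (R \mPo q) ->
  P \mPo sigma = R -> (forall i, tnth q i \mPo sigma = 'X_i) ->
  D \mPo sigma = 1 -> S \mPo sigma = 1 -> irreducible_elt R.
Proof.
move=> Pirr R0 Ru E Ps qs Ds Ss; split=> // R1 R2 RE.
have [P0 Pu Pprime] := mpoly_irreducible_prime Pirr.
have rqs (R' : {mpoly K[m]}) : (R' \mPo q) \mPo sigma = R'.
  rewrite comp_mpolyA -[RHS]comp_mpoly_id; congr (_ \mPo _).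
  by apply: eq_from_tnth => i; rewrite !tnth_mktuple.
have unit_of (A B : {mpoly K[m]}) : A * B = 1 -> B \is a GRing.unit.
  by move=> AB; apply/unitrP; exists A; split; rewrite // mulrC.
have half R1' R2' : R = R1' * R2' -> rdvd P (R1' \mPo q) -> R2' \is a GRing.unit.
  move=> RE' [A AE].
  have E' : D ^+ d = S * A * (R2' \mPo q).
    apply: (mulIf P0); rewrite E RE' rmorphM /= AE; ring.
  apply: (unit_of (A \mPo sigma)).
  have := congr1 (comp_mpoly sigma) E'; rewrite rmorphXn !rmorphM /= Ds expr1n Ss rqs.
  by rewrite mul1r => <-.
have [|[A SA]|] := Pprime S (R \mPo q).
- by exists (D ^+ d); rewrite E.
- case/negP: Ru; apply: (unit_of (A \mPo sigma)).
  by rewrite -Ps -rmorphM /= -SA Ss.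
rewrite RE rmorphM /= => /Pprime [h|h]; first by right; apply: half RE h.
by left; apply: half h; rewrite RE mulrC.
Qed.

(** * Inverses of exponentials and nilpotency *)

Section UnipotentExp.
Variables (F : fieldType).
Hypothesis charF : [pchar F] =i pred0.
Variables (V : vectType F) (br : V -> V -> V).
Hypothesis hL : lie_bracket br.

Lemma exp_ad_aut u : ad_nilpotent br u ->
  exists2 g : 'End(V), g =1 exp_ad br u & lie_aut br g.
Proof.
move=> nilu; have brl := lie_linearr hL u.
pose g : {linear V -> V} :=
  HB.pack (exp_ad br u) (GRing.isLinear.Build F V V _ (exp_ad br u) (exp_ad_linear brl)).
exists (linfun g); first by move=> v; rewrite lfunE.
split; last by move=> x y; rewrite !lfunE /= (exp_ad_br charF).
apply/eqP; rewrite -subv0; apply/subvP => x; rewrite memv_ker lfunE memv0 /= => /eqP.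
by move/(exp_ad_inj brl nilu) => ->.
Qed.

Lemma iter_brZ (t : F) u v i : iter i (br (t *: u)) v = t ^+ i *: iter i (br u) v.
Proof.
elim: i => [|i IH]; first by rewrite expr0 scale1r.
by rewrite !iterS IH (brZl hL) (brZr hL) scalerA exprS.
Qed.

Lemma ad_nilpotentZ t u : ad_nilpotent br u -> ad_nilpotent br (t *: u).
Proof. by move=> [m um]; exists m => v; rewrite iter_brZ um scaler0. Qed.

(** [expD_leibniz] for the evaluation of endomorphisms on vectors: right composition with
    $\mathrm{ad}\,u$ and the action of $-u$ cancel, so the derivation induced on the values is 0. *)
Lemma exp_adK u v : ad_nilpotent br u -> exp_ad br u (exp_ad br (- u) v) = v.
Proof.
move=> nilu; have brl := lie_linearr hL; have [m um] := nilu.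
have nilN : ad_nilpotent br (- u) by rewrite -scaleN1r; apply: ad_nilpotentZ.
pose N := (m + \dim {:V})%N.
rewrite (exp_adE (brl u) nilu (N := N)) ?leq_addl // (exp_adE (brl (- u)) nilN (N := N)) ?leq_addl //.
pose W := 'End(V); pose D1 (phi : W) : W := (phi \o adl br u)%VF.
have uN w : iter N (br u) w = 0 by rewrite /N addnC iterD um iter_fix // (br0r hL).
have D1E i phi w : iter i D1 phi w = phi (iter i (br u) w).
  elim: i phi w => // i IH phi w; rewrite iterSr IH /D1 comp_lfunE adlE //.
have D1l : linear D1.
  by move=> a x y; apply/lfunP => w; rewrite !(comp_lfunE, add_lfunE, scale_lfunE).
have E (phi : W) x : (expD D1 N phi : W) (expD (br (- u)) N x) = expD (fun _ => 0) (N + N) (phi x).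
  apply: (@expD_leibniz F charF W V V (fun (phi : W) (x : V) => phi x)).
  - by move=> psi a y z; rewrite linearP.
  - by move=> y a psi chi; rewrite add_lfunE scale_lfunE.
  - by move=> a y z; rewrite scaler0 addr0.
  - by move=> psi y; rewrite comp_lfunE adlE // (brNl hL) linearN addrN.
  - by move=> psi; apply/lfunP => w; rewrite D1E uN linear0 zero_lfunE.
  - by move=> y; rewrite -scaleN1r iter_brZ uN scaler0.
have -> w : expD (br u) N w = (expD D1 N \1%VF : W) w.
  rewrite /expD sum_lfunE; apply: eq_bigr => i _.
  by rewrite scale_lfunE D1E id_lfunE.
rewrite E id_lfunE /expD; have [N0|Npos] := posnP N.
  have V0 (w : V) : w = 0.
    move/eqP: N0; rewrite addn_eq0 => /andP [_ /eqP d0].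
    by apply/eqP; rewrite -memv0; move: (memvf w); have /eqP -> : {:V}%VS == 0%VS by rewrite -dimv_eq0 d0.
  by rewrite (V0 v) big1 // => i _; rewrite -[RHS](V0 (_ *: _)).
rewrite -(prednK (ltn_addr N Npos)) big_ord_recl /= fact0 invr1 scale1r big1 ?addr0 // => i _.
by rewrite scaler0.
Qed.

Section Nilpotency.
Variable H0 f e : V.
Hypotheses (hS : lie_simple br) (hg : grading br H0) (hVp : Vplus br H0 <> 0%VS).
Notation Vp := (Vplus br H0).
Notation Vz := (Vzero br H0).
Notation Vm := (Vminus br H0).

(** Nilpotency passes from $V^+$ to $V^-$ by duality under $K$, and to $V_0=[V^-,V^+]$ by the
    Leibniz rule. *)
Lemma ad_nilpotent_of_Vp u m : u \in Vz ->
  (forall x, x \in Vp -> iter m (br u) x = 0) -> ad_nilpotent br u.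
Proof.
move=> uz nilp.
have itz i : forall x, x \in Vp -> iter i (br u) x \in Vp.
  by elim: i => // i IH x xp; rewrite iterS; apply: (br_zp hL uz); apply: IH.
have itm i : forall y, y \in Vm -> iter i (br u) y \in Vm.
  by elim: i => // i IH x xp; rewrite iterS; apply: (br_zm hL uz); apply: IH.
have it0 i : iter i (br u) 0 = 0 by elim: i => // i IH; rewrite iterS IH (br0r hL).
have itD i x y : iter i (br u) (x + y) = iter i (br u) x + iter i (br u) y.
  by elim: i => // i IH; rewrite !iterS IH (brDr hL).
have itK i : forall x y, killing br (iter i (br u) y) x = (-1) ^+ i * killing br y (iter i (br u) x).
  elim: i => [|i IH] x y; first by rewrite mul1r.
  rewrite iterS (brC hL) killingNl // killing_br // IH -iterSr exprS mulN1r mulNr.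
  by [].
have nilm y : y \in Vm -> iter m (br u) y = 0.
  move=> ym; apply: (killing_nondeg_m charF hL hS hg hVp (itm _ _ ym)) => x xp.
  by rewrite itK nilp // killing0r // mulr0.
have itbr n : forall i j y x, (i + j = n)%N -> iter i (br u) y = 0 -> iter j (br u) x = 0 ->
    iter n (br u) (br y x) = 0.
  elim: n => [|n IH] i j y x.
    move=> /eqP; rewrite addn_eq0 => /andP [/eqP -> /eqP ->] /= -> _; by rewrite /= (br0l hL).
  move=> ijE iy jx; rewrite iterSr (brA hL u) itD.
  case: i ijE iy => [|i] ijE iy; first by rewrite /= in iy; rewrite iy !(br0r hL, br0l hL) it0 addr0.
  case: j ijE jx => [|j] ijE jx; first by rewrite /= in jx; rewrite jx !(br0r hL) it0 addr0.
  rewrite (IH i j.+1) ?(IH i.+1 j) ?addr0 //; try by rewrite -iterSr.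
  - by move: ijE; rewrite addnS => -[].
  - by move: ijE; rewrite addSn => -[].
have nilz w : w \in Vz -> iter (m + m) (br u) w = 0.
  move=> /(Vz_generated charF hL hS hg hVp) /(@coord_span _ _ _ (in_tuple _)) ->.
  apply: (big_ind (fun v => iter (m + m) (br u) v = 0)) => // [x y hx hy|i _].
    by rewrite itD hx hy addr0.
  have itZ k c v : iter k (br u) (c *: v) = c *: iter k (br u) v.
    by elim: k => // k IH; rewrite !iterS IH (brZr hL).
  rewrite itZ; have := mem_nth 0 (ltn_ord i) => /allpairsP [[y z] /= [/vbasis_mem yU /vbasis_mem zU ->]].
  by rewrite /= (itbr _ m m _ _ erefl (nilm _ yU) (nilp _ zU)) scaler0.
exists (m + m)%N => v; have [a [z [p [aa zz pp ->]]]] := grade_dec charF hL hg v.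
by rewrite !itD (nilz z zz) !iterD (nilp p pp) (nilm a aa) !it0 !addr0.
Qed.

End Nilpotency.
End UnipotentExp.

Lemma avec_poly_id (F : fieldType) (V : vectType F) (U : {vspace V}) :
  avec (poly_on U) (fun X => X).
Proof.
move=> i; exists (\sum_(j < \dim U) coord (vbasis {:V}) i (vbasis U)`_j *: 'X_j) => X XU.
rewrite {1}(coord_vbasis XU) linear_sum /peval rmorph_sum; apply: eq_bigr => j _ /=.
by rewrite linearZ mevalZ mevalXU mulrC.
Qed.

(** * Semi-invariance, unipotent invariance and homogeneity *)

Section GradedPolynomials.
Variables (F : fieldType).
Hypothesis charF : [pchar F] =i pred0.
Variables (V : vectType F) (br : V -> V -> V).
Hypotheses (hL : lie_bracket br) (hS : lie_simple br).

Let nz n : n.+1%:R != 0 :> F. Proof. exact (natSf_neq0 charF n). Qed.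

Variables (H0 : V).
Hypotheses (hg : grading br H0) (hVp : Vplus br H0 <> 0%VS).
Notation Vp := (Vplus br H0).
Notation Vz := (Vzero br H0).
Notation Vm := (Vminus br H0).
Notation K := (killing br).

Variables (U : {vspace V}) (hU : U = Vp) (P : {mpoly F[\dim U]}) (c : F).
Hypothesis hlog : forall X Y z, gtriple br H0 Y H0 X -> z \in Vp ->
  dpe P X z = c * K Y z * peval P X.

Section Whole.
Variables (f e : V).
Hypotheses (ht : gtriple br H0 f H0 e) (Pe : peval P e = 1).

Lemma aut_semi_invariance (g : 'End(V)) X : lie_aut br g -> g H0 = H0 -> X \in Vp ->
  peval P (g X) = peval P (g e) * peval P X.
Proof.
move=> hga gH Xp; have [_ gbr] := hga.
have gp x : x \in Vp -> g x \in Vp.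
  by move=> /(VpP hL) hx; apply/(VpP hL); rewrite -{1}gH -gbr hx linearZ.
have gm x : x \in Vm -> g x \in Vm.
  by move=> /(VmP hL) hx; apply/(VmP hL); rewrite -{1}gH -gbr hx linearZ.
have := block_semi_invariance charF hL hS hg hVp hlog (block0 hL ht) _ (phi := g).
rewrite !add0r => /(_ Pe) H; have := H _ _ _ X Xp (br0l hL _); rewrite !add0r; apply.
- by move=> a x y; rewrite linearP.
- by move=> Z Zp _; rewrite (br0l hL); split=> //; apply: gp.
- move=> Z Zm Zp _ Zmm _ ZZ; exists (g Zm); split=> //; first exact: gm.
  + by rewrite (br0l hL).
  + by rewrite -gbr ZZ gH.
  + by move=> z _ _; rewrite killing_aut.
Qed.

(** $p(t)=P(e^{t\,\mathrm{ad}\,u}e)$ is polynomial in $t$ by nilpotency, and semi-invariance gives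
    $p(t)p(-t)=1$, so $p$ is the constant $p(0)=1$. *)
Lemma unipotent_invariance u m X : u \in Vz ->
  (forall x, x \in Vp -> iter m (br u) x = 0) -> X \in Vp ->
  peval P (exp_ad br u X) = peval P X.
Proof.
move=> uz unil Xp; have nilu := ad_nilpotent_of_Vp charF hL hS hg hVp uz unil.
have ep : e \in Vp by case: ht.
have expp t x : x \in Vp -> exp_ad br (t *: u) x \in Vp.
  move=> xp; apply: memv_suml => i _; apply: memvZ; rewrite iter_brZ //; apply: memvZ.
  by elim: (nat_of_ord i) => // k IH; rewrite iterS; apply: (br_zp hL uz).
have semi t x : x \in Vp ->
    peval P (exp_ad br (t *: u) x) = peval P (exp_ad br (t *: u) e) * peval P x.
  move=> xp; have niltu := ad_nilpotentZ hL t nilu.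
  have [g gE hga] := exp_ad_aut charF hL niltu.
  rewrite -!gE; apply: aut_semi_invariance => //; rewrite gE.
  rewrite /exp_ad (bigD1 ord0) //= fact0 invr1 scale1r big1 ?addr0 // => i i0.
  have -> : nat_of_ord i = i.-1.+1 by case: i i0 => -[].
  have it0 n : iter n (br (t *: u)) 0 = 0 by elim: n => // n IH; rewrite iterS IH (br0r hL).
  by rewrite iterSr (brZl hL) (brC hL) ((VzP hL _ _) uz) oppr0 scaler0 it0 scaler0.
have [p pE] : upoly (fun t => peval P (exp_ad br (t *: u) e)).
  apply: (avec_peval (upoly_alg F)); apply: (avec_sum (upoly_alg F)) => i _.
  apply: (avec_scale (upoly_alg F)); first exact: (fa_cst (upoly_alg F)).
  apply: (avec_ext (upoly_alg F) (x := fun t => t ^+ i *: iter i (br u) e)).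
    by move=> t; rewrite iter_brZ.
  apply: (avec_scale (upoly_alg F)); last exact: (avec_cst (upoly_alg F)).
  exact: (fa_exp (upoly_alg F) _ (upoly_id F)).
have pp : p * (p \Po (- 'X)) = 1.
  apply/eqP; rewrite -subr_eq0; apply/eqP/(poly_eq0_eval charF) => t.
  rewrite hornerD hornerN hornerC hornerM horner_comp hornerN hornerX -!pE -semi ?expp //.
  rewrite scaleNr exp_adK ?Pe ?subrr //; exact: ad_nilpotentZ.
have p1 : size p = 1%N.
  have := congr1 (fun r : {poly F} => r \is a GRing.unit) pp.
  by rewrite unitrM unitr1 poly_unitE => /andP [/andP [/eqP]].
have /size_poly1P [a a0 pa] : size p == 1%N by rewrite p1.
have := semi 1 X Xp; rewrite scale1r => ->.
have := pE 0; rewrite scale0r pa hornerC.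
have -> : exp_ad br 0 e = e.
  rewrite /exp_ad (bigD1 ord0) //= fact0 invr1 scale1r big1 ?addr0 // => i i0.
  have -> : nat_of_ord i = i.-1.+1 by case: i i0 => -[].
  by rewrite iterS (br0l hL) scaler0.
by rewrite Pe => a1; have := pE 1; rewrite scale1r pa hornerC -a1 => ->; rewrite mul1r.
Qed.

End Whole.

Section Block.
Variables (f1 h1 e1 f2 h2 e2 : V).
Hypothesis hb : block br H0 f1 h1 e1 f2 h2 e2.
Hypothesis Pe : peval P (e1 + e2) = 1.

Let t1 : gtriple br H0 f1 h1 e1. Proof. by case: hb. Qed.
Let t2 : gtriple br H0 f2 h2 e2. Proof. by case: hb. Qed.
Let hh : h1 + h2 = H0. Proof. by case: hb. Qed.
Let f1m : f1 \in Vm. Proof. by case: t1. Qed.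
Let f2m : f2 \in Vm. Proof. by case: t2. Qed.
Let e1p : e1 \in Vp. Proof. by case: t1. Qed.
Let e2p : e2 \in Vp. Proof. by case: t2. Qed.
Let h1e : br h1 e1 = 2%:R *: e1. Proof. by case: t1 => _ _ []. Qed.
Let h1f : br h1 f1 = - 2%:R *: f1. Proof. by case: t1 => _ _ []. Qed.
Let fe1 : br f1 e1 = h1. Proof. by case: t1 => _ _ []. Qed.
Let fe2 : br f2 e2 = h2. Proof. by case: t2 => _ _ []. Qed.
Let h2e : br h2 e2 = 2%:R *: e2. Proof. by case: t2 => _ _ []. Qed.
Let h1e2 := block_h1e2 charF hL hg hb.
Let h1f2 := block_h1f2 charF hL hg hb.
Let ht := block_gtriple hL hb.

(** At an invertible $Z$ the logarithmic derivative in the direction $Z$ is $c\,K(Z_m,Z)$, and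
    $K(h_2,h_2)=K([h_2,Z_m],Z)=-2K(Z_m,Z)$ does not depend on $Z$. *)
Lemma block_euler Z : Z \in Vp -> br h1 Z = 0 ->
  dpe P (e1 + Z) Z = - (c * K h2 h2 / 2%:R) * peval P (e1 + Z).
Proof.
move=> Zp hZ; set m := - _; pose D := Z - e2.
have [p [pE _]] := dpe_curve P (e1 + e2) D e2 D.
have [q [qE _]] := peval_curve P (e1 + e2) D 0.
have H := @block_dense _ charF _ _ hL hS _ hg hVp _ _ _ _ _ _ hb (fun t => (p - m *: q).[t]) Z Zp hZ.
suff E : forall t, (p - m *: q).[t] = 0.
  have := E 1; rewrite hornerD hornerN hornerZ pE qE scaler0 !addr0 !scale1r.
  have -> : e1 + e2 + D = e1 + Z by rewrite -addrA [e2 + D]addrC subrK.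
  by rewrite [e2 + D]addrC subrK => /eqP; rewrite subr_eq0 => /eqP.
apply: H; first by exists (p - m *: q).
move=> t Zm; rewrite /= -/D.
set Zt := e2 + _ => Zmm hZm ZZ.
rewrite hornerD hornerN hornerZ pE qE scaler0 !addr0 -!addrA -/Zt.
have Dp : D \in Vp by apply: memvB.
have hD : br h1 D = 0 by rewrite (brBr hL) hZ h1e2 subrr.
have Ztp : Zt \in Vp by apply: memvD => //; apply: memvZ.
have hZt : br h1 Zt = 0 by rewrite (brDr hL) (brZr hL) hD h1e2 scaler0 addr0.
rewrite (block_log charF hL hg hlog hb Ztp hZt Zmm hZm ZZ Ztp hZt).
have hZm2 : br h2 Zm = - 2%:R *: Zm.
  have hZm0 : br h1 Zm = 0 *: Zm by rewrite scale0r.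
  by rewrite (h2_wt hL hb ((VmP hL _ _) Zmm) hZm0) subr0.
rewrite /m; have -> : K h2 h2 = - 2%:R * K Zm Zt by rewrite -{2}ZZ -killing_br // hZm2 killingZl.
by field; rewrite ?nz.
Qed.

(** Euler's equation holds on every line $e_1+tZ$. The line through $e_2$, where $P$ is not
    identically 0, shows that the constant is a natural number. *)
Lemma block_homog : exists2 d : nat, - (c * K h2 h2 / 2%:R) = d%:R &
  forall t Z, Z \in Vp -> br h1 Z = 0 ->
    peval P (e1 + t *: Z) = t ^+ d * peval P (e1 + Z).
Proof.
have curve Z : Z \in Vp -> br h1 Z = 0 -> exists p : {poly F},
    (forall t, p.[t] = peval P (e1 + t *: Z)) /\
    'X * p^`() = - (c * K h2 h2 / 2%:R) *: p.
  move=> Zp hZ; have [p [pE pD]] := peval_curve P e1 Z 0; exists p; split.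
    by move=> t; rewrite pE scaler0 addr0.
  apply/eqP; rewrite -subr_eq0; apply/eqP/(poly_eq0_eval charF) => t.
  rewrite hornerD hornerN hornerM hornerX hornerZ pE pD !scaler0 !addr0 -dpeZ.
  by rewrite block_euler ?subrr ?memvZ // (brZr hL) hZ scaler0.
have [p [pE pX]] := curve e2 e2p h1e2.
have p0 : p != 0.
  apply: contra_neq (oner_neq0 F) => p0; rewrite -Pe -[e2]scale1r -pE p0 horner0 //.
have [d dE] := euler_monomial pX p0.
exists d => // t Z Zp hZ; have [q [qE qX]] := curve Z Zp hZ.
rewrite dE in qX; have := euler_eval charF qX t.
by rewrite !qE scale1r.
Qed.

(** In degree 0 the restriction is constant, so its derivative at $e_2$ makes $f_2$ orthogonal to
    the weight 0 space, hence to $V^+$; then $f_2=0$, $h_2=0$ and $e_2=0$. *)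
Lemma block_degree_gt0 d : c != 0 -> e2 != 0 ->
  (forall t Z, Z \in Vp -> br h1 Z = 0 ->
    peval P (e1 + t *: Z) = t ^+ d * peval P (e1 + Z)) -> (0 < d)%N.
Proof.
move=> c0 e20 hd; rewrite lt0n; apply: contraNneq e20 => d0.
have cst Z : Z \in Vp -> br h1 Z = 0 -> peval P (e1 + Z) = 1.
  move=> Zp hZ; have := hd 0 Z Zp hZ; rewrite d0 expr0 mul1r scale0r addr0 => <-.
  by have := hd 0 e2 e2p h1e2; rewrite d0 expr0 mul1r scale0r addr0 Pe.
have f2z Z : Z \in Vp -> br h1 Z = 0 -> K f2 Z = 0.
  move=> Zp hZ; have := block_log charF hL hg hlog hb e2p h1e2 f2m h1f2 fe2 Zp hZ.
  rewrite Pe mulr1 => E; apply: (mulfI c0); rewrite mulr0 -E.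
  have [p [pE pD]] := peval_curve P (e1 + e2) Z 0.
  have p1 : p = 1.
    apply/eqP; rewrite -subr_eq0; apply/eqP/(poly_eq0_eval charF) => t.
    rewrite hornerD hornerN hornerC pE scaler0 addr0 -addrA cst ?subrr //.
      by apply: memvD => //; apply: memvZ.
    by rewrite (brDr hL) (brZr hL) hZ h1e2 scaler0 addr0.
  by have := pD 0; rewrite p1 derivC horner0 !scale0r !scaler0 !addr0.
have f20 : f2 = 0.
  apply: (killing_nondeg_m charF hL hS hg hVp f2m) => x xp.
  have := peirce_wt charF hL hg t1 xp; have := peirce_mem hL t1 xp.
  have := peirce_sum charF br h1 x.
  move: (peirce0 _ _ _) (peirce1 _ _ _) (peirce2 _ _ _) => x0 x1 x2 -> [m0 _ _] [w0 w1 w2].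
  have hf2 : br h1 f2 = 0 *: f2 by rewrite scale0r.
  have w1' : br h1 x1 = 1 *: x1 by rewrite scale1r.
  rewrite !(killingDr hL) (f2z _ m0 w0) (killing_eigen hL hf2 w1') ?add0r ?oner_neq0 //.
  by rewrite (killing_eigen hL hf2 w2) ?add0r ?nz.
have h20 : h2 = 0 by rewrite -fe2 f20 (br0l hL).
by move: h2e; rewrite h20 (br0l hL) => /esym/eqP; rewrite scaler_eq0 (negPf (nz 1)).
Qed.

(** With $c=0$ all derivatives at invertible points vanish, and $P$ would be constant. *)
Lemma block_chi_neq0 : irreducible_elt P -> c != 0.
Proof.
move=> [P0 Pu _]; apply/eqP => c0; case/negP: Pu.
have ep : e1 + e2 \in Vp by apply: memvD.
suff PE : P = 1%:MP by rewrite PE mpolyC1 unitr1.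
apply: (peval_ext charF) => x xU; have xp : x \in Vp by rewrite -hU.
rewrite {2}/peval mevalC.
have qe0 : qdet br H0 (f1 + f2) (e1 + e2) != 0 by rewrite (qdet_e charF hL hg ht) oner_neq0.
have Dp : x - (e1 + e2) \in Vp by apply: memvB.
have [d d0 dinv] := invertible_line charF hL hS hg ht hVp ep Dp qe0.
have [p [pE pD]] := peval_curve P (e1 + e2) (x - (e1 + e2)) 0.
have p'0 : p^`() = 0.
  apply: (poly_eq0_dense charF d0) => t /dinv [Y tY].
  by rewrite pD !scaler0 !addr0 (hlog tY Dp) c0 !mul0r.
have := deriv_ratio_const charF (p := p) (q := 1) (t0 := 0).
rewrite p'0 mul0r derivC mulr0 hornerC oner_neq0 => /(_ erefl isT).
rewrite pE scale0r scaler0 !addr0 Pe divr1 scale1r => p1.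
by have := pE 1; rewrite p1 hornerC scale1r scaler0 addr0 addrC subrK.
Qed.

Variables (U2 : {vspace V}) (hU2 : forall Z, (Z \in U2) = (Z \in Vp) && (br h1 Z == 0)).

Lemma block_poly : exists R : {mpoly F[\dim U2]},
  forall Z, Z \in U2 -> peval R Z = peval P (e1 + Z).
Proof.
have [R RE] : poly_on U2 (fun Z => peval P (e1 + Z)).
  apply: (avec_peval (poly_on_alg U2)); apply: (avec_add (poly_on_alg U2)).
    exact: (avec_cst (poly_on_alg U2)).
  exact: avec_poly_id.
by exists R => Z ZU; rewrite RE.
Qed.

End Block.
End GradedPolynomials.

Lemma map_mpoly_comp_mpoly n m (K L : fieldType) (f : {rmorphism K -> L})
    (p : {mpoly K[n]}) (q : n.-tuple {mpoly K[m]}) :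
  map_mpoly f (p \mPo q) = map_mpoly f p \mPo [tuple map_mpoly f (tnth q i) | i < n].
Proof.
elim/mpoly_alg_ind: p => [c|i|p1 p2 IH1 IH2|p1 p2 IH1 IH2].
- by rewrite map_mpolyC !comp_mpolyC map_mpolyC.
- by rewrite map_mpolyX !comp_mpolyXU -!tnth_nth tnth_mktuple.
- by rewrite !rmorphD /= IH1 IH2.
- by rewrite !rmorphM /= IH1 IH2.
Qed.

Lemma avec_subst (F : fieldType) (V : vectType F) (U W : {vspace V}) (q : V -> V) :
  avec (poly_on U) q -> exists tau : (\dim W).-tuple {mpoly F[\dim U]},
    (forall x i, x \in U -> peval (tnth tau i) x = coord (vbasis W) i (q x)) /\
    (forall x (R : {mpoly F[\dim W]}), x \in U -> peval (R \mPo tau) x = peval R (q x)).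
Proof.
move=> Aq.
have /fin_all_exists [t tE] i := avec_scalar (poly_on_alg U) (coord (vbasis W) i) Aq.
exists [tuple t i | i < \dim W]; have tE' x i : x \in U ->
    peval (tnth [tuple t i | i < \dim W] i) x = coord (vbasis W) i (q x).
  by move=> xU; rewrite tnth_mktuple tE.
split=> // x R xU; rewrite /peval comp_mpoly_meval; apply: meval_eq => i.
exact: tE'.
Qed.

Lemma msize_peval_homog (F : fieldType) (V : vectType F) (U : {vspace V})
    (R : {mpoly F[\dim U]}) d : [pchar F] =i pred0 -> R != 0 ->
  (forall t Z, Z \in U -> peval R (t *: Z) = t ^+ d * peval R Z) -> msize R = d.+1.
Proof.
move=> charF R0 H; apply: (msize_homog charF R0) => t v; pose Z := \sum_i v i *: (vbasis U)`_i.
have ZU : Z \in U.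
  by apply: memv_suml => i _; rewrite memvZ //; apply/vbasis_mem/mem_nth; rewrite size_tuple.
have cZ i : coord (vbasis U) i Z = v i by rewrite coord_sum_free // (basis_free (vbasisP U)).
have -> : R.@[fun i => t * v i] = R.@[fun i => coord (vbasis U) i (t *: Z)].
  by apply: meval_eq => i; rewrite linearZ /= cZ.
by have := H t Z ZU; rewrite /peval => ->; congr (_ * _); apply: meval_eq => i; rewrite cZ.
Qed.

Lemma exp_ad_cube0 (F : fieldType) (V : vectType F) (br : V -> V -> V) u v :
  lie_bracket br -> ad_nilpotent br u -> br u (br u (br u v)) = 0 ->
  exp_ad br u v = v + br u v + 2%:R^-1 *: br u (br u v).
Proof.
move=> hL nilu uv; have brl := lie_linearr hL u.
rewrite (exp_adE brl nilu (N := (3 + \dim {:V})%N)) ?leq_addl //.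
rewrite /expD big_split_ord /= [X in _ + X]big1 ?addr0 => [|i _]; last first.
  have it0 n : iter n (br u) 0 = 0 by elim: n => // n IH; rewrite iterS IH (br0r hL).
  by have /= E := iterD i 3 (br u) v; rewrite addn3 /= uv it0 in E; rewrite E scaler0.
by rewrite !big_ord_recr big_ord0 /= add0r !invr1 !scale1r.
Qed.

(** * Unipotent elimination of the weight 1 component *)

Section PeirceHalf.
Variables (F : fieldType).
Hypothesis charF : [pchar F] =i pred0.
Variables (V : vectType F) (br : V -> V -> V).
Hypotheses (hL : lie_bracket br) (hS : lie_simple br).

Let nz n : n.+1%:R != 0 :> F. Proof. exact (natSf_neq0 charF n). Qed.

Variables (H0 f h e : V).
Hypotheses (hg : grading br H0) (hVp : Vplus br H0 <> 0%VS) (ht : gtriple br H0 f h e).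
Notation Vp := (Vplus br H0).
Notation Vz := (Vzero br H0).

Definition half_space : {vspace V} := (Vp :&: ad_eigen br h 1)%VS.
(** The Jordan multiplication by $Y$ on the weight 1 space, up to normalisation: it is the identity
    for $Y=e$, so its determinant is not identically 0. *)
Definition half_op (Y : V) : 'End(V) := (- (adl br Y \o adl br f))%VF.

Let ep : e \in Vp. Proof. by case: ht. Qed.
Let fm : f \in Vminus br H0. Proof. by case: ht. Qed.
Let he : br h e = 2%:R *: e. Proof. by case: ht => _ _ []. Qed.
Let hf : br h f = - 2%:R *: f. Proof. by case: ht => _ _ []. Qed.
Let fe : br f e = h. Proof. by case: ht => _ _ []. Qed.

Lemma half_opE Y W : half_op Y W = br (br f W) Y.
Proof. by rewrite opp_lfunE comp_lfunE !adlE // -(brC hL). Qed.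

Lemma half_spaceP W : reflect (W \in Vp /\ br h W = W) (W \in half_space).
Proof.
rewrite memv_cap; apply: (iffP andP) => -[-> hW]; split=> //.
  by have /(ad_eigenP hL) := hW; rewrite scale1r.
by apply/(ad_eigenP hL); rewrite scale1r.
Qed.

Lemma half_wt W : br h W = W -> br h (br f W) = - br f W.
Proof.
move=> hW; rewrite (brA hL) hf hW (brZl hL) -{2}[br f W]scale1r -scalerDl -scaleN1r.
by congr (_ *: _); ring.
Qed.

Lemma half_op_mem Y W : Y \in Vp -> br h Y = 2%:R *: Y -> W \in half_space ->
  half_op Y W \in half_space.
Proof.
move=> Yp hY /half_spaceP [Wp hW]; rewrite half_opE; apply/half_spaceP; split.
  by apply: (br_zp hL) => //; apply: (br_mp hL).
rewrite (brA hL) half_wt // hY (brNl hL) (brZr hL) -{3}[br (br f W) Y]scale1r -scaleN1r -scalerDl.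
by congr (_ *: _); ring.
Qed.

Lemma half_op_e W : W \in half_space -> half_op e W = W.
Proof.
move=> /half_spaceP [Wp hW]; rewrite half_opE; have := brA hL f e W.
rewrite (br_pp charF hL hg ep Wp) (br0r hL) fe hW => /esym/eqP.
by rewrite addr_eq0 (brC hL e) opprK => /eqP.
Qed.

(* If [M = half_op x2] is invertible, then [u = [f, M^-1 x1]] has weight -1   *)
(* and [exp_ad u] maps [x2] to [x2 + x1] modulo weight 0.                     *)
Lemma half_exp x2 x1 x0 : x2 \in Vp -> br h x2 = 2%:R *: x2 -> x1 \in Vp -> br h x1 = x1 ->
  x0 \in Vp -> br h x0 = 0 -> detU half_space (half_op x2) != 0 ->
  let u := (detU half_space (half_op x2))^-1 *: br f (adjU half_space (half_op x2) x1) in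
  [/\ u \in Vz, ad_nilpotent br u, forall x, x \in Vp -> iter 3 (br u) x = 0,
      br u x1 \in Vp /\ br h (br u x1) = 0
    & exp_ad br u (x2 + x0) = x2 + x1 + x0 + 2%:R^-1 *: br u x1].
Proof.
move=> m2 w2 m1 w1 m0 w0; set Dx := detU _ _ => D0; set a := adjU _ _ _ => u.
have x1U : x1 \in half_space by apply/half_spaceP.
have Ma : half_op x2 a = Dx *: x1 by apply: adjUK => // v; apply: half_op_mem.
have [ap ha] : a \in Vp /\ br h a = a by apply/half_spaceP/mem_adjU.
have uz : u \in Vz by apply: memvZ; apply: (br_mp hL).
have hu : br h u = - u by rewrite (brZr hL) half_wt // scalerN.
have ux2 : br u x2 = x1.
  by rewrite (brZl hL) -half_opE Ma scalerA mulVf // scale1r.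
have uwt b x' : br h x' = b *: x' -> br h (br u x') = (b - 1) *: br u x'.
  by move=> hx'; rewrite (brA hL) hu hx' (brNl hL) (brZr hL) scalerBl scale1r addrC.
have uzp x' : x' \in Vp -> br u x' \in Vp by apply: (br_zp hL uz).
have ux0 x' : x' \in Vp -> br h x' = 0 -> br u x' = 0.
  move=> xp' hx'; have := uwt 0 x'; rewrite scale0r => /(_ hx') hux'.
  apply: (wt_p charF hL hg ht (uzp _ xp') hux').
  by rewrite (_ : _ * _ = - 6%:R) ?oppr_eq0 ?nz //; ring.
have uux1 x' : x' \in Vp -> br h x' = x' -> br h (br u x') = 0.
  by move=> xp' hx'; rewrite (uwt 1) ?scale1r // subrr scale0r.
have cub x' : x' \in Vp -> iter 3 (br u) x' = 0.
  move=> xp'; have := peirce_wt charF hL hg ht xp'; have := peirce_mem hL ht xp'.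
  have := peirce_sum charF br h x'.
  move: (peirce0 _ _ _) (peirce1 _ _ _) (peirce2 _ _ _) => y0 y1 y2 -> [n0 n1 n2] [v0 v1 v2].
  rewrite /= !(brDr hL) (ux0 y0) // !(br0r hL) addr0 (ux0 (br u y1)) ?uzp ?uux1 // !(br0r hL) addr0.
  apply: (ux0); first by rewrite !uzp.
  apply: (uux1); first exact: uzp.
  by rewrite (uwt 2%:R y2 v2) -[RHS]scale1r; congr (_ *: _); ring.
have nilu := ad_nilpotent_of_Vp charF hL hS hg hVp uz cub.
split=> //; first by split; [apply: uzp|apply: uux1].
rewrite (exp_ad_cube0 hL nilu); last exact/cub/memvD.
rewrite (brDr hL) ux2 (ux0 x0) // addr0.
by move: (2%:R^-1 *: br u x1) => w; vring.
Qed.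

End PeirceHalf.

(** * Irreducibility of the restriction to a block *)

Section BlockIrreducible.
Variables (F : fieldType).
Hypothesis charF : [pchar F] =i pred0.
Variables (V : vectType F) (br : V -> V -> V).
Hypotheses (hL : lie_bracket br) (hS : lie_simple br).

Let nz n : n.+1%:R != 0 :> F. Proof. exact (natSf_neq0 charF n). Qed.

Variables (H0 : V).
Hypotheses (hg : grading br H0) (hVp : Vplus br H0 <> 0%VS).
Notation Vp := (Vplus br H0).
Notation Vz := (Vzero br H0).
Notation Vm := (Vminus br H0).
Notation K := (killing br).

Variables (U : {vspace V}) (hU : U = Vp) (P : {mpoly F[\dim U]}) (c : F).
Hypothesis hlog : forall X Y z, gtriple br H0 Y H0 X -> z \in Vp ->
  dpe P X z = c * K Y z * peval P X.

Variables (f1 h1 e1 f2 h2 e2 : V).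
Hypothesis hb : block br H0 f1 h1 e1 f2 h2 e2.
Hypothesis Pe : peval P (e1 + e2) = 1.

Let t1 : gtriple br H0 f1 h1 e1. Proof. by case: hb. Qed.
Let t2 : gtriple br H0 f2 h2 e2. Proof. by case: hb. Qed.
Let f1m : f1 \in Vm. Proof. by case: t1. Qed.
Let e1p : e1 \in Vp. Proof. by case: t1. Qed.
Let e2p : e2 \in Vp. Proof. by case: t2. Qed.
Let h1e : br h1 e1 = 2%:R *: e1. Proof. by case: t1 => _ _ []. Qed.
Let h1f : br h1 f1 = - 2%:R *: f1. Proof. by case: t1 => _ _ []. Qed.
Let fe1 : br f1 e1 = h1. Proof. by case: t1 => _ _ []. Qed.
Let h1e2 := block_h1e2 charF hL hg hb.
Let ht := block_gtriple hL hb.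

Notation U1 := (half_space br H0 h1).
Notation M := (half_op br f1).

Let D (x : V) := detU U1 (M (peirce2 br h1 x)).
(** The Schur complement $x_0-\frac12[u,x_1]$ of $x$, with $u=[f_1,M^{-1}x_1]$, multiplied by the
    determinant [D] to be polynomial. *)
Let q (x : V) := D x *: peirce0 br h1 x
  - 2%:R^-1 *: br (br f1 (adjU U1 (M (peirce2 br h1 x)) (peirce1 br h1 x))) (peirce1 br h1 x).

Let decomp x : x \in Vp -> exists x2 x1 x0,
  [/\ [/\ x2 \in Vp, x1 \in Vp & x0 \in Vp],
      [/\ br h1 x2 = 2%:R *: x2, br h1 x1 = x1 & br h1 x0 = 0],
      x = x2 + x1 + x0, D x = detU U1 (M x2) /\ peirce2 br h1 x = x2 &
      q x = D x *: x0 - 2%:R^-1 *: br (br f1 (adjU U1 (M x2) x1)) x1].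
Proof.
move=> xp; have [w0 w1 w2] := peirce_wt charF hL hg t1 xp.
have [m0 m1 m2] := peirce_mem hL t1 xp.
by exists (peirce2 br h1 x), (peirce1 br h1 x), (peirce0 br h1 x); split; rewrite -?peirce_sum.
Qed.

(** Where $D(x)\ne0$, the unipotent of [half_exp] carries $x_2+q(x)/D(x)$ to $x$. Invariance under
    it, [block_factor] and homogeneity of degree $d$ give the identity. *)
Let schur_eq d x : (forall t Z, Z \in Vp -> br h1 Z = 0 ->
    peval P (e1 + t *: Z) = t ^+ d * peval P (e1 + Z)) ->
  x \in Vp -> D x != 0 ->
  D x ^+ d * peval P x = peval P (peirce2 br h1 x + e2) * peval P (e1 + q x).
Proof.
move=> hd xp; have [x2 [x1 [x0 [[m2 m1 m0] [w2 w1 w0] xE [-> ->] ->]]]] := decomp xp.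
move=> D0; have [_ _ _ [m0' w0'] _] := half_exp charF hL hS hg hVp t1 m2 w2 m1 w1 m0 w0 D0.
set u := _ *: _ in m0' w0'; pose x0' := x0 - 2%:R^-1 *: br u x1.
have m0'' : x0' \in Vp by apply: memvB => //; apply: memvZ.
have w0'' : br h1 x0' = 0 by rewrite (brBr hL) (brZr hL) w0 w0' scaler0 subrr.
have [uz nilu cub _ E] := half_exp charF hL hS hg hVp t1 m2 w2 m1 w1 m0'' w0'' D0.
rewrite -/u in uz nilu cub E.
have {}E : exp_ad br u (x2 + x0') = x.
  by rewrite E xE /x0'; move: (2%:R^-1 *: br u x1) => w; vring.
have xp2 : x2 + x0' \in Vp by apply: memvD.
rewrite -E (unipotent_invariance charF hL hS hg hVp hlog ht Pe uz cub xp2).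
rewrite (block_factor charF hL hS hg hVp hlog hb Pe m2 w2 m0'' w0'').
rewrite mulrCA -hd //; congr (_ * peval P (_ + _)).
by rewrite /x0' scalerBr; congr (_ - _); rewrite /u (brZl hL) !scalerA mulrAC mulfV // mul1r.
Qed.

Variables (U2 : {vspace V}) (hU2 : forall Z, (Z \in U2) = (Z \in Vp) && (br h1 Z == 0)).
Variables (R : {mpoly F[\dim U2]}).
Hypothesis RE : forall Z, Z \in U2 -> peval R Z = peval P (e1 + Z).

Let q_U2 x : x \in Vp -> q x \in U2.
Proof.
move=> xp; have [x2 [x1 [x0 [[m2 m1 m0] [w2 w1 w0] _ [-> _] ->]]]] := decomp xp.
set a := adjU _ _ _; have [ap ha] : a \in Vp /\ br h1 a = a by apply/(half_spaceP hL)/mem_adjU.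
have f1az : br f1 a \in Vz by apply: (br_mp hL).
move: (D x) a f1az ap ha => Dx a f1az ap ha; rewrite hU2; apply/andP; split.
  by apply: memvB; apply: memvZ => //; apply: (br_zp hL).
apply/eqP; rewrite (brBr hL) !(brZr hL) w0 (brA hL) (half_wt hL t1) // w1 (brNl hL) addNr.
by rewrite !scaler0 subrr.
Qed.

Let section_q Z : Z \in U2 ->
  [/\ e1 + Z \in Vp, q (e1 + Z) = Z, D (e1 + Z) = 1 & peirce2 br h1 (e1 + Z) = e1].
Proof.
rewrite hU2 => /andP [Zp /eqP hZ]; have xp : e1 + Z \in Vp by apply: memvD.
have pE : [/\ peirce2 br h1 (e1 + Z) = e1, peirce1 br h1 (e1 + Z) = 0 & peirce0 br h1 (e1 + Z) = Z].
  rewrite /peirce0 /peirce1 /peirce2 !(brDr hL) hZ h1e !(brZr hL, br0r hL) h1e.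
  by split; vfield; rewrite ?nz.
have D1 : D (e1 + Z) = 1.
  by rewrite /D; case: pE => -> _ _; apply: detU_id => w; apply: (half_op_e charF hL hg t1).
split=> //; last by case: pE.
by rewrite /q D1; case: pE => _ -> ->; rewrite (br0r hL) scaler0 subr0 scale1r.
Qed.

(** The identity [schur_eq] is between polynomials over $F$, so it persists over [L], where
    [irreducible_schur] applies with the section $Z\mapsto e_1+Z$. *)
Lemma block_irreducible (L : fieldType) (f : {rmorphism F -> L}) :
  e2 != 0 -> irreducible_elt (map_mpoly f P) -> irreducible_elt (map_mpoly f R).
Proof.
move=> e20 irr; have c0 : c != 0.
  exact: (block_chi_neq0 charF hL hS hg hVp hU hlog hb Pe (irreducible_map irr)).
have [d _ hd] := block_homog charF hL hS hg hVp hlog hb Pe.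
have d0 := block_degree_gt0 charF hL hS hg hVp hlog hb Pe c0 e20 hd.
have Re2 : peval R e2 = 1 by rewrite RE ?Pe // hU2 e2p h1e2 eqxx.
have fE n (p : {mpoly F[n]}) : map_mpoly f p = 0 -> p = 0.
  move=> p0; apply/mpolyP => m; apply: (fmorph_inj f).
  by rewrite -mcoeff_map_mpoly p0 !mcoeff0 rmorph0.
have hA := poly_on_alg U.
have Aid : avec (poly_on U) (fun x => x) by apply: avec_poly_id.
have Abr v x : avec (poly_on U) x -> avec (poly_on U) (fun t => br v (x t)).
  move=> Ax; apply: (avec_bilinear hA) => //; last exact: avec_cst.
    by move=> w a x' y'; rewrite (brDl hL) (brZl hL).
  by move=> w a x' y'; rewrite (brDr hL) (brZr hL).
have Abr2 x y : avec (poly_on U) x -> avec (poly_on U) y ->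
    avec (poly_on U) (fun t => br (x t) (y t)).
  apply: (avec_bilinear hA).
    by move=> w a x' y'; rewrite (brDl hL) (brZl hL).
  by move=> w a x' y'; rewrite (brDr hL) (brZr hL).
have Asc s (x : V -> V) : avec (poly_on U) x -> avec (poly_on U) (fun t => s *: x t).
  by move=> Ax; apply: (avec_scale hA) => //; apply: (fa_cst hA).
have Alin s0 s1 s2 : avec (poly_on U) (fun t => s0 *: t + s1 *: br h1 t + s2 *: br h1 (br h1 t)).
  apply: (avec_add hA (x := fun t => s0 *: t + s1 *: br h1 t) (y := fun t => s2 *: br h1 (br h1 t))).
    apply: (avec_add hA (x := fun t => s0 *: t) (y := fun t => s1 *: br h1 t)); first exact: Asc.
    exact/Asc/Abr.
  by apply: (Asc s2 (fun t => br h1 (br h1 t))); apply: (Abr _ (br h1)); apply: Abr.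
have A0 : avec (poly_on U) (peirce0 br h1).
  apply: (avec_ext hA) (Alin 1 (- (3%:R / 2%:R)) 2%:R^-1) => t.
  by rewrite /peirce0 scale1r scaleNr.
have A1 : avec (poly_on U) (peirce1 br h1).
  apply: (avec_ext hA) (Alin 0 2%:R (-1)) => t.
  by rewrite /peirce1 scale0r add0r scaleN1r.
have A2 : avec (poly_on U) (peirce2 br h1).
  apply: (avec_ext hA) (Alin 0 (- 2%:R^-1) 2%:R^-1) => t.
  by rewrite /peirce2 scale0r add0r scalerBr scaleNr addrC.
have AM w : w \in U1 -> avec (poly_on U) (fun t => M (peirce2 br h1 t) w).
  move=> _; apply: (avec_ext hA (x := fun t => br (br f1 w) (peirce2 br h1 t))).
    by move=> t; rewrite half_opE.
  exact: Abr.
have [Dp DpE] : poly_on U D by apply: (fa_detU hA).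
have [Sp SpE] : poly_on U (fun x => peval P (peirce2 br h1 x + e2)).
  apply: (avec_peval hA); apply: (avec_add hA) => //; exact: avec_cst.
have Aq : avec (poly_on U) q.
  apply: (avec_add hA); first by apply: (avec_scale hA) => //; apply: (fa_detU hA).
  apply: (avec_opp hA); apply: Asc; apply: Abr2 => //; apply: Abr.
  exact: (avec_adjU hA).
have [tau [tauE tauR]] := avec_subst U2 Aq.
have As : avec (poly_on U2) (fun Z => e1 + Z).
  apply: (avec_add (poly_on_alg U2)); first exact: (avec_cst (poly_on_alg U2)).
  exact: avec_poly_id.
have [sigma [_ sigmaP]] := avec_subst U As.
have inU x : (x \in U) = (x \in Vp) by rewrite hU.
have pM (W : {vspace V}) (p1 p2 : {mpoly F[\dim W]}) x : peval (p1 * p2) x = peval p1 x * peval p2 x.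
  by rewrite /peval rmorphM.
have pX (W : {vspace V}) (p1 : {mpoly F[\dim W]}) n x : peval (p1 ^+ n) x = peval p1 x ^+ n.
  by rewrite /peval rmorphXn.
have Dp0 : Dp != 0.
  apply: contra_neq (oner_neq0 F) => Dp0.
  have /section_q [xp _ <- _] : e2 \in U2 by rewrite hU2 e2p h1e2 eqxx.
  by rewrite DpE ?inU // Dp0 /peval meval0.
have E : Dp ^+ d * P = Sp * (R \mPo tau).
  (* The extra factor $D$ makes the identity trivial at the points where $D$ vanishes. *)
  apply: (mulIf Dp0); apply: (peval_ext charF) => x; rewrite inU => xp.
  rewrite !pM pX -DpE ?inU // -SpE ?inU // tauR ?inU //.
  have [->|Dx0] := eqVneq (D x) 0; first by rewrite !mulr0.
  by rewrite (schur_eq hd xp Dx0) RE ?q_U2.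
have Ps : P \mPo sigma = R.
  by apply: (peval_ext charF) => Z ZU; rewrite sigmaP // RE.
have comp1 (A : {mpoly F[\dim U]}) (a : V -> F) : (forall x, x \in U -> a x = peval A x) ->
    (forall Z, Z \in U2 -> a (e1 + Z) = 1) -> A \mPo sigma = 1.
  move=> aA a1; apply: (peval_ext charF) => Z ZU; rewrite sigmaP //.
  have [xp _ _ _] := section_q ZU; rewrite -aA ?inU // a1 //.
  by rewrite /peval -mpolyC1 mevalC.
have Ds : Dp \mPo sigma = 1 by apply: comp1 DpE _ => Z /section_q [].
have Ss : Sp \mPo sigma = 1.
  by apply: comp1 SpE _ => Z /section_q [_ _ _ ->].
have ts i : tnth tau i \mPo sigma = 'X_i.
  apply: (peval_ext charF) => Z ZU; have [xp qZ _ _] := section_q ZU.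
  by rewrite sigmaP // tauE ?inU // qZ /peval mevalXU.
have R0 : R != 0.
  by apply: contra_neq (oner_neq0 F) => R0; rewrite -Re2 R0 /peval meval0.
have Ru : R \isn't a GRing.unit.
  rewrite mpoly_unitE (_ : msize R = d.+1); first by rewrite eqSS -lt0n.
  apply: (msize_peval_homog charF R0) => t Z ZU; have := ZU; rewrite hU2 => /andP [Zp /eqP hZ].
  by rewrite !RE ?memvZ // hd.
pose mp n (p : {mpoly F[n]}) := map_mpoly f p.
apply: (@irreducible_schur _ _ _ (mp _ P) (mp _ Dp) (mp _ Sp) (mp _ R)
  [tuple mp _ (tnth tau i) | i < _] [tuple mp _ (tnth sigma i) | i < _] d irr).
- by apply: contra_neq R0 => /fE.
- move: Ru; rewrite !mpoly_unitE !msizeE.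
  rewrite (perm_big _ (msupp_map_mpoly _ _)) //; exact: fmorph_inj.
- by rewrite -map_mpoly_comp_mpoly -rmorphXn -!rmorphM E.
- by rewrite -map_mpoly_comp_mpoly Ps.
- move=> i; rewrite tnth_mktuple -map_mpoly_comp_mpoly ts.
  by rewrite /mp map_mpolyX.
- by rewrite -map_mpoly_comp_mpoly Ds rmorph1.
- by rewrite -map_mpoly_comp_mpoly Ss rmorph1.
Qed.

End BlockIrreducible.

(** * Relative invariance under the automorphisms of a subalgebra *)

Section SubBracket.
Variables (F : fieldType) (V : vectType F) (br : V -> V -> V) (W : {vspace V}).
Hypotheses (hL : lie_bracket br) (hW : forall x y, x \in W -> y \in W -> br x y \in W).

Lemma vsval_sub_br (x y : subvs_of W) : vsval (sub_br br x y) = br (vsval x) (vsval y).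
Proof. by rewrite vsprojK // hW ?subvsP. Qed.

Lemma sub_br_lie : lie_bracket (sub_br br (W := W)).
Proof.
split=> [y c x x'|x c y y'|x|x y z]; apply: val_inj; rewrite ?(linearD, linearZ) /= ?vsval_sub_br /= ?(linearD, linearZ) /= ?vsval_sub_br.
- by rewrite (brDl hL) (brZl hL).
- by rewrite (brDr hL) (brZr hL).
- by rewrite (brxx hL).
- exact: (lie_jacobi hL).
Qed.

End SubBracket.

Section SubalgebraInvariance.
Variables (F : fieldType) (Fbar : closedFieldType) (iota : {rmorphism F -> Fbar}).
Hypothesis charF : [pchar F] =i pred0.
Variables (V : vectType F) (br : V -> V -> V).
Hypotheses (hL : lie_bracket br) (hS : lie_simple br).

Let nz n : n.+1%:R != 0 :> F. Proof. exact (natSf_neq0 charF n). Qed.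

Variables (H0 : V).
Hypotheses (hg : grading br H0) (hVp : Vplus br H0 <> 0%VS).
Notation Vp := (Vplus br H0).
Notation Vz := (Vzero br H0).
Notation Vm := (Vminus br H0).
Notation K := (killing br).

Variables (U : {vspace V}) (P : {mpoly F[\dim U]}) (c : F).
Hypothesis hlog : forall X Y z, gtriple br H0 Y H0 X -> z \in Vp ->
  dpe P X z = c * K Y z * peval P X.

Variables (f1 h1 e1 f2 h2 e2 : V).
Hypothesis hb : block br H0 f1 h1 e1 f2 h2 e2.
Hypothesis Pe : peval P (e1 + e2) = 1.

Variable W : {vspace V}.
Hypotheses (hW : forall x y, x \in W -> y \in W -> br x y \in W).
Hypotheses (e2W : e2 \in W) (f2W : f2 \in W) (h1W : forall w, w \in W -> br h1 w = 0).
Hypothesis WU2 : forall Z, Z \in Vp -> br h1 Z = 0 -> Z \in W.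

Let t1 : gtriple br H0 f1 h1 e1. Proof. by case: hb. Qed.
Let t2 : gtriple br H0 f2 h2 e2. Proof. by case: hb. Qed.
Let hh : h1 + h2 = H0. Proof. by case: hb. Qed.
Let e2p : e2 \in Vp. Proof. by case: t2. Qed.
Let fe2 : br f2 e2 = h2. Proof. by case: t2 => _ _ []. Qed.
Let h1e2 := block_h1e2 charF hL hg hb.

Let h2W : h2 \in W. Proof. by rewrite -fe2 hW. Qed.

Lemma Vplus_sub_block Z : (Z \in Vplus_sub br H0 W) = (Z \in Vp) && (br h1 Z == 0).
Proof.
rewrite memv_cap; apply/andP/andP => -[Zp hZ]; split=> //; first exact/eqP/h1W.
by apply: WU2 => //; apply/eqP.
Qed.

Variables (R : {mpoly F[\dim (Vplus_sub br H0 W)]}).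
Hypothesis RE : forall Z, Z \in Vplus_sub br H0 W -> peval R Z = peval P (e1 + Z).

Notation S := (Aut0_fix iota (sub_br br (W := W)) (vsproj W h2)).

Let act_br g x y : S g -> x \in W -> y \in W ->
  br (sub_act g x) (sub_act g y) = sub_act g (br x y).
Proof.
move=> [[[_ gbr] _] _] xW yW; rewrite /sub_act -vsval_sub_br // -gbr.
by rewrite /sub_br !vsprojK.
Qed.

Let act_h2 g : S g -> sub_act g h2 = h2.
Proof. by move=> [_ gh]; rewrite /sub_act gh vsprojK. Qed.

Let act_W (g : 'End(subvs_of W)) x : sub_act g x \in W. Proof. exact: subvsP. Qed.

Let H0W x : x \in W -> br H0 x = br h2 x.
Proof. by move=> xW; rewrite -hh (brDl hL) h1W // add0r. Qed.

Let act_wt g (a : F) x : S g -> x \in W -> br H0 x = a *: x -> br H0 (sub_act g x) = a *: sub_act g x.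
Proof.
move=> Sg xW hx; rewrite H0W // -{1}(act_h2 Sg) act_br // -H0W // hx.
by rewrite /sub_act !linearZ.
Qed.

(** The form is the Killing form of the ambient algebra restricted to [W]; membership in
    $\mathrm{Aut}_0$ of [W] is what makes [g] an isometry for it. *)
Let act_killing g x y : S g -> x \in W -> y \in W -> K (sub_act g x) (sub_act g y) = K x y.
Proof.
move=> [Ag _] xW yW; pose b (u v : subvs_of W) := K (vsval u) (vsval v).
have -> : K (sub_act g x) (sub_act g y) = b (g (vsproj W x)) (g (vsproj W y)) by [].
rewrite (@Aut0_form _ _ iota charF _ _ (sub_br_lie hL hW) b) //.
- by rewrite /b !vsprojK.
- by move=> u a v w; rewrite /b linearP killingDr // killingZr.
- by move=> u a v w; rewrite /b linearP killingDl // killingZl.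
- move=> u v w; rewrite /b !vsval_sub_br // (brC hL) killingNl // killing_br //.
  by rewrite addNr.
Qed.

Let act_linear (g : 'End(subvs_of W)) : linear (sub_act g).
Proof. by move=> a x y; rewrite /sub_act !linearP. Qed.

Let act_U2 g Z : S g -> Z \in Vp -> br h1 Z = 0 -> sub_act g Z \in Vp /\ br h1 (sub_act g Z) = 0.
Proof.
move=> Sg Zp hZ; split; last exact/h1W/act_W.
by apply/(VpP hL)/act_wt => //; [exact: WU2|exact/(VpP hL)].
Qed.

Lemma block_sub_semi_invariance g Z : S g -> Z \in Vp -> br h1 Z = 0 ->
  peval P (e1 + sub_act g Z) = peval P (e1 + sub_act g e2) * peval P (e1 + Z).
Proof.
move=> Sg; apply: (block_semi_invariance charF hL hS hg hVp hlog hb Pe (act_linear g)).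
  by move=> *; apply: act_U2.
move=> Z' Zm Zp' hZ' Zmm hZm ZZ.
have ZW : Z' \in W by apply: WU2.
have Zm2 : br h2 Zm = - 2%:R *: Zm.
  have hZm0 : br h1 Zm = 0 *: Zm by rewrite scale0r.
  by rewrite (h2_wt hL hb ((VmP hL _ _) Zmm) hZm0) subr0.
(* $\mathrm{ad}(e_2)^2Z_m$ is a weight 0 vector of $V^+$, hence in [W], and $\mathrm{ad}(f_2)^2$
   brings it back to $4Z_m$. *)
have ZmW : Zm \in W.
  have -> : Zm = 4%:R^-1 *: br f2 (br f2 (br e2 (br e2 Zm))).
    by rewrite (ffee_m charF hL hg t2 Zmm Zm2) scalerA mulVf ?scale1r ?nz.
  apply: memvZ; apply: hW => //; apply: hW => //; apply: WU2.
    by apply: (br_pz hL) => //; apply: (br_pm hL).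
  by rewrite !(brA hL h1 e2) h1e2 hZm !(br0l hL) !(br0r hL) !add0r ?(br0r hL).
exists (sub_act g Zm); split.
- by apply/(VmP hL)/act_wt => //; apply/(VmP hL).
- exact/h1W/act_W.
- by rewrite act_br // ZZ act_h2.
- by move=> z zp hz; rewrite act_killing //; apply: WU2.
Qed.

(** The character is $g\mapsto R(g\,e_2)$, as $R(e_2)=1$. *)
Lemma block_relatively_invariant : relatively_invariant S (@sub_act F V W) R.
Proof.
have U2P Z : Z \in Vplus_sub br H0 W -> Z \in Vp /\ br h1 Z = 0.
  by rewrite Vplus_sub_block => /andP [Zp /eqP].
have actU g Z : S g -> Z \in Vplus_sub br H0 W -> sub_act g Z \in Vplus_sub br H0 W.
  move=> Sg /U2P [Zp hZ]; have [Zp' /eqP hZ'] := act_U2 Sg Zp hZ.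
  by rewrite Vplus_sub_block Zp' hZ'.
have e2U : e2 \in Vplus_sub br H0 W by rewrite Vplus_sub_block e2p h1e2 eqxx.
have inv g Z : S g -> Z \in Vplus_sub br H0 W ->
    peval R (sub_act g Z) = peval R (sub_act g e2) * peval R Z.
  move=> Sg ZU; have [Zp hZ] := U2P _ ZU.
  by rewrite !RE ?actU // block_sub_semi_invariance.
exists (fun g => peval R (sub_act g e2)); last by move=> g Z Sg ZU; apply: inv.
split=> [g Sg|g g' Sg Sg'].
  have [[[/eqP g0 gbr] _] gh] := Sg.
  (* Nonvanishing of the character: $e_2$ is itself of the form $gZ$. *)
  pose y := (g^-1)%VF (vsproj W e2); pose Z := vsval y.
  have gy : g y = vsproj W e2.
    have := limg_ker_dim g fullv; rewrite (eqP g0) capv0 dimv0 add0n => dg.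
    have : limg g = fullv by apply/eqP; rewrite eqEdim subvf dg leqnn.
    by move=> lg; apply: limg_lfunVK; rewrite lg memvf.
  have ZU : Z \in Vplus_sub br H0 W.
    rewrite Vplus_sub_block; apply/andP; split; last exact/eqP/h1W/subvsP.
    apply/(VpP hL); rewrite H0W ?subvsP //.
    have -> : br h2 Z = vsval (sub_br br (vsproj W h2) y) by rewrite vsval_sub_br // vsprojK.
    rewrite -linearZ; congr (vsval _); apply: (can_inj (lker0_lfunK _) (f := g)) => //.
    rewrite gbr gh gy linearZ /= gy; apply: val_inj; rewrite /= vsval_sub_br // ?linearZ /= !vsprojK //.
    by rewrite -H0W //; apply/(VpP hL).
  have := inv _ _ Sg ZU; rewrite {1}/sub_act /Z vsvalK gy vsprojK // RE // Pe => /esym E.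
  by apply: contra_eq_neq E => ->; rewrite mul0r eq_sym oner_neq0.
have -> : sub_act (g \o g')%VF e2 = sub_act g (sub_act g' e2).
  by rewrite /sub_act comp_lfunE vsvalK.
exact: inv (actU _ _ Sg' e2U).
Qed.

End SubalgebraInvariance.

(** * A triple without weight 0 on V^+ has neutral element H_0 *)

Section FullTripleCriterion.
Variables (F : fieldType).
Hypothesis charF : [pchar F] =i pred0.
Variables (V : vectType F) (br : V -> V -> V).
Hypotheses (hL : lie_bracket br) (hS : lie_simple br).

Let nz n : n.+1%:R != 0 :> F. Proof. exact (natSf_neq0 charF n). Qed.

Variables (H0 f' e' f h e : V).
Hypotheses (hg : grading br H0) (hVp : Vplus br H0 <> 0%VS).
Hypotheses (ht' : gtriple br H0 f' H0 e') (ht : gtriple br H0 f h e).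
Notation Vp := (Vplus br H0).
Notation Vz := (Vzero br H0).
Notation Vm := (Vminus br H0).
Notation K := (killing br).
Hypothesis no0 : forall x, x \in Vp -> br h x = 0 -> x = 0.

Let ep : e \in Vp. Proof. by case: ht. Qed.
Let hz : h \in Vz. Proof. exact: (triple_hz hL ht). Qed.

Let dec x : x \in Vp -> exists x1 x2, [/\ x1 \in Vp, x2 \in Vp, br h x1 = x1,
  br h x2 = 2%:R *: x2 & x = x2 + x1].
Proof.
move=> xp; have [w0 w1 w2] := peirce_wt charF hL hg ht xp.
have [m0 m1 m2] := peirce_mem hL ht xp.
exists (peirce1 br h x), (peirce2 br h x); split=> //.
by rewrite {1}(peirce_sum charF br h x) (no0 m0 w0) addr0.
Qed.

(** Two open conditions, invertibility of $x_2+x_1$ and of [half_op] at $x_2$, are met at once on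
    the line $e'+se$, where $e'$ is the given invertible element. *)
Let generic : exists x1 x2, [/\ x1 \in Vp, br h x1 = x1, x2 \in Vp, br h x2 = 2%:R *: x2
  & detU (half_space br H0 h) (half_op br f x2) != 0 /\ exists Y, gtriple br H0 Y H0 (x2 + x1)].
Proof.
have e'p : e' \in Vp by case: ht'.
have he : br h e = 2%:R *: e by case: ht => _ _ [].
have [x1 [x2 [m1 m2 w1 w2 eE]]] := dec e'p.
have qe0 : qdet br H0 f' e' != 0 by rewrite (qdet_e charF hL hg ht') oner_neq0.
have [d d0 dinv] := invertible_line charF hL hS hg ht' hVp e'p ep qe0.
pose D Y := detU (half_space br H0 h) (half_op br f Y).
have ax2 y t x : half_op br f (y + t *: x) = (half_op br f y + t *: half_op br f x)%VF.
  by apply/lfunP => v; rewrite add_lfunE scale_lfunE !half_opE // (brDr hL) (brZr hL).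
have curve y x : exists p : {poly F}, forall t, D (y + t *: x) = p.[t].
  apply: (fa_detU (upoly_alg F)) => v _.
  apply: (avec_ext (upoly_alg F) (x := fun t => half_op br f y v + t *: half_op br f x v)).
    by move=> t; rewrite ax2 add_lfunE scale_lfunE.
  apply: (avec_add (upoly_alg F)); first exact: (avec_cst (upoly_alg F)).
  by apply: (avec_scale (upoly_alg F)); [exact: upoly_id|exact: (avec_cst (upoly_alg F))].
have DZ t y : D (t *: y) = t ^+ \dim (half_space br H0 h) * D y.
  rewrite /D /detU -detZ; congr (\det _); apply/matrixP => i j; rewrite !mxE.
  by rewrite !half_opE // (brZr hL) linearZ.
have [p pE] := curve e x2; have [q qE] := curve x2 e.
have p0 : p != 0.
  apply: contra_neq (oner_neq0 F) => p0.
  have := pE 0; rewrite scale0r addr0 p0 horner0 => <-.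
  by symmetry; apply: detU_id => v; apply: (half_op_e charF hL hg ht).
(* The determinant is homogeneous, so its values on the lines $e+tx_2$ and $x_2+te$ correspond under
   $t\mapsto t^{-1}$. *)
have q0 : q != 0.
  apply: contra_neq p0 => q0; apply/eqP; have /eqP : p * 'X = 0.
    apply: (poly_eq0_eval charF) => t; rewrite hornerM hornerX -pE.
    have [->|t0] := eqVneq t 0; first by rewrite mulr0.
    have -> : e + t *: x2 = t *: (x2 + t^-1 *: e).
      by rewrite scalerDr scalerA mulfV // scale1r addrC.
    by rewrite DZ qE q0 horner0 mulr0 mul0r.
  by rewrite mulf_eq0 polyX_eq0 orbF.
have [s sE] : exists s, (d * q).[s] != 0.
  apply: NNPP => H; move: (mulf_neq0 d0 q0); apply/negP; rewrite negbK; apply/eqP.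
  by apply: (poly_eq0_eval charF) => t; apply/eqP; apply: contraT => ht0; case: H; exists t.
move: sE; rewrite hornerM mulf_eq0 negb_or => /andP [ds qs].
have [Y tY] := dinv s ds.
exists x1, (x2 + s *: e); split=> //.
- by apply: memvD => //; apply: memvZ.
- by rewrite (brDr hL) (brZr hL) w2 he; vring.
split; first by rewrite -/(D _) qE.
by exists Y; move: tY; rewrite eE addrAC.
Qed.

(** As weight 0 is absent, a unipotent carries $x_2$ exactly to the invertible $x_2+x_1$, so
    $\mathrm{ad}(x_2)^2$ maps $V^-$ onto $V^+$. It commutes with $\mathrm{ad}(H_0-h)$, whose
    eigenvalues on $V^-$ are among $0,-1,-2$, whereas the eigenvalue on weight 1 vectors of $V^+$ is
    1. *)
Let no1 x : x \in Vp -> br h x = x -> x = 0.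
Proof.
move=> xp hx; have [x1 [x2 [m1 w1 m2 w2 [D0 [Y tY]]]]] := generic.
have [uz nilu _ [m0 w0] E] := half_exp charF hL hS hg hVp ht m2 w2 m1 w1 (mem0v _) (br0r hL h) D0.
move: E; rewrite (no0 m0 w0) scaler0 !addr0.
set u := _ *: _ in uz nilu m0 w0 * => E.
have nilNu : ad_nilpotent br (- u) by rewrite -scaleN1r; apply: ad_nilpotentZ.
have expN v : exp_ad br (- u) (exp_ad br u v) = v.
  by rewrite -{2}[u]opprK exp_adK.
have expm v : v \in Vm -> exp_ad br (- u) v \in Vm.
  move=> vm; apply: memv_suml => i _; apply: memvZ; elim: (nat_of_ord i) => // n IH.
  by rewrite iterS; apply: (br_zm hL) => //; rewrite memvN.
have expp v : v \in Vp -> exp_ad br u v \in Vp.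
  move=> vm; apply: memv_suml => i _; apply: memvZ; elim: (nat_of_ord i) => // n IH.
  by rewrite iterS; apply: (br_zp hL).
pose uu v := br (H0 - h) v.
have uuD v w : uu (v + w) = uu v + uu w by rewrite /uu (brDr hL).
have uuZ t v : uu (t *: v) = t *: uu v by rewrite /uu (brZr hL).
(* $T=\delta(\delta+1)(\delta+2)$ for $\delta=\mathrm{ad}(H_0-h)$ kills $V^-$, and equals 6 on
   weight 1 in $V^+$. *)
pose T v := uu (uu (uu v)) + 3%:R *: uu (uu v) + 2%:R *: uu v.
have TD v w : T (v + w) = T v + T w by rewrite /T !(uuD, scalerDr); vring.
have Teig t v : uu v = t *: v -> T v = (t * (t + 1) * (t + 2%:R)) *: v.
  by move=> hv; rewrite /T !(hv, uuZ); vring.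
have TVm y : y \in Vm -> T y = 0.
  move=> ym; have := peirceN_wt charF hL hg ht ym; have := peirceN_mem hL ht ym.
  have := peirce_sum charF br (- h) y => /=.
  move: (peirce0 _ _ _) (peirce1 _ _ _) (peirce2 _ _ _) => y0 y1 y2 -> [n0 n1 n2] [v0 v1 v2].
  have u0 : uu y0 = - 2%:R *: y0 by rewrite /uu (brBl hL) v0 subr0 ((VmP hL _ _) n0).
  have u1 : uu y1 = - 1 *: y1 by rewrite /uu (brBl hL) v1 ((VmP hL _ _) n1); vring.
  have u2 : uu y2 = 0 *: y2 by rewrite /uu (brBl hL) v2 ((VmP hL _ _) n2); vring.
  by rewrite !TD (Teig _ _ u0) (Teig _ _ u1) (Teig _ _ u2); vring.
have ux2 v : uu (br x2 v) = br x2 (uu v).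
  by rewrite /uu (brA hL) (brBl hL) ((VpP hL _ _) m2) w2 subrr (br0l hL) add0r.
have Tx2 y : y \in Vm -> T (br x2 (br x2 y)) = 0.
  move=> ym; have -> : T (br x2 (br x2 y)) = br x2 (br x2 (T y)).
    by rewrite /T !ux2 !(brDr hL) !(brZr hL).
  by rewrite TVm // !(br0r hL).
have [y ym yE] : exists2 y, y \in Vm & br x2 (br x2 y) = x.
  have exp_x : exp_ad br u x \in Vp by apply: expp.
  pose y' := 4%:R^-1 *: br Y (br Y (exp_ad br u x)).
  have y'm : y' \in Vm.
    have Ym : Y \in Vm by case: tY.
    by apply: memvZ; apply: (br_mz hL) => //; apply: (br_mp hL).
  exists (exp_ad br (- u) y'); first exact: expm.
  have x2E : x2 = exp_ad br (- u) (x2 + x1) by rewrite -E expN.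
  rewrite {1 2}x2E -!(exp_ad_br charF _ _ hL nilNu).
  by rewrite /y' !(brZr hL) (full_eeff charF hL hg tY exp_x) scalerA mulVf ?nz // scale1r expN.
have ux : uu x = 1 *: x by rewrite /uu (brBl hL) ((VpP hL _ _) xp) hx; vring.
have := Tx2 _ ym; rewrite yE (Teig _ _ ux) => /eqP; rewrite scaler_eq0.
by rewrite (_ : _ * _ = 6%:R) ?(negPf (nz 5)) => [/eqP|] //; ring.
Qed.

(** Now $V^+$ is purely of weight 2, so $H_0-h$ kills $V^+$, then $V^-$ by duality and
    $V_0=[V^-,V^+]$; it is central, hence 0. *)
Lemma triple_full : h = H0.
Proof.
apply/esym/eqP; rewrite -subr_eq0; apply/eqP/(center0 hL hS).
have up x : x \in Vp -> br (H0 - h) x = 0.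
  move=> xp; have [x1 [x2 [m1 m2 w1 w2 ->]]] := dec xp.
  by rewrite (no1 m1 w1) addr0 (brBl hL) w2 ((VpP hL _ _) m2) subrr.
have um y : y \in Vm -> br (H0 - h) y = 0.
  move=> ym; have uz : H0 - h \in Vz by rewrite memvB // mem_H0.
  apply: (killing_nondeg_m charF hL hS hg hVp); first exact: (br_zm hL).
  by move=> x xp; rewrite (brC hL) killingNl // killing_br // up // killing0r // oppr0.
move=> v; have [m [z [p [mm zz pp ->]]]] := grade_dec charF hL hg v.
rewrite !(brDr hL) (up p pp) (um m mm) addr0 add0r.
have := Vz_generated charF hL hS hg hVp zz.
have sub : (bracket_space br Vm Vp <= lker (adl br (H0 - h)))%VS.
  apply: bracket_space_sub => // x y xm yp.
  by rewrite memv_ker adlE // (brA hL) (um x xm) (up y yp) (br0l hL) (br0r hL) addr0.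
by move/(subvP sub); rewrite memv_ker adlE // => /eqP.
Qed.

End FullTripleCriterion.

(** * Root spaces and simultaneous diagonalization *)

Section Roots.
Variables (F : fieldType) (V : vectType F) (br : V -> V -> V).
Hypothesis hL : lie_bracket br.

(** By induction on the eigenvalues: $\mathrm{ad}\,t-c$ sends a vector of [W] into the sum over the
    other eigenvalues, where it is invertible ([solve]); correcting by the preimage leaves an
    eigenvector for [c] in [W]. *)
Lemma eigen_stable_sub t (W : {vspace V}) (s : seq F) : (forall x, x \in W -> br t x \in W) ->
  (W :&: \sum_(c <- s) ad_eigen br t c <= \sum_(c <- s) (ad_eigen br t c :&: W))%VS.
Proof.
move=> Wt; have solve c : forall s', c \notin s' ->
    forall w, w \in (\sum_(c <- s') (ad_eigen br t c :&: W))%VS ->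
    exists2 z, z \in (\sum_(c <- s') (ad_eigen br t c :&: W))%VS & br t z - c *: z = w.
  elim=> [|d s' IH] cs w.
    rewrite big_nil memv0 => /eqP ->; exists 0; first by rewrite mem0v.
    by rewrite (br0r hL) scaler0 subrr.
  rewrite big_cons; move: cs; rewrite inE negb_or => /andP [cd cs].
  move=> /memv_addP [y yE [z zS ->]]; have [z' z'S <-] := IH cs z zS.
  move: yE; rewrite memv_cap => /andP [/(ad_eigenP hL) ty yW].
  have dc : d - c != 0 by rewrite subr_eq0 eq_sym.
  exists ((d - c)^-1 *: y + z').
    apply: memv_add => //; apply: memvZ; rewrite memv_cap yW andbT.
    exact/(ad_eigenP hL).
  rewrite (brDr hL) (brZr hL) ty scalerDr opprD addrACA; congr (_ + _).
  by rewrite !scalerA -scalerBl mulrC -mulrBl mulfV // scale1r.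
elim: s => [|c s IH]; first by rewrite !big_nil capv0 subvv.
rewrite !big_cons; apply/subvP => x; rewrite memv_cap => /andP [xW /memv_addP [y yE [z zS xE]]].
have [cs|cs] := boolP (c \in s).
  apply: (subvP (addvSr _ _)); apply: (subvP IH); rewrite memv_cap xW xE memvD //.
  by move: yE; apply/subvP; rewrite (big_rem c) //= addvSl.
pose T v := br t v - c *: v.
have TD v w : T (v + w) = T v + T w by rewrite /T (brDr hL) scalerDr opprD addrACA.
have TS v : v \in (\sum_(c <- s) ad_eigen br t c)%VS -> T v \in (\sum_(c <- s) ad_eigen br t c)%VS.
  elim: (s) v => [|d s' IHs] v.
    by rewrite big_nil memv0 => /eqP ->; rewrite /T (br0r hL) scaler0 subrr mem0v.
  rewrite big_cons => /memv_addP [v1 v1E [v2 v2S ->]]; rewrite TD memv_add ?IHs //.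
  move/(ad_eigenP hL): v1E => tv; rewrite /T tv -scalerBl memvZ //; exact/(ad_eigenP hL).
have Tx : T x \in (\sum_(c <- s) (ad_eigen br t c :&: W))%VS.
  apply: (subvP IH); rewrite memv_cap; apply/andP; split.
    by rewrite memvB ?Wt ?memvZ.
  by rewrite xE TD; move/(ad_eigenP hL): yE => ty; rewrite {1}/T ty subrr add0r TS.
have [z' z'S Tz'] := solve c s cs _ Tx.
have z'W : z' \in W.
  move: z'S; apply/subvP; elim: (s) => [|d s' IHs]; first by rewrite big_nil sub0v.
  by rewrite big_cons subv_add IHs capvSr.
rewrite -(subrK z' x); apply: memv_add => //; rewrite memv_cap; apply/andP; split; last exact: memvB.
apply/(ad_eigenP hL)/eqP; rewrite -subr_eq0 (_ : _ - _ = T x - (br t z' - c *: z')); first by rewrite Tz' subrr.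
by rewrite (brBr hL) /T; vring.
Qed.

Variable a : {vspace V}.

Lemma pairing_linear (mu : dual a) : scalar (pairing mu).
Proof. by move=> c x y; rewrite /pairing !linearP. Qed.

Lemma root_spaceP (mu : dual a) x :
  reflect (forall t, t \in a -> br t x = pairing mu t *: x) (x \in root_space br mu).
Proof.
apply: (iffP idP) => [xm t ta|H]; last first.
  rewrite memvE; apply/subv_bigcapP => i _; rewrite -memvE.
  by apply/(ad_eigenP hL)/H/vbasis_mem/mem_nth; rewrite size_tuple.
have H (i : 'I_(\dim a)) : br (vbasis a)`_i x = pairing mu (vbasis a)`_i *: x.
  have /subv_bigcapP /(_ i isT) : (<[x]> <= root_space br mu)%VS by rewrite -memvE.
  by rewrite -memvE => /(ad_eigenP hL).
pose pl : {scalar V} :=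
  HB.pack (pairing mu) (GRing.isLinear.Build F V F _ (pairing mu) (pairing_linear mu)).
have plE v : pairing mu v = pl v by [].
rewrite (coord_vbasis ta) (br_suml hL) plE linear_sum scaler_suml; apply: eq_bigr => i _.
rewrite (brZl hL) linearZ /= -scalerA; congr (_ *: _).
exact: H.
Qed.

Lemma root_space_br (mu nu : dual a) x y : x \in root_space br mu -> y \in root_space br nu ->
  br x y \in root_space br (mu + nu).
Proof.
move=> /root_spaceP xm /root_spaceP yn; apply/root_spaceP => t ta.
by rewrite (br_eigen hL (xm t ta) (yn t ta)) /pairing add_lfunE.
Qed.

Hypothesis ha : split_abelian br a.

(** Diagonalize under a basis of [a] one element at a time; the eigenvalues of a nonzero common
    eigenvector then form a linear form on [a]. *)
Lemma root_dec (W : {vspace V}) x : (forall t y, t \in a -> y \in W -> br t y \in W) -> x \in W ->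
  exists2 s : seq V, x = \sum_(y <- s) y &
    forall y, y \in s -> [/\ y \in W, y != 0 & exists mu : dual a, y \in root_space br mu].
Proof.
have [aa ad] := ha.
have step (l : seq V) : {subset l <= a} -> forall (W : {vspace V}) x,
    (forall t y, t \in a -> y \in W -> br t y \in W) -> x \in W ->
    exists2 s : seq V, x = \sum_(y <- s) y &
      forall y, y \in s -> y \in W /\ forall t, t \in l -> exists c, br t y = c *: y.
  elim: l => [|t l IH] la {}W {}x Wa xW.
    by exists [:: x]; rewrite ?big_seq1 // => y; rewrite inE => /eqP ->.
  have ta : t \in a by apply: la; rewrite mem_head.
  have [s sE] := ad t ta.
  have : x \in (\sum_(c <- s) (ad_eigen br t c :&: W))%VS.
    apply: (subvP (eigen_stable_sub s (fun x => Wa t x ta))).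
    by rewrite memv_cap xW sE memvf.
  elim: {sE} (s) {xW} x => [|c s' IHs] x.
    by rewrite big_nil memv0 => /eqP ->; exists [::]; rewrite ?big_nil.
  rewrite big_cons => /memv_addP [y yE [z /IHs [s2 -> s2P] ->]].
  have [|||s1 -> s1P] := IH _ (ad_eigen br t c :&: W)%VS y.
  - by move=> v vl; apply: la; rewrite inE vl orbT.
  - move=> t' v t'a; rewrite !memv_cap => /andP [/(ad_eigenP hL) tv vW]; rewrite Wa // andbT.
    by apply/(ad_eigenP hL); rewrite (brA hL) (aa t t') // (br0l hL) add0r tv (brZr hL).
  - by [].
  exists (s1 ++ s2); first by rewrite big_cat.
  move=> v; rewrite mem_cat => /orP [/s1P [vW vl]|/s2P //].
  move: vW; rewrite memv_cap => /andP [/(ad_eigenP hL) tv ->]; split=> // t'.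
  by rewrite inE => /orP [/eqP ->|/vl //]; exists c.
move=> Wa xW; have [s xE sP] := step (vbasis a) (fun v => @vbasis_mem _ _ v a) W x Wa xW.
exists [seq y <- s | y != 0].
  rewrite xE big_filter (bigID (fun y => y == 0)) /= big1 ?add0r //.
  by move=> y /eqP.
move=> y; rewrite mem_filter => /andP [y0 /sP [yW yP]]; split=> //.
have fy : free [tuple y] by rewrite seq1_free.
have cy c : coord [tuple y] ord0 (c *: y) = c.
  by have := coord_free (@ord0 0) ord0 fy; rewrite eqxx linearZ /= => ->; rewrite mulr1.
have yE t : t \in a -> exists c, br t y = c *: y.
  move=> ta; have /fin_all_exists [c cE] (i : 'I_(\dim a)) : exists c, br (vbasis a)`_i y = c *: y.
    by apply: yP; rewrite mem_nth // size_tuple.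
  exists (\sum_i coord (vbasis a) i t * c i).
  rewrite {1}(coord_vbasis ta) (br_suml hL) scaler_suml; apply: eq_bigr => i _.
  by rewrite (brZl hL) cE scalerA.
pose m (t : subvs_of a) : F^o := coord [tuple y] ord0 (br (vsval t) y).
have ml : linear m.
  by move=> c u v; rewrite /m linearP (brDl hL) (brZl hL) linearP.
pose m' : {linear subvs_of a -> F^o} := HB.pack m (GRing.isLinear.Build F _ _ _ m ml).
exists (linfun m'); apply/root_spaceP => t ta.
rewrite /pairing lfunE /= /m vsprojK //; have [c ->] := yE t ta.
by rewrite cy.
Qed.

End Roots.

(** * Weyl elements as members of Aut_0 *)

Section ProductsOfExponentials.
Variables (F : fieldType) (Fbar : closedFieldType) (iota : {rmorphism F -> Fbar}).
Hypothesis charF : [pchar F] =i pred0.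
Variables (V : vectType F) (br : V -> V -> V).
Hypothesis hL : lie_bracket br.

Let nz n : n.+1%:R != 0 :> F. Proof. exact (natSf_neq0 charF n). Qed.

Definition exp_prod (s : seq V) : V -> V := foldr (fun x f => exp_ad br x \o f) id s.

Lemma exp_prod_Aut0 (s : seq V) : (forall x, x \in s -> ad_nilpotent br x) ->
  exists2 g : 'End(V), g =1 exp_prod s & Aut0 iota br g.
Proof.
move=> nils; suff [g gE] : exists g : 'End(V), g =1 exp_prod s.
  by exists g => //; apply: (Aut0_exp iota charF hL nils).
elim: s nils => [|x s IH] nils; first by exists \1%VF => v; rewrite id_lfunE.
have [|g gE] := IH; first by move=> y ys; apply: nils; rewrite inE ys orbT.
have [ex exE _] := exp_ad_aut charF hL (nils x (mem_head _ _)).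
by exists (ex \o g)%VF => v; rewrite comp_lfunE exE gE.
Qed.

Variables (W : {vspace V}) (hW : forall x y, x \in W -> y \in W -> br x y \in W).

Lemma vsval_exp_ad (x v : subvs_of W) : ad_nilpotent br (vsval x) ->
  ad_nilpotent (sub_br br (W := W)) x /\ vsval (exp_ad (sub_br br (W := W)) x v) = exp_ad br (vsval x) (vsval v).
Proof.
move=> nilx; have it n w : vsval (iter n (sub_br br (W := W) x) w) = iter n (br (vsval x)) (vsval w).
  by elim: n => // n IH; rewrite !iterS vsval_sub_br // IH.
have nilx' : ad_nilpotent (sub_br br (W := W)) x.
  by have [m xm] := nilx; exists m => w; apply: val_inj; rewrite /= it xm.
split=> //; pose N := (\dim {:subvs_of W} + \dim {:V})%N.
rewrite (exp_adE (lie_linearr (sub_br_lie hL hW) x) nilx' (N := N)) ?leq_addr //.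
rewrite (exp_adE (lie_linearr hL _) nilx (N := N)) ?leq_addl //.
by rewrite /expD linear_sum; apply: eq_bigr => i _; rewrite linearZ /= it.
Qed.

Lemma exp_prod_sub (s : seq V) : (forall x, x \in s -> x \in W /\ ad_nilpotent br x) ->
  exists2 g : 'End(subvs_of W), Aut0 iota (sub_br br (W := W)) g &
    forall v, v \in W -> sub_act g v = exp_prod s v.
Proof.
move=> hs; have nils (x : subvs_of W) : x \in [seq vsproj W y | y <- s] -> ad_nilpotent (sub_br br (W := W)) x.
  move=> /mapP [y /hs [yW ny] ->].
  by have [] := @vsval_exp_ad (vsproj W y) 0; rewrite // vsprojK.
suff [g gE gs] : exists2 g : 'End(subvs_of W),
    g =1 foldr (fun x f => exp_ad (sub_br br (W := W)) x \o f) id [seq vsproj W y | y <- s] &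
    forall v, v \in W -> sub_act g v = exp_prod s v.
  by exists g => //; apply: (Aut0_exp iota charF (sub_br_lie hL hW) nils).
elim: s hs nils => [|x s IH] hs nils.
  by exists \1%VF => v; rewrite ?id_lfunE // => vW; rewrite /sub_act id_lfunE vsprojK.
have [||g gE gs] := IH.
- by move=> y ys; apply: hs; rewrite inE ys orbT.
- by move=> y ys; apply: nils; rewrite /= inE ys orbT.
have [xW nx] := hs x (mem_head _ _).
have [ex exE _] := exp_ad_aut charF (sub_br_lie hL hW) (nils _ (mem_head _ _)).
exists (ex \o g)%VF => v; first by rewrite comp_lfunE exE gE.
move=> vW; rewrite /sub_act comp_lfunE exE.
have [|_ ->] := @vsval_exp_ad (vsproj W x) (g (vsproj W v)); first by rewrite vsprojK.
by rewrite vsprojK //= -gs.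
Qed.

End ProductsOfExponentials.

Section WeylElements.
Variables (F : fieldType) (Fbar : closedFieldType) (iota : {rmorphism F -> Fbar}).
Hypothesis charF : [pchar F] =i pred0.
Variables (V : vectType F) (br : V -> V -> V).
Hypothesis hL : lie_bracket br.
Variable H0 : V.
Hypothesis hg : grading br H0.

Let nz n : n.+1%:R != 0 :> F. Proof. exact (natSf_neq0 charF n). Qed.

Lemma weyl_eltE X Y v : weyl_elt br X Y v = exp_prod br [:: X; Y; X] v.
Proof. by []. Qed.

Lemma weyl_H0 Y X : gtriple br H0 Y H0 X -> weyl_elt br X Y H0 = - H0.
Proof.
move=> [Ym Xp [HX HY YX]].
have XH : br X H0 = - 2%:R *: X by rewrite (brC hL) HX scaleNr.
have YH : br Y H0 = 2%:R *: Y by rewrite (brC hL) HY scaleNr opprK.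
have XY : br X Y = - H0 by rewrite (brC hL) YX.
rewrite /weyl_elt (exp_ad_p charF hL hg H0 Xp) XH (brZr hL) (brxx hL) !scaler0 addr0.
rewrite (exp_ad_m charF hL hg _ Ym) !(brDr hL) !(brZr hL) !(YH, YX, brZr hL, brxx hL).
have -> : H0 + - 2%:R *: X + (2%:R *: Y + - 2%:R *: H0) +
    2%:R^-1 *: (2%:R *: 0 + - 2%:R *: (2%:R *: Y)) = - H0 - 2%:R *: X.
  by vfield; rewrite ?nz.
rewrite (exp_ad_p charF hL hg _ Xp) !(brBr hL) !(brZr hL, brNr hL, XH, brxx hL).
by rewrite (br0r hL); vfield; rewrite ?nz.
Qed.

Lemma weyl_prod_nilpotent Y X f e x : gtriple br H0 Y H0 X -> gtriple br H0 f H0 e ->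
  x \in [:: X; Y; X; e; f; e] -> ad_nilpotent br x.
Proof.
move=> [Ym Xp _] [fm ep _] xs; have : all (fun v => (v \in Vplus br H0) || (v \in Vminus br H0)) [:: X; Y; X; e; f; e].
  by rewrite /= Xp Ym ep fm !orbT.
move/allP/(_ x xs) => /orP [xp|xm]; first exact: (ad_nilpotent_p charF hL hg xp).
exact: (ad_nilpotent_m charF hL hg xm).
Qed.

(** Each Weyl element sends $H_0$ to $-H_0$, so a product of two fixes it. *)
Lemma weyl_prod_Aut0 Y X f e : gtriple br H0 Y H0 X -> gtriple br H0 f H0 e ->
  exists2 g : 'End(V), Aut0_fix iota br H0 g & forall x, g x = weyl_elt br X Y (weyl_elt br e f x).
Proof.
move=> t t'; have [g gE gA] := exp_prod_Aut0 iota charF hL (fun x => weyl_prod_nilpotent t t').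
exists g => [|x]; last by rewrite gE.
split=> //; rewrite gE -[LHS]/(weyl_elt br X Y (weyl_elt br e f H0)) (weyl_H0 t').
have hs x : x \in [:: X; Y; X] -> ad_nilpotent br x.
  by move=> xs; apply: (weyl_prod_nilpotent t t'); rewrite (mem_cat _ [:: X; Y; X]) xs.
have [g' g'E _] := exp_prod_Aut0 iota charF hL hs.
by rewrite weyl_eltE -g'E linearN /= g'E -weyl_eltE (weyl_H0 t) opprK.
Qed.

(** The invariance of $P_0$ is stated for $\mathrm{Aut}_0$ of [gsub] at 0, a subspace equal to the
    whole algebra, hence this variant acting on the vectors of [W]. *)
Lemma weyl_prod_sub (W : {vspace V}) Y X f e :
  (forall x y, x \in W -> y \in W -> br x y \in W) -> (Vplus br H0 <= W)%VS -> (Vminus br H0 <= W)%VS ->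
  gtriple br H0 Y H0 X -> gtriple br H0 f H0 e ->
  exists2 g : 'End(subvs_of W), Aut0_fix iota (sub_br br (W := W)) (vsproj W H0) g &
    forall x, x \in W -> sub_act g x = weyl_elt br X Y (weyl_elt br e f x).
Proof.
move=> hW pW mW t t'.
have sW : all (mem W) [:: X; Y; X; e; f; e].
  have [Ym Xp _] := t; have [fm ep _] := t'.
  by rewrite /= !((subvP pW) _ Xp, (subvP pW) _ ep, (subvP mW) _ Ym, (subvP mW) _ fm).
have hs x : x \in [:: X; Y; X; e; f; e] -> x \in W /\ ad_nilpotent br x.
  by move=> xs; split; [exact: (allP sW)|exact: (weyl_prod_nilpotent t t')].
have [g gA gE] := exp_prod_sub iota charF hL hW hs.
exists g => [|x xW]; last by rewrite gE.
split=> //; have HW : H0 \in W.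
  have [Ym Xp [_ _ <-]] := t; apply: hW; [exact: (subvP mW)|exact: (subvP pW)].
apply: val_inj; rewrite /= -[LHS]/(sub_act g H0) gE // vsprojK //.
have [g' [_ g'H] g'E] := weyl_prod_Aut0 t t'.
by rewrite -[RHS]g'H g'E.
Qed.

End WeylElements.

Section Automorphisms.
Variables (F : fieldType) (V : vectType F) (br : V -> V -> V).
Variables (g : 'End(V)) (hga : lie_aut br g).

Lemma aut_exp_ad x v : g (exp_ad br x v) = exp_ad br (g x) (g v).
Proof.
rewrite /exp_ad linear_sum; apply: eq_bigr => i _; rewrite linearZ /=; congr (_ *: _).
by elim: (nat_of_ord i) => // n IH; rewrite !iterS (proj2 hga) IH.
Qed.

Lemma aut_weyl x y v : g (weyl_elt br x y v) = weyl_elt br (g x) (g y) (g v).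
Proof. by rewrite /weyl_elt !aut_exp_ad. Qed.

Lemma aut_gtriple H0 f h e : lie_bracket br ->
  gtriple br H0 f h e -> gtriple br (g H0) (g f) (g h) (g e).
Proof.
move=> hL [fm ep [he hf fe]]; have gbr := proj2 hga; split.
- by apply/(VmP hL); rewrite -gbr (VmP hL _ _ fm) linearZ.
- by apply/(VpP hL); rewrite -gbr (VpP hL _ _ ep) linearZ.
by split; rewrite -gbr ?he ?hf ?fe ?linearZ.
Qed.

End Automorphisms.

Lemma msize_linear_form n (R : nzRingType) (c : 'I_n -> R) :
  (msize (\sum_i c i *: 'X_i : {mpoly R[n]}) <= 2)%N.
Proof.
apply: leq_trans (msize_sum _ _ _) _; apply/bigmax_leqP => i _.
by apply: leq_trans (msizeZ_le _ _) _; rewrite msizeX mdeg1.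
Qed.

(** [g] is a linear section of [f], so [irreducible_comp] applies after extending scalars. *)
Lemma irreducible_pullback (F L : fieldType) (iota : {rmorphism F -> L}) (V : vectType F)
    (U W : {vspace V}) (f g : 'End(V)) (p : {mpoly F[\dim W]}) (q : {mpoly F[\dim U]}) :
  [pchar F] =i pred0 -> (forall x, x \in U -> f x \in W) -> (forall x, x \in W -> g x \in U) ->
  (forall x, x \in W -> f (g x) = x) ->
  (forall x, x \in U -> peval q x = peval p (f x)) ->
  irreducible_elt (map_mpoly iota p) -> irreducible_elt (map_mpoly iota q).
Proof.
move=> charF fU gW fg qE irr.
pose lin (U1 U2 : {vspace V}) (h : 'End(V)) : (\dim U2).-tuple {mpoly F[\dim U1]} :=
  [tuple \sum_(i < \dim U1) coord (vbasis U2) j (h (vbasis U1)`_i) *: 'X_i | j < \dim U2].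
have linE (U1 U2 : {vspace V}) h (r : {mpoly F[\dim U2]}) x : x \in U1 ->
    peval (r \mPo lin U1 U2 h) x = peval r (h x) by apply: peval_pullback.
have coordE (U1 : {vspace V}) (i : 'I_(\dim U1)) x : coord (vbasis U1) i x = peval ('X_i) x.
  by rewrite /peval mevalXU.
have qp : q = p \mPo lin U W f.
  by apply: (peval_ext charF) => x xU; rewrite linE // qE.
have sz (U1 U2 : {vspace V}) h i : (msize (map_mpoly iota (tnth (lin U1 U2 h) i)) <= 2)%N.
  rewrite tnth_mktuple raddf_sum (eq_bigr (fun j : 'I__ =>
    iota (coord (vbasis U2) i (h (vbasis U1)`_j)) *: 'X_j)); first exact: msize_linear_form.
  by move=> j _ /=; rewrite map_mpolyZ map_mpolyX.
rewrite qp map_mpoly_comp_mpoly.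
apply: (irreducible_comp (sigma := [tuple map_mpoly iota (tnth (lin W U g) i) | i < _])) irr.
- by move=> i; rewrite tnth_mktuple.
- by move=> i; rewrite tnth_mktuple.
move=> i; rewrite tnth_mktuple -map_mpoly_comp_mpoly -(map_mpolyX iota); congr map_mpoly.
apply: (peval_ext charF) => x xW; rewrite linE //.
have -> : tnth (lin U W f) i = 'X_i \mPo lin U W f by rewrite comp_mpolyXU -tnth_nth.
by rewrite linE ?gW // fg.
Qed.

(** Evaluation at a point where $Q=1$ gives the character. It does not vanish because [g] is
    bijective on [U], so that the point itself is of the form $gy$. *)
Lemma semi_invariant_character (F : fieldType) (V : vectType F) (S : 'End(V) -> Prop)
    (U : {vspace V}) (Q : {mpoly F[\dim U]}) (y0 : V) :
  y0 \in U -> peval Q y0 = 1 ->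
  (forall g, S g -> lker g = 0%VS /\ forall y, y \in U -> g y \in U) ->
  (forall g y, S g -> y \in U -> peval Q (g y) = peval Q (g y0) * peval Q y) ->
  is_character S (fun g => peval Q (g y0)).
Proof.
move=> y0U Q1 SU inv; split=> [g Sg|g g' Sg Sg'].
  have [g0 gU] := SU g Sg.
  have gE : (g @: U)%VS = U.
    apply/eqP; rewrite eqEdim limg_dim_eq ?g0 ?capv0 // leqnn andbT.
    by apply/subvP => x /memv_imgP [y yU ->]; apply: gU.
  have [y yU yE] : exists2 y, y \in U & y0 = g y by apply/memv_imgP; rewrite gE.
  have := inv g y Sg yU; rewrite -yE Q1 => /esym E.
  by apply: contra_eq_neq E => ->; rewrite mul0r eq_sym oner_neq0.
by rewrite comp_lfunE inv //; have [_ ->] := SU g' Sg'.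
Qed.

(** * Uniqueness from the logarithmic derivative *)

Section Uniqueness.
Variables (F : fieldType).
Hypothesis charF : [pchar F] =i pred0.
Variables (V : vectType F) (br : V -> V -> V).
Hypotheses (hL : lie_bracket br) (hS : lie_simple br).
Variables (H0 f e : V).
Hypotheses (hg : grading br H0) (hVp : Vplus br H0 <> 0%VS) (ht : gtriple br H0 f H0 e).
Notation Vp := (Vplus br H0).
Notation K := (killing br).
Variables (U : {vspace V}) (hU : U = Vp).

Let log (P : {mpoly F[\dim U]}) (c : F) := forall X Y z,
  gtriple br H0 Y H0 X -> z \in Vp -> dpe P X z = c * K Y z * peval P X.

Let logZ a P c : log P c -> log (a *: P) c.
Proof.
move=> H X Y z t zp; have aE R x : peval (a *: R : {mpoly F[\dim U]}) x = a * peval R x.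
  by rewrite /peval mevalZ.
rewrite aE mulrCA -(H X Y z t zp) /dpe mulr_sumr; apply: eq_bigr => i _.
by rewrite mderivZ aE mulrA.
Qed.

(* Both polynomials have logarithmic derivatives proportional to [K Y z], so  *)
(* suitable powers of them are proportional.                                  *)
Lemma log_derivative_unique (P Q : {mpoly F[\dim U]}) cP cQ : log P cP -> log Q cQ ->
  irreducible_elt P -> irreducible_elt Q -> exists c : F, Q = c *: P.
Proof.
move=> lP lQ irrP irrQ.
have pM (p1 p2 : {mpoly F[\dim U]}) x : peval (p1 * p2) x = peval p1 x * peval p2 x.
  by rewrite /peval rmorphM.
have pX (p1 : {mpoly F[\dim U]}) n x : peval (p1 ^+ n) x = peval p1 x ^+ n.
  by rewrite /peval rmorphXn.
have pZ a (p1 : {mpoly F[\dim U]}) x : peval (a *: p1) x = a * peval p1 x.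
  by rewrite /peval mevalZ.
have ep : e \in Vp by case: ht.
have [P0 Pu Pdiv] := irrP; have [Q0 Qu Qdiv] := irrQ.
have [x0 x0U PQ0] := peval_neq0 charF (mulf_neq0 P0 Q0); rewrite hU in x0U.
have qe0 : qdet br H0 f e != 0 by rewrite (qdet_e charF hL hg ht) oner_neq0.
have Dp : x0 - e \in Vp by apply: memvB.
have [d d0 dinv] := invertible_line charF hL hS hg ht hVp ep Dp qe0.
have [r [rE _]] := peval_curve (P * Q) e (x0 - e) 0.
have r0 : r != 0.
  apply: contra_neq PQ0 => r0; have := rE 1.
  by rewrite r0 horner0 scale1r scaler0 addr0 addrC subrK => ->.
have [s sE] : exists s, (d * r).[s] != 0.
  apply: NNPP => H; move: (mulf_neq0 d0 r0); apply/negP; rewrite negbK; apply/eqP.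
  by apply: (poly_eq0_eval charF) => t; apply/eqP; apply: contraT => ht0; case: H; exists t.
move: sE; rewrite hornerM mulf_eq0 negb_or => /andP [/dinv [f' t'] ].
rewrite rE scaler0 addr0 pM mulf_eq0 negb_or; set e' := e + _ in t' * => /andP [Pe' Qe'].
have e'p : e' \in Vp by case: t'.
(* Both polynomials are normalised at an invertible point where neither vanishes. *)
pose P' := (peval P e')^-1 *: P; pose Q' := (peval Q e')^-1 *: Q.
have irrZ a (R : {mpoly F[\dim U]}) : a != 0 -> irreducible_elt R -> irreducible_elt (a *: R).
  move=> a0 [R0 Ru Rd]; split; first by rewrite scaler_eq0 negb_or a0.
    by rewrite mpoly_unitE msizeZ // -mpoly_unitE.
  move=> y z E; have [|uy|uz] := Rd (a^-1 *: y) z.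
  - by rewrite -scalerAl -E scalerA mulVf // scale1r.
  - by left; rewrite mpoly_unitE msizeZ ?invr_eq0 // -mpoly_unitE in uy.
  - by right.
have irrP' : irreducible_elt P' by apply: irrZ => //; rewrite invr_eq0.
have irrQ' : irreducible_elt Q' by apply: irrZ => //; rewrite invr_eq0.
have lP' : log P' cP by apply: logZ.
have lQ' : log Q' cQ by apply: logZ.
have P1 : peval P' (0 + e') = 1 by rewrite add0r pZ mulVf.
have Q1 : peval Q' (0 + e') = 1 by rewrite add0r pZ mulVf.
have hb := block0 hL t'.
have cQ0 := block_chi_neq0 charF hL hS hg hVp hU lQ' hb Q1 irrQ'.
have [dP dPE _] := block_homog charF hL hS hg hVp lP' hb P1.
have [dQ dQE hdQ] := block_homog charF hL hS hg hVp lQ' hb Q1.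
have e'0 : e' != 0.
  have KH := killing_H0 charF hL hg hVp.
  apply: contraNneq KH => e'0; case: t' => _ _ [_ _]; rewrite e'0 (br0r hL) => <-.
  by rewrite killing0l.
have dQ0 := block_degree_gt0 charF hL hS hg hVp lQ' hb Q1 cQ0 e'0 hdQ.
have qe0' : qdet br H0 f' e' != 0 by rewrite (qdet_e charF hL hg t') oner_neq0.
(* The degrees are proportional to the constants [cP] and [cQ], by [block_homog], so these powers
   have equal logarithmic derivatives. *)
have PQ : Q' ^+ dP = P' ^+ dQ.
  apply: (peval_ext charF) => x xU; have xp : x \in Vp by rewrite -hU.
  have Dp' : x - e' \in Vp by apply: memvB.
  have [d' d'0 dinv'] := invertible_line charF hL hS hg t' hVp e'p Dp' qe0'.
  have [p [pE pD]] := peval_curve (P' ^+ dQ) e' (x - e') 0.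
  have [q [qE qD]] := peval_curve (Q' ^+ dP) e' (x - e') 0.
  have cdE : cQ * dP%:R = cP * dQ%:R.
    by rewrite -dPE -dQE; ring.
  have dpow R c m X Y z : log R c -> gtriple br H0 Y H0 X -> z \in Vp ->
      dpe (R ^+ m) X z = c * m%:R * K Y z * peval R X ^+ m.
    move=> lR t zp; case: m => [|m].
      rewrite expr0 mulr0 !mul0r /dpe big1 // => i _.
      by rewrite -mpolyC1 mderivC /peval meval0 mul0r.
    rewrite dpeX (lR X Y z t zp) exprS -mulr_natr; ring.
  have E : q^`() * p = q * p^`().
    apply/eqP; rewrite -subr_eq0; apply/eqP; apply: (poly_eq0_dense charF d'0) => t /dinv' [Y tY].
    rewrite hornerD hornerN !hornerM qD pD qE pE !scaler0 !addr0.
    rewrite (dpow _ _ _ _ _ _ lP' tY Dp') (dpow _ _ _ _ _ _ lQ' tY Dp') cdE !pX; ring.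
  have p0 : p.[0] = 1 by rewrite pE scale0r scaler0 !addr0 pX -{1}[e']add0r P1 expr1n.
  have q0 : q.[0] = 1 by rewrite qE scale0r scaler0 !addr0 pX -{1}[e']add0r Q1 expr1n.
  have := deriv_ratio_const charF E (t0 := 0); rewrite p0 q0 oner_neq0 divr1 scale1r => /(_ isT) qp.
  have := qE 1; have := pE 1; rewrite qp scale1r scaler0 addr0 addrC subrK => -> //.
have [_ _ prime] := mpoly_irreducible_prime irrP'.
have [P'0 P'u _] := irrP'; have [_ _ Q'div] := irrQ'.
have [A QA] : rdvd P' Q'.
  have : rdvd P' (Q' ^+ dP).
    by rewrite PQ -(prednK dQ0) exprS; exists (P' ^+ dQ.-1); rewrite mulrC.
  elim: dP {PQ dPE} => [|m IH].
    rewrite expr0 => -[A AE]; case/negP: P'u; apply/unitrP; exists A.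
    by split; [symmetry|rewrite mulrC; symmetry].
  by rewrite exprS => /prime [//|/IH].
have [|] : A \is a GRing.unit \/ P' \is a GRing.unit by apply: Q'div; rewrite QA.
  rewrite mpoly_unitE => /msize_poly1P [b b0 bE].
  exists (peval Q e' * b * (peval P e')^-1).
  have QE : Q = peval Q e' *: Q' by rewrite scalerA mulfV // scale1r.
  by rewrite {1}QE QA bE mul_mpolyC /P' !scalerA.
by move/negP: P'u.
Qed.

End Uniqueness.

Lemma intf_inj (F : fieldType) : [pchar F] =i pred0 -> injective (fun z : int => z%:~R : F).
Proof.
move=> charF x y /eqP; rewrite -subr_eq0 -mulrzBr => xy; apply/eqP; rewrite -subr_eq0.
case: (x - y) xy => n; first by rewrite -pmulrn (natf_eq0 charF).
by rewrite NegzE mulrNz oppr_eq0 -pmulrn (natf_eq0 charF).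
Qed.

Section TorusWeights.
Variables (F : fieldType).
Hypothesis charF : [pchar F] =i pred0.
Variables (V : vectType F) (br : V -> V -> V).
Hypothesis hL : lie_bracket br.
Variables (a : {vspace V}) (A : 'End(V) -> Prop).
Hypothesis hA : split_torus A (fun f => exists2 x, x \in a & f = adl br x).

(* The weights [c i] of the torus are determined by the action of its Lie     *)
(* algebra because [F] has characteristic 0.                                  *)
Lemma split_torus_scalar b (m : V -> F) : A b -> exists beta : F,
  (forall v, (forall t, t \in a -> br t v = m t *: v) -> b v = beta *: v) /\
  ((forall t, m t = 0) -> beta = 1).
Proof.
have [r [n [W [c [[sW dW] _ _ AE LE]]]]] := hA; move=> /AE [t [t0 bt]].
pose pr i : 'End(V) := sumv_pi_for (esym sW) i.
have prW i v : pr i v \in W i by apply: memv_sum_pi.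
have prS v : \sum_i pr i v = v by apply: sumv_pi_sum; rewrite memvf.
have prU (u w : 'I_n -> V) : (forall i, u i \in W i) -> (forall i, w i \in W i) ->
    \sum_i u i = \sum_i w i -> forall i, u i = w i.
  move=> uW wW E i; have := directv_sum_unique dW u w (fun i _ => uW i) (fun i _ => wW i).
  by rewrite E eqxx => /esym/forallP /(_ i) /eqP.
have prK i j v : v \in W i -> pr j v = if j == i then v else 0.
  move=> vi; apply: (prU (fun j => pr j v) (fun j => if j == i then v else 0)) => //.
    by move=> l; case: eqP => [->|_]; rewrite ?mem0v.
  by rewrite prS (bigD1 i) //= eqxx big1 ?addr0 // => l /negPf ->.
pose theta (s : 'I_r -> F) i := \sum_m0 s m0 *~ c i m0.
(* The diagonal operator with eigenvalues [theta s] lies in the Lie algebra of the torus, hence is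
   $\mathrm{ad}\,x$ with $x\in\mathfrak a$; compare the two on the components of [v]. *)
have supp v s : (forall t, t \in a -> br t v = m t *: v) ->
    exists2 x, x \in a & forall i, pr i v != 0 -> theta s i = m x.
  move=> vm; pose f : 'End(V) := (\sum_i theta s i *: pr i)%R.
  have fE w : f w = \sum_i theta s i *: pr i w.
    by rewrite sum_lfunE; apply: eq_bigr => i _; rewrite scale_lfunE.
  have /LE [x xa fx] : exists s : 'I_r -> F, forall i v, v \in W i -> f v = (\sum_m0 s m0 *~ c i m0) *: v.
    exists s => i w wi; rewrite fE (bigD1 i) //= (prK i) // eqxx big1 ?addr0 //.
    by move=> j /negPf ji; rewrite (prK i) // ji scaler0.
  exists x => // i pv; have E : forall i, theta s i *: pr i v = m x *: pr i v.
    apply: (prU (fun i => theta s i *: pr i v) (fun i => m x *: pr i v)) => [j|j|]; try exact: memvZ.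
    by rewrite -fE fx adlE // vm // -scaler_sumr prS.
  move/eqP: (E i); rewrite -subr_eq0 -scalerBl scaler_eq0 (negPf pv) orbF subr_eq0.
  by move/eqP.
have thetad i m0 : theta (fun m' => (m' == m0)%:R) i = (c i m0)%:~R.
  rewrite /theta (bigD1 m0) //= eqxx big1 ?addr0 // => l /negPf ->.
  by rewrite mul0rz.
have [[i0 [v0 [v0m pv0]]]|none] := classic (exists i0 v0,
    (forall t, t \in a -> br t v0 = m t *: v0) /\ pr i0 v0 != 0); last first.
  exists 1; split=> // v vm; rewrite scale1r.
  have -> : v = 0.
    rewrite -(prS v) big1 // => i _; apply: NNPP => /eqP pv.
    by apply: none; exists i, v.
  by rewrite linear0.
exists (\prod_m0 t m0 ^ c i0 m0); split=> [v vm|m0].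
  have ci i : pr i v != 0 -> forall m0, c i m0 = c i0 m0.
    move=> pv m0; apply: (intf_inj charF); rewrite /= -!thetad.
    have vv0 : forall t, t \in a -> br t (v + v0) = m t *: (v + v0).
      by move=> t' ta; rewrite (brDr hL) vm // v0m // scalerDr.
    have [x xa xv] := supp v (fun m' => (m' == m0)%:R) vm.
    have [x0 x0a xv0] := supp v0 (fun m' => (m' == m0)%:R) v0m.
    (* When [v] and [v0] have no common component, their sum is an eigenvector having the components
       of both. *)
    have [[j [pj pj0]]|no] := classic (exists j, pr j v != 0 /\ pr j v0 != 0).
      by rewrite (xv _ pv) -(xv _ pj) (xv0 _ pj0) (xv0 _ pv0).
    have [y ya yv] := supp (v + v0) (fun m' => (m' == m0)%:R) vv0.
    have pv00 : pr i0 v = 0 by apply: NNPP => /eqP pi; apply: no; exists i0.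
    have piv0 : pr i v0 = 0 by apply: NNPP => /eqP pi; apply: no; exists i.
    by rewrite (yv i) ?(yv i0) // linearD /= ?pv00 ?piv0 ?add0r ?addr0.
  transitivity (\sum_i b (pr i v)); first by rewrite -linear_sum prS.
  transitivity (\sum_i (\prod_m0 t m0 ^ c i0 m0) *: pr i v); last by rewrite -scaler_sumr prS.
  apply: eq_bigr => i _.
  have [->|pv] := eqVneq (pr i v) 0; first by rewrite linear0 scaler0.
  by rewrite (bt i) //; congr (_ *: _); apply: eq_bigr => l _; rewrite ci.
rewrite big1 // => l _; suff -> : c i0 l = 0 by rewrite expr0z.
have [x _ /(_ _ pv0)] := supp v0 (fun m' => (m' == l)%:R) v0m.
by rewrite thetad m0 => E; apply: (intf_inj charF); rewrite /= E.
Qed.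

End TorusWeights.

(** * Coroots and commuting triples of the descent *)

Section DescentStructure.
Variables (F : fieldType).
Hypothesis charF : [pchar F] =i pred0.
Variables (V : vectType F) (br : V -> V -> V).
Hypotheses (hL : lie_bracket br) (hS : lie_simple br).

Let nz n : n.+1%:R != 0 :> F. Proof. exact (natSf_neq0 charF n). Qed.

Variable H0 : V.
Hypotheses (hg : grading br H0) (hVp : Vplus br H0 <> 0%VS).
Hypothesis hH0 : exists f e, gtriple br H0 f H0 e.
Notation Vp := (Vplus br H0).
Notation Vz := (Vzero br H0).
Notation Vm := (Vminus br H0).

Variable a : {vspace V}.
Hypotheses (aVz : (a <= Vz)%VS) (H0a : H0 \in a) (ha : split_abelian br a).
Variable B : seq (dual a).
Hypothesis hBH0 : forall mu, mu \in B -> pairing mu H0 = 0 \/ pairing mu H0 = 2%:R.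
Variables (k : nat) (lam : 'I_k.+1 -> dual a).
Hypothesis hlam : is_descent br H0 lam B.
Variable h : 'I_k.+1 -> V.
Hypothesis hh : forall j, is_coroot br (lam j) (h j).
Variables X Y : 'I_k.+1 -> V.
Hypothesis hX : forall j, X j \in root_space br (lam j) /\ X j != 0.
Hypothesis hY : forall j, Y j \in root_space br (- lam j) /\ Y j != 0.
Hypothesis hXY : forall j, sl2_triple br (Y j) (h j) (X j).
Implicit Types (i j s r : 'I_k.+1) (A : {set 'I_k.+1}) (mu nu : dual a).

Notation g mu := (root_space br mu).

Let ha_ j : h j \in a. Proof. by case: (hh j). Qed.
Let fe j : br (Y j) (X j) = h j. Proof. by case: (hXY j). Qed.

Lemma pairing_add mu nu t : pairing (mu + nu) t = pairing mu t + pairing nu t.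
Proof. by rewrite /pairing add_lfunE. Qed.

Lemma pairing_opp mu t : pairing (- mu) t = - pairing mu t.
Proof. by rewrite /pairing opp_lfunE. Qed.

Lemma lam_H0 j : pairing (lam j) H0 = 2%:R.
Proof. by have [Bj [_ _ _ -> _]] := descent_step hlam j. Qed.

Lemma root_space_p j x : x \in g (lam j) -> x \in Vp.
Proof. by move=> /(root_spaceP hL) H; apply/(VpP hL); rewrite H // lam_H0. Qed.

Lemma root_space_m j x : x \in g (- lam j) -> x \in Vm.
Proof. by move=> /(root_spaceP hL) H; apply/(VmP hL); rewrite H // pairing_opp lam_H0. Qed.

Let Xp j : X j \in Vp. Proof. exact: (root_space_p (proj1 (hX j))). Qed.
Let Ym j : Y j \in Vm. Proof. exact: (root_space_m (proj1 (hY j))). Qed.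

Lemma descent_gtriple j : gtriple br H0 (Y j) (h j) (X j). Proof. by split. Qed.

Let brhX s j : br (h s) (X j) = pairing (lam j) (h s) *: X j.
Proof. by case: (hX j) => /(root_spaceP hL) ->. Qed.

Let brhY s j : br (h s) (Y j) = - pairing (lam j) (h s) *: Y j.
Proof. by case: (hY j) => /(root_spaceP hL) -> //; rewrite pairing_opp. Qed.

(** $[Y_s,X_j]$ would have weight $\lambda_j-\lambda_s$, which strong orthogonality forbids; the
    Jacobi identity then gives $\lambda_j(H_{\lambda_s})=0$. *)
Let orth_lt s j : (s < j)%N -> br (Y s) (X j) = 0 /\ pairing (lam j) (h s) = 0.
Proof.
move=> sj; have [Bj [[BjS _ _] _ /BjS [_ /(_ s sj) so] _ _]] := descent_step hlam j.
have YX : br (Y s) (X j) = 0.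
  have [_ nz0 _ nroot] := so; apply: NNPP => /eqP w0; apply: nroot; split=> // g0.
  move/eqP: w0; apply; apply/eqP; rewrite -memv0 -g0 addrC.
  by apply: (root_space_br hL); [case: (hY s)|case: (hX j)].
split=> //; have := brA hL (Y s) (X s) (X j).
rewrite (br_pp charF hL hg (Xp s) (Xp j)) YX !(br0r hL) addr0 fe brhX => /esym/eqP.
by rewrite scaler_eq0 => /orP [/eqP //|X0]; case: (hX j); rewrite X0.
Qed.

(** The descent states strong orthogonality for $s<j$ only. In the other order $[Y_s,X_j]\in V_0$
    has weight 2 under $H_{\lambda_j}$, which does not occur in $V_0$. *)
Lemma descent_orth s j : s != j -> br (Y s) (X j) = 0 /\ pairing (lam j) (h s) = 0.
Proof.
rewrite neq_ltn => /orP [/orth_lt //|js]; have [_ p0] := orth_lt js.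
have YX : br (Y s) (X j) = 0.
  apply: (wt2_z charF hL hg (descent_gtriple j)); first exact: br_mp.
  rewrite (brA hL) brhY p0 oppr0 scale0r (br0l hL) add0r.
  by case: (hXY j) => -> _ _; rewrite (brZr hL).
split=> //; have := brA hL (Y s) (X s) (X j).
rewrite (br_pp charF hL hg (Xp s) (Xp j)) YX !(br0r hL) addr0 fe brhX => /esym/eqP.
by rewrite scaler_eq0 => /orP [/eqP //|X0]; case: (hX j); rewrite X0.
Qed.

Lemma pairing_lam_h s j : pairing (lam j) (h s) = if s == j then 2%:R else 0.
Proof. by have [->|/descent_orth []] := eqVneq s j; first by case: (hh j). Qed.

Lemma pairing_sum mu A : pairing mu (\sum_(s in A) h s) = \sum_(s in A) pairing mu (h s).
Proof.
elim/big_rec2: _ => [|s x y _ <-]; first by rewrite /pairing linear0 linear0.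
by rewrite /pairing !linearD.
Qed.

Lemma pairing_lam_sum j A : pairing (lam j) (\sum_(s in A) h s) = if j \in A then 2%:R else 0.
Proof.
rewrite pairing_sum; case: ifP => jA.
  rewrite (bigD1 j) //= pairing_lam_h eqxx big1 ?addr0 // => s /andP [_ sj].
  by rewrite pairing_lam_h (negPf sj).
by rewrite big1 // => s sA; rewrite pairing_lam_h; case: eqP => // sj; rewrite -sj sA in jA.
Qed.

Let hA_a A : \sum_(s in A) h s \in a. Proof. exact: memv_suml. Qed.

Lemma br_hA_root A mu x : x \in g mu ->
  br (\sum_(s in A) h s) x = pairing mu (\sum_(s in A) h s) *: x.
Proof. by move=> /(root_spaceP hL) ->. Qed.

Lemma subset_gtriple A :
  gtriple br H0 (\sum_(s in A) Y s) (\sum_(s in A) h s) (\sum_(s in A) X s).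
Proof.
split; first exact: memv_suml; first exact: memv_suml; split.
- rewrite (br_sumr hL) scaler_sumr; apply: eq_bigr => s sA.
  by rewrite (br_hA_root _ (proj1 (hX s))) pairing_lam_sum sA.
- rewrite (br_sumr hL) scaler_sumr; apply: eq_bigr => s sA.
  by rewrite (br_hA_root _ (proj1 (hY s))) pairing_opp pairing_lam_sum sA.
- rewrite (br_suml hL); apply: eq_bigr => s sA; rewrite (br_sumr hL) (bigD1 s) //= fe.
  by rewrite big1 ?addr0 // => j /andP [_ js]; case: (descent_orth (s := s) (j := j)); rewrite // eq_sym.
Qed.

Lemma disjoint_YX A A' : [disjoint A & A'] -> br (\sum_(s in A) Y s) (\sum_(s in A') X s) = 0.
Proof.
move=> dA; rewrite (br_suml hL) big1 // => s sA; rewrite (br_sumr hL) big1 // => j jA'.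
case: (descent_orth (s := s) (j := j)) => //; apply: contraTneq jA' => <-.
by rewrite (disjointFr dA).
Qed.

(* A vector of [V^+] of weight 0 under the [sl_2]-triple of a subset containing *)
(* [s] commutes with [l_s], because weight -2 does not occur in [g].           *)
Lemma lsub_centralizes f' h' e' s x w : gtriple br H0 f' h' e' -> h' \in a ->
  pairing (lam s) h' = 2%:R -> x \in Vp -> br h' x = 0 -> w \in lsub br lam s -> br w x = 0.
Proof.
move=> t' ha' h2 xp hx ws; have : w \in centralizer br <[x]>%VS.
  move: ws; apply/subvP/lie_gen_min => //; last by move=> u v; apply: centralizer_br.
  rewrite subv_add; apply/andP; split; apply/subvP => y yg; apply/(centralizerP hL) => v.
    by move/vlineP => [c ->]; rewrite (brZl hL) (br_pp charF hL hg xp (root_space_p yg)) scaler0.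
  move=> /vlineP [c ->]; rewrite (brZl hL) (_ : br x y = 0) ?scaler0 //.
  apply: (wtm2_z charF hL hg t'); first exact: (br_pm hL xp (root_space_m yg)).
  rewrite (brA hL) hx (br0l hL) add0r; move/(root_spaceP hL): yg => -> //.
  by rewrite pairing_opp h2 (brZr hL).
by move/(centralizerP hL)/(_ x (memv_line x)); rewrite (brC hL) => /eqP; rewrite oppr_eq0 => /eqP.
Qed.

Lemma lsub_centralizes_m r s w : r != s -> w \in lsub br lam s -> br w (Y r) = 0.
Proof.
move=> rs ws; have : w \in centralizer br <[Y r]>%VS.
  move: ws; apply/subvP/lie_gen_min => //; last by move=> u v; apply: centralizer_br.
  rewrite subv_add; apply/andP; split; apply/subvP => y yg; apply/(centralizerP hL) => v; last first.
    by move/vlineP => [c ->]; rewrite (brZl hL) (br_mm charF hL hg (Ym r) (root_space_m yg)) scaler0.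
  move=> /vlineP [c ->]; rewrite (brZl hL) (_ : br (Y r) y = 0) ?scaler0 //.
  apply: (wt2_z charF hL hg (descent_gtriple s)); first exact: (br_mp hL (Ym r) (root_space_p yg)).
  rewrite (brA hL) brhY pairing_lam_h eq_sym (negPf rs) oppr0 scale0r (br0l hL) add0r.
  by move/(root_spaceP hL): yg => -> //; rewrite pairing_lam_h eqxx (brZr hL).
by move/(centralizerP hL)/(_ _ (memv_line _)); rewrite (brC hL) => /eqP; rewrite oppr_eq0 => /eqP.
Qed.

Lemma lsub_centralizes_h t s w : t \in a -> pairing (lam s) t = 0 ->
  w \in lsub br lam s -> br t w = 0.
Proof.
move=> ta t0 ws; have : w \in centralizer br <[t]>%VS.
  move: ws; apply/subvP/lie_gen_min => //; last by move=> u v; apply: centralizer_br.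
  rewrite subv_add; apply/andP; split; apply/subvP => y yg; apply/(centralizerP hL) => v;
    move/vlineP => [c ->]; rewrite (brZl hL); move/(root_spaceP hL): yg => -> //.
    by rewrite t0 scale0r scaler0.
  by rewrite pairing_opp t0 oppr0 scale0r scaler0.
by move/(centralizerP hL)/(_ _ (memv_line _)).
Qed.

Lemma lsub_X s : X s \in lsub br lam s.
Proof.
apply: (subvP (lie_gen_sub br _)); apply: (subvP (addvSl _ _)); exact: (proj1 (hX s)).
Qed.

Lemma lsub_Y s : Y s \in lsub br lam s.
Proof.
apply: (subvP (lie_gen_sub br _)); apply: (subvP (addvSr _ _)); exact: (proj1 (hY s)).
Qed.

Lemma lsub_h s : h s \in lsub br lam s.
Proof. by rewrite -fe (lie_gen_br hL) ?lsub_X ?lsub_Y. Qed.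

(** Apply [triple_full]: a vector of $V^+$ killed by the sum of the coroots centralizes every
    $\widetilde{\mathfrak l}_s$, hence is 0 because the descent has stopped. *)
Lemma sum_h : \sum_s h s = H0.
Proof.
have [f [e tH]] := hH0; have := subset_gtriple [set: 'I_k.+1].
rewrite !(eq_bigl _ _ (fun s => in_setT s)) => t.
apply: (triple_full charF hL hS hg hVp tH t) => x xp hx.
apply/eqP; rewrite -memv0 -(descent_stop hlam) memv_cap xp /=; apply/(centralizerP hL) => w.
elim/big_rec: _ w => [|s U _ IH] w; first by rewrite memv0 => /eqP ->; rewrite (br0l hL).
move=> /memv_addP [w1 w1s [w2 /IH w2x ->]]; rewrite (brDl hL) w2x addr0.
apply: (lsub_centralizes t _ _ xp hx w1s); first exact: memv_suml.
have := pairing_lam_sum s [set: 'I_k.+1]; rewrite in_setT => <-.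
by congr (pairing _ _); apply: eq_bigl => r; rewrite in_setT.
Qed.

Lemma sum_setC (f : 'I_k.+1 -> V) A : \sum_(s in A) f s + \sum_(s in ~: A) f s = \sum_s f s.
Proof. by rewrite [RHS](bigID (mem A)) /=; congr (_ + _); apply: eq_bigl => s; rewrite inE. Qed.

Lemma subset_block A : block br H0
  (\sum_(s in A) Y s) (\sum_(s in A) h s) (\sum_(s in A) X s)
  (\sum_(s in ~: A) Y s) (\sum_(s in ~: A) h s) (\sum_(s in ~: A) X s).
Proof.
split; try exact: subset_gtriple; try (by rewrite sum_setC sum_h); apply: disjoint_YX.
  by rewrite -setI_eq0 setICr.
by rewrite -setI_eq0 setIC setICr.
Qed.

Lemma descent_full_triple : gtriple br H0 (\sum_s Y s) H0 (\sum_s X s).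
Proof. by rewrite -{2}sum_h; have := subset_gtriple [set: 'I_k.+1]; rewrite !(eq_bigl _ _ (fun s => in_setT s)). Qed.

(* weights of [h_A] on [V^+]: zero iff each [h_s] kills *)
Lemma h_killed A s x : s \in A -> x \in Vp -> br (\sum_(r in A) h r) x = 0 -> br (h s) x = 0.
Proof.
move=> sA xp hx; apply: (lsub_centralizes (subset_gtriple A) _ _ xp hx (lsub_h s)) => //.
by rewrite pairing_lam_sum sA.
Qed.

Let pred_set (n : nat) : {set 'I_k.+1} := [set s : 'I_k.+1 | (s < n)%N].

(** On $V^+$, centralizing $\widetilde{\mathfrak l}_s$ for $s<n$ reduces to being killed by the
    single element $\sum_{s<n}H_{\lambda_s}$; this links the centralizers to blocks. *)
Lemma gsub_p n x : x \in Vp -> br (\sum_(s < k.+1 | (s < n)%N) h s) x = 0 -> x \in gsub br lam n.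
Proof.
move=> xp hx; apply/(centralizerP hL) => w.
have hx' : br (\sum_(s in pred_set n) h s) x = 0.
  by rewrite -[RHS]hx; congr (br _ _); apply: eq_bigl => s; rewrite inE.
elim/big_rec: _ w => [|s U sn IH] w; first by rewrite memv0 => /eqP ->; rewrite (br0l hL).
move=> /memv_addP [w1 w1s [w2 /IH w2x ->]]; rewrite (brDl hL) w2x addr0.
by apply: (lsub_centralizes (subset_gtriple (pred_set n)) _ _ xp hx' w1s) => //;
  rewrite pairing_lam_sum inE sn.
Qed.

Lemma gsub_h n s x : (s < n)%N -> x \in gsub br lam n -> br (h s) x = 0.
Proof.
move=> sn /(centralizerP hL); apply; apply: (subvP _ _ (lsub_h s)).
by rewrite (bigD1 s) //= addvSl.
Qed.

Lemma gsub_h_sum n x : x \in gsub br lam n -> br (\sum_(s < k.+1 | (s < n)%N) h s) x = 0.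
Proof. by move=> xg; rewrite (br_suml hL) big1 // => s sn; apply: gsub_h xg. Qed.

Lemma gsub_X n s : (n <= s)%N -> X s \in gsub br lam n.
Proof.
move=> ns; apply: gsub_p => //; rewrite (br_suml hL) big1 // => r rn.
rewrite brhX pairing_lam_h; case: eqP => [rs|]; last by rewrite scale0r.
by move: rn; rewrite rs ltnNge ns.
Qed.

Lemma gsub_Y n s : (n <= s)%N -> Y s \in gsub br lam n.
Proof.
move=> ns; apply/(centralizerP hL) => w.
elim/big_rec: _ w => [|r U rn IH] w; first by rewrite memv0 => /eqP ->; rewrite (br0l hL).
move=> /memv_addP [w1 w1s [w2 /IH w2x ->]]; rewrite (brDl hL) w2x addr0.
apply: lsub_centralizes_m w1s; apply: contraTneq rn => <-.
by rewrite -leqNgt.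
Qed.

Lemma gsub0 : gsub br lam 0 = fullv.
Proof.
apply/eqP; rewrite eqEsubv subvf; apply/subvP => x _; apply/(centralizerP hL) => w.
by rewrite big_pred0 // memv0 => /eqP ->; rewrite (br0l hL).
Qed.

Lemma root_is_root mu x : x != 0 -> x \in g mu -> pairing mu H0 != 0 -> is_root br mu.
Proof.
move=> x0 xg p0; split; last by move=> g0; move: xg x0; rewrite g0 memv0 => ->.
by move=> mu0; move: p0; rewrite mu0 /pairing lfunE eqxx.
Qed.

Lemma root_H0 mu : is_root br mu ->
  [\/ pairing mu H0 = 0, pairing mu H0 = 2%:R | pairing mu H0 = - 2%:R].
Proof.
move=> [_ g0]; have xg : vpick (g mu) \in g mu by apply: memv_pick.
have x0 : vpick (g mu) != 0 by rewrite vpick0; apply/eqP.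
set p := pairing mu H0; have : p * (p * p - 4%:R) == 0.
  apply: contraNT x0 => p0; apply/eqP; apply: (eigen_bad hL hg _ p0).
  by move/(root_spaceP hL): xg => ->.
rewrite (_ : p * _ = p * (p - 2%:R) * (p + 2%:R)); last by ring.
rewrite !mulf_eq0 subr_eq0 addr_eq0 => /orP [/orP [/eqP|/eqP]|/eqP]; [exact: Or31|exact: Or32|exact: Or33].
Qed.

Let no_wt r mu : pairing mu H0 = 0 ->
  pairing mu (h r) = 2%:R \/ pairing mu (h r) = - 2%:R -> ~ is_root br mu.
Proof.
move=> p0 pr [_ g0]; apply: g0; apply/eqP; rewrite -subv0; apply/subvP => x /(root_spaceP hL) xg.
have xz : x \in Vz by apply/(VzP hL); rewrite xg // p0 scale0r.
have hx := xg _ (ha_ r); rewrite memv0; apply/eqP.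
by case: pr => pr; rewrite pr in hx; [apply: (wt2_z charF hL hg (descent_gtriple r) xz hx)|
  apply: (wtm2_z charF hL hg (descent_gtriple r) xz hx)].
Qed.

(** Adding or subtracting $\lambda_r$ would give either value $\pm4$ at $H_0$, or value 0 at $H_0$
    with weight $\pm2$ under $H_{\lambda_r}$; neither is a root. *)
Let Sigma_p s mu : is_root br mu -> (forall r, (r < s)%N -> pairing mu (h r) = 0) ->
  pairing mu H0 = 2%:R \/ pairing mu H0 = - 2%:R -> Sigma br lam s mu.
Proof.
move=> mur hr p; split=> // r rs.
have pD : pairing (mu + lam r) H0 = pairing mu H0 + 2%:R by rewrite pairing_add lam_H0.
have pB : pairing (mu - lam r) H0 = pairing mu H0 - 2%:R by rewrite pairing_add pairing_opp lam_H0.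
have hD : pairing (mu + lam r) (h r) = 2%:R.
  by rewrite pairing_add hr // pairing_lam_h eqxx add0r.
have hB : pairing (mu - lam r) (h r) = - 2%:R.
  by rewrite pairing_add pairing_opp hr // pairing_lam_h eqxx add0r.
have p00 t : pairing (0 : dual a) t = 0 by rewrite /pairing lfunE.
have big nu : pairing nu H0 = 4%:R \/ pairing nu H0 = - 4%:R -> ~ is_root br nu.
  move=> pn /root_H0 [] E; case: pn; rewrite E => /eqP; apply/negP;
  rewrite ?(eq_sym 0) ?eqr_opp ?oppr_eq0 ?(natf_eqr charF) ?(natf_eq0 charF) //.
    by rewrite -subr_eq0 opprK -natrD (natf_eq0 charF).
  by rewrite eq_sym -subr_eq0 opprK -natrD (natf_eq0 charF).
split.
- by move=> E; move: hD; rewrite E p00 => /esym/eqP; apply/negP.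
- by move=> E; move: hB; rewrite E p00 => /esym/eqP; rewrite oppr_eq0; apply/negP.
- case: p => p; [apply: big; left|apply: (no_wt (r := r)); [|by left]].
    by rewrite pD p -natrD.
  by rewrite pD p addNr.
- case: p => p; [apply: (no_wt (r := r)); [|by right]|apply: big; right].
    by rewrite pB p subrr.
  by rewrite pB p -opprD -natrD.
Qed.

(** Here $\mu(H_{\lambda_s})=2$, so $\mu$ and $2\lambda_s-\mu$, the opposite of its reflection, are
    both nonnegative combinations of the basis of $\widetilde\Sigma_s$. Their sum is $2\lambda_s$,
    so the coefficients off $\lambda_s$ vanish, and evaluation at $H_0$ gives the coefficient 1. *)
Lemma root_unique s mu x : x \in g mu -> x != 0 -> x \in Vp ->
  (forall r, r != s -> br (h r) x = 0) -> mu = lam s.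
Proof.
move=> xg x0 xp hx; have xgP := root_spaceP hL _ _ xg.
have inj c d : c *: x = d *: x -> c = d.
  by move=> /eqP; rewrite -subr_eq0 -scalerBl scaler_eq0 (negPf x0) orbF subr_eq0 => /eqP.
have p2 : pairing mu H0 = 2%:R by apply: inj; rewrite -xgP // (VpP hL _ _ xp).
have pr r : r != s -> pairing mu (h r) = 0.
  by move=> rs; apply: inj; rewrite -xgP // hx // scale0r.
have ps : pairing mu (h s) = 2%:R.
  apply: inj; rewrite -xgP // -(VpP hL _ _ xp) -sum_h (bigD1 s) //= (brDl hL) (br_suml hL).
  by rewrite [X in _ + X]big1 ?addr0 // => r; apply: hx.
have mur : is_root br mu by apply: (root_is_root x0 xg); rewrite p2 nz.
have [Bs [[BsS Bsf Bspn] Bspos lamBs _ lamU]] := descent_step hlam s.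
(* Elements of [Bs] are positive for [B], hence nonnegative at $H_0$, and only $\lambda_s$ takes the
   value 2. *)
have BsH mu' : mu' \in Bs -> pairing mu' H0 = if mu' == lam s then 2%:R else 0.
  move=> muB; case: eqP => [->|ne]; first exact: lam_H0.
  have [mur' [c cE]] := Bspos _ muB.
  have [n nE] : exists n : nat, pairing mu' H0 = n%:R.
    rewrite cE; elim/big_ind: _ => [|u v [n nE] [m mE]|i _].
    - by exists 0%N; rewrite /pairing lfunE.
    - by exists (n + m)%N; rewrite pairing_add nE mE natrD.
    - have := hBH0 (mem_nth 0 (ltn_ord i)); elim: (c i) => [|n IH] H.
        by exists 0%N; rewrite mulr0n /pairing lfunE.
      have [m mE] := IH H; rewrite mulrS pairing_add mE.
      by case: H => ->; [exists m; rewrite add0r|exists (2 + m)%N; rewrite natrD].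
  case: (root_H0 mur') => // E; first by case: ne; apply: lamU.
  by move: nE; rewrite E => /eqP; rewrite eq_sym -subr_eq0 opprK -natrD (natf_eq0 charF) addn2.
have nth_lam (i : 'I_(size Bs)) : (Bs`_i == lam s) = (i == index (lam s) Bs :> nat).
  rewrite -{1}(nth_index 0 lamBs) nth_uniq ?index_mem //; exact: free_uniq.
pose i0 := Ordinal (etrans (index_mem (lam s) Bs) lamBs).
have combH (c : nat -> nat) : pairing (\sum_(i < size Bs) Bs`_i *+ c i) H0 = (2 * c i0)%:R.
  have mulH nu n : pairing (nu *+ n) H0 = pairing nu H0 *+ n.
    by elim: n => [|n IH]; rewrite ?mulr0n ?mulrS ?pairing_add ?IH // /pairing lfunE.
  have -> : pairing (\sum_(i < size Bs) Bs`_i *+ c i) H0 = \sum_(i < size Bs) pairing Bs`_i H0 *+ c i.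
    elim/big_rec2: _ => [|i y z _ <-]; first by rewrite /pairing lfunE.
    by rewrite pairing_add mulH.
  rewrite (bigD1 i0) //= big1 ?addr0 => [|i ii0].
    by rewrite BsH ?nth_index // eqxx natrM mulr_natr.
  by rewrite BsH ?mem_nth // nth_lam -(inj_eq val_inj) /= in ii0 *; rewrite (negPf ii0) mul0rn.
have no_neg nu : pairing nu H0 = - 2%:R -> ~ nonneg_comb Bs nu.
  move=> pn [c cE]; move: pn; rewrite cE combH => /eqP.
  by rewrite -subr_eq0 opprK -natrD (natf_eq0 charF) addn2.
have [c cE] : nonneg_comb Bs mu.
  have /Bspn [//|/no_neg []] : Sigma br lam s mu.
    by apply: Sigma_p => //; [move=> r rs; apply: pr; rewrite neq_ltn rs|left].
  by rewrite pairing_opp p2.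
have ci0 : c i0 = 1%N.
  have := combH c; rewrite -cE p2 => /(natf_inj charF) /eqP.
  by rewrite -{1}[2%N]muln1 eqn_pmul2l // => /eqP.
(* The reflection of $\mu$ in $\lambda_s$, with value $-2$ at $H_0$. *)
pose mu' := mu - 2%:R *: lam s.
have mur' : is_root br mu' by have [_ _ /(_ mu mur)] := hh s; rewrite ps.
have scaleH nu t c' : pairing (c' *: nu) t = c' * pairing nu t by rewrite /pairing scale_lfunE.
have [d dE] : nonneg_comb Bs (- mu').
  have pm' : pairing mu' H0 = - 2%:R.
    by rewrite pairing_add pairing_opp scaleH p2 lam_H0; ring.
  have /Bspn [/no_neg|//] : Sigma br lam s mu'.
    apply: Sigma_p => //; last by right.
    move=> r rs; have rs' : r != s by rewrite neq_ltn rs.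
    by rewrite pairing_add pairing_opp scaleH pr // pairing_lam_h (negPf rs') mulr0 subr0.
  by move=> /(_ pm').
have lamE : lam s = Bs`_i0 by rewrite /= nth_index.
have E : \sum_(i < size Bs) ((c i + d i)%:R - (i == i0)%:R * 2%:R : F) *: Bs`_i = 0.
  transitivity (\sum_(i < size Bs) (Bs`_i *+ c i + Bs`_i *+ d i) -
      \sum_(i < size Bs) ((i == i0)%:R * 2%:R : F) *: Bs`_i).
    rewrite -sumrB; apply: eq_bigr => i _.
    by rewrite scalerBl -scaler_nat natrD scalerDl !scaler_nat.
  rewrite big_split /= -cE -dE [X in _ - X](bigD1 i0) //= [X in _ - (_ + X)]big1; last first.
    by move=> i /negPf ->; rewrite mul0r scale0r.
  by rewrite eqxx mul1r -lamE addr0 /mu' opprB addrC subrK subrr.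
have cd := @freeP _ _ _ (in_tuple Bs) Bsf _ E.
rewrite cE (bigD1 i0) //= ci0 mulr1n big1 ?addr0 ?nth_index // => i ii0.
have := cd i; rewrite (negPf ii0) mul0r subr0 => /eqP; rewrite (natf_eq0 charF) addn_eq0.
by case/andP => /eqP ->; rewrite mulr0n.
Qed.

Let stable_a A (c : F) t y : t \in a -> y \in (Vp :&: ad_eigen br (\sum_(r in A) h r) c)%VS ->
  br t y \in (Vp :&: ad_eigen br (\sum_(r in A) h r) c)%VS.
Proof.
move=> ta; rewrite !memv_cap => /andP [yp /(ad_eigenP hL) hy].
rewrite (br_zp hL) ?(subvP aVz) //=; apply/(ad_eigenP hL).
by rewrite (brA hL) (proj1 ha _ _ (hA_a A) ta) (br0l hL) add0r hy (brZr hL).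
Qed.

Lemma root_space_weight s x : x \in Vp -> br (\sum_(r in ~: [set s]) h r) x = 0 -> x \in g (lam s).
Proof.
move=> xp hx; set A := ~: _ in hx.
have [|u -> uP] := root_dec hL ha (x := x) (stable_a (A := A) (c := 0)).
  by rewrite memv_cap xp; apply/(ad_eigenP hL); rewrite hx scale0r.
elim: u uP => [|y u IH] uP; first by rewrite big_nil mem0v.
rewrite big_cons memvD ?IH //; last by move=> z zu; apply: uP; rewrite inE zu orbT.
have [|yW y0 [mu ymu]] := uP y; first exact: mem_head.
move: yW; rewrite memv_cap => /andP [yp /(ad_eigenP hL)]; rewrite scale0r => hy.
rewrite -(root_unique (s := s) ymu y0 yp) // => r rs.
by apply: (h_killed _ yp hy); rewrite !inE.
Qed.

Lemma lsub_p s x : x \in Vp -> br (\sum_(r in ~: [set s]) h r) x = 0 -> x \in lsub br lam s.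
Proof.
move=> xp hx; apply: (subvP (lie_gen_sub br _)); apply: (subvP (addvSl _ _)).
exact: root_space_weight.
Qed.

Lemma lsub_h_sum s x : x \in lsub br lam s -> br (\sum_(r in ~: [set s]) h r) x = 0.
Proof.
apply: lsub_centralizes_h => //; by rewrite pairing_lam_sum !inE eqxx.
Qed.

Lemma EijP i j (p q : int) x : reflect
  [/\ br (h i) x = p%:~R *: x, br (h j) x = q%:~R *: x
    & forall s, s != i -> s != j -> br (h s) x = 0] (x \in Eij br h i j p q).
Proof.
apply: (iffP idP) => [|[xi xj xs]].
  rewrite /Eij !memv_cap => /andP [/andP [/(ad_eigenP hL) xi /(ad_eigenP hL) xj] xs].
  split=> // s si sj; have /subv_bigcapP /(_ s) : (<[x]> <= \bigcap_(s | (s != i) && (s != j)) ad_eigen br (h s) 0)%VS.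
    by rewrite -memvE.
  by rewrite si sj -memvE => /(_ isT) /(ad_eigenP hL); rewrite scale0r.
rewrite /Eij !memv_cap; apply/andP; split; first by apply/andP; split; apply/(ad_eigenP hL).
rewrite memvE; apply/subv_bigcapP => s /andP [si sj]; rewrite -memvE.
by apply/(ad_eigenP hL); rewrite scale0r xs.
Qed.

Notation hlt n := (\sum_(s < k.+1 | (s < n)%N) h s).

Lemma lt_block n : block br H0
  (\sum_(s < k.+1 | (s < n)%N) Y s) (hlt n) (\sum_(s < k.+1 | (s < n)%N) X s)
  (\sum_(s < k.+1 | (n <= s)%N) Y s) (\sum_(s < k.+1 | (n <= s)%N) h s)
  (\sum_(s < k.+1 | (n <= s)%N) X s).
Proof.
have := subset_block (pred_set n).
have lt (f : 'I_k.+1 -> V) : \sum_(s in pred_set n) f s = \sum_(s < k.+1 | (s < n)%N) f s.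
  by apply: eq_bigl => s; rewrite inE.
have ge (f : 'I_k.+1 -> V) : \sum_(s in ~: pred_set n) f s = \sum_(s < k.+1 | (n <= s)%N) f s.
  by apply: eq_bigl => s; rewrite !inE -leqNgt.
by rewrite !lt !ge.
Qed.

Lemma pairing_lam_lt r n : pairing (lam r) (hlt n) = if (r < n)%N then 2%:R else 0.
Proof.
have := pairing_lam_sum r (pred_set n); rewrite inE => <-.
by congr (pairing _ _); apply: eq_bigl => s; rewrite inE.
Qed.

Lemma Vplus_jP n x : (x \in Vplus_sub br H0 (gsub br lam n)) = (x \in Vp) && (br (hlt n) x == 0).
Proof.
rewrite memv_cap; apply/andP/andP => -[xp xg]; split=> //; first exact/eqP/gsub_h_sum.
by apply: gsub_p => //; apply/eqP.
Qed.

Lemma EijP11 r s x : r != s -> x \in Eij br h r s 1 1 ->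
  [/\ x \in Vp, br (h r) x = x, br (h s) x = x &
    forall i, i != r -> i != s -> br (h i) x = 0].
Proof.
move=> rs /EijP; rewrite !scale1r => -[xr xs xi]; split=> //.
apply/(VpP hL); rewrite -sum_h (bigD1 r) //= (bigD1 s) 1?eq_sym //= (brDl hL) (brDl hL) xr xs.
by rewrite (br_suml hL) big1 ?addr0 => [|i /andP [ir is_]]; [vring|apply: xi].
Qed.

Lemma sum_nat_eq2 (n : 'I_k.+1 -> nat) : (\sum_s n s = 2)%N ->
  (exists r, n r = 2%N /\ forall i, i != r -> n i = 0%N) \/
  (exists r s, [/\ (r < s)%N, n r = 1%N, n s = 1%N & forall i, i != r -> i != s -> n i = 0%N]).
Proof.
have ex (P : pred 'I_k.+1) : (\sum_(s | P s) n s <> 0)%N -> exists2 r, P r & (0 < n r)%N.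
  move=> H; have /eqP := H; rewrite sum_nat_eq0 => /forallPn [r]; rewrite negb_imply => /andP [Pr nr].
  by exists r; rewrite // lt0n.
move=> n2; have [|r _ nr] := ex xpredT; first by rewrite n2.
move: n2; rewrite (bigD1 r) //=; set S := (\sum_(_ | _) _)%N => n2.
have zero (P : pred 'I_k.+1) : (\sum_(s | P s) n s = 0)%N -> forall i, P i -> n i = 0%N.
  by move=> /eqP; rewrite sum_nat_eq0 => /forallP H i Pi; have /implyP /(_ Pi) /eqP := H i.
case E : (n r) nr n2 => [|[|[|m]]] // _ n2; last first.
  by left; exists r; split=> // i ir; apply: (zero (fun i => i != r)) => //; case: n2.
right; have S1 : S = 1%N by case: n2.
have [|s sr ns] := ex (fun i => i != r); first by rewrite -/S S1.
move: S1; rewrite /S (bigD1 s) //=; case Es : (n s) ns => [|[|m]] // _ [S0].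
have zi := zero (fun i => (i != r) && (i != s)) S0.
case: (ltngtP r s) => [rs|sr'|/val_inj rs]; last by rewrite rs eqxx in sr.
  by exists r, s; split=> // i ir is_; apply: zi; rewrite ir.
by exists s, r; split=> // i ir is_; apply: zi; rewrite ir is_.
Qed.

(** The weights of the coroots on a root vector of $V^+$ lie in $\{0,1,2\}$ and add up to 2, because
    the coroots add up to $H_0$; so they are a single 2 or two 1s. *)
Lemma Vplus_root_dec x : x \in Vp -> exists2 u : seq V, x = \sum_(y <- u) y &
  forall y, y \in u -> (exists r, y \in g (lam r)) \/
    (exists r s, (r < s)%N /\ y \in Eij br h r s 1 1).
Proof.
move=> xp; have [|u -> uP] := root_dec hL ha (W := Vp) _ xp.
  by move=> t y ta yp; apply: (br_zp hL) => //; apply: (subvP aVz).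
exists u => // y /uP [yp y0 [mu ymu]]; have yP := root_spaceP hL _ _ ymu.
have inj c d : c *: y = d *: y -> c = d.
  by move=> /eqP; rewrite -subr_eq0 -scalerBl scaler_eq0 (negPf y0) orbF subr_eq0 => /eqP.
have /fin_all_exists [n nE] s : exists n, pairing mu (h s) = n%:R.
  have hy := yP _ (ha_ s); set c := pairing mu (h s) in hy *.
  have : c * (c - 1) * (c - 2%:R) == 0.
    by apply: contraNT y0 => c0; apply/eqP; apply: (wt_p charF hL hg (descent_gtriple s) yp hy c0).
  rewrite !mulf_eq0 !subr_eq0 => /orP [/orP [/eqP ->|/eqP ->]|/eqP ->]; by [exists 0%N|exists 1%N|exists 2%N].
have hs s : br (h s) y = (n s)%:R *: y by rewrite yP // nE.
have /sum_nat_eq2 [[r [nr nz0]]|[r [s [rs nr ns nz0]]]] : (\sum_s n s = 2)%N.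
- apply: (natf_inj charF); apply: inj; rewrite natr_sum scaler_suml -(VpP hL _ _ yp) -sum_h.
  by rewrite (br_suml hL); apply: eq_bigr => s _; rewrite hs.
- left; exists r; apply: root_space_weight => //; rewrite (br_suml hL) big1 // => s.
  by rewrite !inE => sr; rewrite hs nz0 // scale0r.
- right; exists r, s; split=> //; apply/EijP; rewrite !hs nr ns; split=> // i ir is_.
  by rewrite hs nz0 // scale0r.
Qed.

(** The element $\sum_{s<j}H_{\lambda_s}$ has only weights 1 and 2 on $V_j^\perp$, and [peirce0] is
    half of $(h-1)(h-2)$. *)
Lemma Vperp_weight j v : v \in Vperp br lam h j -> v \in Vp /\ peirce0 br (hlt j) v = 0.
Proof.
have pD u w : peirce0 br (hlt j) (u + w) = peirce0 br (hlt j) u + peirce0 br (hlt j) w.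
  by move: (hlt j) => t; rewrite /peirce0 !(brDr hL); vring.
have p0 : peirce0 br (hlt j) 0 = 0 by rewrite /peirce0 !(br0r hL); vring.
have eig u c : br (hlt j) u = c *: u -> (c - 1) * (c - 2%:R) = 0 -> peirce0 br (hlt j) u = 0.
  move=> hu c0; rewrite /peirce0 hu (brZr hL) hu scalerA.
  have -> : u - (3%:R / 2%:R) *: (c *: u) + 2%:R^-1 *: ((c * c) *: u) =
    (2%:R^-1 * ((c - 1) * (c - 2%:R))) *: u by vfield; rewrite ?nz.
  by rewrite c0 mulr0 scale0r.
pose W (v : V) := v \in Vp /\ peirce0 br (hlt j) v = 0.
have WD u w : W u -> W w -> W (u + w).
  by move=> [up pu] [wp pw]; split; [exact: memvD|rewrite pD pu pw addr0].
have W0 : W 0 by split; [exact: mem0v|].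
have Wsum (I : finType) (P : pred I) (U : I -> {vspace V}) (v' : V) :
    (forall (i : I) (v : V), P i -> v \in U i -> W v) -> v' \in (\sum_(i | P i) U i)%VS -> W v'.
  move=> UW; elim/big_rec: _ v' => [|i S Pi IH] w; first by rewrite memv0 => /eqP ->.
  by move=> /memv_addP [w1 /(UW _ _ Pi) W1 [w2 /IH W2 ->]]; apply: WD.
move=> /memv_addP [v1 v1E [v2 v2E ->]]; apply: WD.
  apply: (Wsum _ _ _ _ _ v1E) => r w _; apply: (Wsum) => s {}w /andP [rs rj] wE.
  have rs' : r != s by rewrite neq_ltn rs.
  have [wp wr ws wi] := EijP11 rs' wE; split=> //.
  have [sj|sj] := ltnP s j.
    apply: (eig _ 2%:R); last by ring.
    rewrite (bigD1 r) //= (bigD1 s) /= ?sj 1?eq_sym //= (brDl hL) (brDl hL) wr ws (br_suml hL) big1.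
      by vring.
    by move=> i /andP [/andP [_ ir] is_]; apply: wi.
  apply: (eig _ 1); last by ring.
  rewrite (bigD1 r) //= (brDl hL) wr (br_suml hL) big1 ?addr0 ?scale1r //.
  move=> i /andP [ij ir]; apply: wi => //; apply: contraTneq ij => ->; by rewrite -leqNgt.
apply: (Wsum _ _ _ _ _ v2E) => r w rj wg; split; first exact: root_space_p wg.
apply: (eig _ 2%:R); last by ring.
by rewrite (root_spaceP hL _ _ wg) ?pairing_lam_lt ?rj // memv_suml.
Qed.

(** Replaces the abstract projection in $\Delta_j$ by a polynomial in $\mathrm{ad}$ of a sum of
    coroots, which automorphisms transform well. *)
Lemma proj_Vplus_j j x : x \in Vp ->
  daddv_pi (Vplus_j br H0 lam j) (Vperp br lam h j) x = peirce0 br (hlt j) x.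
Proof.
move=> xp; have [x0 x0j [x1 x1j ->]] : exists2 x0, x0 \in Vplus_j br H0 lam j &
    exists2 x1, x1 \in Vperp br lam h j & x = x0 + x1.
  apply/memv_addP; have [u -> uP] := Vplus_root_dec xp.
  rewrite big_seq; apply: memv_suml => y /uP [[r yr]|[r [s [rs yrs]]]].
    have [rj|rj] := ltnP r j.
      apply: (subvP (addvSr _ _)); apply: (subvP (addvSr _ _)).
      by move: yr; apply/subvP; rewrite (bigD1 r) //= addvSl.
    apply: (subvP (addvSl _ _)); rewrite /Vplus_j Vplus_jP (root_space_p yr) /=.
    by rewrite (root_spaceP hL _ _ yr) ?memv_suml // pairing_lam_lt ltnNge rj /= scale0r.
  have [rj|rj] := ltnP r j.
    apply: (subvP (addvSr _ _)); apply: (subvP (addvSl _ _)).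
    by move: yrs; apply/subvP; rewrite (bigD1 r) //= (bigD1 s) ?rs ?rj //= -addvA addvSl.
  have rs' : r != s by rewrite neq_ltn rs.
  have [yp yr ys yi] := EijP11 rs' yrs.
  apply: (subvP (addvSl _ _)); rewrite /Vplus_j Vplus_jP yp /= (br_suml hL) big1 // => i ij.
  apply: yi; apply: contraTneq ij => ->; rewrite -leqNgt //.
  exact: leq_trans rj (ltnW rs).
have disj : (Vplus_j br H0 lam j :&: Vperp br lam h j = 0)%VS.
  apply/eqP; rewrite -subv0; apply/subvP => v; rewrite memv_cap => /andP [].
  rewrite /Vplus_j Vplus_jP => /andP [_ /eqP hv] /Vperp_weight [_].
  by rewrite /peirce0 hv (br0r hL) !scaler0 subr0 addr0 => ->; rewrite mem0v.
have x0P := x0j; rewrite /Vplus_j Vplus_jP in x0P; case/andP: x0P => x0p /eqP hx0.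
have [x1p px1] := Vperp_weight x1j.
have x1d : daddv_pi (Vplus_j br H0 lam j) (Vperp br lam h j) x1 = 0.
  have := @daddv_pi_add _ _ _ _ x1 disj (subvP (addvSr _ _) _ x1j).
  rewrite [X in _ + X]daddv_pi_id // 1?capvC // => /eqP; rewrite -subr_eq0 addrK => /eqP //.
rewrite linearD /= x1d daddv_pi_id // addr0.
have -> : peirce0 br (hlt j) (x0 + x1) = peirce0 br (hlt j) x0 + peirce0 br (hlt j) x1.
  by move: (hlt j) => t; rewrite /peirce0 !(brDr hL); vring.
by rewrite px1 addr0 /peirce0 hx0 (br0r hL) !scaler0 subr0 addr0.
Qed.

(** * The polynomials P_j in terms of P_0, and their degrees *)

Variables (Fbar : closedFieldType) (iota : {rmorphism F -> Fbar}).
Hypothesis hRG : regular_graded iota br H0.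
Variable P : forall j, {mpoly F[\dim (Vplus_j br H0 lam j)]}.
Hypothesis hP : forall j, sub_fundamental_invariant iota (hgrade h j) (P j).
Hypothesis hP1 : forall j, peval (Delta h (P j)) (\sum_s X s) = 1.

Notation elt n := (\sum_(s < k.+1 | (s < n)%N) X s).
Notation ege n := (\sum_(s < k.+1 | (n <= s)%N) X s).

Lemma Vplus_0 : Vplus_j br H0 lam ord0 = Vp.
Proof. by rewrite /Vplus_j /Vplus_sub gsub0 capvf. Qed.

Lemma Delta_peval j x : x \in Vp ->
  peval (Delta h (P j)) x = peval (P j) (peirce0 br (hlt j) x).
Proof. by move=> xp; rewrite /Delta peval_pullback // proj_Vplus_j. Qed.

Lemma sum_lt_ge (f : 'I_k.+1 -> V) n :
  \sum_(s < k.+1 | (s < n)%N) f s + \sum_(s < k.+1 | (n <= s)%N) f s = \sum_s f s.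
Proof.
rewrite [RHS](bigID (fun s : 'I_k.+1 => (s < n)%N)) /=; congr (_ + _).
by apply: eq_bigl => s; rewrite -leqNgt.
Qed.

Lemma peirce0_lt_e j : peirce0 br (hlt j) (\sum_s X s) = ege j.
Proof.
have h1 : br (hlt j) (elt j) = 2%:R *: elt j by case: (lt_block j) => -[_ _ []].
have h2 := block_h1e2 charF hL hg (lt_block j).
rewrite -(sum_lt_ge X j).
move: (elt j) (ege j) (hlt j) h1 h2 => u v t h1 h2.
by rewrite /peirce0 !(brDr hL) h1 h2 !(brZr hL, brDr hL, br0r hL) h1; vfield; rewrite ?nz.
Qed.

Lemma P_ege j : peval (P j) (ege j) = 1.
Proof.
rewrite -peirce0_lt_e -Delta_peval ?hP1 //; exact: memv_suml.
Qed.

Lemma P0_e : peval (P ord0) (\sum_s X s) = 1.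
Proof. by have := P_ege ord0. Qed.

Lemma abs_irreducible_neq0 n (Q : {mpoly F[n]}) : abs_irreducible iota Q -> Q != 0.
Proof. by move=> [Q0 _ _]; apply: contra_neq Q0 => ->; rewrite rmorph0. Qed.

Lemma P0_log : exists c, forall X' Y' z, gtriple br H0 Y' H0 X' -> z \in Vp ->
  dpe (P ord0) X' z = c * killing br Y' z * peval (P ord0) X'.
Proof.
have [irr [chi _ inv] _] := hP ord0.
apply: (log_derivative charF hL hS hRG hg descent_full_triple hVp Vplus_0 (abs_irreducible_neq0 irr)).
move=> X' Y' t; pose W := gsub br lam 0.
have Wf x : x \in W by rewrite /W gsub0 memvf.
have [|||g gA gE] := weyl_prod_sub iota charF hL hg (W := W) _ _ _ t descent_full_triple.
- by [].
- by apply/subvP => x _.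
- by apply/subvP => x _.
exists (chi g) => x xp; rewrite -gE //; apply: inv; last by move: xp; rewrite -Vplus_0.
by rewrite /hgrade (eq_bigl xpredT) ?sum_h.
Qed.

(** The restriction of $P_0$ to the block is absolutely irreducible and relatively invariant, so it
    is a multiple of the fundamental invariant $P_j$; both are 1 at $X_j+\dots+X_k$. *)
Lemma P_block j Z : Z \in Vplus_j br H0 lam j ->
  peval (P j) Z = peval (P ord0) (elt j + Z).
Proof.
have [c hlog] := P0_log; have hb := lt_block j.
have Pe : peval (P ord0) (elt j + ege j) = 1 by rewrite sum_lt_ge P0_e.
have [R RE] := block_poly (P ord0) (elt j) (Vplus_j br H0 lam j).
have ege0 : ege j != 0.
  apply/eqP => e0; have [_ [_ _ [_ _ h0]] _ _ _] := hb.
  move: h0; rewrite e0 (br0r hL) => h0; have hX0 : br (hlt j) (X j) = 0.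
    by rewrite (root_spaceP hL _ _ (proj1 (hX j))) ?memv_suml // pairing_lam_lt ltnn scale0r.
  have /eqP : br H0 (X j) = 0 by rewrite -sum_h -(sum_lt_ge h j) (brDl hL) hX0 -h0 (br0l hL) addr0.
  by rewrite (VpP hL _ _ (Xp j)) scaler_eq0 (negPf (nz 1)) => /eqP X0; case: (hX j); rewrite X0 eqxx.
have irr := block_irreducible charF hL hS hg hVp Vplus_0 hlog hb Pe (Vplus_jP j) RE ege0.
have inv := block_relatively_invariant iota charF hL hS hg hVp hlog hb Pe
  (W := gsub br lam j) _ _ _ _ _ RE.
have [irr0 _ _] := hP ord0; have [_ _ uniq] := hP j.
have [||d dE] := uniq R.
- exact: irr irr0.
- apply: inv.
  + by move=> x y; apply: (centralizer_br hL).
  + by apply: memv_suml => s; apply: gsub_X.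
  + by apply: memv_suml => s; apply: gsub_Y.
  + by move=> w; apply: gsub_h_sum.
  + by move=> w wp hw; apply: gsub_p.
move=> Zj; have egej : ege j \in Vplus_j br H0 lam j.
  by rewrite /Vplus_j Vplus_jP memv_suml //= (block_h1e2 charF hL hg hb).
have pZ d' Z' : peval (d' *: P j) Z' = d' * peval (P j) Z' by rewrite /peval mevalZ.
have := RE _ egej; rewrite dE Pe pZ P_ege mulr1 => d1.
by rewrite -RE // dE d1 scale1r.
Qed.

Variable kappa : nat.
Hypothesis hkappa : forall j,
  exists2 Q : {mpoly F[\dim (Vplus_sub br H0 (lsub br lam j))]},
    sub_fundamental_invariant iota (h j) Q & msize Q = kappa.+1.

(** The complementary block of $\{s\}$ is the rank one algebra $\widetilde{\mathfrak l}_s$, and the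
    restriction of $P_0$ is its fundamental invariant up to a scalar; this is where $\kappa$
    enters. *)
Lemma P0_line s t Z : Z \in Vp -> br (\sum_(r in ~: [set s]) h r) Z = 0 ->
  peval (P ord0) (\sum_(r in ~: [set s]) X r + t *: Z) =
  t ^+ kappa * peval (P ord0) (\sum_(r in ~: [set s]) X r + Z).
Proof.
have [c hlog] := P0_log; have hb := subset_block (~: [set s]).
rewrite setCK !big_set1 in hb; set hA := \sum_(r in _) h r; set eA := \sum_(r in _) X r.
rewrite -/hA -/eA in hb.
have Pe : peval (P ord0) (eA + X s) = 1.
  by have := sum_setC X (~: [set s]); rewrite setCK big_set1 -/eA => ->; rewrite P0_e.
have U2 Z' : (Z' \in Vplus_sub br H0 (lsub br lam s)) = (Z' \in Vp) && (br hA Z' == 0).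
  rewrite memv_cap; apply/andP/andP => -[zp zl]; split=> //; first exact/eqP/lsub_h_sum.
  by apply: lsub_p => //; apply/eqP.
have [R RE] := block_poly (P ord0) eA (Vplus_sub br H0 (lsub br lam s)).
have [irr0 _ _] := hP ord0; have [Q [_ _ uniq] szQ] := hkappa s.
have Xs0 : X s != 0 by case: (hX s).
have irr := block_irreducible charF hL hS hg hVp Vplus_0 hlog hb Pe U2 RE Xs0 irr0.
have [||d dE] := uniq R; first exact: irr.
  apply: (block_relatively_invariant iota charF hL hS hg hVp hlog hb Pe _ _ _ _ _ RE).
  - by move=> x y; apply: (lie_gen_br hL).
  - exact: lsub_X.
  - exact: lsub_Y.
  - by move=> w; apply: lsub_h_sum.
  - by move=> w wp hw; apply: lsub_p.
have R0 := abs_irreducible_neq0 irr.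
have [m _ hm] := block_homog charF hL hS hg hVp hlog hb Pe.
have szR : msize R = m.+1.
  apply: (msize_peval_homog charF R0) => t' Z' ZU; have := ZU; rewrite U2 => /andP [zp /eqP hz].
  by rewrite !RE ?memvZ // hm.
move=> Zp hZ; rewrite hm //; suff -> : m = kappa by [].
have d0 : d != 0 by apply: contra_neq R0 => d0; rewrite dE d0 scale0r.
by apply/eqP; rewrite -eqSS -szR -szQ dE msizeZ.
Qed.

(** One coordinate is split off at a time by [block_factor] and evaluated by [P0_line]. *)
Lemma P0_diag (x : 'I_k.+1 -> F) :
  peval (P ord0) (\sum_s x s *: X s) = \prod_s x s ^+ kappa.
Proof.
have [c hlog] := P0_log.
have one s (y : 'I_k.+1 -> F) : peval (P ord0) (\sum_r y r *: X r) =
    y s ^+ kappa * peval (P ord0) (\sum_r (if r == s then 1 else y r) *: X r).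
  have hb := blockC (subset_block (~: [set s])); rewrite setCK !big_set1 in hb.
  pose Z := \sum_(r in ~: [set s]) y r *: X r.
  have Zp : Z \in Vp by apply: memv_suml => r _; apply: memvZ.
  have hsX r : r != s -> br (h s) (X r) = 0.
    by move=> rs; rewrite brhX pairing_lam_h eq_sym (negPf rs) scale0r.
  have hZ : br (h s) Z = 0.
    by rewrite (br_sumr hL) big1 // => r; rewrite !inE => rs; rewrite (brZr hL) hsX // scaler0.
  have Pe : peval (P ord0) (X s + \sum_(r in ~: [set s]) X r) = 1.
    by have := sum_setC X [set s]; rewrite big_set1 => ->; rewrite P0_e.
  have split (y' : 'I_k.+1 -> F) : \sum_r y' r *: X r =
      y' s *: X s + \sum_(r in ~: [set s]) y' r *: X r.
    by have := sum_setC (fun r => y' r *: X r) [set s]; rewrite big_set1 => <-.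
  have ysX : br (h s) (y s *: X s) = 2%:R *: (y s *: X s).
    by rewrite (brZr hL) brhX pairing_lam_h eqxx; vring.
  rewrite !split eqxx scale1r -/Z.
  have -> : \sum_(r in ~: [set s]) (if r == s then 1 else y r) *: X r = Z.
    by apply: eq_bigr => r; rewrite !inE => /negPf ->.
  rewrite (block_factor charF hL hS hg hVp hlog hb Pe _ ysX Zp hZ) ?memvZ //.
  congr (_ * _); rewrite addrC P0_line //; last first.
    by rewrite (br_hA_root _ (proj1 (hX s))) pairing_lam_sum !inE eqxx scale0r.
  by rewrite [X in peval _ X]addrC Pe mulr1.
have H (u : seq 'I_k.+1) : uniq u -> forall y : 'I_k.+1 -> F, peval (P ord0) (\sum_r y r *: X r) =
    \prod_(s <- u) y s ^+ kappa * peval (P ord0) (\sum_r (if r \in u then 1 else y r) *: X r).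
  elim: u => [|s u IH] /=; first by move=> _ y; rewrite big_nil mul1r.
  move=> /andP [su uu] y; rewrite (one s) (IH uu) big_cons mulrA.
  congr (_ * _ * _).
    by apply: eq_big_seq => r ru; case: eqP => // rs; rewrite rs (negPf su) in ru.
  by congr (peval _ _); apply: eq_bigr => r _; rewrite inE; case: (r == s); case: (r \in u).
rewrite (H _ (enum_uniq 'I_k.+1)) big_enum /= -[RHS]mulr1; congr (_ * _).
rewrite -[RHS]P0_e; congr (peval _ _); apply: eq_bigr => r _.
by rewrite mem_enum scale1r.
Qed.

(** The degree from [block_homog] is identified by evaluating at $2(X_j+\dots+X_k)$, where [P0_diag]
    gives $2^{\kappa(k+1-j)}$. *)
Lemma P_homog j t Z : Z \in Vplus_j br H0 lam j ->
  peval (P j) (t *: Z) = t ^+ (kappa * (k.+1 - j)) * peval (P j) Z.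
Proof.
move=> Zj; have [c hlog] := P0_log; have hb := lt_block j.
have Pe : peval (P ord0) (elt j + ege j) = 1 by rewrite sum_lt_ge P0_e.
have [m _ hm] := block_homog charF hL hS hg hVp hlog hb Pe.
have := Zj; rewrite /Vplus_j Vplus_jP => /andP [Zp /eqP hZ].
rewrite (P_block (memvZ t Zj)) (P_block Zj) (hm t Z Zp hZ); suff -> : m = (kappa * (k.+1 - j))%N by [].
have egep : ege j \in Vp by apply: memv_suml.
have := hm 2%:R (ege j) egep (block_h1e2 charF hL hg hb); rewrite Pe mulr1.
have -> : elt j + 2%:R *: ege j = \sum_(s < k.+1) (if (s < j)%N then 1 else 2%:R : F) *: X s.
  rewrite -(sum_lt_ge (fun s : 'I_k.+1 => (if (s < j)%N then 1 else 2%:R : F) *: X s) j) scaler_sumr.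
  by congr (_ + _); apply: eq_bigr => s; [move=> ->; rewrite scale1r|rewrite leqNgt => /negPf ->].
rewrite P0_diag (bigID (fun s : 'I_k.+1 => (s < j)%N)) /= big1 ?mul1r; last first.
  by move=> s ->; rewrite expr1n.
rewrite (eq_bigr (fun _ => 2%:R ^+ kappa)); last by move=> s /negPf ->.
rewrite (eq_bigl (fun s : 'I_k.+1 => true && (j <= s)%N)); last by move=> s; rewrite -leqNgt.
rewrite -(big_geq_mkord j k.+1 xpredT (fun _ => 2%:R ^+ kappa)) prodr_const_nat -exprM.
move=> /esym; rewrite -!natrX => /(natf_inj charF) /eqP; rewrite eqn_exp2l // => /eqP ->.
by [].
Qed.

Lemma P_msize j : msize (P j) = (kappa * (k.+1 - j)).+1.
Proof.
have [irr _ _] := hP j.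
exact: (msize_peval_homog charF (abs_irreducible_neq0 irr) (fun t Z => @P_homog j t Z)).
Qed.

(** * Transport by the involution *)

Variable gamma : 'End(V).
Hypothesis hgamma : lie_aut br gamma.
Hypothesis gamma_h : forall j, gamma (h j) = - h (rev_ord j).
Hypothesis gamma_X : forall j, gamma (X j) = Y (rev_ord j).
Hypothesis gammaK : forall x, gamma (gamma x) = x.

Notation e := (\sum_s X s).
Notation f := (\sum_s Y s).
Notation Nabla j := (nabla h (P j) gamma).
Notation pi j := (peirce0 br (hlt j)).

Let ht : gtriple br H0 f H0 e := descent_full_triple.
Let ep : e \in Vp. Proof. by case: ht. Qed.
Let fm : f \in Vm. Proof. by case: ht. Qed.

Lemma gamma_H0 : gamma H0 = - H0.
Proof.
rewrite -sum_h linear_sum (reindex_inj rev_ord_inj) /= -sumrN; apply: eq_bigr => j _.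
by rewrite gamma_h rev_ordK.
Qed.

Lemma gamma_Y j : gamma (Y j) = X (rev_ord j).
Proof. by rewrite -[RHS]gammaK gamma_X rev_ordK. Qed.

Lemma gamma_p x : x \in Vm -> gamma x \in Vp.
Proof.
move=> /(VmP hL) hx; apply/(VpP hL); apply: oppr_inj.
by have := congr1 gamma hx; rewrite (proj2 hgamma) gamma_H0 (brNl hL) linearZ /= scaleNr.
Qed.

Lemma gamma_m x : x \in Vp -> gamma x \in Vm.
Proof.
move=> /(VpP hL) hx; apply/(VmP hL); apply: oppr_inj.
by have := congr1 gamma hx; rewrite (proj2 hgamma) gamma_H0 (brNl hL) linearZ /= scaleNr opprK.
Qed.

Lemma gamma_e : gamma e = f.
Proof. by rewrite linear_sum [RHS](reindex_inj rev_ord_inj); apply: eq_bigr => j _; apply: gamma_X. Qed.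

Lemma gamma_f : gamma f = e.
Proof. by rewrite -gamma_e gammaK. Qed.

Lemma pi_Vplus_j j x : x \in Vp -> pi j x \in Vplus_j br H0 lam j.
Proof.
move=> xp; have [t1 _ _ _ _] := lt_block j.
have [w0 _ _] := peirce_wt charF hL hg t1 xp; have [m0 _ _] := peirce_mem hL t1 xp.
by rewrite /Vplus_j Vplus_jP m0 w0 eqxx.
Qed.

Lemma pi_id j x : x \in Vplus_j br H0 lam j -> pi j x = x.
Proof.
rewrite /Vplus_j Vplus_jP => /andP [_ /eqP hx].
by rewrite /peirce0 hx (br0r hL) !scaler0 subr0 addr0.
Qed.

Lemma Vplus_jp j x : x \in Vplus_j br H0 lam j -> x \in Vp.
Proof. by rewrite memv_cap => /andP []. Qed.

Lemma Nabla_P j y : y \in Vm -> peval (Nabla j) y = peval (P j) (pi j (gamma y)).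
Proof. by move=> ym; rewrite /nabla peval_pullback // Delta_peval // gamma_p. Qed.

(** $\Delta_j$ expressed through $P_0$ alone, so that the differential equation of $P_0$ serves for
    every $j$. *)
Definition D_ j x := peval (P ord0) (elt j + pi j x).

Lemma Nabla_D j y : y \in Vm -> peval (Nabla j) y = D_ j (gamma y).
Proof. by move=> ym; rewrite Nabla_P // P_block // pi_Vplus_j // gamma_p. Qed.

Lemma Nabla_f j : peval (Nabla j) f = 1.
Proof. by rewrite Nabla_P // gamma_f peirce0_lt_e P_ege. Qed.

(** $\nabla_j$ is $P_j$ composed with a linear surjection $V^-\to V_j^+$, of which $\gamma$ is a
    section since $\gamma^2=1$. *)
Lemma Nabla_abs_irreducible j : abs_irreducible iota (Nabla j).
Proof.
have [irr _ _] := hP j.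
apply: (irreducible_pullback (f := (daddv_pi (Vplus_j br H0 lam j) (Vperp br lam h j) \o gamma)%VF)
  (g := gamma) charF _ _ _ _ irr).
- by move=> x /gamma_p gx; rewrite comp_lfunE proj_Vplus_j ?pi_Vplus_j.
- by move=> x /Vplus_jp; apply: gamma_m.
- by move=> x xj; rewrite comp_lfunE gammaK proj_Vplus_j ?pi_id // (Vplus_jp xj).
- by move=> x xm; rewrite comp_lfunE /nabla !peval_pullback // gamma_p.
Qed.

Lemma Nabla_msize j : msize (Nabla j) = (kappa * (k.+1 - j)).+1.
Proof.
apply: (msize_peval_homog charF (abs_irreducible_neq0 (Nabla_abs_irreducible j))) => t y ym.
rewrite !Nabla_P ?memvZ // linearZ /=.
have -> : pi j (t *: gamma y) = t *: pi j (gamma y).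
  by move: (hlt j) => u; rewrite /peirce0 !(brZr hL); vring.
by apply: P_homog; apply: pi_Vplus_j; apply: gamma_p.
Qed.

(** An automorphism fixing the coroots commutes with $\pi_j$ and respects inverses within the block,
    so [block_semi_invariance] applies. *)
Lemma D_Levi j (g' : 'End(V)) x : lie_aut br g' -> (forall s, g' (h s) = h s) -> x \in Vp ->
  D_ j (g' x) = D_ j (g' e) * D_ j x.
Proof.
move=> hg' g'h xp; have g'br := proj2 hg'.
have sumE (Q : pred 'I_k.+1) : g' (\sum_(s | Q s) h s) = \sum_(s | Q s) h s.
  by rewrite linear_sum; apply: eq_bigr => s _; apply: g'h.
have g'H0 : g' H0 = H0 by rewrite -sum_h sumE.
have g'wt (Q : pred 'I_k.+1) c y : br (\sum_(s | Q s) h s) y = c *: y ->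
    br (\sum_(s | Q s) h s) (g' y) = c *: g' y.
  by move=> hy; rewrite -{1}sumE -g'br hy linearZ.
have g'wt0 y : br (hlt j) y = 0 -> br (hlt j) (g' y) = 0.
  by move=> hy; rewrite -[RHS](scale0r (g' y)); apply: g'wt; rewrite hy scale0r.
have g'p y : y \in Vp -> g' y \in Vp.
  by move=> /(VpP hL) hy; apply/(VpP hL); rewrite -{1}g'H0 -g'br hy linearZ.
have g'm y : y \in Vm -> g' y \in Vm.
  by move=> /(VmP hL) hy; apply/(VmP hL); rewrite -{1}g'H0 -g'br hy linearZ.
have pig' y : pi j (g' y) = g' (pi j y).
  by rewrite /peirce0 !linearD !linearN !linearZ /= !g'br sumE.
have [c hlog] := P0_log; have hb := lt_block j.
have Pe : peval (P ord0) (elt j + ege j) = 1 by rewrite sum_lt_ge P0_e.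
have := pi_Vplus_j j xp; rewrite /Vplus_j Vplus_jP => /andP [pxp /eqP hpx].
rewrite /D_ !pig' peirce0_lt_e.
apply: (block_semi_invariance charF hL hS hg hVp hlog hb Pe (phi := g')) => //.
- by move=> t y z; rewrite linearP.
- by move=> Z Zp hZ; split; [apply: g'p|apply: g'wt0].
- move=> Z Zm Zp hZ Zmm hZm ZZ; exists (g' Zm); split.
  + exact: g'm.
  + exact: g'wt0.
  + by rewrite -g'br ZZ sumE.
  + by move=> z _ _; rewrite killing_aut.
Qed.

(** Conjugation by $\gamma$ preserves the automorphisms fixing all coroots, which reduces the claim
    to [D_Levi]. *)
Lemma Nabla_Levi j (l : 'End(V)) y : lie_aut br l -> (forall s, l (h s) = h s) -> y \in Vm ->
  peval (Nabla j) (l y) = peval (Nabla j) (l f) * peval (Nabla j) y.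
Proof.
move=> [l0 lbr] lh ym.
have lH0 : l H0 = H0 by rewrite -sum_h linear_sum; apply: eq_bigr => s _; apply: lh.
have lm z : z \in Vm -> l z \in Vm.
  by move=> /(VmP hL) hz; apply/(VmP hL); rewrite -{1}lH0 -lbr hz linearZ.
pose l' := (gamma \o l \o gamma)%VF.
have l'E x : gamma (l x) = l' (gamma x) by rewrite !comp_lfunE gammaK.
have gi x : gamma x = 0 -> x = 0 by move=> gx; rewrite -[x]gammaK gx linear0.
rewrite !Nabla_D ?lm // !l'E gamma_f; apply: D_Levi; last exact: gamma_p.
  split; last by move=> x z; rewrite !comp_lfunE (proj2 hgamma) lbr (proj2 hgamma).
  apply/eqP; rewrite -subv0; apply/subvP => x; rewrite memv_ker !comp_lfunE memv0 => /eqP /gi lx.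
  have : gamma x \in lker l by rewrite memv_ker lx.
  by rewrite l0 memv0 => /eqP /gi ->.
by move=> s; rewrite !comp_lfunE gamma_h linearN /= lh linearN /= gamma_h rev_ordK opprK.
Qed.
(** $l f-f$ lies in $V^-$ and commutes with $e$, and $\mathrm{ad}(e)^2$ is injective on $V^-$. *)
Lemma fix_f (l : 'End(V)) : lie_aut br l -> l H0 = H0 -> l e = e -> l f = f.
Proof.
move=> [_ lbr] lH0 le; have lm : l f \in Vm.
  by apply/(VmP hL); rewrite -{1}lH0 -lbr (VmP hL _ _ fm) linearZ.
apply/eqP; rewrite -subr_eq0; have ym : l f - f \in Vm by apply: memvB.
have ye : br e (l f - f) = 0.
  have fe_ : br f e = H0 by case: ht => _ _ [].
  by rewrite (brC hL) (brBl hL) -{1}le -lbr fe_ lH0 subrr oppr0.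
have := full_ffee charF hL hg ht ym; rewrite ye !(br0r hL) => /esym/eqP.
by rewrite scaler_eq0 (negPf (nz 3)).
Qed.

(** * The unipotent group N *)

Lemma nsub_E i r x : (i < r)%N -> x \in Eij br h i r 1 (-1) -> x \in nsub br h.
Proof.
by move=> ir; apply/subvP; rewrite /nsub (bigD1 i) //= (bigD1 r) //= -addvA addvSl.
Qed.

Lemma nsub_wt i r x : (i < r)%N ->
  (forall t, br (h t) x = ((t == i)%:R - (t == r)%:R) *: x) -> x \in nsub br h.
Proof.
move=> ir hx; have ri : (r == i) = false by apply/negbTE; rewrite neq_ltn ir orbT.
apply: (nsub_E ir); apply/EijP; split=> [||t ti tr]; rewrite hx ?eqxx.
- by rewrite eq_sym ri subr0.
- by rewrite ri sub0r.
- by rewrite (negPf ti) (negPf tr) subrr scale0r.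
Qed.

Lemma nsub_ind (Q : V -> Prop) : Q 0 -> (forall u v, Q u -> Q v -> Q (u + v)) ->
  (forall i r x, (i < r)%N -> (forall t, br (h t) x = ((t == i)%:R - (t == r)%:R) *: x) -> Q x) ->
  forall x, x \in nsub br h -> Q x.
Proof.
move=> Q0 QD QE x; rewrite /nsub.
elim/big_rec: _ x => [|i S _ IH] x; first by rewrite memv0 => /eqP ->.
move=> /memv_addP [x1 x1E [x2 /IH Q2 ->]]; apply: (QD _ _ _ Q2); move: x1E {IH Q2}.
elim/big_rec: _ x1 => [|r S' ir IH] y; first by rewrite memv0 => /eqP ->.
move=> /memv_addP [y1 y1E [y2 /IH Q2 ->]]; apply: (QD _ _ _ Q2); apply: (QE i r) => // t.
have [yi yr yt] := EijP _ _ _ _ _ y1E.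
have ri : (r == i) = false by apply/negbTE; rewrite neq_ltn ir orbT.
have [->|ti] := eqVneq t i; first by rewrite yi eq_sym ri subr0.
have [->|tr] := eqVneq t r; first by rewrite yr sub0r.
by rewrite yt // subrr scale0r.
Qed.

Lemma nsub_Vz x : x \in nsub br h -> x \in Vz.
Proof.
move: x; apply: nsub_ind => [|u v|i r x ir hx]; [exact: mem0v|exact: memvD|].
apply/(VzP hL); rewrite -sum_h (br_suml hL) (eq_bigr _ (fun t _ => hx t)) -scaler_suml.
rewrite sumrB (bigD1 i) //= eqxx big1 => [|t /negPf -> //].
by rewrite (bigD1 r) //= eqxx big1 => [|t /negPf -> //]; rewrite subrr scale0r.
Qed.

Let wt_neg t w : w \in Vp -> br (h t) w = - 1 *: w -> w = 0.
Proof.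
move=> wp hw; apply: (wt_p charF hL hg (descent_gtriple t) wp hw).
by rewrite (_ : _ * _ = - 6%:R) ?oppr_eq0 ?nz //; ring.
Qed.

(** Give a vector of $\widetilde{\mathfrak g}^{\lambda_r}$ the level $2r$ and one of $E_{r,s}(1,1)$
    the level $r+s$. An element of $E_{i,r}(1,-1)$ with $i<r$ replaces an index $r$ by $i$ or kills,
    so levels drop, and they start at most at $2k$. *)
Lemma nsub_nilpotent x v : x \in nsub br h -> v \in Vp -> iter (k + k).+1 (br x) v = 0.
Proof.
move=> xn vp.
pose wt r s y := y \in Vp /\ forall t, br (h t) y = ((t == r)%:R + (t == s)%:R) *: y.
pose S m v := exists2 u : seq V, v = \sum_(y <- u) y &
  forall y, y \in u -> exists r s : 'I_k.+1, (r + s < m)%N /\ wt r s y.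
have S0 m : S m 0 by exists [::]; rewrite ?big_nil.
have SD m v1 v2 : S m v1 -> S m v2 -> S m (v1 + v2).
  move=> [u1 -> u1P] [u2 -> u2P]; exists (u1 ++ u2); rewrite ?big_cat // => y.
  by rewrite mem_cat => /orP [/u1P|/u2P].
have S1 m r s y : (r + s < m)%N -> wt r s y -> S m y.
  by move=> rs w; exists [:: y]; rewrite ?big_seq1 // => z; rewrite inE => /eqP ->; exists r, s.
have step : forall m v, S m.+1 v -> S m (br x v).
  move: x xn; apply: nsub_ind => [m w _|x1 x2 H1 H2 m w Sw|i r x ir hx m w].
  - by rewrite (br0l hL).
  - by rewrite (brDl hL); apply: SD; [apply: H1|apply: H2].
  have xz : x \in Vz by apply: nsub_Vz (nsub_wt ir hx).
  move=> [u -> uP]; rewrite (br_sumr hL) big_seq; elim/big_ind: _ => [|v1 v2|y yu]; [exact: S0|exact: SD|].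
  have [r' [s' [rs' [yp yw]]]] := uP y yu.
  have xyp : br x y \in Vp by apply: (br_zp hL xz).
  have xyw t : br (h t) (br x y) =
      ((t == i)%:R - (t == r)%:R + ((t == r')%:R + (t == s')%:R)) *: br x y.
    by rewrite (br_eigen hL (hx t) (yw t)).
  have lt1 (p q : 'I_k.+1) : (p + q < m.+1)%N -> q = r -> (p + i < m)%N.
    by move=> pq qr; apply: leq_trans (_ : p + q <= m)%N; rewrite // ltn_add2l qr.
  have [rs|rs] := eqVneq s' r.
    apply: (S1 _ r' i (br x y) (lt1 _ _ rs' rs)); split=> // t.
    by rewrite xyw rs; congr (_ *: _); ring.
  have [rr|rr] := eqVneq r' r.
    rewrite addnC in rs'; apply: (S1 _ s' i (br x y) (lt1 _ _ rs' rr)); split=> // t.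
    by rewrite xyw rr; congr (_ *: _); ring.
  rewrite (wt_neg (t := r) xyp) //; rewrite xyw eqxx; congr (_ *: _).
  have -> : (r == i) = false by apply/negbTE; rewrite neq_ltn ir orbT.
  by rewrite eq_sym (negPf rr) eq_sym (negPf rs) !addr0 sub0r.
have Sv : S (k + k).+1 v.
  have [u -> uP] := Vplus_root_dec vp; rewrite big_seq; elim/big_ind: _ => [|v1 v2|y yu]; [exact: S0|exact: SD|].
  have le r s : ((r : 'I_k.+1) + (s : 'I_k.+1) < (k + k).+1)%N by rewrite ltnS leq_add // -ltnS.
  have [[r yr]|[r [s [rs yrs]]]] := uP y yu.
    apply: (S1 _ r r) => //; split; first exact: root_space_p yr.
    move=> t; rewrite (root_spaceP hL _ _ yr) // pairing_lam_h.
    by case: eqP => _; rewrite ?addr0 // -natrD.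
  have rs' : r != s by rewrite neq_ltn rs.
  have [yp hr hs ht'] := EijP11 rs' yrs; apply: (S1 _ r s) => //; split=> // t.
  have [->|tr] := eqVneq t r; first by rewrite hr (negPf rs') addr0 scale1r.
  have [->|ts] := eqVneq t s; first by rewrite hs add0r scale1r.
  by rewrite ht' // addr0 scale0r.
elim: (k + k).+1 v {vp} Sv => [|m IH] w Sw.
  have [[|y u] -> uP] := Sw; first by rewrite big_nil.
  by have [|r [s []]] := uP y; first exact: mem_head.
by rewrite iterSr; apply/IH/step.
Qed.

Lemma pi_wt j w n : w \in Vp -> br (hlt j) w = n.+1%:R *: w -> pi j w = 0.
Proof.
move=> wp hw; have [t1 _ _ _ _] := lt_block j.
have [n2|n2] := leqP 2 n.
  suff -> : w = 0 by rewrite /peirce0 !(br0r hL) !scaler0 subr0 addr0.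
  apply: (wt_p charF hL hg t1 wp hw); case: n n2 hw => [|[|n]] // _ _.
  rewrite (_ : _ * _ = n.+3%:R * n.+2%:R * n.+1%:R) ?mulf_neq0 ?nz //.
  by rewrite -![n.+3%:R]natr1 -![n.+2%:R]natr1; ring.
rewrite /peirce0 hw (brZr hL) hw scalerA; case: n n2 hw => [|[|n]] // _ _.
  by vfield; rewrite ?nz.
by vfield; rewrite ?nz.
Qed.

Lemma piD j u w : pi j (u + w) = pi j u + pi j w.
Proof. by move: (hlt j) => t; rewrite /peirce0 !(brDr hL); vring. Qed.

Lemma piZ j c w : pi j (c *: w) = c *: pi j w.
Proof. by move: (hlt j) => t; rewrite /peirce0 !(brZr hL); vring. Qed.

Lemma pi0 j : pi j 0 = 0.
Proof. by have := piZ j 0 0; rewrite !scale0r. Qed.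

(** [x2] keeps the components of $x$ in $E_{i,r}(1,-1)$ with $j\le i$. These commute with
    $\sum_{s<j}H_{\lambda_s}$, hence with the projection, and they kill $X_s$ for $s<j$. *)
Lemma pi_nsub j x : x \in nsub br h -> exists x2,
  [/\ x2 \in nsub br h, forall s, (s < j)%N -> br x2 (X s) = 0
    & forall v, v \in Vp -> pi j (br x v) = br x2 (pi j v)].
Proof.
move: x; apply: nsub_ind => [|u v [u2 [un uX up]] [v2 [vn vX vp]]|i r x ir hx].
- exists 0; split=> [|s _|v _]; rewrite ?mem0v ?(br0l hL) ?pi0 //.
- exists (u2 + v2); split=> [|s sj|w wp]; first exact: memvD.
    by rewrite (brDl hL) uX // vX // addr0.
  by rewrite !(brDl hL) piD up // vp.
have ri : (r == i) = false by apply/negbTE; rewrite neq_ltn ir orbT.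
have xn := nsub_wt ir hx.
have xz := nsub_Vz xn.
have hxlt : br (hlt j) x = ((i < j)%N%:R - (r < j)%N%:R) *: x.
  have one (q : 'I_k.+1) : \sum_(t < k.+1 | (t < j)%N) (t == q)%:R = (q < j)%N%:R :> F.
    case qj : (q < j)%N; first by rewrite (bigD1 q) //= eqxx big1 ?addr0 // => t /andP [_ /negPf ->].
    by rewrite big1 // => t tj; case: eqP => // tq; rewrite -tq tj in qj.
  rewrite (br_suml hL) (eq_bigr _ (fun t _ => hx t)) -scaler_suml sumrB.
  by rewrite (one i) (one r).
have dec v : v \in Vp -> exists v1 v2, [/\ v1 \in Vp, v2 \in Vp, br (hlt j) v1 = 1 *: v1,
    br (hlt j) v2 = 2%:R *: v2 & v = v2 + v1 + pi j v].
  move=> vp; have [t1 _ _ _ _] := lt_block j.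
  have [_ w1 w2] := peirce_wt charF hL hg t1 vp; have [_ m1 m2] := peirce_mem hL t1 vp.
  exists (peirce1 br (hlt j) v), (peirce2 br (hlt j) v).
  by split; rewrite ?scale1r // -peirce_sum.
have xwt c w : br (hlt j) w = c *: w ->
    br (hlt j) (br x w) = ((i < j)%N%:R - (r < j)%N%:R + c) *: br x w.
  by move=> hw; rewrite (br_eigen hL hxlt hw).
have xp w : w \in Vp -> br x w \in Vp by exact: (br_zp hL xz).
have kill v : v \in Vp -> pi j (br x v) = pi j (br x (pi j v)).
  move=> vp; have [v1 [v2 [v1p v2p h1 h2]]] := dec v vp.
  move: (pi j v) => v0 ->; rewrite !(brDr hL) !piD.
  have [rj|rj] := ltnP r j; last have [ij|ij] := ltnP i j.
  - rewrite (pi_wt (n := 1) (xp _ v2p)) ?(pi_wt (n := 0) (xp _ v1p)) ?add0r //.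
      by rewrite (xwt _ _ h1) rj (ltn_trans ir rj) subrr add0r.
    by rewrite (xwt _ _ h2) rj (ltn_trans ir rj) subrr add0r.
  - rewrite (pi_wt (n := 2) (xp _ v2p)) ?(pi_wt (n := 1) (xp _ v1p)) ?add0r //.
      by rewrite (xwt _ _ h1) ij ltnNge rj; congr (_ *: _); rewrite /=; ring.
    by rewrite (xwt _ _ h2) ij ltnNge rj; congr (_ *: _); rewrite /=; ring.
  - rewrite (pi_wt (n := 1) (xp _ v2p)) ?(pi_wt (n := 0) (xp _ v1p)) ?add0r //.
      by rewrite (xwt _ _ h1) !ltnNge ij rj subrr add0r.
    by rewrite (xwt _ _ h2) !ltnNge ij rj subrr add0r.
have pv0 v : v \in Vp -> br (hlt j) (pi j v) = 0 *: pi j v.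
  by move=> vp; have := pi_Vplus_j j vp; rewrite /Vplus_j Vplus_jP scale0r => /andP [_ /eqP].
(* For $i<j$ the bracket $[x,\pi_jv]$ is 0 if $r<j$, having weight $-1$ under $H_{\lambda_r}$, and
   otherwise has weight 1 and projects to 0. *)
have [ij|ij] := ltnP i j.
  exists 0; split=> [|s _|v vp]; rewrite ?mem0v ?(br0l hL) //.
  rewrite kill //; have vj := pi_Vplus_j j vp; have vjp := Vplus_jp vj.
  have [rj|rj] := ltnP r j.
    rewrite (wt_neg (t := r) (xp _ vjp)) ?pi0 //.
    have hr : br (h r) (pi j v) = 0 *: pi j v.
      by rewrite scale0r; apply: (gsub_h rj); move: vj; rewrite memv_cap => /andP [].
    by rewrite (br_eigen hL (hx r) hr) eqxx ri sub0r addr0.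
  by apply: (pi_wt (n := 0) (xp _ vjp)); rewrite (xwt _ _ (pv0 v vp)) ij ltnNge rj subr0 addr0.
exists x; split=> // [s sj|v vp].
  apply: (wt_neg (t := r) (xp _ (Xp s))).
  have hr : br (h r) (X s) = 0 *: X s.
    rewrite brhX pairing_lam_h; case: eqP => // rs; move: sj; rewrite -rs ltnNge.
    by rewrite (leq_trans ij (ltnW ir)).
  by rewrite (br_eigen hL (hx r) hr) eqxx ri sub0r addr0.
rewrite kill //; apply: pi_id; have vj := pi_Vplus_j j vp; have vjp := Vplus_jp vj.
rewrite /Vplus_j Vplus_jP xp //= (xwt _ _ (pv0 v vp)) ltnNge ij ltnNge.
by rewrite (leq_trans ij (ltnW ir)) subrr add0r scale0r.
Qed.

(** After projection $x$ acts as [x2], whose exponential fixes $X_0+\dots+X_{j-1}$; so it acts on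
    the full argument of $P_0$, and [unipotent_invariance] concludes. *)
Lemma D_nsub j x v : x \in nsub br h -> v \in Vp -> D_ j (exp_ad br x v) = D_ j v.
Proof.
move=> xn vp; have [x2 [x2n x2X x2p]] := pi_nsub j xn.
have [c hlog] := P0_log.
have piE : pi j (exp_ad br x v) = exp_ad br x2 (pi j v).
  rewrite /exp_ad (big_morph (pi j) (piD j) (pi0 j)).
  apply: eq_bigr => i _; rewrite piZ; congr (_ *: _).
  have : iter i (br x) v \in Vp /\ pi j (iter i (br x) v) = iter i (br x2) (pi j v).
    elim: (nat_of_ord i) => // n [IHp IH]; rewrite !iterS x2p // IH; split=> //.
    exact: (br_zp hL (nsub_Vz xn)).
  by case.
have eltE : exp_ad br x2 (elt j) = elt j.
  have x2e : br x2 (elt j) = 0 by rewrite (br_sumr hL) big1.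
  rewrite /exp_ad big_ord_recl fact0 invr1 scale1r [X in _ + X]big1 ?addr0 // => i _.
  rewrite lift0 iterSr x2e; have -> : iter i (br x2) 0 = 0.
    by elim: (nat_of_ord i) => // n IH; rewrite iterS IH (br0r hL).
  by rewrite scaler0.
have vj := pi_Vplus_j j vp.
have eltp : elt j \in Vp by apply: memv_suml.
have exD u w : exp_ad br x2 (u + w) = exp_ad br x2 u + exp_ad br x2 w.
  by have := exp_ad_linear (lie_linearr hL x2) 1 u w; rewrite !scale1r.
rewrite /D_ piE -{1}eltE -exD.
apply: (unipotent_invariance charF hL hS hg hVp hlog ht P0_e (m := (k + k).+1)).
- exact: nsub_Vz.
- by move=> w; apply: nsub_nilpotent.
- by apply: memvD => //; apply: Vplus_jp vj.
Qed.

(** $\gamma$ negates the weights and reverses the indices; the two effects combine to send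
    $E_{i,r}(1,-1)$ to $E_{k-r,k-i}(1,-1)$. *)
Lemma gamma_nsub x : x \in nsub br h -> gamma x \in nsub br h.
Proof.
move: x; apply: nsub_ind => [|u v|i r x ir hx]; first by rewrite linear0 mem0v.
  by move=> u' v'; rewrite linearD; apply: memvD.
have hgx t : br (h t) (gamma x) = ((t == rev_ord r)%:R - (t == rev_ord i)%:R) *: gamma x.
  have -> : h t = gamma (- h (rev_ord t)) by rewrite linearN /= gamma_h rev_ordK opprK.
  rewrite -(proj2 hgamma) (brNl hL) hx -scaleNr linearZ /= opprB.
  have revE u : (rev_ord t == u) = (t == rev_ord u) by rewrite -(inj_eq rev_ord_inj) rev_ordK.
  by rewrite !revE.
by apply: (nsub_wt _ hgx); rewrite /= ltn_sub2l // ltnS (leq_trans ir) // -ltnS.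
Qed.

Lemma Ngroup_aut n : Ngroup br h n ->
  [/\ lie_aut br n, n H0 = H0 & forall y, y \in Vm -> n y \in Vm].
Proof.
move=> [x xn nE]; have xz := nsub_Vz xn.
have nilx := ad_nilpotent_of_Vp charF hL hS hg hVp xz (fun v => nsub_nilpotent xn (v := v)).
have [ex exE exa] := exp_ad_aut charF hL nilx.
have -> : n = ex by apply/lfunP => v; rewrite nE exE.
split=> // [|y ym]; rewrite exE /exp_ad.
  rewrite big_ord_recl fact0 invr1 scale1r big1 ?addr0 // => i _.
  rewrite lift0 iterSr (brC hL) (VzP hL _ _ xz) oppr0; have -> : iter i (br x) 0 = 0.
    by elim: (nat_of_ord i) => // m IH; rewrite iterS IH (br0r hL).
  by rewrite scaler0.
apply: memv_suml => i _; apply: memvZ; elim: (nat_of_ord i) => // m IH.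
by rewrite iterS; apply: (br_zm hL xz).
Qed.

Lemma Nabla_N j n y : Ngroup br h n -> y \in Vm -> peval (Nabla j) (n y) = peval (Nabla j) y.
Proof.
move=> Nn ym; have [_ _ nm] := Ngroup_aut Nn; have [x xn nE] := Nn.
rewrite !Nabla_D ?nm // nE (aut_exp_ad hgamma) D_nsub ?gamma_nsub //; exact: gamma_p.
Qed.

(** * The characters on P and A, and relative invariance under G *)

Lemma Lgroup_h l s : Lgroup br H0 h iota l -> l (h s) = h s.
Proof. by move=> [_ lh]; apply: lh; apply/memv_span/map_f; rewrite mem_enum. Qed.

Lemma Lgroup_aut l : Lgroup br H0 h iota l -> lie_aut br l /\ l H0 = H0.
Proof. by move=> [[[la _] lH] _]. Qed.

Lemma aut_Vm (l : 'End(V)) y : lie_aut br l -> l H0 = H0 -> y \in Vm -> l y \in Vm.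
Proof.
by move=> [_ lbr] lH /(VmP hL) hy; apply/(VmP hL); rewrite -{1}lH -lbr hy linearZ.
Qed.

Lemma aut_Vp (l : 'End(V)) y : lie_aut br l -> l H0 = H0 -> y \in Vp -> l y \in Vp.
Proof.
by move=> [_ lbr] lH /(VpP hL) hy; apply/(VpP hL); rewrite -{1}lH -lbr hy linearZ.
Qed.

Lemma Nabla_L j l y : Lgroup br H0 h iota l -> y \in Vm ->
  peval (Nabla j) (l y) = peval (Nabla j) (l f) * peval (Nabla j) y.
Proof.
by move=> Ll ym; have [la _] := Lgroup_aut Ll; apply: Nabla_Levi => // s; apply: Lgroup_h.
Qed.

Lemma Pgroup_Vm q : Pgroup br H0 h iota q ->
  lker q = 0%VS /\ forall y, y \in Vm -> q y \in Vm.
Proof.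
move=> [l [n [Ll Nn ->]]]; have [la lH] := Lgroup_aut Ll; have [na nH nm] := Ngroup_aut Nn.
split; last by move=> y ym; rewrite comp_lfunE aut_Vm ?nm.
apply/eqP; rewrite -subv0; apply/subvP => x; rewrite memv_ker comp_lfunE => lnx.
by rewrite -na.1 memv_ker -memv0 -la.1 memv_ker.
Qed.

Lemma Nabla_Pgroup j q y : Pgroup br H0 h iota q -> y \in Vm ->
  peval (Nabla j) (q y) = peval (Nabla j) (q f) * peval (Nabla j) y.
Proof.
move=> [l [n [Ll Nn ->]]] ym; have [_ _ nm] := Ngroup_aut Nn.
rewrite !comp_lfunE (Nabla_L j Ll (nm y ym)) (Nabla_L j Ll (nm f fm)).
by rewrite (Nabla_N j Nn ym) (Nabla_N j Nn fm) Nabla_f mulr1.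
Qed.

Section Torus.
Variable A : 'End(V) -> Prop.
Hypothesis hA : split_torus A (fun f => exists2 x, x \in a & f = adl br x).
Hypothesis AG : forall b, A b -> Aut0_fix iota br H0 b.

Lemma torus_h b s : A b -> b (h s) = h s.
Proof.
move=> Ab; have [beta [bE b1]] := split_torus_scalar charF hL hA (fun _ => 0) Ab.
by rewrite bE ?b1 ?scale1r // => t ta; rewrite scale0r (proj1 ha).
Qed.

Lemma torus_L b : A b -> Lgroup br H0 h iota b.
Proof.
move=> Ab; split=> [|x]; first exact: AG.
move=> /(@coord_span _ _ _ (in_tuple _)) ->; rewrite linear_sum; apply: eq_bigr => i _.
rewrite linearZ /=; congr (_ *: _); set u := _`_i.
have /mapP [s _ ->] : u \in [seq h j | j <- enum 'I_k.+1] by apply: mem_nth; rewrite /= ltn_ord.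
exact: torus_h.
Qed.

Notation sc b s := (scalar_on b (g (lam s))).

(** $b$ fixes $H_{\lambda_s}=[Y_s,X_s]$, so its eigenvalues on $X_s$ and $Y_s$ are inverse to each
    other. *)
Lemma torus_Y b s : A b -> b (Y s) = (sc b s)^-1 *: Y s.
Proof.
move=> Ab; have [[_ bbr] _] := (AG Ab).1.
have [beta [bE _]] := split_torus_scalar charF hL hA (pairing (lam s)) Ab.
have [beta' [bE' _]] := split_torus_scalar charF hL hA (pairing (- lam s)) Ab.
have [Xg X0] := hX s; have [Yg Y0] := hY s.
have vg : vpick (g (lam s)) \in g (lam s) by apply: memv_pick.
have v0 : vpick (g (lam s)) != 0.
  by rewrite vpick0; apply: contraNneq X0 => g0; rewrite g0 memv0 in Xg.
have scE : sc b s = beta.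
  have fv : free [tuple vpick (g (lam s))] by rewrite seq1_free.
  have := coord_free (@ord0 0) ord0 fv; rewrite eqxx /= => c1.
  by rewrite /scalar_on bE ?linearZ /= ?c1 ?mulr1 //; apply/(root_spaceP hL).
have bX : b (X s) = beta *: X s by apply/bE/(root_spaceP hL).
have bY : b (Y s) = beta' *: Y s by apply/bE'/(root_spaceP hL).
have hs0 : h s != 0.
  apply: contraNneq X0 => h0; have := brhX s s; rewrite pairing_lam_h eqxx h0 (br0l hL).
  by move/esym/eqP; rewrite scaler_eq0 (negPf (nz 1)).
have : (beta' * beta - 1) *: h s == 0.
  by rewrite scalerBl scale1r -{2}(torus_h s Ab) -fe bbr bX bY (brZl hL) (brZr hL) scalerA subrr.
rewrite scaler_eq0 (negPf hs0) orbF subr_eq0 => /eqP bb.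
rewrite bY scE; congr (_ *: _); have b0 : beta != 0.
  by apply: contra_eq_neq bb => ->; rewrite mulr0 eq_sym oner_neq0.
by rewrite -[RHS]mul1r -bb mulfK.
Qed.

Lemma pi_diag j (c : 'I_k.+1 -> F) :
  pi j (\sum_s c s *: X s) = \sum_(s < k.+1 | (j <= s)%N) c s *: X s.
Proof.
rewrite -(sum_lt_ge (fun s => c s *: X s) j) piD.
have ltp : \sum_(s < k.+1 | (s < j)%N) c s *: X s \in Vp.
  by apply: memv_suml => s _; apply: memvZ.
have hXlt s : br (hlt j) (X s) = (if (s < j)%N then 2%:R else 0) *: X s.
  by rewrite (root_spaceP hL _ _ (proj1 (hX s))) ?memv_suml // pairing_lam_lt.
rewrite (pi_wt (n := 1) ltp) ?add0r; last first.
  rewrite (br_sumr hL) scaler_sumr; apply: eq_bigr => s sj.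
  by rewrite (brZr hL) hXlt sj !scalerA mulrC.
apply: pi_id; rewrite /Vplus_j Vplus_jP; apply/andP; split.
  by apply: memv_suml => s _; apply: memvZ.
rewrite (br_sumr hL) big1 // => s; rewrite leqNgt => /negPf sj.
by rewrite (brZr hL) hXlt sj scale0r scaler0.
Qed.

(** $\gamma(b.I^-)$ is diagonal with entry $b^{-\lambda_{k-s}}$ at $X_s$. The projection keeps $s\ge
    j$, which after reversal becomes $s\le k-j$, and [P0_diag] evaluates. *)
Lemma Nabla_torus j b : A b ->
  peval (Nabla j) (b f) = (\prod_(s < k.+1 | (s <= k - j)%N) sc b s) ^- kappa.
Proof.
move=> Ab; have [ba bH] := Lgroup_aut (torus_L Ab).
rewrite Nabla_D ?aut_Vm //.
have -> : gamma (b f) = \sum_s (sc b (rev_ord s))^-1 *: X s.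
  rewrite linear_sum linear_sum (reindex_inj rev_ord_inj); apply: eq_bigr => s _.
  by rewrite /= (torus_Y _ Ab) linearZ /= gamma_Y rev_ordK.
pose c s := if (s < j)%N then 1 else (sc b (rev_ord s))^-1.
rewrite /D_ pi_diag.
have -> : elt j + \sum_(s < k.+1 | (j <= s)%N) (sc b (rev_ord s))^-1 *: X s =
    \sum_s c s *: X s.
  rewrite -(sum_lt_ge (fun s => c s *: X s) j); congr (_ + _); apply: eq_bigr => s.
    by rewrite /c => ->; rewrite scale1r.
  by rewrite /c leqNgt => /negPf ->.
rewrite P0_diag (bigID (fun s : 'I_k.+1 => (s < j)%N)) /= big1 ?mul1r; last first.
  by move=> s sj; rewrite /c sj expr1n.
rewrite (reindex_inj rev_ord_inj) /= -prodrXl -prodfV; apply: eq_big => s.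
  by rewrite -leqNgt subSS (leq_subRL _ (ltnSE (ltn_ord s))) (leq_subRL _ (ltnSE (ltn_ord j))) addnC.
by rewrite /c => /negPf ->; rewrite rev_ordK exprVn.
Qed.

End Torus.

Lemma D_0 x : D_ ord0 x = peval (P ord0) x.
Proof.
rewrite /D_; have -> : elt (@ord0 k) = 0 by rewrite big_pred0.
have -> : hlt (@ord0 k) = 0 by rewrite big_pred0.
by rewrite /peirce0 !(br0l hL) !scaler0 subr0 addr0 add0r.
Qed.

(** At index 0 the projection is the identity, so semi-invariance of $P_0$ under all automorphisms
    fixing $H_0$ can be conjugated by $\gamma$. *)
Lemma Nabla0_G (l : 'End(V)) y : Aut0_fix iota br H0 l -> y \in Vm ->
  peval (Nabla ord0) (l y) = peval (Nabla ord0) (l f) * peval (Nabla ord0) y.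
Proof.
move=> [[la _] lH] ym; have [c hlog] := P0_log; have [l0 lbr] := la.
pose l' := (gamma \o l \o gamma)%VF.
have l'E x : gamma (l x) = l' (gamma x) by rewrite !comp_lfunE gammaK.
have gi x : gamma x = 0 -> x = 0 by move=> gx; rewrite -[x]gammaK gx linear0.
have l'a : lie_aut br l'.
  split; last by move=> x z; rewrite !comp_lfunE (proj2 hgamma) lbr (proj2 hgamma).
  apply/eqP; rewrite -subv0; apply/subvP => x; rewrite memv_ker !comp_lfunE memv0 => /eqP /gi lx.
  have : gamma x \in lker l by rewrite memv_ker lx.
  by rewrite l0 memv0 => /eqP /gi ->.
have l'H : l' H0 = H0 by rewrite !comp_lfunE gamma_H0 linearN /= lH linearN /= gamma_H0 opprK.
rewrite !Nabla_D ?aut_Vm // !D_0 !l'E gamma_f.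
exact: (aut_semi_invariance charF hL hS hg hVp hlog ht P0_e l'a l'H (gamma_p ym)).
Qed.

(** For uniqueness, a competitor $Q$ composed with $\gamma$ lives on $V^+$ and has a logarithmic
    derivative of the same form as $P_0$, so [log_derivative_unique] compares the two. *)
Lemma Nabla0_fundamental :
  fundamental_invariant iota (Aut0_fix iota br H0) (fun (l : 'End(V)) x => l x) (Nabla ord0).
Proof.
split; first exact: Nabla_abs_irreducible.
  exists (fun l => peval (Nabla ord0) (l f)); last by move=> l x Sl xm; apply: Nabla0_G.
  apply: semi_invariant_character => //; first exact: Nabla_f.
    by move=> l [[la _] lH]; split; [exact: la.1|move=> y; apply: aut_Vm].
  by move=> l y Sl; apply: Nabla0_G.
move=> Q irrQ [chi _ inv].
pose U0 := Vplus_j br H0 lam ord0; pose Q' := pullback U0 gamma Q.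
have inU x : (x \in U0) = (x \in Vp) by rewrite /U0 Vplus_0.
have Q'E x : x \in Vp -> peval Q' x = peval Q (gamma x) by move=> xp; rewrite peval_pullback ?inU.
have irrQ' : abs_irreducible iota Q'.
  apply: (irreducible_pullback (f := gamma) (g := gamma) charF _ _ _ _ irrQ).
  - by move=> x; rewrite inU; apply: gamma_m.
  - by move=> x; rewrite inU; apply: gamma_p.
  - by move=> x _; apply: gammaK.
  - by move=> x; rewrite inU; apply: Q'E.
have [cQ logQ] : exists c, forall X' Y' z, gtriple br H0 Y' H0 X' -> z \in Vp ->
    dpe Q' X' z = c * killing br Y' z * peval Q' X'.
  apply: (log_derivative charF hL hS hRG hg ht hVp Vplus_0 (abs_irreducible_neq0 irrQ')).
  move=> X' Y' t'.
  (* $\gamma$ turns triples for $H_0$ into triples for $-H_0$; the Weyl products of the latter still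
     fix $H_0$, so $Q$ is invariant under them up to its character. *)
  have tg f' e' : gtriple br H0 f' H0 e' -> gtriple br (- H0) (gamma f') (- H0) (gamma e').
    by move=> /(aut_gtriple hgamma hL); rewrite gamma_H0.
  have [w [wA wH] wE] := weyl_prod_Aut0 iota charF hL (gradingN hL hg) (tg _ _ t') (tg _ _ ht).
  have [w' [[w'a _] w'H] w'E] := weyl_prod_Aut0 iota charF hL hg t' ht.
  exists (chi w) => x xp; rewrite -w'E !Q'E ?aut_Vp // w'E !(aut_weyl hgamma) -wE.
  apply: inv; last exact: gamma_m.
  by split=> //; move: wH; rewrite linearN => /oppr_inj.
have [c0 hlog] := P0_log; have [irrP _ _] := hP ord0.
have [c Qc] := log_derivative_unique charF hL hS hg hVp ht Vplus_0 hlog logQ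
  (irreducible_map irrP) (irreducible_map irrQ').
exists c; apply: (peval_ext charF) => y ym.
have -> : peval (c *: Nabla ord0) y = c * peval (Nabla ord0) y by rewrite /peval mevalZ.
rewrite Nabla_D // D_0 -[y in LHS]gammaK -Q'E ?gamma_p // Qc.
by rewrite /peval mevalZ.
Qed.

End DescentStructure.

Theorem theorem4p5p2
  (* F is a finite extension of Q_p, of residue characteristic <> 2, with
     algebraic closure Fbar *)
  (p : nat) (Qp : fieldType) (v : Qp -> int) (hQp : is_padic_field p v)
  (F : fieldExtType Qp) (hF : residue_char_neq v F 2)
  (Fbar : closedFieldType) (iota : {rmorphism F -> Fbar})
  (hFbar : is_algebraic_closure iota)
  (* (V, br, H0) is a simple regular graded Lie algebra *)
  (V : vectType F) (br : V -> V -> V) (H0 : V)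
  (hgraded : regular_graded iota br H0) (hsimple : lie_simple br)
  (* the roots, the descent and the coroots *)
  (a : {vspace V}) (ha : max_split_abelian br H0 a)
  (B : seq (dual a)) (hB : root_basis (is_root br (a := a)) B)
  (hBH0 : forall mu, mu \in B -> pairing mu H0 = 0 \/ pairing mu H0 = 2%:R)
  (k : nat) (lam : 'I_k.+1 -> dual a) (hlam : is_descent br H0 lam B)
  (h : 'I_k.+1 -> V) (hh : forall j, is_coroot br (lam j) (h j))
  (* the triples *)
  (X Y : 'I_k.+1 -> V)
  (hX : forall j, X j \in root_space br (lam j) /\ X j != 0)
  (hY : forall j, Y j \in root_space br (- lam j) /\ Y j != 0)
  (hXY : forall j, sl2_triple br (Y j) (h j) (X j))
  (Xg Yg : 'I_k.+1 -> V)
  (hXg : forall i : 'I_k.+1, (i.*2 < k)%N ->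
     [/\ Xg i \in Eij br h i (rev_ord i) 1 (-1),
         Yg i \in Eij br h i (rev_ord i) (-1) 1
       & sl2_triple br (Yg i) (h i - h (rev_ord i)) (Xg i)])
  (hXrev : forall i : 'I_k.+1, (i.*2 < k)%N ->
     weyl_elt br (Xg i) (Yg i) (X i) = X (rev_ord i))
  (* the involution gamma *)
  (gamma : 'End(V)) (hgamma : Aut0 iota br gamma)
  (hgamma_def : forall x, gamma x = gamma_tilde br X Y Xg Yg (w_elt br X Y x))
  (hgamma_a0 : (gamma @: a0 h)%VS = a0 h)
  (hgamma_h : forall j, gamma (h j) = - h (rev_ord j))
  (hgamma_X : forall j, gamma (X j) = Y (rev_ord j))
  (hgamma_inv : forall x, gamma (gamma x) = x)
  (* the maximal split torus A of G with Lie algebra a *)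
  (A : 'End(V) -> Prop)
  (hA : max_split_torus (Aut0_fix iota br H0) A
          (fun f => exists2 x, x \in a & f = adl br x))
  (* the polynomials P_j, normalised by Delta_j(I^+) = 1, and kappa *)
  (P : forall j, {mpoly F[\dim (Vplus_j br H0 lam j)]})
  (hP : forall j, sub_fundamental_invariant iota (hgrade h j) (P j))
  (hP1 : forall j, peval (Delta h (P j)) (\sum_s X s) = 1)
  (kappa : nat)
  (hkappa : forall j,
     exists2 Q : {mpoly F[\dim (Vplus_sub br H0 (lsub br lam j))]},
       sub_fundamental_invariant iota (h j) Q & msize Q = kappa.+1) :
  let G := Aut0_fix iota br H0 in
  let PG := Pgroup br H0 h iota in
  let Nabla j := nabla h (P j) gamma in
  [/\ (* irreducible of degree kappa (k + 1 - j) *)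
      forall j : 'I_k.+1, irreducible_elt (Nabla j) /\
        msize (Nabla j) = (kappa * (k.+1 - j)).+1,
      (* (1) *)
      fundamental_invariant iota G (fun g x => g x) (Nabla ord0)
    & (* (2) *)
      forall j : 'I_k.+1, exists chi : 'End(V) -> F,
      [/\ is_character PG chi,
          forall q y, PG q -> y \in Vminus br H0 ->
            peval (Nabla j) (q y) = chi q * peval (Nabla j) y,
          forall n, Ngroup br h n -> chi n = 1,
          forall b, A b -> chi b =
            (\prod_(s < k.+1 | (s <= k - j)%N)
               scalar_on b (root_space br (lam s))) ^- kappa
        & forall l, Lgroup br H0 h iota l ->
            l (\sum_s X s) = \sum_s X s -> chi l = 1]].
Proof.
move=> G PG Nabla.
have charF : [pchar F] =i pred0 by move=> q; rewrite pchar_lalg (padic_char0 hQp).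
have hL := rg_lie hgraded; have hVp := rg_Vplus_neq0 hgraded.
have hg : grading br H0.
  move=> x; have : x \in (Vminus br H0 + Vzero br H0 + Vplus br H0)%VS.
    by rewrite (rg_sum hgraded) memvf.
  move=> /memv_addP [y /memv_addP [m /(VmP hL) hm [z /(VzP hL) hz ->]] [q /(VpP hL) hq ->]].
  by rewrite !(brDr hL, hm, hz, hq, brZr hL, br0r hL); vring.
have hH0 : exists f e, gtriple br H0 f H0 e by have [f [e [fm ep t]]] := rg_sl2 hgraded; exists f, e.
have [aVz H0a ha' _] := ha; have hg' : lie_aut br gamma by case: hgamma.
have [hA1 AG _] := hA.
pose f := \sum_s Y s.
have fm : f \in Vminus br H0.
  by have [] := descent_full_triple charF hL hsimple hg hVp hH0 H0a hlam hh hX hY hXY.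
have Nf j : peval (Nabla j) f = 1.
  exact: (Nabla_f charF hL hsimple hg hVp hH0 aVz H0a ha' hBH0 hlam hh hX hY hXY hP1 hg' hgamma_h hgamma_X hgamma_inv).
split.
- move=> j; have irr : abs_irreducible iota (Nabla j).
    exact: (Nabla_abs_irreducible charF hL hsimple hg hVp hH0 aVz H0a ha' hBH0 hlam hh hX hY hXY hP hg' hgamma_h hgamma_inv).
  split; first exact: (irreducible_map irr).
  exact: (Nabla_msize charF hL hsimple hg hVp hH0 aVz H0a ha' hBH0 hlam hh hX hY hXY hgraded hP hP1 hkappa hg' hgamma_h hgamma_inv).
- exact: (Nabla0_fundamental charF hL hsimple hg hVp hH0 aVz H0a ha' hBH0 hlam hh hX hY hXY hgraded hP hP1 hg' hgamma_h hgamma_X hgamma_inv).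
(* The value at $I^-$ of the translated polynomial is the character, because $\nabla_j(I^-)=1$. *)
move=> j; exists (fun q => peval (Nabla j) (q f)).
have PGm q : PG q -> lker q = 0%VS /\ forall y, y \in Vminus br H0 -> q y \in Vminus br H0.
  exact: (Pgroup_Vm charF hL hsimple hg hVp hH0 aVz H0a ha' hBH0 hlam hh hX hY hXY).
have PGi q y : PG q -> y \in Vminus br H0 ->
    peval (Nabla j) (q y) = peval (Nabla j) (q f) * peval (Nabla j) y.
  exact: (Nabla_Pgroup charF hL hsimple hg hVp hH0 aVz H0a ha' hBH0 hlam hh hX hY hXY hgraded hP hP1 hg' hgamma_h hgamma_X hgamma_inv).
split.
- exact: (semi_invariant_character fm).
- exact: PGi.
- move=> n Nn; rewrite -(Nf j).
  exact: (Nabla_N charF hL hsimple hg hVp hH0 aVz H0a ha' hBH0 hlam hh hX hY hXY hgraded hP hP1 hg' hgamma_h j Nn fm).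
- move=> b Ab.
  exact: (Nabla_torus charF hL hsimple hg hVp hH0 aVz H0a ha' hBH0 hlam hh hX hY hXY hgraded hP hP1 hkappa hg' hgamma_h hgamma_X hgamma_inv hA1 AG).
(* An element of $L$ fixing $I^+$ fixes $I^-$ too, so the character takes the value
   $\nabla_j(I^-)$. *)
move=> l Ll le; rewrite -(Nf j); have [la lH] := Lgroup_aut Ll.
congr (peval _ _).
exact: (fix_f charF hL hsimple hg hVp hH0 H0a hlam hh hX hY hXY la lH le).
Qed.
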